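(* For every $2<p<\infty$ there exists a constant $c_p>0$, depending only on $p$, such that the following holds. Let $X=(\mathbb R^n,\|\cdot\|)$ be an $n$-dimensional subspace of $L_p$, represented on $\mathbb R^n$, whose unit ball $B_X$ is in Lewis' position. Then for every $\varepsilon\in(0,1)$ there exists $k\ge c_p\,\psi(n,p,\varepsilon)$ such that the random $k$-dimensional subspace $F$ of $X$ (with respect to the Haar probability measure on the Grassmannian $G_{n,k}$) is $(1+\varepsilon)$-spherical with probability greater than $1-e^{-c_p\psi(n,p,\varepsilon)}$.
   Context: $\psi(n,p,t):=\min\left\{\frac{t^2n}{p4^p},(tn)^{2/p}\right\}$ for $t>0$. $S^{n-1}$ is the Euclidean unit sphere of $\mathbb R^n$. An even Borel measure $\mu$ on $S^{n-1}$ is isotropic if $\|x\|_2^2=\int_{S^{n-1}}|\langle x,\theta\rangle|^2\,d\mu(\theta)$ for all $x\in\mathbb R^n$. The space $X$ (represented on $\mathbb R^n$) has unit ball in Lewis' position if its norm is $\|x\|=\left(\int_{S^{n-1}}|\langle x,\theta\rangle|^p\,d\mu(\theta)\right)^{1/p}$ for some isotropic Borel measure $\mu$ on $S^{n-1}$; every $n$-dimensional subspace of $L_p$ is linearly isometric to such a space. A $k$-dimensional subspace $F$ of $X$ is $(1+\varepsilon)$-spherical if $\frac{1-\varepsilon}{M}B_F\subseteq B_X\cap F\subseteq\frac{1+\varepsilon}{M}B_F$, where $B_F$ is the Euclidean unit ball of $F$, $M=\int_{S^{n-1}}\|\theta\|\,d\sigma(\theta)$ and $\sigma$ is the uniform probability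 measure on $S^{n-1}$. *)

(* Defs.v *)
From HB Require Import structures.
From mathcomp Require Import all_boot all_order all_algebra.
From mathcomp Require Import all_classical all_reals all_analysis.

Set Implicit Arguments.
Unset Strict Implicit.
Unset Printing Implicit Defensive.

Import Order.TTheory GRing.Theory Num.Theory.
Import numFieldNormedType.Exports.

Local Open Scope classical_set_scope.
Local Open Scope ring_scope.

Notation borelType T := (g_sigma_algebraType (@open T)).

Section Euclidean.
Context {R : realType} {n : nat}.
Implicit Types x y : 'rV[R]_n.

Definition dot x y : R := \sum_(i < n) x 0 i * y 0 i.

(* The library norm `|x| on row vectors is the sup norm. *)
Definition enorm x : R := Num.sqrt (dot x x).

Definition sphere : set 'rV[R]_n := [set x | enorm x = 1].

Definition orthogonal (O : 'M[R]_n) : Prop := O *m O^T = 1%:M.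

(* A measure on S^{n-1} is a Borel measure on R^n that vanishes off S^{n-1}. *)
Definition on_sphere (mu : {measure set (borelType 'rV[R]_n) -> \bar R}) : Prop :=
  mu (~` sphere) = 0%E.

Definition uniform_on_sphere (sigma : probability (borelType 'rV[R]_n) R) : Prop :=
  on_sphere sigma /\
  forall O : 'M[R]_n, orthogonal O ->
  forall A : set (borelType 'rV[R]_n), measurable A ->
    sigma [set x *m O | x in A] = sigma A.

Definition isotropic (mu : {measure set (borelType 'rV[R]_n) -> \bar R}) : Prop :=
  [/\ on_sphere mu,
      forall A : set (borelType 'rV[R]_n), measurable A ->
        mu (-%R @` A) = mu A
    & forall x, ((enorm x ^+ 2)%:E =
        \int[mu]_(theta in sphere) (`|dot x theta| ^+ 2)%:E)%E].

(* N x is the norm of <x, .> in L_p(mu), so that x |-> <x, .> embeds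
   (R^n, N) isometrically in L_p(mu). *)
Definition lewis_position (p : R) (N : 'rV[R]_n -> R) : Prop :=
  exists2 mu : {measure set (borelType 'rV[R]_n) -> \bar R},
    isotropic mu & forall x, (N x)%:E = Lnorm mu p%:E (fun theta => (dot x theta)%:E).

Definition mean_norm (sigma : probability (borelType 'rV[R]_n) R)
    (N : 'rV[R]_n -> R) : R :=
  \int[sigma]_(theta in sphere) N theta.

Definition eball (F : {vspace 'rV[R]_n}) : set 'rV[R]_n :=
  [set x | x \in F /\ enorm x <= 1].

Definition spherical (sigma : probability (borelType 'rV[R]_n) R)
    (N : 'rV[R]_n -> R) (eps : R) (F : {vspace 'rV[R]_n}) : Prop :=
  let M := mean_norm sigma N in
  let BXF := [set x | N x <= 1] `&` [set x | x \in F] in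
  [set ((1 - eps) / M) *: x | x in eball F] `<=` BXF /\
  BXF `<=` [set ((1 + eps) / M) *: x | x in eball F].

End Euclidean.

Section Grassmannian.
Context (R : realType) (n : nat).

(* Matrix, acting on row vectors, of the projection onto F along the orthogonal
   complement of F. *)
Definition orthoproj (F : {vspace 'rV[R]_n}) : 'M[R]_n :=
  let B : 'M[R]_(\dim F, n) := \matrix_(i < \dim F) (vbasis F)`_i in
  proj_mx <<B>>%MS (kermx B^T).

Context (k : 'I_n.+1).

Definition grassmannian := {F : {vspace 'rV[R]_n} | \dim F == k}.

Lemma dim_span_take : \dim <<take k (vbasis {:'rV[R]_n})>>%VS == k.
Proof.
have fB : free (take k (vbasis {:'rV[R]_n})).
  have := basis_free (vbasisP {:'rV[R]_n}).
  by rewrite -{1}(cat_take_drop k (vbasis _)) => /catl_free.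
by rewrite (eqP fB) size_take_min size_tuple dimvf /dim /= mul1n (minn_idPl (leq_ord k)).
Qed.

Definition coordinate_subspace : grassmannian :=
  exist _ <<take k (vbasis {:'rV[R]_n})>>%VS dim_span_take.

HB.instance Definition _ := Choice.on grassmannian.
HB.instance Definition _ := isPointed.Build grassmannian coordinate_subspace.
(* The topology of the metric |P_E - P_F|, with P the orthogonal projection. *)
HB.instance Definition _ := Topological.copy grassmannian
  (initial_topology (fun F : grassmannian => orthoproj (val F))).

Definition haar_grassmannian (nu : probability (borelType grassmannian) R) : Prop :=
  forall O : 'M[R]_n, orthogonal O ->
  forall A : set (borelType grassmannian), measurable A ->
    nu [set F : grassmannian |
      exists2 E : grassmannian, A E & val F = (linfun (mulmxr O) @: val E)%VS] = nu A.

End Grassmannian.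

Definition psi {R : realType} (n : nat) (p t : R) : R :=
  Num.min (t ^+ 2 * n%:R / (p * 4 `^ p)) ((t * n%:R) `^ (2 / p)).

(* Main.v *)
Require Import Defs.
From HB Require Import structures.
From mathcomp Require Import all_boot all_order all_algebra.
From mathcomp Require Import all_classical all_reals all_analysis.
From mathcomp Require Import measurable_realfun.
From mathcomp Require Import ring lra zify.

Import Order.TTheory GRing.Theory Num.Theory.
Import numFieldNormedType.Exports.
Import Defs.

Local Open Scope classical_set_scope.
Local Open Scope ring_scope.

Set Implicit Arguments.
Unset Strict Implicit.
Unset Printing Implicit Defensive.

(* Write M for the mean of the norm N on the sphere and U for a Haar-distributed orthogonal
   matrix, so that a random section of X is X0 U with X0 a fixed k x n matrix with orthonormal
   rows.  On the sphere n^(1/p - 1/2) <= N <= 1, and the gradient of the p-th moment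
   W_p = N^p at x has squared length at most p^2 W_{2p-2}(x).  Walking from a U to b U in small
   steps along a great circle and averaging over the sign of each component orthogonal to the
   path bounds E (N(a U) - N(b U))^(2r) by
   (C n^(2/p - 1) |a - b|^2 (r/n + r^p/n^2))^r.
   If the rate min(eps^2 n, (eps n)^(2/p)) exceeds a constant, these moments feed a chaining
   argument over the unit sphere of R^k, with failure probability at most e^-k for k
   proportional to the rate.
   If the rate is bounded, then so is eps^2 n, and for k = 1 it suffices that the
   probability P of |N - M| <= eps M / 2 is at least c eps^2 n.  The covariance of N with its
   truncation at distance eps M / 4 from M is bounded below in terms of eps M and above by an
   average of the squared gradient of W_p over the event; this gives the bound as soon as the
   squared gradient is O(n^(2-p)) there, on average.  That holds by moment bounds unless eps is
   smaller than a power of 1/n; and then either E |N - M| is much larger than eps M, in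
   which case the trivial bound on the gradient suffices, or N is so close to a constant in
   mean that testing W_p against the polynomials <x, .>^(2j) forces
   W_p <= K n^(1 - p/2) everywhere.
   Finally the probability in the Grassmannian is the integral over U of the probability that
   F U is spherical, which by Fubini is at least the infimum over orthonormal X0. *)

(** * Bounded measurable functions *)

(** When psi is small the required probability is only of order psi, but k is still at least 1.
    Upper tail bounds then say nothing: what is needed is a lower bound, with a constant free of n,
    for the chance that a single value of the norm is close to its mean. Hence the separate
    treatment of the bounded rate, where eps^2 n takes the place of the minimum. The moment W_p is
    preferred to N because it is linear in the measure, so that averages over U pass inside by
    Fubini, and convex, so that an increment lies between the first-order terms at its two end
    points; no derivative of W_p is taken. Returning to N costs a factor L^(1-p) = L n^(p/2-1),
    where L = n^(1/p-1/2) is the lower bound of N on the sphere; this is offset exactly when the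
    squared gradient has its typical size n^(2-p), and the case distinctions at bounded rate serve
    to reach that size. All integrands are bounded everywhere, not only almost surely, so that
    integrals are real numbers and one predicate, stable under all operations used, settles
    measurability, integrability and Fubini. *)

Section BoundedMeasurable.
Context {d : measure_display} {T : measurableType d} {R : realType}.
Implicit Types f g : T -> R.

Definition bmf f := measurable_fun setT f /\ exists K : R, forall x, `|f x| <= K.

Lemma bmf_cst (c : R) : bmf (fun=> c).
Proof. by split; [exact: measurable_cst | exists `|c|]. Qed.

Lemma bmfD f g : bmf f -> bmf g -> bmf (fun x => f x + g x).
Proof.
move=> [mf [K hK]] [mg [L hL]]; split; first exact: measurable_funD.
by exists (K + L) => x; rewrite (le_trans (ler_normD _ _))// lerD.
Qed.

Lemma bmfN f : bmf f -> bmf (fun x => - f x).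
Proof.
move=> [mf [K hK]]; split; first exact: measurableT_comp.
by exists K => x; rewrite normrN.
Qed.

Lemma bmfB f g : bmf f -> bmf g -> bmf (fun x => f x - g x).
Proof. by move=> hf hg; apply: bmfD => //; exact: bmfN. Qed.

Lemma bmfM f g : bmf f -> bmf g -> bmf (fun x => f x * g x).
Proof.
move=> [mf [K hK]] [mg [L hL]]; split; first exact: measurable_funM.
by exists (K * L) => x; rewrite normrM ler_pM.
Qed.

Lemma bmfX f n : bmf f -> bmf (fun x => f x ^+ n).
Proof.
move=> [mf [K hK]]; split; first exact: measurable_funX.
by exists (K ^+ n) => x; rewrite normrX lerXn2r// nnegrE// (le_trans _ (hK x)).
Qed.

Lemma bmf_norm f : bmf f -> bmf (fun x => `|f x|).
Proof.
move=> [mf [K hK]]; split; first exact: measurableT_comp.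
by exists K => x; rewrite normr_id.
Qed.

Lemma bmf_sum (I : Type) (s : seq I) (P : pred I) (F : I -> T -> R) :
  (forall i, bmf (F i)) -> bmf (fun x => \sum_(i <- s | P i) F i x).
Proof.
move=> hF; elim: s => [|i s IH].
  by under eq_fun do rewrite big_nil; exact: bmf_cst.
under eq_fun do rewrite big_cons.
by case: (P i) => //; exact: bmfD.
Qed.

Lemma bmf_powR f (p : R) : 0 <= p -> bmf f -> bmf (fun x => `|f x| `^ p).
Proof.
move=> p0 hf; have [mf [K hK]] := bmf_norm hf; split.
  exact: (measurableT_comp (measurable_powR p)).
exists (K `^ p) => x; rewrite ger0_norm ?powR_ge0// ge0_ler_powR// ?nnegrE//.
  by rewrite (le_trans _ (hK x)).
by have := hK x; rewrite normr_id.
Qed.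

Lemma bmf_indic (A : set T) : measurable A -> bmf (\1_A : T -> R).
Proof.
move=> mA; split; first exact: measurable_indic.
by exists 1 => x; rewrite indicE; case: (_ \in _); rewrite ?normr1// normr0.
Qed.

End BoundedMeasurable.

Lemma bmf_comp {d d' : measure_display} {T : measurableType d}
    {T' : measurableType d'} {R : realType} (f : T' -> R) (g : T -> T') :
  measurable_fun setT g -> bmf f -> bmf (fun x => f (g x)).
Proof.
move=> mg [mf [K hK]]; split; last by exists K.
exact: measurableT_comp.
Qed.

Section Integral.
Context {d : measure_display} {T : measurableType d} {R : realType}.
Variable m : {finite_measure set T -> \bar R}.
Implicit Types f g : T -> R.

Lemma bmf_integrable f : bmf f -> m.-integrable setT (EFin \o f).
Proof.
move=> [mf [K hK]]; apply: measurable_bounded_integrable => //.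
  by rewrite ltey_eq fin_num_measure.
exists K; split; first exact: num_real.
by move=> L KL x _; apply: le_trans (hK x) (ltW KL).
Qed.

Lemma bintE f : bmf f -> (\int[m]_x (f x)%:E)%E = (\int[m]_x f x)%:E.
Proof. by move=> hf; rewrite /Rintegral fineK//; apply: integrable_fin_num => //; exact: bmf_integrable. Qed.

Lemma bintD f g : bmf f -> bmf g ->
  \int[m]_x (f x + g x) = \int[m]_x f x + \int[m]_x g x.
Proof. by move=> hf hg; rewrite RintegralD//; exact: bmf_integrable. Qed.

Lemma bintB f g : bmf f -> bmf g ->
  \int[m]_x (f x - g x) = \int[m]_x f x - \int[m]_x g x.
Proof. by move=> hf hg; rewrite RintegralB//; exact: bmf_integrable. Qed.

Lemma bintZ (c : R) f : bmf f -> \int[m]_x (c * f x) = c * \int[m]_x f x.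
Proof. by move=> hf; rewrite RintegralZl//; exact: bmf_integrable. Qed.

Lemma bintZr (c : R) f : bmf f -> \int[m]_x (f x * c) = (\int[m]_x f x) * c.
Proof. by move=> hf; rewrite RintegralZr//; exact: bmf_integrable. Qed.

Lemma bint_le f g : bmf f -> bmf g -> (forall x, f x <= g x) ->
  \int[m]_x f x <= \int[m]_x g x.
Proof. by move=> hf hg fg; apply: le_Rintegral => //; exact: bmf_integrable. Qed.

Lemma bint_ge0 f : (forall x, 0 <= f x) -> 0 <= \int[m]_x f x.
Proof. by move=> f0; exact: Rintegral_ge0. Qed.

Lemma bint_norm f : bmf f -> `|\int[m]_x f x| <= \int[m]_x `|f x|.
Proof. by move=> hf; apply: le_normr_Rintegral => //; exact: bmf_integrable. Qed.

Lemma bint_cst (c : R) : \int[m]_x c = c * fine (m setT).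
Proof. exact: Rintegral_cst. Qed.

Lemma bint_sum (I : Type) (s : seq I) (P : pred I) (F : I -> T -> R) :
  (forall i, bmf (F i)) ->
  \int[m]_x (\sum_(i <- s | P i) F i x) = \sum_(i <- s | P i) \int[m]_x F i x.
Proof.
move=> hF; elim: s => [|i s IH].
  under eq_Rintegral do rewrite big_nil.
  by rewrite bint_cst mul0r big_nil.
under eq_Rintegral do rewrite big_cons.
rewrite big_cons; case: (P i) => //.
by rewrite bintD ?IH//; exact: bmf_sum.
Qed.

Lemma bint_indic (A : set T) : measurable A ->
  \int[m]_x (\1_A x : R) = fine (m A).
Proof. by move=> mA; rewrite /Rintegral integral_indic// setIT. Qed.

Lemma bint_bound f K : bmf f -> (forall x, `|f x| <= K) ->
  `|\int[m]_x f x| <= K * fine (m setT).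
Proof.
move=> hf hK; rewrite (le_trans (bint_norm hf))// -bint_cst.
by apply: bint_le => //; [exact: bmf_norm | exact: bmf_cst].
Qed.

End Integral.

Section ProbabilityIntegral.
Context {d : measure_display} {T : measurableType d} {R : realType}.
Variable m : probability T R.

Lemma pint_cst (c : R) : \int[m]_x c = c.
Proof. by rewrite bint_cst [X in fine X](_ : _ = 1%E) ?mulr1//; exact: probability_setT. Qed.

(** Convexity of the power on the half-line. Multiplying the induction hypothesis by t leaves the
    nonnegative defect (r + 1) A (t - a)^2. *)
Lemma tangent_exprn (r : nat) (a t : R) : 0 <= a -> 0 <= t ->
  a ^+ r + r%:R * a ^+ r.-1 * (t - a) <= t ^+ r.
Proof.
move=> a0 t0; elim: r => [|r IH]; first by rewrite !expr0 !mul0r addr0.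
rewrite /= [leRHS]exprS; have := ler_wpM2l t0 IH; apply: le_trans.
case: r IH => [|r] IH; first by rewrite /= !expr1 !expr0; lra.
have A0 : 0 <= a ^+ r by exact: exprn_ge0.
rewrite /= !exprS -[in r.+2%:R]addn1 natrD -[in r.+1%:R]addn1 natrD.
rewrite -subr_ge0; set A := a ^+ r in A0 *.
have -> : t * (a * A + (r%:R + 1%:R) * A * (t - a)) -
  (a * (a * A) + (r%:R + 1%:R + 1%:R) * (a * A) * (t - a)) =
  (r%:R + 1) * A * (t - a) ^+ 2 by ring.
by rewrite mulr_ge0 ?sqr_ge0// mulr_ge0// addr_ge0.
Qed.

(** Integrate the tangent line at the mean of f: its linear term averages to zero. *)
Lemma pint_jensen (r : nat) (f : T -> R) : bmf f -> (forall x, 0 <= f x) ->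
  (\int[m]_x f x) ^+ r <= \int[m]_x (f x ^+ r).
Proof.
move=> hf f0; set a := \int[m]_x f x.
have a0 : 0 <= a by exact: bint_ge0.
have hB : bmf (fun x => f x - a) by apply: bmfB => //; exact: bmf_cst.
rewrite (_ : a ^+ r = \int[m]_x (a ^+ r + r%:R * a ^+ r.-1 * (f x - a))).
  apply: bint_le => [||x]; last exact: tangent_exprn.
    apply: bmfD; first exact: bmf_cst.
    by apply: bmfM => //; exact: bmf_cst.
  exact: bmfX.
rewrite bintD ?pint_cst//; [|exact: bmf_cst|].
  rewrite bintZ// bintB ?pint_cst//; last exact: bmf_cst.
  by rewrite subrr mulr0 addr0.
by apply: bmfM => //; exact: bmf_cst.
Qed.

Lemma pint_jensen_even (r : nat) (f : T -> R) : bmf f ->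
  (\int[m]_x f x) ^+ r.*2 <= \int[m]_x (f x ^+ r.*2).
Proof.
move=> hf; have en (u : R) : u ^+ r.*2 = `|u| ^+ r.*2.
  by rewrite -[in RHS]muln2 mulnC [RHS]exprM real_normK ?num_real// -exprM mulnC muln2.
rewrite en; apply: (@le_trans _ _ ((\int[m]_x `|f x|) ^+ r.*2)).
  by rewrite lerXn2r ?nnegrE ?bint_ge0// bint_norm.
apply: le_trans (pint_jensen _ _ _) _ => //; first exact: bmf_norm.
by under [leRHS]eq_Rintegral do rewrite en.
Qed.

End ProbabilityIntegral.

Section ProductIntegral.
Context {d1 d2 : measure_display} {T1 : measurableType d1}
  {T2 : measurableType d2} {R : realType}.
Variables (m1 : {finite_measure set T1 -> \bar R})
  (m2 : {finite_measure set T2 -> \bar R}).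
Implicit Types f : T1 * T2 -> R.

Lemma bmf_pair1 f y : bmf f -> bmf (fun x => f (x, y)).
Proof.
move=> [mf [K hK]]; split; last by exists K => x.
exact: measurable_fun_pair1.
Qed.

Lemma bmf_pair2 f x : bmf f -> bmf (fun y => f (x, y)).
Proof.
move=> [mf [K hK]]; split; last by exists K => y.
exact: measurable_fun_pair2.
Qed.

Lemma bmf_prod_integrable f : bmf f ->
  (m1 \x m2)%E.-integrable setT (EFin \o f).
Proof.
move=> hf; have [mf [K hK]] := hf.
apply/integrable12ltyP; first exact/measurable_EFinP.
apply: (@le_lt_trans _ _ (\int[m1]_x (\int[m2]_y `|K|)%:E)%E); last first.
  by rewrite integral_cst// lte_mul_pinfty ?lee_fin ?bint_ge0// ltey_eq fin_num_measure.
apply: ge0_le_integral => //=.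
- by move=> x _; apply: integral_ge0.
- have mg : measurable_fun setT (fun z => `|(f z)%:E|%E).
    by apply: measurableT_comp => //; exact/measurable_EFinP.
  exact: (@measurable_fun_fubini_tonelli_F _ _ _ _ _ m2 _ mg).
move=> x _; rewrite -bintE; last exact: bmf_cst.
apply: ge0_le_integral => //=.
  have [mx _] := bmf_pair2 x hf.
  by apply/measurable_EFinP; exact: measurableT_comp.
by move=> y _; rewrite lee_fin; apply: le_trans (hK (x, y)) (ler_norm _).
Qed.

Lemma bmf_int2_prod f : bmf f -> bmf (fun x => \int[m2]_y f (x, y)).
Proof.
move=> hf; split.
  apply: measurableT_comp => //.
  exact: (measurable_fubini_F (bmf_prod_integrable hf)).
have [_ [K hK]] := hf; exists (K * fine (m2 setT)) => x.
by apply: bint_bound => //; exact: bmf_pair2.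
Qed.

Lemma bmf_int1_prod f : bmf f -> bmf (fun y => \int[m1]_x f (x, y)).
Proof.
move=> hf; split.
  apply: measurableT_comp => //.
  exact: (measurable_fubini_G (bmf_prod_integrable hf)).
have [_ [K hK]] := hf; exists (K * fine (m1 setT)) => x.
by apply: bint_bound => //; exact: bmf_pair1.
Qed.

Lemma bint_Fubini f : bmf f ->
  \int[m1]_x \int[m2]_y f (x, y) = \int[m2]_y \int[m1]_x f (x, y).
Proof.
move=> hf; apply: EFin_inj.
rewrite -bintE; last exact: bmf_int2_prod.
rewrite -bintE; last exact: bmf_int1_prod.
have := Fubini (bmf_prod_integrable hf).
have E1 x : (\int[m2]_y (EFin \o f) (x, y))%E = (\int[m2]_y f (x, y))%:E.
  by rewrite -bintE//; exact: bmf_pair2.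
have E2 y : (\int[m1]_x (EFin \o f) (x, y))%E = (\int[m1]_x f (x, y))%:E.
  by rewrite -bintE//; exact: bmf_pair1.
under eq_integral do rewrite E1.
by under [X in _ = X -> _]eq_integral do rewrite E2.
Qed.

End ProductIntegral.

(** Measurability of a partial integral does not depend on a measure on the first factor; a Dirac
    mass supplies the one that [bmf_int2_prod] takes. *)
Lemma bmf_int2 {d1 d2 : measure_display} {T1 : measurableType d1}
    {T2 : measurableType d2} {R : realType} (m2 : {finite_measure set T2 -> \bar R})
    (f : T1 * T2 -> R) : bmf f -> bmf (fun x => \int[m2]_y f (x, y)).
Proof. exact: (@bmf_int2_prod _ _ _ _ _ (@dirac _ T1 point R)). Qed.

(** * Borel measurability of matrix-valued maps *)

Lemma borel_continuous (R : realType) (T : ptopologicalType) (f : T -> R) :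
  continuous f -> measurable_fun setT (f : borelType T -> R).
Proof.
move=> cf; apply: (measurability _ (RGenOInfty.measurableE R)) => //.
move=> /= _ [_ [a ->] <-]; rewrite setTI; apply: sub_sigma_algebra.
by apply: open_comp => //; exact: open_gt.
Qed.

Lemma borel_entry (R : realType) (m n : nat) (i : 'I_m) (j : 'I_n) :
  measurable_fun setT (fun A : borelType 'M[R]_(m, n) => A i j).
Proof. by apply: borel_continuous; exact: coord_continuous. Qed.

(** Every open set of matrices is a countable union of the boxes with rational centre and radius
    1/(k+1) that it contains, and the preimage of a box is a finite intersection of conditions on
    entries. *)
Lemma measurable_mx_entries {d : measure_display} (T : measurableType d)
    (R : realType) (m n : nat) (X : T -> 'M[R]_(m, n)) :
  (forall i j, measurable_fun setT (fun t => X t i j)) ->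
  measurable_fun setT (X : T -> borelType 'M[R]_(m, n)).
Proof.
move=> mX; have E : @measurable _ (borelType 'M[R]_(m, n)) = <<s @open 'M[R]_(m, n) >> by [].
apply: (measurability _ E) => _ [B oB <-]; rewrite setTI.
pose box (c : 'M[rat]_(m, n) * nat) : set 'M[R]_(m, n) :=
  [set y | forall i j, `|y i j - ratr (c.1 i j)| < c.2.+1%:R^-1].
rewrite (_ : X @^-1` B =
    \bigcup_c (if `[< box c `<=` B >] then X @^-1` box c else set0)).
  apply: countable_bigcupT_measurable => // c; case: asboolP => // _.
  rewrite (_ : X @^-1` box c = \bigcap_i \bigcap_j
      ((fun t => X t i j) @^-1` [set y | `|y - ratr (c.1 i j)| < c.2.+1%:R^-1])).
    apply: fin_bigcap_measurable; [exact: finite_finset|] => i _; apply: fin_bigcap_measurable; [exact: finite_finset|] => j _.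
    rewrite -[X in measurable X]setTI; apply: mX => //.
    apply: open_measurable.
    rewrite (_ : [set y | _] = ball (ratr (c.1 i j) : R^o) (c.2.+1%:R^-1 : R)).
      exact: ball_open.
    by apply/seteqP; split => y /=; rewrite distrC -ball_normE.
  by apply/seteqP; split => t h; [move=> i _ j _|move=> i j]; exact: h.
apply/seteqP; split => [t Ot|t [c _]]; last first.
  by case: asboolP => // cO; exact: cO.
have : nbhs (X t) B by exact: open_nbhs_nbhs.
move=> /nbhs_ballP[e /= e0 eO].
(* Twice the radius stays below e: one [del] leads from [X t] to the rational centre, another from
   the centre to any point of the box. *)
pose k := Num.truncn (2 / e); pose del : R := k.+1%:R^-1.
have d0 : 0 < del by rewrite invr_gt0.
have de : 2 * del < e.
  by rewrite ltr_pdivrMr// mulrC -ltr_pdivrMr// truncnS_gt.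
have hq i j : exists q : rat, `|X t i j - ratr q| < del.
  have /rat_in_itvoo[q] : X t i j - del < X t i j + del by lra.
  by rewrite in_itv /= => /andP[h1 h2]; exists q; rewrite ltr_norml; lra.
pose q : 'M[rat]_(m, n) := \matrix_(i, j) xchoose (hq i j).
exists (q, k) => //; case: asboolP => [_ i j|[]].
  by rewrite /= mxE; exact: (xchooseP (hq i j)).
move=> y hy; apply: eO; split => // i j.
rewrite -ball_normE /=; have := hy i j; rewrite /= mxE.
have := xchooseP (hq i j); set r := ratr _.
rewrite -/del !ltr_norml; lra.
Qed.

(** * Euclidean geometry of row vectors *)

Section EuclideanGeometry.
Context {R : realType} {n : nat}.
Implicit Types (x y z : 'rV[R]_n) (O : 'M[R]_n).

Lemma dot_mulmx x y : dot x y = (x *m y^T) 0 0.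
Proof. by rewrite mxE; apply: eq_bigr => i _; rewrite mxE. Qed.

Lemma dotC x y : dot x y = dot y x.
Proof. by apply: eq_bigr => i _; rewrite mulrC. Qed.

Lemma dotDl x y z : dot (x + y) z = dot x z + dot y z.
Proof. by rewrite -big_split; apply: eq_bigr => i _; rewrite mxE mulrDl. Qed.

Lemma dotZl (a : R) x y : dot (a *: x) y = a * dot x y.
Proof. by rewrite mulr_sumr; apply: eq_bigr => i _; rewrite mxE mulrA. Qed.

Lemma dotDr x y z : dot x (y + z) = dot x y + dot x z.
Proof. by rewrite dotC dotDl !(dotC _ x). Qed.

Lemma dotZr (a : R) x y : dot x (a *: y) = a * dot x y.
Proof. by rewrite dotC dotZl dotC. Qed.

Lemma dotNl x y : dot (- x) y = - dot x y.
Proof. by rewrite -scaleN1r dotZl mulN1r. Qed.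

Lemma dotNr x y : dot x (- y) = - dot x y.
Proof. by rewrite -scaleN1r dotZr mulN1r. Qed.

Lemma dot0l x : dot 0 x = 0.
Proof. by rewrite -(scale0r 0) dotZl mul0r. Qed.

Lemma dot0r x : dot x 0 = 0.
Proof. by rewrite dotC dot0l. Qed.

Definition dotE := (dotDl, dotDr, dotNl, dotNr, dotZl, dotZr, dot0l, dot0r).

Lemma dot_suml (I : Type) (s : seq I) (P : pred I) (F : I -> 'rV[R]_n) y :
  dot (\sum_(i <- s | P i) F i) y = \sum_(i <- s | P i) dot (F i) y.
Proof.
elim/big_rec2 : _ => [|i a b _ <-]; first by rewrite dot0l.
by rewrite dotDl.
Qed.

Lemma dot_sumr (I : Type) (s : seq I) (P : pred I) (F : I -> 'rV[R]_n) y :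
  dot y (\sum_(i <- s | P i) F i) = \sum_(i <- s | P i) dot y (F i).
Proof. by rewrite dotC dot_suml; apply: eq_bigr => i _; rewrite dotC. Qed.

Lemma dot_ge0 x : 0 <= dot x x.
Proof. by apply: sumr_ge0 => i _; rewrite -expr2 sqr_ge0. Qed.

Lemma dot_eq0 x : dot x x = 0 -> x = 0.
Proof.
move=> h; apply/rowP => i; rewrite mxE; apply/eqP.
move: h => /eqP; rewrite psumr_eq0 => [/allP/(_ i)|j _].
  by rewrite mem_index_enum -expr2 sqrf_eq0 => /(_ isT).
by rewrite -expr2 sqr_ge0.
Qed.

Lemma dot_gt0 x : x != 0 -> 0 < dot x x.
Proof.
by move=> x0; rewrite lt_def dot_ge0 andbT; apply: contra x0 => /eqP/dot_eq0 ->.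
Qed.

Lemma dot_delta x i : dot x (delta_mx 0 i) = x 0 i.
Proof.
rewrite /dot (bigD1 i) //= mxE !eqxx mulr1 big1 ?addr0// => j ji.
by rewrite mxE (negbTE ji) andbF mulr0.
Qed.

Lemma dot_CS x y : dot x y ^+ 2 <= dot x x * dot y y.
Proof.
have [->|y0] := eqVneq y 0; first by rewrite !dotE mulr0 expr0n.
have := dot_ge0 (dot y y *: x - dot x y *: y).
rewrite !dotE (dotC y x) => h.
have yy := dot_gt0 y0.
rewrite -subr_ge0 -(pmulr_rge0 _ yy); apply: le_trans h _.
by rewrite le_eqVlt; apply/orP; left; apply/eqP; ring.
Qed.

Lemma orthogonal1 : orthogonal (1%:M : 'M[R]_n).
Proof. by rewrite /orthogonal trmx1 mulmx1. Qed.

Lemma orthogonalM O1 O2 : orthogonal O1 -> orthogonal O2 -> orthogonal (O1 *m O2).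
Proof.
move=> h1 h2; rewrite /orthogonal trmx_mul mulmxA -(mulmxA O1).
by rewrite h2 mulmx1.
Qed.

Lemma orthogonal_trK O : orthogonal O -> O^T *m O = 1%:M.
Proof. exact: mulmx1C. Qed.

Lemma orthogonal_tr O : orthogonal O -> orthogonal O^T.
Proof. by move=> h; rewrite /orthogonal trmxK orthogonal_trK. Qed.

Lemma dot_orthogonal O x y : orthogonal O -> dot (x *m O) (y *m O) = dot x y.
Proof. by move=> h; rewrite !dot_mulmx trmx_mul mulmxA -(mulmxA x) h mulmx1. Qed.

(** The Householder reflection in the hyperplane orthogonal to x - y; equal lengths make it exchange
    x and y. *)
Lemma reflection_exists x y : dot x x = dot y y ->
  exists O, [/\ orthogonal O, x *m O = y &
    forall z, dot z x = dot z y -> z *m O = z].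
Proof.
move=> xy; have [->|ne] := eqVneq x y.
  by exists 1%:M; split=> [||z _]; rewrite ?mulmx1//; exact: orthogonal1.
pose v := x - y; have v0 : v != 0 by rewrite subr_eq0.
have vv := dot_gt0 v0; have vn := lt0r_neq0 vv.
pose H : 'M[R]_n := 1%:M - (2 / dot v v) *: (v^T *m v).
have vvT : v *m v^T = (dot v v)%:M.
  by rewrite [LHS]mx11_scalar dot_mulmx.
have zH z : z *m H = z - (2 * dot z v / dot v v) *: v.
  rewrite mulmxBr mulmx1 -scalemxAr mulmxA.
  rewrite [z *m v^T]mx11_scalar -dot_mulmx mul_scalar_mx scalerA.
  by congr (_ - _ *: _); ring.
have HT : H^T = H by rewrite linearB /= trmx1 linearZ /= trmx_mul trmxK.
exists H; split.
- have AA : v^T *m v *m (v^T *m v) = dot v v *: (v^T *m v).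
    by rewrite mulmxA -(mulmxA v^T) vvT mul_mx_scalar -scalemxAl.
  rewrite /orthogonal HT mulmxBl mul1mx -scalemxAl mulmxBr mulmx1.
  rewrite -scalemxAr AA scalerBr !scalerA -mulrA.
  have -> : 2 / dot v v * (2 / dot v v * dot v v) = 2 / dot v v + 2 / dot v v by field.
  by rewrite scalerDl opprB addrK subrK.
- rewrite zH; have -> : 2 * dot x v / dot v v = 1.
    apply: (mulIf vn); rewrite mulfVK// mul1r /v !dotE (dotC y x) -xy; ring.
  by rewrite scale1r /v subKr.
- move=> z zxy; rewrite zH (_ : dot z v = 0); last by rewrite /v !dotE zxy subrr.
  by rewrite mulr0 mul0r scale0r subr0.
Qed.

(** After V has matched the tails, one reflection carries x V to y. It fixes the matched tail, whose
    members have equal inner products with x V and y by equality of the Gram matrices. *)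
Lemma congruence (xs ys : seq 'rV[R]_n) : size xs = size ys ->
  (forall i j, (i < size xs)%N -> (j < size xs)%N ->
     dot xs`_i xs`_j = dot ys`_i ys`_j) ->
  exists2 O, orthogonal O & map (mulmx^~ O) xs = ys.
Proof.
elim: xs ys => [|x xs IH] [|y ys] //= => [_ _|[sz] h].
  by exists 1%:M => //; exact: orthogonal1.
have [|V hV eV] := IH ys sz; first by move=> i j il jl; exact: (h i.+1 j.+1).
have [|H [hH eH fH]] := @reflection_exists (x *m V) y.
  by rewrite dot_orthogonal//; exact: (h 0%N 0%N).
exists (V *m H); first exact: orthogonalM.
rewrite mulmxA eH; congr (_ :: _); rewrite -eV; apply/eq_in_map => z zxs.
rewrite /= mulmxA fH// dot_orthogonal//.
have iz : (index z xs < size xs)%N by rewrite index_mem.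
have := h (index z xs).+1 0%N iz isT; rewrite /= nth_index// => ->.
by rewrite -eV (nth_map 0)// nth_index.
Qed.

Lemma exists_unit_orthogonal (s : seq 'rV[R]_n) : (size s < n)%N ->
  exists2 v : 'rV[R]_n, dot v v = 1 & forall x, x \in s -> dot v x = 0.
Proof.
move=> sn; pose M : 'M[R]_(n, size s) := \matrix_(i, j) (s`_j) 0 i.
have : kermx M != 0.
  rewrite -mxrank_eq0 mxrank_ker -lt0n subn_gt0.
  exact: leq_ltn_trans (rank_leq_col _) sn.
move=> /rowV0Pn[v /sub_kermxP vM v0].
have vv := dot_gt0 v0.
exists ((Num.sqrt (dot v v))^-1 *: v) => [|x xs].
  rewrite !dotE mulrA -expr2 exprVn sqr_sqrtr ?ltW// mulVf//.
  by rewrite lt0r_neq0.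
rewrite dotZl; apply/eqP; rewrite mulf_eq0; apply/orP; right; apply/eqP.
have ix : (index x s < size s)%N by rewrite index_mem.
have := congr1 (fun A : 'rV_(size s) => A 0 (Ordinal ix)) vM; rewrite !mxE; apply: etrans.
by apply: eq_bigr => i _; rewrite mxE /= nth_index.
Qed.

End EuclideanGeometry.

(** * A left-invariant random orthogonal matrix *)

Lemma bint_invariant {d : measure_display} {T : measurableType d} {R : realType}
    (m : {finite_measure set T -> \bar R}) (g : T -> T) (f : T -> R) :
  measurable_fun setT g -> (forall S, measurable S -> m (g @^-1` S) = m S) ->
  bmf f -> \int[m]_x f (g x) = \int[m]_x f x.
Proof.
move=> mg hg hf; rewrite /Rintegral; congr fine.
have hfg := bmf_comp mg hf.
have := @integral_pushforward _ _ _ _ _ _ mg m setT (EFin \o f).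
rewrite preimage_setT => <- //.
- by apply: eq_measure_integral => A mA _; exact: hg.
- by apply/measurable_EFinP; case: hf.
- exact: bmf_integrable.
Qed.

Lemma image_law {d d' : measure_display} {T : measurableType d}
    {T' : measurableType d'} {R : realType} (P : probability T R) (f : T -> T') :
  measurable_fun setT f -> exists Q : probability T' R, forall S, Q S = P (f @^-1` S).
Proof. by move=> mf; exists (distribution P (mfun_Sub (mem_set mf))). Qed.

Lemma conditioned_law {d : measure_display} {T : measurableType d} {R : realType}
    (m : {measure set T -> \bar R}) (E : set T) (P : probability T R) :
  measurable E -> m E != 0%E -> m E \is a fin_num ->
  exists Q : probability T R,
    forall S, Q S = (m (S `&` E) * (fine (m E))^-1%:E)%E.
Proof.
move=> mE E0 Efin; exists (mnormalize (mrestr m mE) P) => S.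
have Ey : m E != +oo%E by rewrite -ltey -ge0_fin_numE.
by rewrite /= /mnormalize /= /mrestr setTI (negbTE E0) (negbTE Ey).
Qed.

Section BorelMatrixMaps.
Context {d : measure_display} {T : measurableType d} {R : realType}.

Lemma measurable_entry m n (A : T -> 'M[R]_(m, n)) i j :
  measurable_fun setT (A : T -> borelType 'M[R]_(m, n)) ->
  measurable_fun setT (fun t => A t i j).
Proof. by move=> mA; exact: (measurableT_comp (borel_entry i j)). Qed.

Lemma measurable_mulmx m n q (A : T -> 'M[R]_(m, n)) (B : T -> 'M[R]_(n, q)) :
  measurable_fun setT (A : T -> borelType 'M[R]_(m, n)) ->
  measurable_fun setT (B : T -> borelType 'M[R]_(n, q)) ->
  measurable_fun setT ((fun t => A t *m B t) : T -> borelType 'M[R]_(m, q)).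
Proof.
move=> mA mB; apply: measurable_mx_entries => i j.
under eq_fun do rewrite mxE.
by apply: measurable_sum => k; apply: measurable_funM; exact: measurable_entry.
Qed.

Lemma measurable_trmx m n (A : T -> 'M[R]_(m, n)) :
  measurable_fun setT (A : T -> borelType 'M[R]_(m, n)) ->
  measurable_fun setT ((fun t => (A t)^T) : T -> borelType 'M[R]_(n, m)).
Proof.
move=> mA; apply: measurable_mx_entries => i j.
by under eq_fun do rewrite mxE; exact: measurable_entry.
Qed.

Lemma measurable_subr_mx m n (A B : T -> 'M[R]_(m, n)) :
  measurable_fun setT (A : T -> borelType 'M[R]_(m, n)) ->
  measurable_fun setT (B : T -> borelType 'M[R]_(m, n)) ->
  measurable_fun setT ((fun t => A t - B t) : T -> borelType 'M[R]_(m, n)).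
Proof.
move=> mA mB; apply: measurable_mx_entries => i j.
under eq_fun do rewrite !mxE.
by apply: measurable_funB; exact: measurable_entry.
Qed.

Lemma measurable_scale_mx m n (c : T -> R) (A : T -> 'M[R]_(m, n)) :
  measurable_fun setT c ->
  measurable_fun setT (A : T -> borelType 'M[R]_(m, n)) ->
  measurable_fun setT ((fun t => c t *: A t) : T -> borelType 'M[R]_(m, n)).
Proof.
move=> mc mA; apply: measurable_mx_entries => i j.
under eq_fun do rewrite !mxE.
by apply: measurable_funM => //; exact: measurable_entry.
Qed.

Lemma measurable_col_mx m1 m2 n (A : T -> 'M[R]_(m1, n)) (B : T -> 'M[R]_(m2, n)) :
  measurable_fun setT (A : T -> borelType 'M[R]_(m1, n)) ->
  measurable_fun setT (B : T -> borelType 'M[R]_(m2, n)) ->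
  measurable_fun setT ((fun t => col_mx (A t) (B t)) : T -> borelType 'M[R]_(m1 + m2, n)).
Proof.
move=> mA mB; apply: measurable_mx_entries => i j.
case: (split_ordP i) => k ->.
  by under eq_fun do rewrite col_mxEu; exact: measurable_entry.
by under eq_fun do rewrite col_mxEd; exact: measurable_entry.
Qed.

Lemma measurable_dot n (x y : T -> 'rV[R]_n) :
  measurable_fun setT (x : T -> borelType 'rV[R]_n) ->
  measurable_fun setT (y : T -> borelType 'rV[R]_n) ->
  measurable_fun setT (fun t => dot (x t) (y t)).
Proof.
move=> mx my; apply: measurable_sum => k.
by apply: measurable_funM; exact: measurable_entry.
Qed.

Lemma measurable_mx_eq m n (A B : T -> 'M[R]_(m, n)) :
  measurable_fun setT (A : T -> borelType 'M[R]_(m, n)) ->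
  measurable_fun setT (B : T -> borelType 'M[R]_(m, n)) ->
  measurable [set t | A t = B t].
Proof.
move=> mA mB; rewrite (_ : [set t | _] =
    \bigcap_i \bigcap_j (fun t => A t i j == B t i j) @^-1` [set true]).
  apply: fin_bigcap_measurable; [exact: finite_finset|] => i _.
  apply: fin_bigcap_measurable; [exact: finite_finset|] => j _.
  rewrite -[X in measurable X]setTI; apply: measurable_fun_eqr => //;
  exact: measurable_entry.
apply/seteqP; split => t /=.
  by move=> h i _ j _ /=; rewrite h eqxx.
by move=> h; apply/matrixP => i j; apply/eqP/(h i I j I).
Qed.

End BorelMatrixMaps.

Lemma borel_id (R : realType) m n :
  measurable_fun setT (fun A : borelType 'M[R]_(m, n) => A).
Proof. exact: measurable_id. Qed.

Section HaarMatrix.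
Context (R : realType) (n : nat).

(* U retracts all matrices onto the orthogonal group, so that functions of U w
   are bounded everywhere and not only almost surely. *)
Definition haar_matrix (tau : probability (borelType 'M[R]_n) R)
    (U : borelType 'M[R]_n -> 'M[R]_n) :=
  [/\ measurable_fun setT (U : _ -> borelType 'M[R]_n),
      forall w, orthogonal (U w),
      forall A, orthogonal A -> U A = A &
      forall (O : 'M[R]_n) (g : borelType 'M[R]_n -> R), orthogonal O -> bmf g ->
        \int[tau]_w g (O *m U w) = \int[tau]_w g (U w)].

Variable sigma : probability (borelType 'rV[R]_n) R.
Hypothesis n_gt0 : (0 < n)%N.
Hypothesis hsigma : uniform_on_sphere sigma.

Lemma measurable_sphere : measurable (sphere : set (borelType 'rV[R]_n)).
Proof.
rewrite (_ : sphere = (fun x : borelType 'rV[R]_n => dot x x) @^-1` [set 1]).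
  rewrite -[X in measurable X]setTI; apply: measurable_dot => //; exact: borel_id.
apply/seteqP; split => x; rewrite /sphere /enorm /= => h.
  by rewrite -[LHS]sqr_sqrtr ?dot_ge0// h expr1n.
by rewrite h sqrtr1.
Qed.

Lemma sphereP (x : 'rV[R]_n) : sphere x <-> dot x x = 1.
Proof.
rewrite /sphere /enorm /=; split => [h|->]; last by rewrite sqrtr1.
by rewrite -[LHS]sqr_sqrtr ?dot_ge0// h expr1n.
Qed.

Lemma sigma_sphere : sigma sphere = 1%E.
Proof.
have [h _] := hsigma; have := probability_setC sigma (measurableC measurable_sphere).
by rewrite setCK => ->; rewrite -[X in (_ - X)%E]/(sigma _) h sube0.
Qed.

Lemma measurable_mulr (O : 'M[R]_n) m : measurable_fun setT
  ((fun A : borelType 'M[R]_(m, n) => A *m O) : _ -> borelType 'M[R]_(m, n)).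
Proof.
apply: measurable_mulmx; first exact: borel_id.
exact: measurable_cst.
Qed.

Lemma sigma_invariant (O : 'M[R]_n) (S : set (borelType 'rV[R]_n)) :
  orthogonal O -> measurable S -> sigma ((fun x => x *m O) @^-1` S) = sigma S.
Proof.
move=> hO mS; have [_ h] := hsigma.
have mP : measurable ((fun x : borelType 'rV[R]_n => x *m O) @^-1` S).
  by rewrite -[X in measurable X]setTI; exact: (@measurable_mulr O 1).
rewrite -(h O hO _ mP); congr (sigma _); apply/seteqP; split => [_ [x xS <-]//|x Sx].
have e : x *m O^T *m O = x by rewrite -mulmxA orthogonal_trK// mulmx1.
by exists (x *m O^T) => //=; rewrite e.
Qed.

(** Invariance makes the mass independent of v. Were it zero, the n sets belonging to the coordinate
    vectors, which cover the sphere, would all be null. The uniform c keeps Gram-Schmidt from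
    degenerating, whatever frame has been drawn before. *)
Lemma sigma_halfspace : exists2 c : R, 0 < c & forall v : 'rV[R]_n, dot v v = 1 ->
  sigma [set x | dot x v != 0] = c%:E.
Proof.
have mS (v : 'rV[R]_n) : measurable [set x : borelType 'rV[R]_n | dot x v != 0].
  rewrite (_ : [set x | _] = (fun x : borelType 'rV[R]_n => dot x v) @^-1` [set~ 0]).
    rewrite -[X in measurable X]setTI.
    have mf : measurable_fun setT (fun x : borelType 'rV[R]_n => dot x v).
      by apply: measurable_dot; [exact: borel_id|exact: measurable_cst].
    by apply: mf => //; exact: measurableC.
  by apply/seteqP; split => x /= /eqP.
have [v0 v01 _] := @exists_unit_orthogonal R n [::] n_gt0.
have inv (v : 'rV[R]_n) : dot v v = 1 ->
    sigma [set x | dot x v != 0] = sigma [set x | dot x v0 != 0].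
  move=> v1; have [|O [hO vO _]] := @reflection_exists _ _ v v0.
    by rewrite v1 v01.
  rewrite -[RHS](@sigma_invariant O)//.
  by congr (sigma _); apply/seteqP; split => x /=; rewrite -vO dot_orthogonal.
have f0 : sigma [set x | dot x v0 != 0] \is a fin_num by exact: fin_num_measure.
exists (fine (sigma [set x | dot x v0 != 0])) => [|v /inv ->]; last by rewrite fineK.
rewrite fine_gt0// -ge0_fin_numE// f0 andbT lt0e measure_ge0 andbT.
apply/eqP => s0; have : (sigma sphere <= 0)%E.
  have := @content_sub_fsum _ _ _ sigma 'I_n setT sphere
    (fun i => [set x | dot x (delta_mx 0 i) != 0]).
  rewrite fsbig1 => [|i _]; last first.
    by rewrite -[LHS]/(sigma _) inv// dot_delta mxE !eqxx.
  move=> h; apply: h => //; [exact: finite_finset|exact: measurable_sphere|].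
  move=> x /sphereP x1.
  have [i xi] : exists i, x 0 i != 0.
    apply/existsP; apply: contra_eqT x1; rewrite negb_exists => /forallP h.
    rewrite (_ : x = 0) ?dot0l ?(eq_sym 0) ?oner_eq0//.
    by apply/rowP => i; rewrite mxE; apply/eqP; have := h i; rewrite negbK.
  by exists i => //=; rewrite dot_delta.
by rewrite sigma_sphere lee_fin ler10.
Qed.

(** An invariant law on the Stiefel manifold of orthonormal j-frames, built one row at a time since
    the uniform law on the sphere is the only given source of randomness. *)
Definition has_frame_law (j : nat) := exists tau : probability (borelType 'M[R]_(j, n)) R,
  tau [set A | A *m A^T = 1%:M] = 1%E /\
  forall (O : 'M[R]_n) (S : set (borelType 'M[R]_(j, n))), orthogonal O ->
    measurable S -> tau ((fun A => A *m O) @^-1` S) = tau S.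

Lemma measurable_frames j :
  measurable [set A : borelType 'M[R]_(j, n) | A *m A^T = 1%:M].
Proof.
apply: measurable_mx_eq; last exact: measurable_cst.
apply: measurable_mulmx; first exact: borel_id.
by apply: measurable_trmx; exact: borel_id.
Qed.

Lemma has_frame_law0 : has_frame_law 0.
Proof.
exists (@dirac _ (borelType 'M[R]_(0, n)) 0 R); split.
  by rewrite /= /dirac indicE mem_set//=; apply/matrixP => -[].
move=> O S hO mS; congr (_ _); apply/seteqP; split => A /=;
  by rewrite (_ : A *m O = A)//; apply/matrixP => -[].
Qed.

Definition frame_residue j (z : 'M[R]_(j, n) * 'rV[R]_n) : 'rV[R]_n :=
  z.2 - z.2 *m z.1^T *m z.1.

(** One Gram-Schmidt step. The real power -1/2 normalises by a total function already known to be
    measurable. *)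
Definition frame_extension j (z : 'M[R]_(j, n) * 'rV[R]_n) : 'M[R]_(1 + j, n) :=
  let y := frame_residue z in col_mx (dot y y `^ (- 2^-1) *: y) z.1.

Lemma measurable_frame_residue j : measurable_fun setT
  (@frame_residue j : borelType 'M[R]_(j, n) * borelType 'rV[R]_n -> borelType 'rV[R]_n).
Proof.
rewrite /frame_residue.
apply: measurable_subr_mx; first exact: measurable_snd.
apply: measurable_mulmx; last exact: measurable_fst.
apply: measurable_mulmx; first exact: measurable_snd.
by apply: measurable_trmx; exact: measurable_fst.
Qed.

Lemma measurable_frame_extension j : measurable_fun setT
  (@frame_extension j :
     borelType 'M[R]_(j, n) * borelType 'rV[R]_n -> borelType 'M[R]_(1 + j, n)).
Proof.
rewrite /frame_extension.
apply: measurable_col_mx; last exact: measurable_fst.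
apply: measurable_scale_mx; last exact: measurable_frame_residue.
apply: (measurableT_comp (measurable_powR (- 2^-1))).
by apply: measurable_dot; exact: measurable_frame_residue.
Qed.

Lemma frame_residueM j (A : 'M[R]_(j, n)) (x : 'rV[R]_n) O : orthogonal O ->
  frame_residue (A *m O, x *m O) = frame_residue (A, x) *m O.
Proof.
move=> hO; rewrite /frame_residue /= trmx_mul mulmxBl; congr (_ - _).
by rewrite !mulmxA -(mulmxA x) hO mulmx1.
Qed.

Lemma frame_extensionM j (A : 'M[R]_(j, n)) (x : 'rV[R]_n) O : orthogonal O ->
  frame_extension (A *m O, x *m O) = frame_extension (A, x) *m O.
Proof.
move=> hO; rewrite /frame_extension frame_residueM// dot_orthogonal//.
by rewrite mul_col_mx scalemxAl.
Qed.

Lemma frame_extensionP j (A : 'M[R]_(j, n)) (x : 'rV[R]_n) :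
  A *m A^T = 1%:M -> frame_residue (A, x) != 0 ->
  frame_extension (A, x) *m (frame_extension (A, x))^T = 1%:M.
Proof.
move=> hA y0; rewrite /frame_extension /=; set y := frame_residue _ in y0 *.
have yA : y *m A^T = 0.
  by rewrite /y /frame_residue /= mulmxBl -!mulmxA hA mulmx1 subrr.
have Ay : A *m y^T = 0 by rewrite -[LHS]trmxK trmx_mul trmxK yA trmx0.
rewrite tr_col_mx mul_col_row linearZ /= -!scalemxAl -!scalemxAr hA Ay yA !scaler0.
rewrite scalerA [y *m y^T]mx11_scalar -dot_mulmx scale_scalar_mx.
have -> : dot y y `^ (- 2^-1) * dot y y `^ (- 2^-1) * dot y y = 1.
  have yy := dot_gt0 y0.
  rewrite -powRD; last by rewrite (lt0r_neq0 yy) implybT.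
  rewrite (_ : - 2^-1 + - 2^-1 = -1 :> R); last by field.
  by rewrite powR_inv1 ?ltW// mulVf// lt0r_neq0.
by rewrite -scalar_mx_block.
Qed.

(** Take a unit v orthogonal to the rows of A: x and its residue have the same inner product with v,
    so a vanishing residue puts x in the hyperplane orthogonal to v. *)
Lemma frame_residue_pos (c : R) j (A : 'M[R]_(j, n)) :
  (forall v : 'rV[R]_n, dot v v = 1 -> sigma [set x | dot x v != 0] = c%:E) ->
  (j < n)%N -> A *m A^T = 1%:M ->
  (c%:E <= sigma [set x | frame_residue (A, x) != 0%R])%E.
Proof.
move=> hc jn hA.
have [|v v1 vA] := @exists_unit_orthogonal R n [seq row i A | i <- enum 'I_j].
  by rewrite size_map size_enum_ord.
have mR : measurable_fun setT
    ((fun x : borelType 'rV[R]_n => frame_residue (A, x)) : _ -> borelType 'rV[R]_n).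
  rewrite /frame_residue /=; apply: measurable_subr_mx; first exact: borel_id.
  apply: measurable_mulmx; last exact: measurable_cst.
  by apply: measurable_mulmx; [exact: borel_id|exact: measurable_cst].
rewrite -(hc v v1); apply: le_measure; rewrite ?inE.
- have -> : [set x : borelType 'rV[R]_n | dot x v != 0] =
    ~` [set x : borelType 'rV[R]_n | const_mx (dot x v) = 0 :> 'rV[R]_1].
    apply/seteqP; split => x /= h.
      by move=> /rowP/(_ 0); rewrite !mxE; exact/eqP.
    by apply/eqP => e; apply: h; apply/rowP => i; rewrite !mxE.
  apply: measurableC; apply: measurable_mx_eq; last exact: measurable_cst.
  apply: measurable_mx_entries => i k; under eq_fun do rewrite mxE.
  by apply: measurable_dot; [exact: borel_id|exact: measurable_cst].
- have -> : [set x | frame_residue (A, x) != 0] = ~` [set x | frame_residue (A, x) = 0].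
    by apply/seteqP; split => x /= /eqP.
  by apply: measurableC; apply: measurable_mx_eq; last exact: measurable_cst.
move=> x /= /eqP xv; apply/eqP => y0; apply: xv.
have -> : dot x v = dot (frame_residue (A, x)) v; last by rewrite y0 dot0l.
rewrite /frame_residue /= dotDl dotNl !dot_mulmx -!mulmxA.
have -> : A *m v^T = 0; last by rewrite !mulmx0 [X in _ - X]mxE subr0.
apply/colP => i; rewrite !mxE; apply: etrans (vA (row i A) _).
  by apply: eq_bigr => k _; rewrite !mxE mulrC.
by apply/mapP; exists i => //; rewrite mem_enum.
Qed.

(** Draw a frame and an independent point, condition on a nonzero residue, and push forward by
    Gram-Schmidt. The extension commutes with the simultaneous rotation of frame and point, so
    invariance reduces to that of the product measure. *)
Lemma has_frame_lawS j : (j < n)%N -> has_frame_law j -> has_frame_law (1 + j).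
Proof.
move=> jn [tau [tau1 tauO]]; have [c c0 hc] := sigma_halfspace.
pose Ev := [set z : borelType 'M[R]_(j, n) * borelType 'rV[R]_n | frame_residue z != 0].
pose Fr := [set A : borelType 'M[R]_(j, n) | A *m A^T = 1%:M].
have mFr : measurable Fr by exact: measurable_frames.
have mEv : measurable Ev.
  have -> : Ev = ~` [set z | frame_residue z = 0] by apply/seteqP; split => x /= /eqP.
  apply: measurableC; apply: measurable_mx_eq; last exact: measurable_cst.
  exact: measurable_frame_residue.
pose rho : {measure set (borelType 'M[R]_(j, n) * borelType 'rV[R]_n) -> \bar R} :=
  (tau \x sigma)%E.
have rhoT : rho setT = 1%E.
  have -> : rho setT = (tau setT * sigma setT)%E.
    by rewrite -setXTT; exact: product_measure1E.
  by rewrite !probability_setT mule1.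
have rhoEv : (c%:E <= rho Ev)%E.
  have -> : c%:E = (\int[tau]_(A in Fr) c%:E)%E by rewrite integral_cst// [X in (_ * X)%E](_ : _ = 1%E) ?mule1.
  rewrite /rho /= /product_measure1.
  apply: (@le_trans _ _ (\int[tau]_(A in Fr) (sigma \o xsection Ev) A)%E).
    apply: ge0_le_integral => //=.
    - by move=> *; rewrite lee_fin ltW.
    - apply: measurable_funTS; exact: measurable_fun_xsection.
    move=> A hA; have := frame_residue_pos hc jn hA.
    by rewrite xsectionE.
  apply: ge0_subset_integral => //; exact: measurable_fun_xsection.
have rhoEv0 : rho Ev != 0%E by rewrite gt_eqF// (lt_le_trans _ rhoEv)// lte_fin.
have rhoEvfin : rho Ev \is a fin_num.
  rewrite ge0_fin_numE// (@le_lt_trans _ _ (rho setT))//; last by rewrite rhoT ltry.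
  by apply: le_measure; rewrite ?inE.
pose pt := @dirac _ (borelType 'M[R]_(j, n) * borelType 'rV[R]_n)%type (0, 0) R.
have [cond condE] := @conditioned_law _ _ _ rho _ pt mEv rhoEv0 rhoEvfin.
have [law lawE] := @image_law _ _ _ _ _ cond _ (@measurable_frame_extension j).
have mFE S : measurable (S : set (borelType 'M[R]_(1 + j, n))) ->
    measurable (@frame_extension j @^-1` S : set (borelType 'M[R]_(j, n) * borelType 'rV[R]_n)).
  by move=> mS; rewrite -[X in measurable X]setTI; exact: measurable_frame_extension.
exists law; split.
  rewrite lawE condE.
  set S := _ @^-1` _.
  have mS : measurable S by apply: mFE; exact: measurable_frames.
  (* Apart from the null set where A is not orthonormal, a nonzero residue already yields an
     orthonormal extension. *)
  suff -> : rho (S `&` Ev) = rho Ev.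
    by rewrite -{1}(fineK rhoEvfin) -EFinM divff// fine_eq0.
  apply/eqP; rewrite eq_le; apply/andP; split.
    by apply: le_measure; rewrite ?inE//; exact: measurableI.
  rewrite -[leRHS](@measureU0 _ _ _ rho _ (~` Fr `*` setT)).
  - apply: le_measure; rewrite ?inE//.
      apply: measurableU; first exact: measurableI.
      by apply: measurableX => //; exact: measurableC.
    move=> [A x] hz; have [hA|hA] := pselect (A *m A^T = 1%:M); last by right.
    by left; split => //; exact: frame_extensionP.
  - exact: measurableI.
  - by apply: measurableX => //; exact: measurableC.
  rewrite [LHS]product_measure1E//; last exact: measurableC.
  have t0 : tau (~` Fr) = 0%E.
    by rewrite probability_setC// [X in (_ - X)%E](_ : _ = 1%E)// subee.
  by rewrite [X in (X * _)%E](_ : _ = 0%E) ?mul0e.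
move=> O S hO mS; rewrite !lawE !condE; congr (_ * _)%E.
pose act (z : borelType 'M[R]_(j, n) * borelType 'rV[R]_n) :
  borelType 'M[R]_(j, n) * borelType 'rV[R]_n := (z.1 *m O, z.2 *m O).
have mact : measurable_fun setT act.
  apply: measurable_fun_pair.
    by apply: measurable_mulmx; [exact: measurable_fst|exact: measurable_cst].
  by apply: measurable_mulmx; [exact: measurable_snd|exact: measurable_cst].
have -> : @frame_extension j @^-1` ((fun A => A *m O) @^-1` S) `&` Ev =
    act @^-1` (@frame_extension j @^-1` S `&` Ev).
  apply/seteqP; split => -[A x] /=; rewrite /Ev /act /= frame_extensionM// frame_residueM//.
    move=> [h1 /eqP h2]; split => //; apply/eqP => h3; apply: h2.
    by rewrite -[LHS]mulmx1 -hO mulmxA h3 mul0mx.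
  move=> [h1 /eqP h2]; split => //; apply/eqP => h3; apply: h2.
  by rewrite h3 mul0mx.
have mB : measurable (@frame_extension j @^-1` S `&` Ev : set (borelType 'M[R]_(j, n) * borelType 'rV[R]_n)).
  by apply: measurableI => //; exact: mFE.
have rhoT0 : rho setT != 0%E by rewrite rhoT onee_neq0.
have rhoTfin : rho setT \is a fin_num by rewrite rhoT.
(* Conditioning on the whole space repackages [rho] as a probability, so that its image under the
   rotation can be formed and identified by its values on rectangles. *)
have [rhoP rhoPE'] := @conditioned_law _ _ _ rho _ pt measurableT rhoT0 rhoTfin.
have rhoPE C : rhoP C = rho C by rewrite rhoPE' setIT rhoT invr1 mule1.
have [rhoO rhoOE] := @image_law _ _ _ _ _ rhoP _ mact.
suff h A B : measurable A -> measurable B -> rhoO (A `*` B) = (tau A * sigma B)%E.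
  by rewrite -rhoPE -rhoOE; apply/esym; exact: (product_measure_unique h).
move=> mA mB'; rewrite rhoOE rhoPE.
have -> : act @^-1` (A `*` B) = ((fun a => a *m O) @^-1` A) `*` ((fun x => x *m O) @^-1` B).
  by apply/seteqP; split => -[].
rewrite [LHS]product_measure1E//.
- by congr (_ * _)%E; [exact: tauO|exact: sigma_invariant].
- by rewrite -[X in measurable X]setTI; exact: (@measurable_mulr O j).
- by rewrite -[X in measurable X]setTI; exact: (@measurable_mulr O 1).
Qed.

Lemma has_frame_law_full : has_frame_law n.
Proof.
suff h j : (j <= n)%N -> has_frame_law j by exact: h.
elim: j => [_|j IH jn]; first exact: has_frame_law0.
by apply: (has_frame_lawS jn); apply: IH; exact: ltnW.
Qed.

Lemma haar_exists : exists tau U, haar_matrix tau U.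
Proof.
have [tau0 [tau01 tau0O]] := has_frame_law_full.
(* Frame laws are invariant on the right, while [haar_matrix] asks for the left; transposition
   exchanges the two. *)
have mT : measurable_fun setT
  ((fun A : borelType 'M[R]_n => A^T) : _ -> borelType 'M[R]_n).
  by apply: measurable_trmx; exact: borel_id.
have [tau tauE] := @image_law _ _ _ _ _ tau0 _ mT.
pose Fr := [set A : borelType 'M[R]_n | A *m A^T = 1%:M].
have mFr : measurable Fr by exact: measurable_frames.
have tauFr : tau Fr = 1%E.
  rewrite tauE -tau01; congr (tau0 _); apply/seteqP; split => A /=; rewrite /Fr /=.
    by rewrite trmxK => /mulmx1C.
  by rewrite trmxK => /mulmx1C.
pose U (A : borelType 'M[R]_n) : borelType 'M[R]_n := if A \in Fr then A else 1%:M.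
have UE A : Fr A -> U A = A by move=> h; rewrite /U mem_set.
have hU w : orthogonal (U w).
  rewrite /U; case: ifPn => [|_]; first by rewrite inE.
  exact: orthogonal1.
have mU : measurable_fun setT U.
  apply: measurable_mx_entries => i j.
  rewrite (_ : (fun t => _) = fun t => \1_Fr t * t i j + \1_(~` Fr) t * 1%:M i j).
    apply: measurable_funD; apply: measurable_funM.
    - exact: measurable_indic.
    - exact: borel_entry.
    - by apply: measurable_indic; exact: measurableC.
    - exact: measurable_cst.
  apply/funext => t; rewrite !indicE in_setC /U; case: (t \in Fr) => /=.
    by rewrite mul1r mul0r addr0.
  by rewrite mul1r mul0r add0r.
exists tau, U; split => // O g hO hg.
have ae (f : borelType 'M[R]_n -> R) : bmf f -> \int[tau]_w f (U w) = \int[tau]_w f w.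
  move=> hf; rewrite /Rintegral; congr fine; apply: ae_eq_integral => //.
  - by apply/measurable_EFinP; case: (bmf_comp mU hf).
  - by apply/measurable_EFinP; case: hf.
  have tau0F : tau (~` Fr) = 0%E by rewrite probability_setC// tauFr subee.
  exists (~` Fr); split => //; first exact: measurableC.
  by move=> w /= hw hFr; apply: hw => _; rewrite UE.
have mO : measurable_fun setT
    ((fun A : borelType 'M[R]_n => O *m A) : _ -> borelType 'M[R]_n).
  by apply: measurable_mulmx; [exact: measurable_cst|exact: borel_id].
have inv (S : set (borelType 'M[R]_n)) : measurable S ->
    tau ((fun A => O *m A) @^-1` S) = tau S.
  move=> mS; rewrite !tauE.
  set ST := (trmx : borelType 'M[R]_n -> borelType 'M[R]_n) @^-1` S.
  have mST : measurable ST by rewrite -[X in measurable X]setTI; exact: mT.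
  rewrite -(tau0O O^T ST) //; last exact: orthogonal_tr.
  by congr (tau0 _); apply/seteqP; split => A; rewrite /ST /= trmx_mul trmxK.
rewrite (ae (fun w => g (O *m w))); last exact: (bmf_comp mO hg).
by rewrite (ae g)//; exact: (@bint_invariant _ _ _ tau _ g mO inv hg).
Qed.

End HaarMatrix.

(** * Moments of linear functionals *)

Section BoundedVectors.
Context {d : measure_display} {T : measurableType d} {R : realType} {n : nat}.

Definition bvec (u : T -> 'rV[R]_n) :=
  measurable_fun setT (u : T -> borelType 'rV[R]_n) /\
  exists K : R, forall t, dot (u t) (u t) <= K.

Lemma bvec_cst (x : 'rV[R]_n) : bvec (fun=> x).
Proof. by split; [exact: measurable_cst | exists (dot x x)]. Qed.

Lemma bvecD u v : bvec u -> bvec v -> bvec (fun t => u t + v t).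
Proof.
move=> [mu [K hK]] [mv [L hL]]; split.
  apply: measurable_mx_entries => i j; under eq_fun do rewrite mxE.
  by apply: measurable_funD; exact: measurable_entry.
exists (2 * K + 2 * L) => t; rewrite !dotE (dotC (v t)).
have := dot_ge0 (u t - v t); rewrite !dotE (dotC (v t)).
have := hK t; have := hL t; lra.
Qed.

Lemma bvecZ (c : R) u : bvec u -> bvec (fun t => c *: u t).
Proof.
move=> [mu [K hK]]; split; first exact: measurable_scale_mx.
exists (c * c * K) => t; rewrite !dotE mulrA ler_wpM2l//.
by rewrite -expr2 sqr_ge0.
Qed.

Lemma bvecN u : bvec u -> bvec (fun t => - u t).
Proof.
move=> hu; have := bvecZ (-1) hu; congr (bvec _).
by apply/funext => t; rewrite scaleN1r.
Qed.

Lemma bmf_dot u v : bvec u -> bvec v -> bmf (fun t => dot (u t) (v t)).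
Proof.
move=> [mu [K hK]] [mv [L hL]]; split; first exact: measurable_dot.
exists (K + L) => t; rewrite ler_norml.
have := dot_ge0 (u t - v t); have := dot_ge0 (u t + v t).
rewrite !dotE (dotC (v t)); have := hK t; have := hL t.
have := dot_ge0 (u t); have := dot_ge0 (v t); lra.
Qed.

End BoundedVectors.

Lemma bvec_comp {d d' : measure_display} {T : measurableType d}
    {T' : measurableType d'} {R : realType} {n : nat} (u : T' -> 'rV[R]_n) (g : T -> T') :
  measurable_fun setT g -> bvec u -> bvec (fun t => u (g t)).
Proof.
move=> mg [mu [K hK]]; split; last by exists K.
exact: (measurableT_comp mu mg).
Qed.

Ltac bm := solve [repeat first
  [ assumption
  | apply: bmf_cst | apply: bmfD | apply: bmfN | apply: bmfM | apply: bmfX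
  | apply: bmf_norm | apply: bmf_dot
  | apply: bvec_cst | apply: bvecD | apply: bvecN | apply: bvecZ ]].

(** * Power means of an isotropic measure and their directional derivatives *)

Section PowerMeans.
Context {R : realType} {n : nat} {d : measure_display} {T : measurableType d}.
Variables (mu : {finite_measure set T -> \bar R}) (X : T -> 'rV[R]_n).
Hypotheses (hX : bvec X) (X1 : forall t, dot (X t) (X t) = 1).
Hypothesis isoX : forall x, \int[mu]_t (dot x (X t) ^+ 2) = dot x x.
Implicit Types (x y z : 'rV[R]_n) (s : R).

Definition powmean s x : R := \int[mu]_t (`|dot x (X t)| `^ s).

(** Multiplied by s, the derivative of the power mean at x in the direction y. *)
Definition powform s x y : R :=
  \int[mu]_t (`|dot x (X t)| `^ (s - 2) * dot x (X t) * dot y (X t)).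

Local Notation W := powmean.
Local Notation Q := powform.

Lemma bmf_dotX x : bmf (fun t => dot x (X t)).
Proof. by apply: bmf_dot; [exact: bvec_cst|]. Qed.
Hint Resolve bmf_dotX : core.

Lemma bmf_W s {d' : measure_display} {T' : measurableType d'} (u : T' -> 'rV[R]_n) :
  0 <= s -> bvec u -> bmf (fun t => W s (u t)).
Proof.
move=> s0 hu.
rewrite /powmean.
apply: (@bmf_int2 _ _ _ _ _ mu (fun z : T' * T => `|dot (u z.1) (X z.2)| `^ s)).
apply: bmf_powR => //; apply: bmf_dot.
  exact: (bvec_comp measurable_fst hu).
exact: (bvec_comp measurable_snd hX).
Qed.

Lemma bmf_Q s {d' : measure_display} {T' : measurableType d'} (u v : T' -> 'rV[R]_n) :
  2 <= s -> bvec u -> bvec v -> bmf (fun t => Q s (u t) (v t)).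
Proof.
move=> s2 hu hv.
rewrite /powform.
apply: (@bmf_int2 _ _ _ _ _ mu (fun z : T' * T => `|dot (u z.1) (X z.2)| `^ (s - 2)
  * dot (u z.1) (X z.2) * dot (v z.1) (X z.2))).
have hd (w : T' -> 'rV[R]_n) : bvec w -> bmf (fun z : T' * T => dot (w z.1) (X z.2)).
  move=> hw; apply: bmf_dot; first exact: (bvec_comp measurable_fst hw).
  exact: (bvec_comp measurable_snd hX).
apply: bmfM; last exact: hd.
by apply: bmfM; [apply: bmf_powR; [lra|exact: hd]|exact: hd].
Qed.

Lemma bmf_WX s x : 0 <= s -> bmf (fun t => `|dot x (X t)| `^ s).
Proof. by move=> s0; exact: bmf_powR. Qed.

Lemma bmf_QX s x y : 2 <= s ->
  bmf (fun t => `|dot x (X t)| `^ (s - 2) * dot x (X t) * dot y (X t)).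
Proof.
by move=> s2; apply: bmfM => //; apply: bmfM => //; apply: bmf_powR => //; lra.
Qed.
Hint Resolve bmf_WX bmf_QX : core.

Lemma powmean_ge0 s x : 0 <= W s x.
Proof. by apply: bint_ge0 => t; exact: powR_ge0. Qed.

Lemma powmean2 x : W 2 x = dot x x.
Proof.
rewrite -isoX; apply: eq_Rintegral => t _.
by rewrite (@powR_mulrn _ _ 2) ?normr_ge0// real_normK ?num_real.
Qed.

Lemma powmeanN s x : W s (- x) = W s x.
Proof. by apply: eq_Rintegral => t _; rewrite dotNl normrN. Qed.

Lemma powmeanZ s (c : R) x : 0 <= s -> W s (c *: x) = `|c| `^ s * W s x.
Proof.
move=> s0; rewrite -bintZ; last exact: bmf_WX.
by apply: eq_Rintegral => t _; rewrite dotZl normrM powRM.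
Qed.

Lemma norm_dotX_le1 x t : dot x x <= 1 -> `|dot x (X t)| <= 1.
Proof.
move=> x1; rewrite -(@ler_pXn2r _ 2)// ?nnegrE// expr1n.
rewrite -normrX ger0_norm ?sqr_ge0//; apply: le_trans (dot_CS _ _) _.
by rewrite X1 mulr1.
Qed.

Lemma powR_le_sqr (a s : R) : 2 <= s -> 0 <= a <= 1 -> a `^ s <= a ^+ 2.
Proof.
move=> s2 /andP[a0 a1]; have [->|an0] := eqVneq a 0.
  by rewrite powR0 ?expr0n//; lra.
by rewrite -(powR_mulrn _ a0); apply: ger_powR => //; rewrite lt_def an0 a0.
Qed.

Lemma powmean_le1 s x : 2 <= s -> dot x x <= 1 -> W s x <= dot x x.
Proof.
move=> s2 x1; rewrite -powmean2; apply: bint_le => [||t]; try by apply: bmf_WX; lra.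
rewrite (@powR_mulrn _ _ 2) ?normr_ge0//; apply: powR_le_sqr => //.
by rewrite normr_ge0 norm_dotX_le1.
Qed.

Lemma powformD s x y z : 2 <= s -> Q s x (y + z) = Q s x y + Q s x z.
Proof.
move=> s2; rewrite -bintD; try exact: bmf_QX.
by apply: eq_Rintegral => t _; rewrite dotDl mulrDr.
Qed.

Lemma powformZ s (c : R) x y : 2 <= s -> Q s x (c *: y) = c * Q s x y.
Proof.
move=> s2; rewrite -bintZ; last exact: bmf_QX.
by apply: eq_Rintegral => t _; rewrite dotZl; ring.
Qed.

Lemma powformN s x y : 2 <= s -> Q s x (- y) = - Q s x y.
Proof. by move=> s2; rewrite -scaleN1r powformZ// mulN1r. Qed.

Lemma powform_sum s x (I : Type) (r : seq I) (P : pred I) (F : I -> 'rV[R]_n) :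
  2 <= s -> Q s x (\sum_(i <- r | P i) F i) = \sum_(i <- r | P i) Q s x (F i).
Proof.
move=> s2; elim/big_rec2 : _ => [|i a b _ <-]; last by rewrite powformD.
by rewrite -(scale0r 0) powformZ// mul0r.
Qed.

(* Convexity of |t|^s, through Young's inequality for |b| |a|^(s-1). *)
Lemma powR_tangent (s a b : R) : 2 <= s ->
  s * (`|a| `^ (s - 2) * a * (b - a)) <= `|b| `^ s - `|a| `^ s.
Proof.
move=> s2; have s0 : 0 < s by lra.
have [->|a0] := eqVneq a 0.
  by rewrite normr0 mulr0 mul0r mulr0 powR0 ?subr0 ?powR_ge0//; lra.
have na : `|a| != 0 by rewrite normr_eq0.
have e2 : `|a| `^ (s - 2) * a ^+ 2 = `|a| `^ s.
  rewrite -[a ^+ 2]real_normK ?num_real// -(@powR_mulrn _ _ 2) ?normr_ge0//.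
  by rewrite -powRD ?subrK// na implybT.
have e1 : `|a| `^ (s - 2) * `|a| = `|a| `^ (s - 1).
  rewrite -{2}(powRr1 (normr_ge0 a)) -powRD ?na ?implybT//.
  by congr (_ `^ _); ring.
have := @conjugate_powR _ (`|a| `^ (s - 1)) `|b| (s / (s - 1)) s
  (powR_ge0 _ _) (normr_ge0 _).
rewrite -powRrM (_ : (s - 1) * (s / (s - 1)) = s); last by field; lra.
have h1 : 0 < s / (s - 1) by rewrite divr_gt0//; lra.
have h2 : (s / (s - 1))^-1 + s^-1 = 1 by field; lra.
move=> /(_ h1 s0 h2); rewrite -(ler_pM2l s0).
have -> : s * (`|a| `^ s / (s / (s - 1)) + `|b| `^ s / s) =
  (s - 1) * `|a| `^ s + `|b| `^ s by field; lra.
rewrite mulrBr mulrBr -(mulrA _ a a) -expr2 e2.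
have : `|a| `^ (s - 2) * a * b <= `|a| `^ (s - 1) * `|b|.
  rewrite -e1 -!mulrA ler_wpM2l ?powR_ge0// -normrM; exact: ler_norm.
move/(ler_wpM2l (ltW s0)); lra.
Qed.

Lemma powmean_tangent s x y : 2 <= s -> s * Q s x (y - x) <= W s y - W s x.
Proof.
move=> s2; have s0 : 0 <= s by lra.
rewrite /powmean /powform -bintB; [|exact: bmf_WX|exact: bmf_WX].
rewrite -bintZ; last exact: bmf_QX.
apply: bint_le => [||t].
- by apply: bmfM; [exact: bmf_cst|exact: bmf_QX].
- by apply: bmfB; exact: bmf_WX.
by rewrite dotDl dotNl; exact: powR_tangent.
Qed.

(** Convexity at both end points brackets the increment between two first-order terms, which stands
    in for the mean value theorem. *)
Lemma powmean_increment s x y : 2 <= s ->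
  `|W s y - W s x| <= s * (`|Q s x (y - x)| + `|Q s y (y - x)|).
Proof.
move=> s2; have s0 : 0 <= s by lra.
have h1 := powmean_tangent x y s2; have h2 := powmean_tangent y x s2.
rewrite -opprB powformN// in h2.
have k1 := ler_wpM2l s0 (ler_norm (- Q s x (y - x))).
have k2 := ler_wpM2l s0 (ler_norm (Q s y (y - x))).
have k3 : 0 <= s * `|Q s x (y - x)| by rewrite mulr_ge0.
have k4 : 0 <= s * `|Q s y (y - x)| by rewrite mulr_ge0.
rewrite normrN in k1; rewrite ler_norml.
move: (W s y) (W s x) (Q s x _) (Q s y _) h1 h2 k1 k2 k3 k4 => a b u v h1 h2 k1 k2 k3 k4.
clear -h1 h2 k1 k2 k3 k4; lra.
Qed.

End PowerMeans.

Section PowerFormBounds.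
Context {R : realType} {n : nat} {d : measure_display} {T : measurableType d}.
Variables (mu : {finite_measure set T -> \bar R}) (X : T -> 'rV[R]_n).
Hypotheses (hX : bvec X) (X1 : forall t, dot (X t) (X t) = 1).
Hypothesis isoX : forall x, \int[mu]_t (dot x (X t) ^+ 2) = dot x x.
Implicit Types (x y z : 'rV[R]_n) (s : R).

Local Notation W := (powmean mu X).
Local Notation Q := (powform mu X).

(** The trace of the isotropy identity: sum it over the coordinate vectors. *)
Lemma isotropic_mass : fine (mu setT) = n%:R.
Proof.
rewrite -[LHS]mul1r -bint_cst.
transitivity (\int[mu]_t dot (X t) (X t)).
  by apply: eq_Rintegral => t _; rewrite X1.
rewrite /dot bint_sum => [|i].
  rewrite (eq_bigr (fun=> 1)) => [|i _]; first by rewrite sumr_const card_ord.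
  have -> : 1 = \int[mu]_t (dot (delta_mx 0 i) (X t) ^+ 2) by rewrite isoX dot_delta mxE !eqxx.
  by apply: eq_Rintegral => t _; rewrite dotC dot_delta expr2.
have h : bmf (fun t => X t 0 i).
  have := bmf_dotX hX (delta_mx 0 i); congr bmf.
  by apply/funext => t; rewrite dotC dot_delta.
exact: bmfM.
Qed.

(** Integrate 2uv <= u^2 + v^2 with v = <y, X>; isotropy turns the integral of v^2 into the squared
    length of y. *)
Lemma powform_le_W2 s x y : 2 <= s -> 2 * Q s x y <= W (2 * s - 2) x + dot y y.
Proof.
move=> s2.
pose F t := `|dot x (X t)| `^ (s - 2) * dot x (X t).
have hF : bmf F by apply: bmfM; [apply: bmf_powR; [lra|]|]; exact: bmf_dotX.
have hy := bmf_dotX hX y.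
have : 0 <= \int[mu]_t ((F t - dot y (X t)) ^+ 2).
  by apply: bint_ge0 => t; exact: sqr_ge0.
have -> : \int[mu]_t ((F t - dot y (X t)) ^+ 2) =
    \int[mu]_t (`|dot x (X t)| `^ (2 * s - 2) + dot y (X t) ^+ 2 -
      2 * (F t * dot y (X t))).
  apply: eq_Rintegral => t _; rewrite sqrrB -mulr_natl [in RHS]addrAC; congr (_ - _ + _).
  rewrite /F exprMn -[dot x _ ^+ 2]real_normK ?num_real//.
  have [->|a0] := eqVneq `|dot x (X t)| 0.
    by rewrite expr0n mulr0 powR0//; lra.
  rewrite -!(@powR_mulrn _ _ 2) ?powR_ge0// -powRrM -powRD ?a0 ?implybT//.
  by congr (_ `^ _); lra.
rewrite bintB ?bintD ?bintZ ?isoX; first by rewrite /powmean /powform; lra.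
all: try by apply: bmfM.
all: try by apply: bmfX.
all: try by apply: bmf_WX => //; lra.
- by apply: bmfD; [apply: bmf_WX => //; lra|exact: bmfX].
- by apply: bmfM; [exact: bmf_cst|exact: bmfM].
Qed.

(** Young's inequality for the exponents s/(s-1) and s, with the weight eta shared between the two
    factors; the coefficients 1 - 1/s and 1/s are bounded by 1. *)
Lemma powform_young s (a b eta : R) : 2 <= s -> 0 < eta ->
  `|a| `^ (s - 2) * a * b <= eta * `|a| `^ s + eta `^ (1 - s) * `|b| `^ s.
Proof.
move=> s2 e0; have s0 : 0 < s by lra.
have [->|a0] := eqVneq a 0.
  rewrite mulr0 mul0r addr_ge0// mulr_ge0 ?powR_ge0//; exact: ltW.
have na : `|a| != 0 by rewrite normr_eq0.
have e1 : `|a| `^ (s - 2) * `|a| = `|a| `^ (s - 1).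
  rewrite -{2}(powRr1 (normr_ge0 a)) -powRD ?na ?implybT//.
  by congr (_ `^ _); ring.
pose u := eta `^ ((s - 1) / s) * `|a| `^ (s - 1).
pose v := eta `^ (- ((s - 1) / s)) * `|b|.
have uv : u * v = `|a| `^ (s - 1) * `|b|.
  by rewrite /u /v powRN; field; rewrite gt_eqF// powR_gt0.
have h1 : 0 < s / (s - 1) by rewrite divr_gt0//; lra.
have h2 : (s / (s - 1))^-1 + s^-1 = 1 by field; lra.
have := conjugate_powR (mulr_ge0 (powR_ge0 eta ((s - 1) / s)) (powR_ge0 `|a| (s - 1)))
  (mulr_ge0 (powR_ge0 eta (- ((s - 1) / s))) (normr_ge0 b)) h1 s0 h2.
rewrite -/u -/v uv => h.
have : `|a| `^ (s - 2) * a * b <= `|a| `^ (s - 1) * `|b|.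
  rewrite -e1 -!mulrA ler_wpM2l ?powR_ge0// -normrM; exact: ler_norm.
move=> /le_trans; apply; apply: le_trans h _.
have -> : u `^ (s / (s - 1)) = eta * `|a| `^ s.
  rewrite /u powRM ?powR_ge0// -!powRrM.
  rewrite (_ : (s - 1) / s * (s / (s - 1)) = 1); last by field; lra.
  rewrite powRr1 ?ltW//; congr (_ * _ `^ _); field; lra.
have -> : v `^ s = eta `^ (1 - s) * `|b| `^ s.
  rewrite /v powRM ?powR_ge0// -!powRrM; congr (_ `^ _ * _); field; lra.
have k1 : 0 < s^-1 by rewrite invr_gt0.
have k2 : 0 < (s / (s - 1))^-1 by rewrite invr_gt0.
apply: lerD; rewrite ler_piMr// ?mulr_ge0 ?powR_ge0 ?(ltW e0)//; lra.
Qed.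

Lemma powform_le_W s x y (eta : R) : 2 <= s -> 0 < eta ->
  Q s x y <= eta * W s x + eta `^ (1 - s) * W s y.
Proof.
move=> s2 e0; have s0 : 0 <= s by lra.
rewrite /powform /powmean -!bintZ; try exact: bmf_WX.
rewrite -bintD; try by apply: bmfM; [exact: bmf_cst|exact: bmf_WX].
apply: bint_le => [||t]; first exact: bmf_QX.
  by apply: bmfD; apply: bmfM; [exact: bmf_cst|exact: bmf_WX|exact: bmf_cst|exact: bmf_WX].
exact: powform_young.
Qed.

Lemma powform_abs_le s x y : 2 <= s -> `|Q s x y| <= W s x + W s y.
Proof.
move=> s2; have h z : Q s x z <= W s x + W s z.
  by have hz := powform_le_W x z s2 ltr01; rewrite powR1 !mul1r in hz; exact: hz.
rewrite ler_norml h andbT -[Q s x y]opprK -powformN//.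
have hy := h (- y); rewrite powmeanN in hy.
by rewrite lerN2; exact: hy.
Qed.

Section Gradient.
Variables (O : 'M[R]_n) (A : pred 'I_n).
Hypothesis hO : orthogonal O.

Lemma dot_row (i j : 'I_n) : dot (row i O) (row j O) = (i == j)%:R.
Proof.
have := congr1 (fun M : 'M[R]_n => M i j) hO; rewrite !mxE => <-.
by apply: eq_bigr => k _; rewrite !mxE.
Qed.

(** For orthogonal O, the squared length of the projection of the gradient of [W s], divided by s,
    onto the span of the rows selected by A. Later A omits two rows, which are reserved for the
    point itself and for a weight. *)
Definition gradsq s x : R := \sum_(i | A i) Q s x (row i O) ^+ 2.

Let dir s x := \sum_(i | A i) Q s x (row i O) *: row i O.

Let dir_dot s x : dot (dir s x) (dir s x) = gradsq s x.
Proof.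
rewrite dot_suml; apply: eq_bigr => i Ai; rewrite dot_sumr (bigD1 i)//= big1 => [|j /andP[_ ji]].
  by rewrite !dotE dot_row eqxx /=; ring.
by rewrite !dotE dot_row eq_sym (negbTE ji) !mulr0.
Qed.

Let dir_form s x : 2 <= s -> Q s x (dir s x) = gradsq s x.
Proof.
move=> s2; rewrite powform_sum//; apply: eq_bigr => i _.
by rewrite powformZ// expr2.
Qed.

Lemma gradsq_ge0 s x : 0 <= gradsq s x.
Proof. by apply: sumr_ge0 => i _; exact: sqr_ge0. Qed.

(** Test [powform_le_W2] in the direction of the projected gradient itself: the left side is then
    twice [gradsq], and one copy cancels against the squared length of the direction. *)
Lemma gradsq_le_W2 s x : 2 <= s -> gradsq s x <= W (2 * s - 2) x.
Proof. by move=> s2; have := powform_le_W2 x (dir s x) s2; rewrite dir_dot dir_form//; lra. Qed.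

Lemma gradsq_le s x (B : R) : 2 <= s ->
  (forall y, dot y y = 1 -> Q s x y <= B) -> gradsq s x <= B ^+ 2.
Proof.
move=> s2 hB; have [g0|gn] := eqVneq (gradsq s x) 0; first by rewrite g0 sqr_ge0.
have gp : 0 < gradsq s x by rewrite lt_def gn gradsq_ge0.
set C := Num.sqrt (gradsq s x).
have C0 : 0 < C by rewrite sqrtr_gt0.
have CC : gradsq s x = C ^+ 2 by rewrite sqr_sqrtr ?gradsq_ge0.
have := hB (C^-1 *: dir s x); rewrite !dotE dir_dot powformZ// dir_form// CC.
have Cn := lt0r_neq0 C0.
have -> : C^-1 * (C^-1 * C ^+ 2) = 1 by field.
have -> : C^-1 * C ^+ 2 = C by field.
move=> /(_ erefl) h.
by rewrite lerXn2r ?nnegrE// ltW// (lt_le_trans C0).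
Qed.

End Gradient.

End PowerFormBounds.

(** * Averaging over random frames *)

(** A Khintchine inequality for one random sign. That the factor of c^2 grows only linearly in r is
    what makes the resulting moments sub-Gaussian; D holds the coordinates treated before. *)
Lemma two_point {R : realType} (r : nat) (t c D : R) : 0 <= D ->
  ((t + c) ^+ 2 + D) ^+ r + ((t - c) ^+ 2 + D) ^+ r <=
  2 * (t ^+ 2 + (4 * r%:R + 1) * c ^+ 2 + D) ^+ r.
Proof.
move=> D0; pose A := t ^+ 2 + c ^+ 2 + D; pose B := 2 * t * c.
have c20 : 0 <= c ^+ 2 by exact: sqr_ge0.
have t20 : 0 <= t ^+ 2 by exact: sqr_ge0.
have A0 : 0 <= A by rewrite /A; lra.
have -> : (t + c) ^+ 2 + D = A + B by rewrite /A /B; ring.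
have -> : (t - c) ^+ 2 + D = A - B by rewrite /A /B; ring.
have -> : t ^+ 2 + (4 * r%:R + 1) * c ^+ 2 + D = A + 4 * r%:R * c ^+ 2.
  by rewrite /A; ring.
have AB : B ^+ 2 <= 4 * c ^+ 2 * A.
  rewrite -subr_ge0; have -> : 4 * c ^+ 2 * A - B ^+ 2 = 4 * c ^+ 2 * (c ^+ 2 + D).
    by rewrite /A /B; ring.
  by rewrite mulr_ge0//; lra.
(* P and E satisfy a linear recurrence. From B^2 <= 4 c^2 A it follows that E k <= 4 k c^2 P k, so
   each further power costs at most the factor A + 4 r c^2. *)
pose P k := (A + B) ^+ k + (A - B) ^+ k; pose E k := B * ((A + B) ^+ k - (A - B) ^+ k).
have PS k : P k.+1 = A * P k + E k by rewrite /P /E !exprS; ring.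
have ES k : E k.+1 = A * E k + B ^+ 2 * P k by rewrite /P /E !exprS; ring.
have inv k : [/\ 0 <= P k, 0 <= E k & E k <= 4 * k%:R * c ^+ 2 * P k].
  elim: k => [|k [P0 E0 EP]].
    by rewrite /P /E !expr0 subrr !mulr0 !mul0r; split; rewrite ?addr_ge0.
  have AP : 0 <= A * P k by exact: mulr_ge0.
  have AE : 0 <= A * E k by exact: mulr_ge0.
  rewrite PS ES; split; first lra.
    by rewrite addr_ge0// mulr_ge0// sqr_ge0.
  have k0 : 0 <= 4 * k.+1%:R * c ^+ 2 by rewrite mulr_ge0// mulr_ge0.
  apply: (@le_trans _ _ (4 * k.+1%:R * c ^+ 2 * (A * P k))); last first.
    by rewrite ler_wpM2l//; lra.
  have h1 := ler_wpM2l A0 EP; have h2 := ler_wpM2r P0 AB.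
  have -> : 4 * k.+1%:R * c ^+ 2 * (A * P k) =
    A * (4 * k%:R * c ^+ 2 * P k) + 4 * c ^+ 2 * A * P k.
    by rewrite -[k.+1]addn1 natrD; ring.
  exact: lerD.
suff h k : (k <= r)%N -> P k <= 2 * (A + 4 * r%:R * c ^+ 2) ^+ k by exact: h.
elim: k => [_|k IH kr]; first by rewrite /P !expr0; lra.
have [P0 E0 EP] := inv k; rewrite PS.
have k1 : k%:R <= r%:R :> R by rewrite ler_nat ltnW.
apply: (@le_trans _ _ ((A + 4 * r%:R * c ^+ 2) * P k)).
  rewrite [leRHS]mulrDl; apply: lerD => //; apply: le_trans EP _.
  by rewrite ler_wpM2r// ler_wpM2r// ler_wpM2l.
rewrite (exprS _ k) [leRHS]mulrCA; apply: ler_wpM2l; last by apply: IH; exact: ltnW.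
by apply: addr_ge0 => //; apply: mulr_ge0 => //; exact: mulr_ge0.
Qed.

Section HaarAverages.
Context {R : realType} {n : nat}.
Variables (tau : probability (borelType 'M[R]_n) R) (U : borelType 'M[R]_n -> 'M[R]_n).
Hypothesis hU : haar_matrix tau U.
Implicit Types (x y z : 'rV[R]_n).

Lemma haar_orthogonal w : orthogonal (U w).
Proof. by have [_ h _ _] := hU. Qed.

Lemma dotU x y w : dot (x *m U w) (y *m U w) = dot x y.
Proof. exact/dot_orthogonal/haar_orthogonal. Qed.

Lemma bvecU x : bvec (fun w => x *m U w).
Proof.
have [mU _ _ _] := hU; split; last by exists (dot x x) => w; rewrite dotU.
by apply: measurable_mulmx => //; exact: measurable_cst.
Qed.

Lemma haar_invariant (H : 'M[R]_n -> R) (O : 'M[R]_n) : orthogonal O ->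
  bmf (fun w => H (U w)) -> \int[tau]_w H (O *m U w) = \int[tau]_w H (U w).
Proof.
move=> hO hH; have [_ oU UK inv] := hU.
have := inv O (fun w => H (U w)) hO hH.
have -> : \int[tau]_w H (U (O *m U w)) = \int[tau]_w H (O *m U w).
  by apply: eq_Rintegral => w _; rewrite UK//; exact: orthogonalM.
by move=> ->; apply: eq_Rintegral => w _; rewrite UK.
Qed.

(** The rotation supplied by [congruence] is absorbed by left invariance, so joint laws depend on
    Gram matrices alone. *)
Lemma haar_congruence (H : seq 'rV[R]_n -> R) (xs ys : seq 'rV[R]_n) :
  size xs = size ys ->
  (forall i j, (i < size xs)%N -> (j < size xs)%N ->
     dot xs`_i xs`_j = dot ys`_i ys`_j) ->
  bmf (fun w => H (map (mulmx^~ (U w)) xs)) ->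
  \int[tau]_w H (map (mulmx^~ (U w)) xs) = \int[tau]_w H (map (mulmx^~ (U w)) ys).
Proof.
move=> sz gram hH; have [V hV <-] := congruence sz gram.
rewrite -(haar_invariant (H := fun A => H (map (mulmx^~ A) xs)) hV)//.
apply: eq_Rintegral => w _; congr H; rewrite -map_comp; apply: eq_map => x.
by rewrite /= mulmxA.
Qed.

Lemma haar_congruence3 (H : 'rV[R]_n -> 'rV[R]_n -> 'rV[R]_n -> R) x y z x' y' z' :
  dot x x = dot x' x' -> dot y y = dot y' y' -> dot z z = dot z' z' ->
  dot x y = dot x' y' -> dot x z = dot x' z' -> dot y z = dot y' z' ->
  bmf (fun w => H (x *m U w) (y *m U w) (z *m U w)) ->
  \int[tau]_w H (x *m U w) (y *m U w) (z *m U w) =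
  \int[tau]_w H (x' *m U w) (y' *m U w) (z' *m U w).
Proof.
move=> xx yy zz xy xz yz hH.
apply: (@haar_congruence (fun s => H s`_0 s`_1 s`_2) [:: x; y; z] [:: x'; y'; z']) => //.
case=> [|[|[|i]]] [|[|[|j]]] //= _ _; first [exact: xx | exact: yy | exact: zz
  | exact: xy | exact: xz | exact: yz | by rewrite dotC xy dotC
  | by rewrite dotC xz dotC | by rewrite dotC yz dotC].
Qed.

Lemma haar_congruence1 (H : 'rV[R]_n -> R) x x' : dot x x = dot x' x' ->
  bmf (fun w => H (x *m U w)) ->
  \int[tau]_w H (x *m U w) = \int[tau]_w H (x' *m U w).
Proof.
by move=> xx hH; apply: (@haar_congruence3 (fun x _ _ => H x) x 0 0 x' 0 0);
  rewrite ?dot0r.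
Qed.

Lemma haar_congruence2 (H : 'rV[R]_n -> 'rV[R]_n -> R) x y x' y' :
  dot x x = dot x' x' -> dot y y = dot y' y' -> dot x y = dot x' y' ->
  bmf (fun w => H (x *m U w) (y *m U w)) ->
  \int[tau]_w H (x *m U w) (y *m U w) = \int[tau]_w H (x' *m U w) (y' *m U w).
Proof.
by move=> xx yy xy hH; apply: (@haar_congruence3 (fun x y _ => H x y) x y 0 x' y' 0);
  rewrite ?dot0r.
Qed.

Section SignMoment.
Variables (g : 'rV[R]_n -> 'rV[R]_n -> R) (Phi : 'rV[R]_n -> 'rV[R]_n -> 'rV[R]_n -> R).
Hypothesis g0 : forall x y, 0 <= g x y.
Hypothesis PhiD : forall x y z z', Phi x y (z + z') = Phi x y z + Phi x y z'.
Hypothesis PhiZ : forall x y (c : R) z, Phi x y (c *: z) = c * Phi x y z.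
Hypothesis bmg : forall x y, bmf (fun w => g (x *m U w) (y *m U w)).
Hypothesis bmPhi : forall x y z, bmf (fun w => Phi (x *m U w) (y *m U w) (z *m U w)).
Variables (i0 i1 : 'I_n) (r : nat).
Let kappa : R := 4 * r%:R + 1.
Let c (A : 'M[R]_n) (i : 'I_n) := Phi (row i0 A) (row i1 A) (row i A).

Let rowU i (A : 'M[R]_n) : row i A = delta_mx 0 i *m A.
Proof. exact: rowE. Qed.

Let bmc i : bmf (fun w => c (U w) i).
Proof. by rewrite /c; under eq_fun do rewrite !rowU; exact: bmPhi. Qed.

Let bmg' : bmf (fun w => g (row i0 (U w)) (row i1 (U w))).
Proof. by under eq_fun do rewrite !rowU; exact: bmg. Qed.

Let Phi_sum x y (s : seq 'I_n) (F : 'I_n -> 'rV[R]_n) :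
  Phi x y (\sum_(i <- s) F i) = \sum_(i <- s) Phi x y (F i).
Proof.
elim/big_rec2 : _ => [|i a b _ <-]; last by rewrite PhiD.
by rewrite -(scale0r 0) PhiZ mul0r.
Qed.

(** Indices pass one by one from the square of the sum to the sum of squares. Negating row i
    preserves the law and leaves rows i0 and i1, hence the weight and the other terms, unchanged up
    to the sign of the i-th term; so that term carries a free sign and [two_point] applies. *)
Let sign_induction (s l : seq 'I_n) : uniq s -> (forall i, i \in s -> i != i0 /\ i != i1) ->
  \int[tau]_w (g (row i0 (U w)) (row i1 (U w)) *
     ((\sum_(i <- s) c (U w) i) ^+ 2 + kappa * \sum_(i <- l) c (U w) i ^+ 2) ^+ r) <=
  \int[tau]_w (g (row i0 (U w)) (row i1 (U w)) *
     (kappa * \sum_(i <- s ++ l) c (U w) i ^+ 2) ^+ r).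
Proof.
have k0 : 0 <= kappa by rewrite addr_ge0// mulr_ge0.
have bsum (t : seq 'I_n) : bmf (fun w => \sum_(i <- t) c (U w) i) by exact: bmf_sum.
have bsq (t : seq 'I_n) : bmf (fun w => kappa * \sum_(i <- t) c (U w) i ^+ 2).
  by apply: bmfM; [exact: bmf_cst|apply: bmf_sum => i; exact: bmfX].
elim: s l => [|i s IH] l.
  move=> _ _; rewrite cat0s le_eqVlt; apply/orP; left; apply/eqP.
  by apply: eq_Rintegral => w _; rewrite big_nil expr0n add0r.
move=> /= /andP[nis us] hs.
have [ii0 ii1] := hs i (mem_head _ _).
have {}hs j : j \in s -> j != i0 /\ j != i1 by move=> js; apply: hs; rewrite in_cons js orbT.
set G := fun w => g (row i0 (U w)) (row i1 (U w)).
pose S w := \sum_(j <- s) c (U w) j; pose D w := kappa * \sum_(j <- l) c (U w) j ^+ 2.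
have ->: \int[tau]_w (G w * ((\sum_(j <- i :: s) c (U w) j) ^+ 2 + D w) ^+ r) =
   \int[tau]_w (G w * ((S w + c (U w) i) ^+ 2 + D w) ^+ r).
  by apply: eq_Rintegral => w _; rewrite big_cons [X in X ^+ 2]addrC.
have [|V [hV iV fV]] := @reflection_exists R n (delta_mx 0 i) (- delta_mx 0 i).
  by rewrite dotNl dotNr opprK.
have rO j (A : 'M[R]_n) : row j (V *m A) = if j == i then - row j A else row j A.
  rewrite !rowU mulmxA; case: eqP => [->|/eqP ji]; first by rewrite iV mulNmx.
  by rewrite fV// dotNr !dot_delta mxE (eq_sym i) (negbTE ji) andbF oppr0.
have PhiN x y z : Phi x y (- z) = - Phi x y z by rewrite -scaleN1r PhiZ mulN1r.
have cO j (A : 'M[R]_n) : c (V *m A) j = if j == i then - c A j else c A j.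
  rewrite /c !rO (eq_sym i0) (negbTE ii0) (eq_sym i1) (negbTE ii1).
  by case: eqP.
have flip : \int[tau]_w (G w * ((S w + c (U w) i) ^+ 2 + D w) ^+ r) =
    \int[tau]_w (G w * ((S w - c (U w) i) ^+ 2 + D w) ^+ r).
  pose H (A : 'M[R]_n) := g (row i0 A) (row i1 A) *
    ((\sum_(j <- s) c A j + c A i) ^+ 2 + kappa * \sum_(j <- l) c A j ^+ 2) ^+ r.
  rewrite -[LHS]/(\int[tau]_w H (U w)) -(haar_invariant hV).
    apply: eq_Rintegral => w _; rewrite /H !rO (eq_sym i0) (negbTE ii0) (eq_sym i1) (negbTE ii1).
    congr (_ * ((_ + _) ^+ 2 + _ * _) ^+ r).
    - apply: eq_big_seq => j js; rewrite cO; case: eqP => // ji.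
      by move: nis; rewrite -ji js.
    - by rewrite cO eqxx.
    - by apply: eq_bigr => j _; rewrite cO; case: eqP; rewrite ?sqrrN.
  apply: (bmfM bmg'); apply: bmfX; apply: bmfD; last exact: bsq.
  by apply: bmfX; apply: bmfD; [exact: bsum|exact: bmc].
have b1 : bmf (fun w => G w * ((S w + c (U w) i) ^+ 2 + D w) ^+ r).
  apply: (bmfM bmg'); apply: bmfX; apply: bmfD; last exact: bsq.
  by apply: bmfX; apply: bmfD; [exact: bsum|exact: bmc].
have b2 : bmf (fun w => G w * ((S w - c (U w) i) ^+ 2 + D w) ^+ r).
  apply: (bmfM bmg'); apply: bmfX; apply: bmfD; last exact: bsq.
  by apply: bmfX; apply: bmfB; [exact: bsum|exact: bmc].
have := IH (i :: l) us hs.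
have -> : \int[tau]_w (G w * (kappa * \sum_(j <- s ++ i :: l) c (U w) j ^+ 2) ^+ r) =
   \int[tau]_w (G w * (kappa * \sum_(j <- (i :: s) ++ l) c (U w) j ^+ 2) ^+ r).
  apply: eq_Rintegral => w _; congr (_ * (_ * _) ^+ r).
  by rewrite /= big_cat !big_cons /= big_cat /= addrCA.
apply: le_trans.
suff : 2 * \int[tau]_w (G w * ((S w + c (U w) i) ^+ 2 + D w) ^+ r) <=
  2 * \int[tau]_w (G w * (S w ^+ 2 + kappa * \sum_(j <- i :: l) c (U w) j ^+ 2) ^+ r) by lra.
rewrite -[leRHS]bintZ; last first.
  apply: (bmfM bmg'); apply: bmfX; apply: bmfD; last exact: bsq.
  by apply: bmfX; exact: bsum.
rewrite mulr_natl mulr2n {2}flip -bintD//; apply: bint_le => [||w].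
- exact: bmfD.
- apply: bmfM; first exact: bmf_cst.
  apply: (bmfM bmg'); apply: bmfX; apply: bmfD; last exact: bsq.
  by apply: bmfX; exact: bsum.
rewrite -mulrDr [leRHS]mulrCA ler_wpM2l// ?g0//.
apply: le_trans (two_point r _ _ _) _.
  by rewrite mulr_ge0// sumr_ge0// => j _; exact: sqr_ge0.
rewrite ler_wpM2l// big_cons mulrDr addrA lexx//.
Qed.

(** By congruence z may be replaced by the normalised sum of the n - 2 rows other than i0 and i1.
    Its normalisation produces the denominator, so one component of the linear form is compared with
    its total squared length. *)
Lemma sign_moment x y z : (2 < n)%N -> i0 != i1 ->
  dot x x = 1 -> dot y y = 1 -> dot z z = 1 ->
  dot x y = 0 -> dot x z = 0 -> dot y z = 0 ->
  \int[tau]_w (g (x *m U w) (y *m U w) * Phi (x *m U w) (y *m U w) (z *m U w) ^+ r.*2) <=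
  ((4 * r%:R + 1) / (n - 2)%:R) ^+ r * \int[tau]_w (g (row i0 (U w)) (row i1 (U w)) *
    (\sum_(i | (i != i0) && (i != i1)) Phi (row i0 (U w)) (row i1 (U w)) (row i (U w)) ^+ 2) ^+ r).
Proof.
move=> n2 i01 xx yy zz xy xz yz.
pose s := [seq i <- index_enum 'I_n | (i != i0) && (i != i1)].
have us : uniq s by exact/filter_uniq/index_enum_uniq.
have hs i : i \in s -> i != i0 /\ i != i1 by rewrite mem_filter => /andP[/andP[]].
have ss : size s = (n - 2)%N.
  have -> : size s = #|[predC pred2 i0 i1]|.
    rewrite cardE /enum_mem -enumT enumT; congr size; apply: eq_filter => i.
    by rewrite !inE negb_or.
  apply: (@addnI 2); rewrite subnKC 1?ltnW//.
  by have := cardC (pred2 i0 i1); rewrite card2 i01 card_ord.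
pose q : R := (n - 2)%:R; have q0 : 0 < q by rewrite ltr0n subn_gt0.
pose a := (Num.sqrt q)^-1.
have a2 : a ^+ 2 = q^-1 by rewrite exprVn sqr_sqrtr// ltW.
pose z0 := a *: \sum_(i <- s) delta_mx 0 i : 'rV[R]_n.
have z0i (i : 'I_n) : i \notin s -> dot (delta_mx 0 i) z0 = 0.
  move=> nis; rewrite dotZr dot_sumr big1_seq ?mulr0// => j /andP[_ js].
  rewrite dot_delta mxE eqxx /=; case: eqP => // ij.
  by move: nis; rewrite -ij js.
have i0s : i0 \notin s by rewrite mem_filter eqxx.
have i1s : i1 \notin s by rewrite mem_filter eqxx andbF.
have dd (i j : 'I_n) : dot (delta_mx 0 i) (delta_mx 0 j) = (i == j)%:R :> R.
  by rewrite dot_delta mxE eqxx eq_sym.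
have z01 : dot z0 z0 = 1.
  rewrite {1}/z0 dotZl dot_suml (eq_big_seq (fun=> a)) => [|i js].
    rewrite big_const_seq iter_addr addr0 count_predT ss -[_ *+ _]mulr_natr mulrA -expr2 a2.
    by rewrite mulVf// gt_eqF.
  rewrite dotZr dot_sumr (bigD1_seq i)//= dd eqxx big1 ?addr0 ?mulr1// => j ji.
  by rewrite dd eq_sym (negbTE ji).
have bH : bmf (fun w => g (x *m U w) (y *m U w) * Phi (x *m U w) (y *m U w) (z *m U w) ^+ r.*2).
  by apply: bmfM => //; exact: bmfX.
rewrite (@haar_congruence3 (fun x y z => g x y * Phi x y z ^+ r.*2) x y z
  (delta_mx 0 i0) (delta_mx 0 i1) z0) ?dd ?eqxx ?(negbTE i01) ?z0i//.
have := sign_induction [::] us hs; rewrite cats0 => h.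
have aa : a ^+ r.*2 = (q^-1) ^+ r by rewrite -a2 -exprM mul2n.
have -> : \int[tau]_w (g (delta_mx 0 i0 *m U w) (delta_mx 0 i1 *m U w) *
    Phi (delta_mx 0 i0 *m U w) (delta_mx 0 i1 *m U w) (z0 *m U w) ^+ r.*2) =
  (q^-1) ^+ r * \int[tau]_w (g (row i0 (U w)) (row i1 (U w)) *
     ((\sum_(i <- s) c (U w) i) ^+ 2 + kappa * \sum_(i <- [::]) c (U w) i ^+ 2) ^+ r).
  rewrite -bintZ; last first.
    apply: (bmfM bmg'); apply: bmfX; apply: bmfD; first by apply: bmfX; apply: bmf_sum => i; exact: bmc.
    by apply: bmfM; [exact: bmf_cst|apply: bmf_sum => i; exact: (bmfX _ (bmc i))].
  apply: eq_Rintegral => w _; rewrite big_nil mulr0 addr0 -!rowU mulrCA.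
  congr (_ * _); rewrite -exprM mul2n -aa -exprMn; congr (_ ^+ _).
  rewrite /z0 -scalemxAl PhiZ mulmx_suml Phi_sum; congr (_ * _).
  by apply: eq_bigr => i _; rewrite -rowU.
have q10 : 0 <= (q^-1) ^+ r by rewrite exprn_ge0// invr_ge0 ltW.
apply: le_trans (ler_wpM2l q10 h) _.
rewrite -bintZ; last first.
  by apply: (bmfM bmg'); apply: bmfX; apply: bmfM; [exact: bmf_cst|apply: bmf_sum => i; exact: (bmfX _ (bmc i))].
rewrite -bintZ; last first.
  by apply: (bmfM bmg'); apply: bmfX; apply: bmf_sum => i; exact: (bmfX _ (bmc i)).
rewrite le_eqVlt; apply/orP; left; apply/eqP; apply: eq_Rintegral => w _.
by rewrite big_filter !exprMn -/kappa; ring.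
by rewrite zz z01.
Qed.

End SignMoment.

End HaarAverages.

(** * Increments along spherical paths *)

Lemma exprn_even_norm {R : realType} (u : R) r : `|u| ^+ r.*2 = u ^+ r.*2.
Proof. by rewrite -mul2n !exprM real_normK ?num_real. Qed.

Lemma exprn_even_ge0 {R : realType} (u : R) r : 0 <= u ^+ r.*2.
Proof. by rewrite -mul2n exprM exprn_ge0// sqr_ge0. Qed.

Lemma power_mean {R : realType} (N r : nat) (a : nat -> R) : (0 < N)%N ->
  (\sum_(j < N) a j) ^+ r.*2 <= N%:R ^+ r.*2 * (N%:R^-1 * \sum_(j < N) a j ^+ r.*2).
Proof.
move=> N0; have NR : (0 : R) < N%:R by rewrite ltr0n.
pose m := N%:R^-1 * \sum_(j < N) `|a j|.
have m0 : 0 <= m.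
  by apply: mulr_ge0; [rewrite invr_ge0 ltW|apply: sumr_ge0].
have h : m ^+ r.*2 <= N%:R^-1 * \sum_(j < N) a j ^+ r.*2.
  have -> : m ^+ r.*2 = N%:R^-1 * \sum_(j < N) (m ^+ r.*2 + (r.*2)%:R * m ^+ r.*2.-1 * (`|a j| - m)).
    rewrite big_split /= -mulr_sumr sumrB !sumr_const card_ord.
    rewrite -[m *+ N]mulr_natr -[m ^+ r.*2 *+ N]mulr_natr.
    have -> : \sum_(j < N) `|a j| = m * N%:R by rewrite /m mulrAC mulVf ?mul1r// gt_eqF.
    by rewrite subrr mulr0 addr0 mulrCA mulVf ?mulr1// gt_eqF.
  apply: ler_wpM2l; first by rewrite invr_ge0 ltW.
  apply: ler_sum => j _.
  by rewrite -[leRHS]exprn_even_norm; exact: tangent_exprn.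
apply: (@le_trans _ _ (N%:R ^+ r.*2 * m ^+ r.*2)); last by rewrite ler_wpM2l// exprn_ge0// ltW.
rewrite -exprMn /m mulrA mulfV ?gt_eqF// mul1r -[leLHS]exprn_even_norm.
by apply: lerXn2r; rewrite ?nnegrE ?sumr_ge0// ler_norm_sum.
Qed.

Lemma power_mean2 {R : realType} (r : nat) (a b : R) :
  (a + b) ^+ r.*2 <= 4 ^+ r * (2^-1 * (a ^+ r.*2 + b ^+ r.*2)).
Proof.
have := @power_mean R 2 r (fun j => if j == 0%N then a else b) isT.
rewrite !big_ord_recl !big_ord0 /= !addr0.
by rewrite (_ : 2%:R ^+ r.*2 = 4 ^+ r :> R)// -mul2n exprM -natrX.
Qed.

Section SphericalGeometry.
Context {R : realType} {n : nat}.
Implicit Types (a b u v x y : 'rV[R]_n).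

Lemma dot_subsq u v : dot u u = 1 -> dot v v = 1 ->
  dot (v - u) (v - u) = 2 - 2 * dot u v.
Proof. by move=> u1 v1; rewrite !dotE u1 v1 (dotC v); ring. Qed.

Lemma dot_unit_bound u v : dot u u = 1 -> dot v v = 1 -> -1 <= dot u v <= 1.
Proof.
move=> u1 v1; have := dot_ge0 (u - v); have := dot_ge0 (u + v).
rewrite !dotE u1 v1 (dotC v) => h1 h2; lra.
Qed.

Lemma normalize x : x != 0 -> dot ((Num.sqrt (dot x x))^-1 *: x) ((Num.sqrt (dot x x))^-1 *: x) = 1.
Proof.
move=> x0; have xx := dot_gt0 x0.
by rewrite !dotE mulrA -expr2 exprVn sqr_sqrtr ?ltW// mulVf// gt_eqF.
Qed.

(** Equally spaced points of the chord, projected radially. A non-obtuse angle keeps the chord at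
    squared distance at least 1/2 from the origin, so that the projection at most doubles squared
    step lengths. *)
Lemma spherical_path a b N : (0 < N)%N -> dot a a = 1 -> dot b b = 1 -> 0 <= dot a b ->
  exists f : nat -> 'rV[R]_n, [/\ f 0%N = a, f N = b,
    forall j, (j <= N)%N -> dot (f j) (f j) = 1,
    forall j, exists al be : R, f j = al *: a + be *: b &
    forall j, (j < N)%N ->
      dot (f j.+1 - f j) (f j.+1 - f j) <= 2 * dot (a - b) (a - b) / N%:R ^+ 2].
Proof.
move=> N0 a1 b1 ab; have NR : (0 : R) < N%:R by rewrite ltr0n.
have ab1 : dot a b <= 1 by have /andP[] := dot_unit_bound a1 b1.
pose p (j : nat) := (1 - j%:R / N%:R) *: a + (j%:R / N%:R) *: b.
pose q (j : nat) := dot (p j) (p j).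
have pp i j : dot (p i) (p j) = 1 - (i%:R / N%:R * (1 - j%:R / N%:R) +
    (1 - i%:R / N%:R) * (j%:R / N%:R)) * (1 - dot a b).
  by rewrite /p !dotE a1 b1 (dotC b); ring.
have t01 (j : nat) : (j <= N)%N -> 0 <= (j%:R / N%:R : R) <= 1.
  move=> jN; apply/andP; split; first exact: divr_ge0.
  by rewrite ler_pdivrMr// mul1r ler_nat.
have qh j : (j <= N)%N -> 2^-1 <= q j.
  move=> /t01 /andP[t0 t1]; rewrite /q pp; set t := _ / _ in t0 t1 *.
  have : 0 <= (1 - 2 * t) ^+ 2 by exact: sqr_ge0.
  by nra.
pose f j := (Num.sqrt (q j))^-1 *: p j.
have p0 j : (j <= N)%N -> p j != 0.
  move=> jN; apply: contraTneq (qh j jN) => e; rewrite /q e dot0l -ltNge; lra.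
exists f; split.
- by rewrite /f /q /p mul0r subr0 scale0r addr0 scale1r a1 sqrtr1 invr1 scale1r.
- by rewrite /f /q /p divff ?gt_eqF// subrr scale0r add0r scale1r b1 sqrtr1 invr1 scale1r.
- by move=> j jN; apply: normalize; exact: p0.
- move=> j; exists ((Num.sqrt (q j))^-1 * (1 - j%:R / N%:R)), ((Num.sqrt (q j))^-1 * (j%:R / N%:R)).
  by rewrite /f /p scalerDr !scalerA.
move=> j jN; have jN' := ltnW jN.
have f1 : dot (f j) (f j) = 1 by apply: normalize; exact: p0.
have f2 : dot (f j.+1) (f j.+1) = 1 by apply: normalize; exact: p0.
rewrite dot_subsq//.
pose A := Num.sqrt (q j); pose B := Num.sqrt (q j.+1).
have q1 := qh j jN'; have q2 := qh j.+1 jN.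
have A0 : 0 < A by rewrite sqrtr_gt0; lra.
have B0 : 0 < B by rewrite sqrtr_gt0; lra.
have A2 : A ^+ 2 = q j by rewrite sqr_sqrtr//; lra.
have B2 : B ^+ 2 = q j.+1 by rewrite sqr_sqrtr//; lra.
have AB : 2^-1 <= A * B.
  rewrite -(@ler_pXn2r _ 2)// ?nnegrE; [|by []|exact/ltW/mulr_gt0].
  rewrite exprMn A2 B2 (_ : 2^-1 ^+ 2 = 2^-1 * 2^-1 :> R)//.
  have h1 : 0 <= q j - 2^-1 by rewrite subr_ge0.
  have h2 : 0 <= q j.+1 - 2^-1 by rewrite subr_ge0.
  have := mulr_ge0 h1 h2; lra.
have -> : dot (f j) (f j.+1) = dot (p j) (p j.+1) / (A * B).
  by rewrite /f !dotE -/A -/B; field; rewrite !gt_eqF.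
have pd : q j + q j.+1 - 2 * dot (p j) (p j.+1) = dot (a - b) (a - b) / N%:R ^+ 2.
  rewrite /q !pp !dotE a1 b1 (dotC b) -addn1 natrD; field; exact: lt0r_neq0.
have D0 : 0 <= dot (a - b) (a - b) / N%:R ^+ 2 by rewrite divr_ge0 ?dot_ge0// exprn_ge0// ltW.
have -> : 2 - 2 * (dot (p j) (p j.+1) / (A * B)) =
    (dot (a - b) (a - b) / N%:R ^+ 2 - (A - B) ^+ 2) / (A * B).
  rewrite -pd -A2 -B2; field; by rewrite !gt_eqF.
rewrite ler_pdivrMr ?mulr_gt0//.
apply: (@le_trans _ _ (dot (a - b) (a - b) / N%:R ^+ 2)).
  by rewrite lerBlDr lerDl sqr_ge0.
by rewrite -mulrA; nra.
Qed.

(** The component of the step along u is of second order in its length and disappears when the path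
    is refined. The rest is a multiple of a unit y orthogonal to both u and x, as [sign_moment]
    requires. *)
Lemma spherical_decomposition x u v : (2 < n)%N ->
  dot u u = 1 -> dot v v = 1 -> dot x u = 0 -> dot x v = 0 ->
  exists (y : 'rV[R]_n) (k : R), [/\ dot y y = 1, dot u y = 0, dot x y = 0,
    k ^+ 2 <= dot (v - u) (v - u) &
    v - u = (- (dot (v - u) (v - u) / 2)) *: u + k *: y].
Proof.
move=> n2 u1 v1 xu xv; rewrite dot_subsq//; set rho := dot u v.
have /andP[r1 r2] : -1 <= rho <= 1 by exact: dot_unit_bound.
pose z := v - rho *: u.
have uz : dot u z = 0 by rewrite /z !dotE u1 -/rho; ring.
have zz : dot z z = 1 - rho ^+ 2.
  by rewrite /z !dotE v1 u1 (dotC v) -/rho; ring.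
have e : v - u = (- ((2 - 2 * rho) / 2)) *: u + z.
  rewrite /z (_ : - ((2 - 2 * rho) / 2) = rho - 1); last by field.
  by rewrite scalerBl scale1r [RHS]addrC addrA subrK.
have [z0|zn0] := eqVneq z 0.
  have [|y y1 hy] := @exists_unit_orthogonal R n [:: u; x]; first exact: n2.
  exists y, 0; rewrite y1 dotC hy ?inE ?eqxx// dotC hy ?inE ?eqxx ?orbT//.
  split => //; first by rewrite expr0n /=; lra.
  by rewrite e z0 scale0r.
exists ((Num.sqrt (dot z z))^-1 *: z), (Num.sqrt (dot z z)).
split; first exact: normalize.
- by rewrite dotZr uz mulr0.
- by rewrite dotZr /z !dotE xv xu !mulr0 subr0 mulr0.
- by rewrite sqr_sqrtr ?dot_ge0// zz; nra.
rewrite scalerA mulfV ?scale1r//.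
by rewrite gt_eqF// sqrtr_gt0 dot_gt0.
Qed.

End SphericalGeometry.

(** * Moments of increments *)

Section IncrementMoments.
Context {R : realType} {n : nat} {d : measure_display} {T : measurableType d}.
Variables (mu : {finite_measure set T -> \bar R}) (X : T -> 'rV[R]_n).
Hypotheses (hX : bvec X) (X1 : forall t, dot (X t) (X t) = 1).
Hypothesis isoX : forall x, \int[mu]_t (dot x (X t) ^+ 2) = dot x x.
Variables (tau : probability (borelType 'M[R]_n) R) (U : borelType 'M[R]_n -> 'M[R]_n).
Hypothesis hU : haar_matrix tau U.
Hypothesis n2 : (2 < n)%N.
Implicit Types (x y z u v a b : 'rV[R]_n) (s : R).

Local Notation W := (powmean mu X).
Local Notation Q := (powform mu X).

Lemma bvec_row (i : 'I_n) : bvec (fun w => row i (U w)).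
Proof. by under eq_fun do rewrite rowE; exact: (bvecU hU). Qed.

Lemma bmf_gradsq {d' : measure_display} {T' : measurableType d'} s (A : pred 'I_n)
    (V : T' -> 'M[R]_n) (u : T' -> 'rV[R]_n) : 2 <= s ->
  (forall i, bvec (fun w => row i (V w))) -> bvec u ->
  bmf (fun w => gradsq mu X (V w) A s (u w)).
Proof.
by move=> s2 hV hu; apply: bmf_sum => i; apply: bmfX; apply: bmf_Q.
Qed.

Ltac bmU := repeat lazymatch goal with
  | |- bmf (fun w => powmean _ _ _ _) => apply: (bmf_W mu hX); [exact: (le_trans (ler0n R 2)) |]
  | |- bmf (fun w => powform _ _ _ _ _) => apply: (bmf_Q mu hX) => //
  | |- bmf (fun w => gradsq _ _ _ _ _ _) => apply: bmf_gradsq => //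
  | |- bmf (fun w => dot _ _) => apply: bmf_dot
  | |- bmf (fun w => `|@?f w|) => apply: bmf_norm
  | |- bmf (fun w => - @?f w) => apply: bmfN
  | |- bmf (fun w => @?f w ^+ _) => apply: bmfX
  | |- bmf (fun w => @?f w * @?h w) => apply: bmfM
  | |- bmf (fun w => @?f w + @?h w) => apply: bmfD
  | |- bmf (fun w => ?k) => first [exact: bmf_cst | assumption | done]
  | |- bvec (fun w => @?f w + @?h w) => apply: bvecD
  | |- bvec (fun w => - @?f w) => apply: bvecN
  | |- bvec (fun w => _ *: @?f w) => apply: bvecZ
  | |- bvec (fun w => _ *m _) => exact: (bvecU hU)
  | |- bvec (fun w => row _ _) => exact: bvec_row
  | |- forall i : _, _ => move=> ?
  end.

Variables (s : R) (g : 'rV[R]_n -> R) (c e : R) (r : nat) (i0 i1 : 'I_n).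
Hypotheses (s2 : 2 <= s) (i01 : i0 != i1) (ce : c ^+ 2 + e ^+ 2 = 1).
Hypotheses (g0 : forall x, 0 <= g x) (bmg : forall x, bmf (fun w => g (x *m U w))).

Let Gam := \int[tau]_w (g (row i0 (U w)) *
  gradsq mu X (U w) (fun i => (i != i0) && (i != i1)) s
    (c *: row i0 (U w) + e *: row i1 (U w)) ^+ r).
Let K : R := (4 * r%:R + 1) / (n - 2)%:R.

Let s0 : 0 <= s.
Proof. exact: le_trans s2. Qed.

Let K0 : 0 <= K.
Proof. by rewrite divr_ge0// addr_ge0// mulr_ge0. Qed.

Let bmgr i : bmf (fun w => g (row i (U w))).
Proof. by under eq_fun do rewrite rowE; exact: bmg. Qed.

Let Gam0 : 0 <= Gam.
Proof. by apply: bint_ge0 => w; rewrite mulr_ge0// exprn_ge0// gradsq_ge0. Qed.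

Let Eg0 x : 0 <= \int[tau]_w g (x *m U w).
Proof. exact: bint_ge0. Qed.

Let direction_moment x u y :
  dot x x = 1 -> dot u u = 1 -> dot y y = 1 -> dot x u = 0 -> dot x y = 0 -> dot u y = 0 ->
  \int[tau]_w (g (x *m U w) * Q s (c *: (x *m U w) + e *: (u *m U w)) (y *m U w) ^+ r.*2)
    <= K ^+ r * Gam.
Proof.
move=> x1 u1 y1 xu xy uy.
have bq x' u' y' : bmf (fun w =>
    Q s (c *: (x' *m U w) + e *: (u' *m U w)) (y' *m U w)) by bmU.
exact: (@sign_moment _ _ tau U hU (fun x _ => g x) (fun x y z => Q s (c *: x + e *: y) z)
  (fun x _ => g0 x) (fun x y z z' => powformD mu hX _ _ _ s2)
  (fun x y k z => powformZ mu hX k _ _ s2) (fun x _ => bmg x) bq i0 i1 r x u y n2 i01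
  x1 u1 y1 xu xy uy).
Qed.

(** The tangential part of the step is controlled by [direction_moment], the radial part by the
    crude bound |Q| <= 2. The latter leaves the error with the extra factor h2^r, which refinement
    removes. *)
Let step_moment x u v h2 : dot x x = 1 -> dot u u = 1 -> dot v v = 1 ->
  dot x u = 0 -> dot x v = 0 -> dot (v - u) (v - u) = h2 ->
  \int[tau]_w (g (x *m U w) * (W s (c *: (x *m U w) + e *: (v *m U w)) -
      W s (c *: (x *m U w) + e *: (u *m U w))) ^+ r.*2) <=
  (16 * s ^+ 2 * e ^+ 2 * h2) ^+ r * (h2 ^+ r * \int[tau]_w g (x *m U w) + K ^+ r * Gam).
Proof.
move=> x1 u1 v1 xu xv h2E.
have h20 : 0 <= h2 by rewrite -h2E dot_ge0.
have eqle (y z : R) : y = z -> y <= z by move=> ->.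
have s40 : 0 <= 4 * s ^+ 2 by rewrite mulr_ge0 ?sqr_ge0.
have e40 : 0 <= 4 * e ^+ 2 by rewrite mulr_ge0 ?sqr_ge0.
have bx := bmg x.
pose H x u v := g x * (Q s (c *: x + e *: u) (e *: (v - u))) ^+ r.*2.
have bH x' u' v' : bmf (fun w => H (x' *m U w) (u' *m U w) (v' *m U w)).
  have bx' := bmg x'; rewrite /H; bmU.
(* The derivative terms at the two ends have the same integral: exchanging u and v changes no inner
   product. *)
have swap : \int[tau]_w H (x *m U w) (v *m U w) (u *m U w) =
    \int[tau]_w H (x *m U w) (u *m U w) (v *m U w).
  by apply: (haar_congruence3 hU (H := H)); rewrite ?x1 ?u1 ?v1 ?xu ?xv// dotC.
have pt x' u' v' : g x' * (W s (c *: x' + e *: v') - W s (c *: x' + e *: u')) ^+ r.*2 <=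
    (4 * s ^+ 2) ^+ r * (2^-1 * (H x' u' v' + H x' v' u')).
  have := powmean_increment mu hX (c *: x' + e *: u') (c *: x' + e *: v') s2.
  have -> : c *: x' + e *: v' - (c *: x' + e *: u') = e *: (v' - u').
    by rewrite opprD addrACA subrr add0r -scalerBr.
  set q1 := Q s _ _; set q2 := Q s _ _; set D := W s _ - _ => hD.
  have q2E : q2 ^+ r.*2 = (Q s (c *: x' + e *: v') (e *: (u' - v'))) ^+ r.*2.
    rewrite -(opprB v' u') scalerN (powformN mu hX _ _ s2) -/q2.
    by rewrite -(exprn_even_norm (- q2)) normrN exprn_even_norm.
  have rg (C G A B : R) : C * (2^-1 * (G * A + G * B)) = G * (C * (2^-1 * (A + B))) by ring.
  rewrite /H -q2E -/q1 rg.
  apply: ler_wpM2l; first exact: g0.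
  rewrite -(exprn_even_norm D); apply: (@le_trans _ _ ((s * (`|q1| + `|q2|)) ^+ r.*2)).
    by apply: lerXn2r; rewrite ?nnegrE ?mulr_ge0 ?addr_ge0.
  have -> : (4 * s ^+ 2) ^+ r = s ^+ r.*2 * 4 ^+ r by rewrite exprMn -exprM mul2n mulrC.
  rewrite exprMn -mulrA; apply: ler_wpM2l; first by rewrite exprn_ge0.
  apply: le_trans (power_mean2 _ _ _) _.
  by rewrite !exprn_even_norm.
have HE x' u' v' : H x' u' v' = g x' * (Q s (c *: x' + e *: u') (e *: (v' - u'))) ^+ r.*2 by [].
clearbody H.
have bS : bmf (fun w => H (x *m U w) (u *m U w) (v *m U w) + H (x *m U w) (v *m U w) (u *m U w)).
  by apply: bmfD; apply: bH.
have bS2 : bmf (fun w => 2^-1 *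
    (H (x *m U w) (u *m U w) (v *m U w) + H (x *m U w) (v *m U w) (u *m U w))).
  by apply: bmfM; [exact: bmf_cst|exact: bS].
have L1 : \int[tau]_w (g (x *m U w) * (W s (c *: (x *m U w) + e *: (v *m U w)) -
      W s (c *: (x *m U w) + e *: (u *m U w))) ^+ r.*2) <=
    (4 * s ^+ 2) ^+ r * \int[tau]_w H (x *m U w) (u *m U w) (v *m U w).
  apply: (@le_trans _ _ (\int[tau]_w ((4 * s ^+ 2) ^+ r * (2^-1 *
     (H (x *m U w) (u *m U w) (v *m U w) + H (x *m U w) (v *m U w) (u *m U w)))))).
    apply: bint_le => [||w]; [by bmU| |exact: pt].
    by apply: bmfM; [exact: bmf_cst|exact: bS2].
  apply: (le_trans (eqle _ _ (bintZ tau _ bS2))).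
  apply: ler_wpM2l; first exact: (exprn_ge0 r s40).
  apply: (le_trans (eqle _ _ (bintZ tau _ bS))).
  have half (z t : R) : t = z + z -> 2^-1 * t <= z by move=> ->; lra.
  apply: half; apply: (etrans (bintD tau (bH _ _ _) (bH _ _ _))).
  by congr (_ + _); exact: swap.
have [y [k [y1 uy xy k2 vu]]] := spherical_decomposition n2 u1 v1 xu xv.
rewrite h2E in k2 vu.
apply: le_trans L1 _.
have -> : (16 * s ^+ 2 * e ^+ 2 * h2) ^+ r = (4 * s ^+ 2) ^+ r * ((4 * e ^+ 2) ^+ r * h2 ^+ r).
  by rewrite -!exprMn; congr (_ ^+ _); ring.
rewrite -mulrA; apply: ler_wpM2l; first exact: (exprn_ge0 r s40).
clear pt bS bS2 swap s40.
pose q w := Q s (c *: (x *m U w) + e *: (u *m U w)) (y *m U w).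
have L2 : \int[tau]_w H (x *m U w) (u *m U w) (v *m U w) <=
   \int[tau]_w ((4 * e ^+ 2) ^+ r * h2 ^+ r *
     (h2 ^+ r * g (x *m U w) + g (x *m U w) * q w ^+ r.*2)).
  apply: bint_le => [||w]; [exact: bH|rewrite /q; bmU|].
  rewrite HE -mulmxBl vu mulmxDl -!scalemxAl powformZ// powformD// !powformZ//.
  rewrite -/(q w); set qu := Q s _ _.
  have qu2 : `|qu| <= 2.
    apply: le_trans (powform_abs_le mu hX _ _ s2) _.
    have p1 : dot (c *: (x *m U w) + e *: (u *m U w)) (c *: (x *m U w) + e *: (u *m U w)) = 1.
      by apply: etrans ce; rewrite !dotE !(dotU hU) x1 u1 (dotC u) xu; ring.
    have h1 := powmean_le1 hX X1 isoX s2 (eqle _ _ p1); rewrite p1 in h1.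
    have h3 : dot (u *m U w) (u *m U w) <= 1 by rewrite (dotU hU) u1.
    have two : (1 : R) + 1 = 2 by ring.
    by rewrite -two; exact: (lerD h1 (le_trans (powmean_le1 hX X1 isoX s2 h3) h3)).
  have rg (C D G A : R) : C * (D * G + G * A) = G * (C * (D + A)) by ring.
  rewrite rg; apply: ler_wpM2l; first exact: g0.
  move: (q w) => qw; rewrite exprMn.
  have -> : e ^+ r.*2 = (e ^+ 2) ^+ r by rewrite -exprM mul2n.
  have -> : (4 * e ^+ 2) ^+ r = (e ^+ 2) ^+ r * 4 ^+ r by rewrite exprMn mulrC.
  rewrite -!mulrA; apply: ler_wpM2l; first by rewrite exprn_ge0 ?sqr_ge0.
  apply: le_trans (power_mean2 _ _ _) _.
  apply: ler_wpM2l; first by rewrite exprn_ge0.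
  have a1 : (- (h2 / 2) * qu) ^+ r.*2 <= h2 ^+ r.*2.
    rewrite -(exprn_even_norm (_ * _)) normrM normrN (ger0_norm (divr_ge0 h20 _))//.
    by apply: lerXn2r; rewrite ?nnegrE ?mulr_ge0 ?divr_ge0//; nra.
  have a2 : (k * qw) ^+ r.*2 <= h2 ^+ r * qw ^+ r.*2.
    rewrite exprMn; apply: ler_wpM2r; first exact: exprn_even_ge0.
    rewrite -mul2n exprM.
    by apply: lerXn2r; rewrite ?nnegrE ?sqr_ge0.
  have a3 : 0 <= h2 ^+ r.*2 by rewrite exprn_ge0.
  have a4 : 0 <= h2 ^+ r * qw ^+ r.*2 by rewrite mulr_ge0 ?exprn_even_ge0 ?exprn_ge0.
  have -> : h2 ^+ r * (h2 ^+ r + qw ^+ r.*2) = h2 ^+ r.*2 + h2 ^+ r * qw ^+ r.*2.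
    by rewrite mulrDr -exprD addnn.
  move: a1 a2 a3 a4.
  move: (_ ^+ r.*2) (_ ^+ r.*2) (h2 ^+ r.*2) (_ * _) => a b c' d'; lra.
have bq : bmf (fun w => g (x *m U w) * q w ^+ r.*2) by rewrite /q; bmU.
have bxq : bmf (fun w => h2 ^+ r * g (x *m U w) + g (x *m U w) * q w ^+ r.*2).
  by apply: bmfD => //; apply: bmfM => //; exact: bmf_cst.
apply: le_trans L2 _; apply: (le_trans (eqle _ _ (bintZ tau _ bxq))).
apply: ler_wpM2l; first by apply: mulr_ge0; apply: exprn_ge0.
have bhx : bmf (fun w => h2 ^+ r * g (x *m U w)) by apply: bmfM => //; exact: bmf_cst.
apply: (le_trans (eqle _ _ (bintD tau bhx bq))).
apply: lerD; first exact: (eqle _ _ (bintZ tau _ bx)).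
exact: direction_moment.
Qed.

(** The power mean inequality over N steps costs N^(2r), which the factor N^(-2r) from the squared
    step lengths cancels. What remains of the radial error is of order N^(-2r), so N tends to
    infinity. *)
Lemma increment_moment x a b : (0 < r)%N ->
  dot x x = 1 -> dot a a = 1 -> dot b b = 1 -> dot x a = 0 -> dot x b = 0 -> 0 <= dot a b ->
  \int[tau]_w (g (x *m U w) * (W s (c *: (x *m U w) + e *: (a *m U w)) -
      W s (c *: (x *m U w) + e *: (b *m U w))) ^+ r.*2) <=
  (32 * s ^+ 2 * e ^+ 2 * dot (a - b) (a - b) * K) ^+ r * Gam.
Proof.
move=> r0 x1 a1 b1 xa xb ab; have bx := bmg x.
set D := dot _ _; have D0 : 0 <= D by exact: dot_ge0.
set L := \int[tau]_w _; set C := 32 * s ^+ 2 * e ^+ 2 * D.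
have C0 : 0 <= C by rewrite mulr_ge0// mulr_ge0 ?sqr_ge0// mulr_ge0 ?sqr_ge0.
have main (N : nat) : (0 < N)%N ->
    L <= C ^+ r * ((2 * D / N%:R ^+ 2) ^+ r * \int[tau]_w g (x *m U w) + K ^+ r * Gam).
  move=> N0; have NR : (0 : R) < N%:R by rewrite ltr0n.
  have [f [fa fb f1 fab fN]] := spherical_path N0 a1 b1 ab.
  have xf j : dot x (f j) = 0.
    by have [al [be ->]] := fab j; rewrite !dotE xa xb !mulr0 addr0.
  pose F w (j : nat) := W s (c *: (x *m U w) + e *: (f j *m U w)).
  pose del w (j : nat) := F w j.+1 - F w j.
  have bdel j : bmf (fun w => del w j) by rewrite /del /F; bmU.
  have bdj j : bmf (fun w => g (x *m U w) * del w j ^+ r.*2).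
    by apply: bmfM => //; exact: bmfX.
  have -> : L = \int[tau]_w (g (x *m U w) * (\sum_(j < N) del w j) ^+ r.*2).
    apply: eq_Rintegral => w _; congr (_ * _).
    have tele (h : nat -> R) : \sum_(j < N) (h j.+1 - h j) = h N - h 0%N.
      by rewrite -(big_mkord xpredT (fun j => h j.+1 - h j)) telescope_sumr.
    rewrite [X in _ = X ^+ _](_ : _ = F w N - F w 0%N); last exact: tele.
    rewrite /F fa fb.
    have sgn (y z : R) : (y - z) ^+ r.*2 = (z - y) ^+ r.*2.
      by rewrite -(exprn_even_norm (y - z)) distrC exprn_even_norm.
    exact: sgn.
  set M := 2 * D / N%:R ^+ 2; have M0 : 0 <= M by rewrite divr_ge0 ?mulr_ge0// exprn_ge0// ltW.
  set B := (16 * s ^+ 2 * e ^+ 2 * M) ^+ r * (M ^+ r * \int[tau]_w g (x *m U w) + K ^+ r * Gam).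
  have hB j : (j < N)%N -> \int[tau]_w (g (x *m U w) * del w j ^+ r.*2) <= B.
    move=> jN; apply: le_trans (step_moment x1 (f1 _ (ltnW jN)) (f1 _ jN) (xf _) (xf _) erefl) _.
    have hM := fN _ jN; rewrite -/M in hM.
    have k16 : 0 <= 16 * s ^+ 2 * e ^+ 2 by rewrite mulr_ge0 ?sqr_ge0// mulr_ge0 ?sqr_ge0.
    apply: ler_pM.
    - by apply: exprn_ge0; apply: mulr_ge0 => //; exact: dot_ge0.
    - by apply: addr_ge0; apply: mulr_ge0 => //; apply: exprn_ge0 => //; exact: dot_ge0.
    - have d0 : 0 <= dot (f j.+1 - f j) (f j.+1 - f j) by exact: dot_ge0.
      by apply: lerXn2r; [exact: mulr_ge0|exact: mulr_ge0|exact: ler_wpM2l].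
    - rewrite lerD2r; apply: ler_wpM2r; first exact: Eg0.
      by apply: lerXn2r; rewrite ?nnegrE ?dot_ge0.
  apply: (@le_trans _ _ (N%:R ^+ r.*2 * B)); last first.
    rewrite /B mulrA; apply: ler_wpM2r.
      by apply: addr_ge0; apply: mulr_ge0 => //; apply: exprn_ge0.
    rewrite -mul2n exprM -exprMn (_ : N%:R ^+ 2 * _ = C)//.
    by rewrite /M /C; field; rewrite gt_eqF.
  apply: (@le_trans _ _ (\int[tau]_w (N%:R ^+ r.*2 * (N%:R^-1 *
      \sum_(j < N) (g (x *m U w) * del w j ^+ r.*2))))).
    apply: bint_le => [||w].
    - by apply: bmfM => //; apply: bmfX; apply: bmf_sum.
    - by do 2 (apply: bmfM; first exact: bmf_cst); apply: bmf_sum.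
    rewrite -mulr_sumr.
    have rg (y z t q : R) : y * (z * (t * q)) = t * (y * (z * q)) by ring.
    by rewrite rg; apply: ler_wpM2l => //; exact: power_mean.
  have bs : bmf (fun w => \sum_(j < N) (g (x *m U w) * del w j ^+ r.*2)) by exact: bmf_sum.
  have bNs : bmf (fun w => N%:R^-1 * \sum_(j < N) (g (x *m U w) * del w j ^+ r.*2)).
    by apply: bmfM => //; exact: bmf_cst.
  rewrite (bintZ tau _ bNs) (bintZ tau _ bs) (bint_sum tau _ _ (fun j : (ordinal N) => bdj j)).
  apply: ler_wpM2l; first by rewrite exprn_ge0 ?ler0n.
  apply: (@le_trans _ _ (N%:R^-1 * \sum_(j < N) B)).
    by apply: ler_wpM2l; rewrite ?invr_ge0 ?ler0n//; apply: ler_sum => j _; exact: hB.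
  by rewrite sumr_const card_ord -[B *+ N]mulr_natr mulrCA mulVf ?mulr1// gt_eqF.
rewrite exprMn -mulrA.
pose B := C ^+ r * ((2 * D) ^+ r * \int[tau]_w g (x *m U w)).
have B0 : 0 <= B by rewrite mulr_ge0 ?exprn_ge0// mulr_ge0 ?exprn_ge0// mulr_ge0.
apply/ler_addgt0Pr => eps eps0.
pose N := (Num.truncn (B / eps)).+1.
have NB : B / eps < N%:R by exact: truncnS_gt.
have NR : (1 : R) <= N%:R by rewrite ler1n.
apply: le_trans (main N isT) _; rewrite mulrDr addrC lerD2l.
have -> : C ^+ r * ((2 * D / N%:R ^+ 2) ^+ r * \int[tau]_w g (x *m U w)) = B / N%:R ^+ r.*2.
  by rewrite /B expr_div_n -exprM mul2n; ring.
rewrite ler_pdivrMr ?exprn_gt0 ?ltr0n// (le_trans (ltW _) (_ : eps * N%:R <= _))//.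
  by rewrite mulrC -ltr_pdivrMr.
rewrite ler_wpM2l ?(ltW eps0)// -[leLHS]expr1; apply: ler_weXn2l => //.
by rewrite double_gt0.
Qed.

End IncrementMoments.

(** * Right invariance and decoupling of deviations *)

Section Decoupling.
Context {R : realType} {n : nat}.
Variables (tau : probability (borelType 'M[R]_n) R) (U : borelType 'M[R]_n -> 'M[R]_n).
Hypothesis hU : haar_matrix tau U.
Implicit Types (x y z a b : 'rV[R]_n).

Let mU : measurable_fun setT (U : _ -> borelType 'M[R]_n).
Proof. by case: hU. Qed.
Let UK A : orthogonal A -> U A = A.
Proof. by case: hU => _ _ + _; apply. Qed.
Let oU w : orthogonal (U w).
Proof. by case: hU => _ + _ _; apply. Qed.

Lemma bmf_retract {d : measure_display} {T : measurableType d} (H : 'M[R]_n -> R)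
    (A : T -> 'M[R]_n) : measurable_fun setT (A : T -> borelType 'M[R]_n) ->
  (forall t, orthogonal (A t)) -> bmf (fun w => H (U w)) -> bmf (fun t => H (A t)).
Proof.
move=> mA oA hH; have := bmf_comp (g := A : T -> borelType 'M[R]_n) mA hH.
by congr bmf; apply/funext => t; rewrite UK.
Qed.

(** The classical argument that an invariant probability is preserved by inversion: integrate H (V^T
    U) over two independent copies in either order. *)
Lemma haar_transpose (H : 'M[R]_n -> R) : bmf (fun w => H (U w)) ->
  \int[tau]_w H ((U w)^T) = \int[tau]_w H (U w).
Proof.
move=> hH.
have oF (z : borelType 'M[R]_n * borelType 'M[R]_n) : orthogonal ((U z.1)^T *m U z.2).
  by apply: orthogonalM => //; exact: orthogonal_tr.
have bF : bmf (fun z : borelType 'M[R]_n * borelType 'M[R]_n => H ((U z.1)^T *m U z.2)).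
  apply: bmf_retract => //; apply: measurable_mulmx.
    apply: measurable_trmx; exact: (measurableT_comp mU measurable_fst).
  exact: (measurableT_comp mU measurable_snd).
have := bint_Fubini tau tau bF; rewrite /=.
under eq_Rintegral => w _ do
  rewrite (haar_invariant hU (H := H) (orthogonal_tr (oU w)) hH).
rewrite pint_cst => ->; rewrite -[LHS](pint_cst tau).
apply: eq_Rintegral => v _.
have hT : bmf (fun w => H ((U w)^T)).
  apply: bmf_retract => // [|w]; last exact: orthogonal_tr.
  by apply: measurable_trmx.
rewrite -[LHS](haar_invariant hU (H := fun A => H (A^T)) (orthogonal_tr (oU v)) hT).
by apply: eq_Rintegral => w _; rewrite trmx_mul trmxK.
Qed.

Lemma haar_right (H : 'M[R]_n -> R) (O : 'M[R]_n) : orthogonal O ->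
  bmf (fun w => H (U w)) -> \int[tau]_w H (U w *m O) = \int[tau]_w H (U w).
Proof.
move=> hO hH.
have hHO : bmf (fun w => H (U w *m O)).
  apply: bmf_retract => // [|w]; last exact: orthogonalM.
  by apply: measurable_mulmx => //; exact: measurable_cst.
have hT : bmf (fun w => H ((U w)^T)).
  apply: bmf_retract => // [|w]; last exact: orthogonal_tr.
  exact: measurable_trmx.
rewrite -(haar_transpose (H := fun A => H (A *m O)) hHO) -[RHS](haar_transpose hH).
rewrite -[RHS](haar_invariant hU (H := fun A => H (A^T)) (orthogonal_tr hO) hT).
by apply: eq_Rintegral => w _; rewrite trmx_mul trmxK.
Qed.

(** Quantifying over all bounded random vectors covers functions of one random matrix and of two
    independent ones alike. *)
Definition borel_bounded (f : 'rV[R]_n -> R) := forall (d : measure_display)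
  (T : measurableType d) (u : T -> 'rV[R]_n), bvec u -> bmf (fun t => f (u t)).

Variables (f : 'rV[R]_n -> R) (a : 'rV[R]_n).
Hypotheses (bf : borel_bounded f) (a1 : dot a a = 1).

Let bvU x : bvec (fun w => x *m U w).
Proof. exact: (bvecU hU). Qed.

Let mean := \int[tau]_w f (a *m U w).

Let bvUU : bvec (fun z : borelType 'M[R]_n * borelType 'M[R]_n => a *m U z.2 *m U z.1).
Proof.
split; last by exists 1 => z; rewrite !(dotU hU) a1.
apply: measurable_mulmx; last exact: (measurableT_comp mU measurable_fst).
apply: measurable_mulmx; first exact: measurable_cst.
exact: (measurableT_comp mU measurable_snd).
Qed.

Let bvU1 : bvec (fun z : borelType 'M[R]_n * borelType 'M[R]_n => a *m U z.1).
Proof. exact: (bvec_comp measurable_fst (bvU a)). Qed.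

(* By right invariance the mean of f may be computed over the points b U with b = a V and V an
   independent copy of U, so that a deviation from the mean becomes an average of increments. *)
Let meanE w : \int[tau]_v f (a *m U v *m U w) = mean.
Proof.
rewrite /mean -(haar_right (H := fun A => f (a *m A)) (oU w)); last exact: bf.
by apply: eq_Rintegral => v _; rewrite mulmxA.
Qed.

Lemma central_moment r (B : R) :
  (forall b, dot b b = 1 -> \int[tau]_w (f (a *m U w) - f (b *m U w)) ^+ r.*2 <= B) ->
  \int[tau]_w (f (a *m U w) - mean) ^+ r.*2 <= B.
Proof.
move=> hB.
pose F (z : borelType 'M[R]_n * borelType 'M[R]_n) :=
  (f (a *m U z.1) - f (a *m U z.2 *m U z.1)) ^+ r.*2.
have bF : bmf F by apply: bmfX; apply: bmfB; apply: bf.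
have bfm : bmf (fun w => f (a *m U w)) by exact: bf.
apply: (@le_trans _ _ (\int[tau]_w \int[tau]_v F (w, v))).
  apply: bint_le => [||w]; [by apply: bmfX; apply: bmfB => //; exact: bmf_cst|exact: bmf_int2|].
  have b2 : bmf (fun v => f (a *m U v *m U w)) := bmf_pair2 w (bf bvUU).
  have bc : bmf (fun _ : borelType 'M[R]_n => f (a *m U w)) by exact: bmf_cst.
  have -> : f (a *m U w) - mean = \int[tau]_v (f (a *m U w) - f (a *m U v *m U w)).
    by rewrite bintB// pint_cst meanE.
  by apply: pint_jensen_even; exact: bmfB.
rewrite (bint_Fubini tau tau bF) -[leRHS](pint_cst tau).
have b1 v : dot (a *m U v) (a *m U v) = 1 by rewrite (dotU hU).
have h1 := bmf_int1_prod tau tau bF; have h2 : bmf (fun _ : borelType 'M[R]_n => B) by exact: bmf_cst.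
by apply: (bint_le tau h1 h2) => v; exact: (hB _ (b1 v)).
Qed.

(** Exchanging a and b preserves the law, so the integral of (f a - f b) h a is half that of the
    product of the two increments. *)
Lemma decoupled_covariance (h : 'rV[R]_n -> R) (B : R) : borel_bounded h ->
  (forall b, dot b b = 1 ->
    \int[tau]_w ((f (a *m U w) - f (b *m U w)) * (h (a *m U w) - h (b *m U w))) <= 2 * B) ->
  \int[tau]_w ((f (a *m U w) - mean) * h (a *m U w)) <= B.
Proof.
move=> bh hB.
pose F (z : borelType 'M[R]_n * borelType 'M[R]_n) :=
  (f (a *m U z.1) - f (a *m U z.2 *m U z.1)) * h (a *m U z.1).
have bF : bmf F by apply: bmfM; [apply: bmfB; apply: bf|exact: bh].
have -> : \int[tau]_w ((f (a *m U w) - mean) * h (a *m U w)) = \int[tau]_w \int[tau]_v F (w, v).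
  apply: eq_Rintegral => w _.
  have b2 : bmf (fun v => f (a *m U v *m U w)) := bmf_pair2 w (bf bvUU).
  have bc : bmf (fun _ : borelType 'M[R]_n => f (a *m U w)) by exact: bmf_cst.
  have b3 := bmfB bc b2.
  have -> : f (a *m U w) - mean = \int[tau]_v (f (a *m U w) - f (a *m U v *m U w)).
    by rewrite bintB// pint_cst meanE.
  exact: (esym (bintZr tau (h (a *m U w)) b3)).
rewrite (bint_Fubini tau tau bF) -[leRHS](pint_cst tau).
have h1 := bmf_int1_prod tau tau bF; have h2 : bmf (fun _ : borelType 'M[R]_n => B) by exact: bmf_cst.
apply: (bint_le tau h1 h2) => v {h1 h2}.
have b1 : dot (a *m U v) (a *m U v) = 1 by rewrite (dotU hU).
rewrite /F /= => {F bF}; move: (a *m U v) b1 => b b1.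
pose D x y := (f x - f y) * h x.
have bD x y : bmf (fun w => D (x *m U w) (y *m U w)).
  by apply: bmfM; [apply: bmfB; apply: bf|exact: bh].
have sw : \int[tau]_w D (b *m U w) (a *m U w) = \int[tau]_w D (a *m U w) (b *m U w).
  by apply: (haar_congruence2 hU (H := D)); rewrite ?a1 ?b1// dotC.
have := hB b b1.
have -> : \int[tau]_w ((f (a *m U w) - f (b *m U w)) * (h (a *m U w) - h (b *m U w))) =
    \int[tau]_w (D (a *m U w) (b *m U w) + D (b *m U w) (a *m U w)).
  by apply: eq_Rintegral => w _; rewrite /D; ring.
change (\int[tau]_w (D (a *m U w) (b *m U w) + D (b *m U w) (a *m U w)) <= 2 * B ->
  \int[tau]_w D (a *m U w) (b *m U w) <= B).
clearbody D; rewrite (bintD tau (bD _ _) (bD _ _)) sw; lra.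
Qed.

End Decoupling.

Section FunctionalMoments.
Context {R : realType} {n : nat}.
Variables (tau : probability (borelType 'M[R]_n) R) (U : borelType 'M[R]_n -> 'M[R]_n).
Hypotheses (hU : haar_matrix tau U) (n2 : (2 < n)%N).
Implicit Types (x y z v : 'rV[R]_n).

Let nR : (0 : R) < n%:R.
Proof. by rewrite ltr0n; apply: leq_trans n2. Qed.

Let n2E : (n - 2)%:R = n%:R - 2 :> R.
Proof. by rewrite natrB// ltnW. Qed.

Let n3 : (3 : R) <= n%:R.
Proof. by rewrite ler_nat. Qed.

Lemma ratio_le (r : nat) : (4 * r%:R + 1) / (n - 2)%:R <= (3 * (4 * r%:R + 1)) / n%:R :> R.
Proof.
have h3 : (3 : R) <= n%:R := n3.
have r0 : 0 <= 4 * r%:R + 1 :> R by rewrite addr_ge0// mulr_ge0.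
rewrite n2E ler_pdivrMr; last lra.
rewrite mulrAC ler_pdivlMr// (mulrC 3) -mulrA; apply: ler_wpM2l => //; lra.
Qed.

Lemma bessel_rows w v (A : pred 'I_n) : \sum_(i | A i) dot (row i (U w)) v ^+ 2 <= dot v v.
Proof.
have <- : \sum_i dot (row i (U w)) v ^+ 2 = dot v v.
  rewrite -(dot_orthogonal v v (orthogonal_tr (haar_orthogonal hU w))) [RHS]/dot.
  apply: eq_bigr => i _; rewrite -expr2; congr (_ ^+ 2).
  by rewrite !mxE dotC; apply: eq_bigr => j _; rewrite !mxE.
rewrite [leRHS](bigID A)/= lerDl; apply: sumr_ge0 => i _; exact: sqr_ge0.
Qed.

Variables (g : 'rV[R]_n -> R) (x z : 'rV[R]_n).
Hypotheses (g0 : forall x, 0 <= g x) (bmg : forall x, bmf (fun w => g (x *m U w))).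
Hypotheses (x1 : dot x x = 1) (z1 : dot z z = 1) (xz : dot x z = 0).

(** [sign_moment] for a linear functional, where Bessel's inequality bounds the sum of squares. The
    moments are those of a Gaussian of variance of order 1/n, even under a weight depending on an
    orthogonal vector. *)
Lemma dot_moment r v : \int[tau]_w (g (x *m U w) * dot (z *m U w) v ^+ r.*2) <=
  ((3 * (4 * r%:R + 1)) / n%:R * dot v v) ^+ r * \int[tau]_w g (x *m U w).
Proof.
have [y y1 hy] := @exists_unit_orthogonal _ _ [:: x; z] n2.
have yx : dot x y = 0 by rewrite dotC; apply: hy; rewrite !inE eqxx.
have yz : dot y z = 0 by apply: hy; rewrite !inE eqxx orbT.
pose i0 := Ordinal (ltn_trans (ltn_trans (ltn0Sn 0) (ltnSn 1)) n2 : (0 < n)%N).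
pose i1 := Ordinal (ltn_trans (ltnSn 1) n2 : (1 < n)%N).
have i01 : i0 != i1 by [].
have bq (x' u' y' : 'rV[R]_n) : bmf (fun w => dot (y' *m U w) v).
  by apply: bmf_dot; [exact: (bvecU hU)|exact: bvec_cst].
have bg0 : bmf (fun w => g (row i0 (U w))) by under eq_fun do rewrite rowE.
have := (@sign_moment _ _ tau U hU (fun x _ => g x) (fun _ _ z => dot z v)
  (fun x _ => g0 x) (fun x y z z' => dotDl z z' v)
  (fun x y k z => dotZl k z v) (fun x _ => bmg x) bq i0 i1 r x y z n2 i01
  x1 y1 z1 yx xz yz) => /= h; apply: le_trans h _.
rewrite [X in _ <= X * _]exprMn -[leRHS]mulrA; apply: ler_pM.
- by rewrite exprn_ge0// divr_ge0// addr_ge0// mulr_ge0.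
- apply: bint_ge0 => w; rewrite mulr_ge0// exprn_ge0// sumr_ge0// => i _; exact: sqr_ge0.
- have r4 : 0 <= 4 * r%:R + 1 :> R by rewrite addr_ge0// mulr_ge0.
  apply: lerXn2r; [exact: divr_ge0| |exact: ratio_le].
  by apply: divr_ge0 => //; exact: mulr_ge0.
have -> : \int[tau]_w g (x *m U w) = \int[tau]_w g (row i0 (U w)).
  under [RHS]eq_Rintegral do rewrite rowE.
  by apply: (haar_congruence1 hU (H := g)) => //; rewrite x1 dot_delta mxE !eqxx.
rewrite -(bintZ tau _ bg0); apply: bint_le => [||w].
- apply: bmfM => //; apply: bmfX; apply: bmf_sum => i; apply: bmfX.
  by under eq_fun do rewrite rowE; exact: bq.
- by apply: bmfM => //; exact: bmf_cst.
rewrite [leRHS]mulrC; apply: ler_wpM2l; first exact: g0.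
by apply: lerXn2r; rewrite ?nnegrE ?dot_ge0 ?bessel_rows//; apply: sumr_ge0 => i _; exact: sqr_ge0.
Qed.

End FunctionalMoments.

(** The sum of the constants of [dot_moment] for the exponents 2, giving 3 * 5 = 15, and 2m, with m
    the integer part of s plus one; s is handled by interpolation between them. *)
Definition moment_cst {R : realType} (s : R) : R :=
  15 + (3 * (4 * (Num.truncn s).+1%:R + 1)) ^+ (Num.truncn s).+1.

(** For a = sqrt c t one has a^s <= a^2 + a^(2m), by the first term if a <= 1 and by the second
    otherwise. With c = n both even moments of a are of order one. *)
Lemma powR_le_even {R : realType} (s t c : R) (m : nat) : 2 <= s -> s <= m.*2%:R -> 0 < c ->
  0 <= t -> t `^ s <= c `^ (- (s / 2)) * (c * t ^+ 2 + c ^+ m * t ^+ m.*2).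
Proof.
move=> s2 sm c0 t0.
pose a := c `^ 2^-1 * t.
have a0 : 0 <= a by rewrite mulr_ge0 ?powR_ge0.
have a2 : a ^+ 2 = c * t ^+ 2.
  have sq : (c `^ 2^-1) ^+ 2 = c.
    by rewrite -(powR_mulrn 2 (powR_ge0 c _)) -powRrM mulVf ?pnatr_eq0// powRr1 ?ltW.
  by rewrite /a exprMn sq.
have am : a ^+ m.*2 = c ^+ m * t ^+ m.*2.
  by rewrite -mul2n exprM a2 exprMn -exprM mul2n.
have -> : t `^ s = c `^ (- (s / 2)) * a `^ s.
  rewrite /a powRM ?powR_ge0// -powRrM mulrA -powRD; last by rewrite (gt_eqF c0) implybT.
  by rewrite (mulrC 2^-1) addNr powRr0 mul1r.
rewrite -a2 -am; apply: ler_wpM2l; first exact: powR_ge0.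
have e1 : 0 <= a ^+ 2 by exact: sqr_ge0.
have e2 : 0 <= a ^+ m.*2 by rewrite exprn_ge0.
have [a_le|a_gt] := leP a 1.
  apply: le_trans (powR_le_sqr s2 _) _; first by rewrite a0.
  by rewrite lerDl.
apply: (@le_trans _ _ (a `^ m.*2%:R)); first by rewrite ler_powR// ltW.
by rewrite powR_mulrn// lerDr.
Qed.

Section PowerMeanMoments.
Context {R : realType} {n : nat} {d : measure_display} {T : measurableType d}.
Variables (mu : {finite_measure set T -> \bar R}) (X : T -> 'rV[R]_n).
Hypotheses (hX : bvec X) (X1 : forall t, dot (X t) (X t) = 1).
Hypothesis isoX : forall x, \int[mu]_t (dot x (X t) ^+ 2) = dot x x.
Variables (tau : probability (borelType 'M[R]_n) R) (U : borelType 'M[R]_n -> 'M[R]_n).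
Hypotheses (hU : haar_matrix tau U) (n2 : (2 < n)%N).
Implicit Types (x y z u v a b : 'rV[R]_n) (s : R).

Local Notation W := (powmean mu X).
Local Notation Q := (powform mu X).

Let nR : (0 : R) < n%:R.
Proof. by rewrite ltr0n; apply: leq_trans n2. Qed.

(** By Fubini each t contributes a functional moment of order n^(-s/2), and the total mass of [mu]
    is n. *)
Lemma powmean_conditional_mean (g : 'rV[R]_n -> R) x z s :
  (forall x, 0 <= g x) -> (forall x, bmf (fun w => g (x *m U w))) ->
  dot x x = 1 -> dot z z = 1 -> dot x z = 0 -> 2 <= s ->
  \int[tau]_w (g (x *m U w) * W s (z *m U w)) <=
  moment_cst s * n%:R `^ (1 - s / 2) * \int[tau]_w g (x *m U w).
Proof.
move=> g0 bmg x1 z1 xz s2.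
pose F (p : borelType 'M[R]_n * T) := g (x *m U p.1) * `|dot (z *m U p.1) (X p.2)| `^ s.
have bF : bmf F.
  apply: bmfM; first exact: (bmf_comp measurable_fst (bmg x)).
  apply: bmf_powR; first lra.
  by apply: bmf_dot; [exact: (bvec_comp measurable_fst (bvecU hU z))|exact: (bvec_comp measurable_snd hX)].
have -> : \int[tau]_w (g (x *m U w) * W s (z *m U w)) = \int[tau]_w \int[mu]_t F (w, t).
  apply: eq_Rintegral => w _; rewrite /F /= /powmean.
  by apply: (esym (bintZ mu _ _)); apply: (bmf_WX hX); lra.
rewrite (bint_Fubini tau mu bF).
set m := (Num.truncn s).+1; set Eg := \int[tau]_w g (x *m U w).
have sm : s <= m.*2%:R.
  by apply: le_trans (ltW (truncnS_gt s)) _; rewrite ler_nat -/m -addnn leq_addr.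
have Eg0 : 0 <= Eg by exact: bint_ge0.
have inner t : \int[tau]_w F (w, t) <= moment_cst s * n%:R `^ (- (s / 2)) * Eg.
  have bd : bmf (fun w => dot (z *m U w) (X t)).
    by apply: bmf_dot; [exact: (bvecU hU)|exact: bvec_cst].
  have b2 : bmf (fun w => g (x *m U w) * dot (z *m U w) (X t) ^+ 1.*2).
    by apply: bmfM => //; exact: bmfX.
  have bm : bmf (fun w => g (x *m U w) * dot (z *m U w) (X t) ^+ m.*2).
    by apply: bmfM => //; exact: bmfX.
  have b2n : bmf (fun w => n%:R * (g (x *m U w) * dot (z *m U w) (X t) ^+ 1.*2)).
    by apply: bmfM => //; exact: bmf_cst.
  have bmn : bmf (fun w => n%:R ^+ m * (g (x *m U w) * dot (z *m U w) (X t) ^+ m.*2)).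
    by apply: bmfM => //; exact: bmf_cst.
  have bs := bmfD b2n bmn.
  have bsn : bmf (fun w => n%:R `^ (- (s / 2)) *
      (n%:R * (g (x *m U w) * dot (z *m U w) (X t) ^+ 1.*2) +
       n%:R ^+ m * (g (x *m U w) * dot (z *m U w) (X t) ^+ m.*2))).
    by apply: bmfM => //; exact: bmf_cst.
  have bFt : bmf (fun w => F (w, t)) := bmf_pair1 t bF.
  apply: le_trans (bint_le tau bFt bsn _) _ => [w|].
    rewrite /F /=; have := powR_le_even s2 sm nR (normr_ge0 (dot (z *m U w) (X t))).
    rewrite real_normK ?num_real// exprn_even_norm => h.
    apply: le_trans (ler_wpM2l (g0 _) h) _; rewrite le_eqVlt; apply/orP; left; apply/eqP; ring.
  rewrite (bintZ tau _ bs) (bintD tau b2n bmn) (bintZ tau _ b2) (bintZ tau _ bm).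
  rewrite (mulrC (moment_cst s)) -mulrA; apply: ler_wpM2l; first exact: powR_ge0.
  have h1 := dot_moment hU n2 g0 bmg x1 z1 xz 1 (X t).
  have hm := dot_moment hU n2 g0 bmg x1 z1 xz m (X t).
  rewrite X1 mulr1 expr1 -/Eg in h1; rewrite X1 mulr1 -/Eg in hm.
  rewrite /moment_cst -/m mulrDl; apply: lerD.
    apply: le_trans (ler_wpM2l (ltW nR) h1) _.
    rewrite mulrA; apply: ler_wpM2r => //.
    by rewrite mulrC divfK ?gt_eqF//; lra.
  apply: le_trans (ler_wpM2l (exprn_ge0 m (ltW nR)) hm) _.
  rewrite mulrA -exprMn; apply: ler_wpM2r => //.
  by rewrite (mulrC n%:R) divfK ?gt_eqF.
have b1 := bmf_int1_prod tau mu bF.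
have bc : bmf (fun _ : T => moment_cst s * n%:R `^ (- (s / 2)) * Eg) by exact: bmf_cst.
apply: le_trans (bint_le mu b1 bc inner) _.
rewrite bint_cst (isotropic_mass hX X1 isoX) le_eqVlt; apply/orP; left; apply/eqP.
rewrite powRD; last by rewrite (gt_eqF nR) implybT.
by rewrite powRr1 ?(ltW nR)//; ring.
Qed.

End PowerMeanMoments.

Lemma exprD_superadd {R : realType} (r : nat) (a b : R) : (0 < r)%N -> 0 <= a -> 0 <= b ->
  a ^+ r + b ^+ r <= (a + b) ^+ r.
Proof.
case: r => // r _ a0 b0; rewrite !exprS mulrDl; apply: lerD; apply: ler_wpM2l => //.
  by apply: lerXn2r; rewrite ?nnegrE ?addr_ge0 ?lerDl.
by apply: lerXn2r; rewrite ?nnegrE ?addr_ge0 ?lerDr.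
Qed.

(** Twice the bound on the mean plus a fluctuation term in rho = r/n. The 64 collects two uses of
    [power_mean2] and the bound 4 on squared distances on the sphere. *)
Definition powmean_bound {R : realType} (s rho nn : R) : R :=
  2 * moment_cst s * nn `^ (1 - s / 2) + ((64 * (32 * 15)) * s ^+ 2 * rho) `^ (s / 2).

Lemma moment_cst_ge0 {R : realType} (s : R) : 0 <= moment_cst s.
Proof. by rewrite addr_ge0// exprn_ge0// mulr_ge0// addr_ge0// mulr_ge0. Qed.

Section IncrementBounds.
Context {R : realType} {n : nat} {d : measure_display} {T : measurableType d}.
Variables (mu : {finite_measure set T -> \bar R}) (X : T -> 'rV[R]_n).
Hypotheses (hX : bvec X) (X1 : forall t, dot (X t) (X t) = 1).
Hypothesis isoX : forall x, \int[mu]_t (dot x (X t) ^+ 2) = dot x x.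
Variables (tau : probability (borelType 'M[R]_n) R) (U : borelType 'M[R]_n -> 'M[R]_n).
Hypotheses (hU : haar_matrix tau U) (n2 : (2 < n)%N).
Variables (i0 i1 : 'I_n) (i01 : i0 != i1).
Implicit Types (x y z u v a b : 'rV[R]_n) (s : R).

Local Notation W := (powmean mu X).
Local Notation Q := (powform mu X).

Let nR : (0 : R) < n%:R.
Proof. by rewrite ltr0n; apply: leq_trans n2. Qed.

Lemma borel_powmean s : 0 <= s -> borel_bounded (W s).
Proof. by move=> s0 d' T' u hu; apply: (bmf_W mu hX). Qed.

Let bWU s x : 0 <= s -> bmf (fun w => W s (x *m U w)).
Proof. by move=> s0; apply: borel_powmean => //; exact: (bvecU hU). Qed.

Definition gradmoment s r := \int[tau]_w
  gradsq mu X (U w) (fun i => (i != i0) && (i != i1)) s (row i1 (U w)) ^+ r.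

Lemma dot_diff_le4 a b : dot a a = 1 -> dot b b = 1 -> dot (a - b) (a - b) <= 4.
Proof. by move=> a1 b1; rewrite dot_subsq//; have := dot_unit_bound b1 a1; lra. Qed.

Lemma ratio_le15 (r : nat) : (0 < r)%N ->
  (4 * r%:R + 1) / (n - 2)%:R <= 15 * (r%:R / n%:R) :> R.
Proof.
move=> r0; have h := @ratio_le R n n2 r; apply: le_trans h _.
rewrite mulrA; apply: ler_wpM2r; first by rewrite invr_ge0 ltW.
have : (1 : R) <= r%:R by rewrite ler1n.
lra.
Qed.

Lemma powmean_increment_moment s r a b : 2 <= s -> (0 < r)%N -> dot a a = 1 -> dot b b = 1 ->
  \int[tau]_w (W s (a *m U w) - W s (b *m U w)) ^+ r.*2 <=
  ((32 * 15) * s ^+ 2 * dot (a - b) (a - b) * (r%:R / n%:R)) ^+ r * gradmoment s r.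
Proof.
move=> s2 r0 a1.
have Gam0 : 0 <= gradmoment s r by apply: bint_ge0 => w; rewrite exprn_ge0// gradsq_ge0.
have main b' : dot b' b' = 1 -> 0 <= dot a b' ->
  \int[tau]_w (W s (a *m U w) - W s (b' *m U w)) ^+ r.*2 <=
  ((32 * 15) * s ^+ 2 * dot (a - b') (a - b') * (r%:R / n%:R)) ^+ r * gradmoment s r.
  move=> b1 ab; have [x x1 hx] := @exists_unit_orthogonal _ _ [:: a; b'] n2.
  have xa : dot x a = 0 by apply: hx; rewrite !inE eqxx.
  have xb : dot x b' = 0 by apply: hx; rewrite !inE eqxx orbT.
  have ce : (0 : R) ^+ 2 + 1 ^+ 2 = 1 by rewrite expr0n expr1n add0r.
  have := @increment_moment _ _ _ _ mu X hX X1 isoX tau U hU n2 s (fun=> 1) 0 1 r i0 i1 s2 i01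
    ce (fun=> ler01) (fun=> bmf_cst 1) x a b' r0 x1 a1 b1 xa xb ab.
  under eq_Rintegral do rewrite !scale0r !add0r !scale1r mul1r.
  under [in X in _ <= X -> _]eq_Rintegral do rewrite !scale0r !add0r !scale1r mul1r.
  rewrite -/(gradmoment s r) expr1n mulr1 => h; apply: le_trans h _.
  apply: ler_wpM2r => //.
  have k0 : 0 <= 32 * s ^+ 2 * dot (a - b') (a - b').
    by rewrite mulr_ge0 ?dot_ge0// mulr_ge0// sqr_ge0.
  have e0 : 0 <= (4 * r%:R + 1) / (n - 2)%:R :> R by rewrite divr_ge0// addr_ge0// mulr_ge0.
  have e1 : 0 <= r%:R / n%:R :> R by rewrite divr_ge0.
  apply: lerXn2r.
  - exact: mulr_ge0.
  - rewrite nnegrE; apply: mulr_ge0 => //; apply: mulr_ge0; last exact: dot_ge0.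
    by apply: mulr_ge0 => //; exact: sqr_ge0.
  apply: le_trans (ler_wpM2l k0 (ratio_le15 r0)) _.
  rewrite le_eqVlt; apply/orP; left; apply/eqP; ring.
(* For an obtuse angle -b is used in place of b: the power mean is even, and -b lies no farther from
   a. *)
move=> b1; have [ab|ab] := leP 0 (dot a b); first exact: main.
have := main (- b); rewrite !dotE a1 b1 opprK => /(_ erefl) h.
have nab : 0 <= - dot a b by rewrite oppr_ge0 ltW.
have {h}h := h nab.
have e : \int[tau]_w (W s (a *m U w) - W s (- b *m U w)) ^+ r.*2 =
    \int[tau]_w (W s (a *m U w) - W s (b *m U w)) ^+ r.*2.
  by apply: eq_Rintegral => w _; rewrite mulNmx powmeanN.
clear main.
have conc (I J B C : R) : I = J -> I <= B -> B <= C -> J <= C by move=> -> /le_trans; apply.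
apply: (conc _ _ _ _ e h); apply: ler_wpM2r; first exact: Gam0.
clear e h conc Gam0.
have k0 : 0 <= (32 * 15) * s ^+ 2 by apply: mulr_ge0; [rewrite mulr_ge0 ?ler0n|exact: sqr_ge0].
have e1 : 0 <= r%:R / n%:R :> R by rewrite divr_ge0.
have d0 := dot_ge0 (a + b); have d1 := dot_ge0 (a - b).
rewrite !dotE a1 b1 (dotC b) in d0 d1.
rewrite (dotC b); apply: lerXn2r.
- by rewrite nnegrE; apply: mulr_ge0 => //; apply: mulr_ge0 => //; lra.
- by rewrite nnegrE; apply: mulr_ge0 => //; apply: mulr_ge0 => //; lra.
by apply: ler_wpM2r => //; apply: ler_wpM2l => //; lra.
Qed.

Let row1 : dot (delta_mx 0 i1 : 'rV[R]_n) (delta_mx 0 i1) = 1.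
Proof. by rewrite dot_delta mxE !eqxx. Qed.

Let brow i : bvec (fun w => row i (U w)).
Proof. by under eq_fun do rewrite rowE; exact: (bvecU hU). Qed.

Let bgrad s r : 2 <= s -> bmf (fun w =>
  gradsq mu X (U w) (fun i => (i != i0) && (i != i1)) s (row i1 (U w)) ^+ r).
Proof. by move=> s2; apply: bmfX; apply: bmf_gradsq. Qed.

Lemma gradmoment_le_W2 s r z : 2 <= s -> dot z z = 1 ->
  gradmoment s r <= \int[tau]_w W (2 * s - 2) (z *m U w) ^+ r.
Proof.
move=> s2 z1; have s20 : 0 <= 2 * s - 2 by lra.
have -> : \int[tau]_w W (2 * s - 2) (z *m U w) ^+ r =
    \int[tau]_w W (2 * s - 2) (row i1 (U w)) ^+ r.
  under [RHS]eq_Rintegral do rewrite rowE.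
  apply: (haar_congruence1 hU (H := fun z => W (2 * s - 2) z ^+ r)); first by rewrite z1 row1.
  by apply: bmfX; exact: bWU.
apply: bint_le => [||w]; first exact: bgrad.
  by apply: bmfX; apply: borel_powmean.
apply: lerXn2r; rewrite ?nnegrE ?gradsq_ge0 ?powmean_ge0//.
by apply: (gradsq_le_W2 hX isoX) => //; exact: (haar_orthogonal hU).
Qed.

(** The gradient of [W s] is bounded through [W s] itself, with a coefficient eta at choice, so that
    moment estimates can be closed without passing to a higher exponent. *)
Lemma gradmoment_le_self s r z (eta : R) : 2 <= s -> 0 < eta -> dot z z = 1 ->
  gradmoment s r <= \int[tau]_w (eta * W s (z *m U w) + eta `^ (1 - s)) ^+ r.*2.
Proof.
move=> s2 eta0 z1; have s0 : 0 <= s by lra.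
have bb (u : borelType 'M[R]_n -> 'rV[R]_n) : bvec u -> bmf (fun w : borelType 'M[R]_n => (eta * W s (u w) + eta `^ (1 - s)) ^+ r.*2).
  move=> hu; apply: bmfX; apply: bmfD; last exact: bmf_cst.
  by apply: bmfM; [exact: bmf_cst|exact: borel_powmean].
have -> : \int[tau]_w (eta * W s (z *m U w) + eta `^ (1 - s)) ^+ r.*2 =
    \int[tau]_w (eta * W s (row i1 (U w)) + eta `^ (1 - s)) ^+ r.*2.
  under [RHS]eq_Rintegral do rewrite rowE.
  apply: (haar_congruence1 hU (H := fun z => (eta * W s z + eta `^ (1 - s)) ^+ r.*2)).
    by rewrite z1 row1.
  by apply: bb; exact: (bvecU hU).
apply: bint_le => [||w]; [exact: bgrad|exact: bb|].
rewrite -mul2n exprM; apply: lerXn2r; rewrite ?nnegrE ?gradsq_ge0 ?sqr_ge0//.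
apply: (gradsq_le hX) => // [|y y1]; first exact: (haar_orthogonal hU).
apply: le_trans (powform_le_W mu hX _ _ s2 eta0) _.
rewrite lerD2l -[leRHS]mulr1; apply: ler_wpM2l; first exact: powR_ge0.
by rewrite -y1; apply: (powmean_le1 hX X1 isoX); rewrite // y1.
Qed.

Lemma powmean_mean z s : 2 <= s -> dot z z = 1 ->
  \int[tau]_w W s (z *m U w) <= moment_cst s * n%:R `^ (1 - s / 2).
Proof.
move=> s2 z1.
have [x x1 hx] := @exists_unit_orthogonal _ _ [:: z] (ltnW n2).
have xz : dot x z = 0 by apply: hx; rewrite mem_head.
have := powmean_conditional_mean hX X1 isoX hU n2 (g := fun=> 1) (fun=> ler01)
  (fun=> bmf_cst 1) x1 z1 xz s2.
rewrite pint_cst mulr1; under eq_Rintegral do rewrite mul1r.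
by [].
Qed.

(** A self-bounding argument: the centred moment is at most a multiple of the gradient moment, which
    by [gradmoment_le_self] is a small multiple of the moment under estimation plus a constant. *)
Lemma powmean_moment z s r : 2 <= s -> (0 < r)%N -> dot z z = 1 ->
  \int[tau]_w W s (z *m U w) ^+ r.*2 <= powmean_bound s (r%:R / n%:R) n%:R ^+ r.*2.
Proof.
move=> s2 r0 z1; have s0 : 0 <= s by lra.
set rho := r%:R / n%:R; have rho0 : 0 < rho by apply: divr_gt0; [rewrite ltr0n|exact: nR].
set A := (64 * (32 * 15)) * s ^+ 2 * rho.
have A0 : 0 < A.
  apply: mulr_gt0 => //; apply: mulr_gt0; first lra.
  by rewrite exprn_gt0//; lra.
(* Chosen so that A eta^2 = 1; the moment then returns on the right with coefficient 1/4 and is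
   absorbed. *)
pose eta := A `^ (- 2^-1); have eta0 : 0 < eta by exact: powR_gt0.
set kap := eta `^ (1 - s).
pose e := \int[tau]_w W s (z *m U w).
have e0 : 0 <= e by apply: bint_ge0 => w; exact: powmean_ge0.
set m2 := \int[tau]_w W s (z *m U w) ^+ r.*2.
have bZ := bWU z s0.
have Aeta : A ^+ r * eta ^+ r.*2 = 1.
  rewrite -mul2n exprM -exprMn (_ : A * eta ^+ 2 = 1) ?expr1n//.
  rewrite -(powR_mulrn 2 (ltW eta0)) /eta -powRrM mulNr mulVf ?pnatr_eq0//.
  by rewrite powRN powRr1 ?(ltW A0)// divff ?gt_eqF.
have Akap : A ^+ r * kap ^+ r.*2 = (A `^ (s / 2)) ^+ r.*2.
  rewrite -mul2n !exprM -exprMn; congr (_ ^+ r).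
  rewrite -!powR_mulrn ?powR_ge0// /kap /eta -!powRrM.
  rewrite -[X in X * _](powRr1 (ltW A0)) -powRD; last by rewrite (gt_eqF A0) implybT.
  by congr (_ `^ _); field.
have gm : gradmoment s r <= 4 ^+ r * (2^-1 * (eta ^+ r.*2 * m2 + kap ^+ r.*2)).
  apply: le_trans (gradmoment_le_self r s2 eta0 z1) _.
  have bZr : bmf (fun w => W s (z *m U w) ^+ r.*2) by exact: bmfX.
  have b1 : bmf (fun w => eta ^+ r.*2 * W s (z *m U w) ^+ r.*2).
    by apply: bmfM => //; exact: bmf_cst.
  have bk : bmf (fun _ : borelType 'M[R]_n => kap ^+ r.*2) by exact: bmf_cst.
  have b2 := bmfD b1 bk.
  have b3 : bmf (fun w => 2^-1 * (eta ^+ r.*2 * W s (z *m U w) ^+ r.*2 + kap ^+ r.*2)).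
    by apply: bmfM => //; exact: bmf_cst.
  have b4 : bmf (fun w => 4 ^+ r * (2^-1 * (eta ^+ r.*2 * W s (z *m U w) ^+ r.*2 + kap ^+ r.*2))).
    by apply: bmfM => //; exact: bmf_cst.
  have b5 : bmf (fun w => (eta * W s (z *m U w) + kap) ^+ r.*2).
    apply: bmfX; apply: bmfD; last exact: bmf_cst.
    by apply: bmfM => //; exact: bmf_cst.
  apply: le_trans (bint_le tau b5 b4 _) _ => [w|].
    by rewrite -exprMn; exact: power_mean2.
  by rewrite (bintZ tau _ b3) (bintZ tau _ b2) (bintD tau b1 bk) (bintZ tau _ bZr) pint_cst.
have cm : \int[tau]_w (W s (z *m U w) - e) ^+ r.*2 <=
    ((4 * (32 * 15)) * s ^+ 2 * rho) ^+ r * gradmoment s r.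
  apply: (central_moment hU (borel_powmean s0) z1) => b b1.
  apply: le_trans (powmean_increment_moment s2 r0 z1 b1) _.
  apply: ler_wpM2r; first by apply: bint_ge0 => w; rewrite exprn_ge0// gradsq_ge0.
  have q0 : 0 <= s ^+ 2 * rho by rewrite mulr_ge0 ?sqr_ge0// ltW.
  have D4 := dot_diff_le4 z1 b1; have D0 := dot_ge0 (z - b).
  have rg (D : R) : (32 * 15) * s ^+ 2 * D * rho = (32 * 15) * (s ^+ 2 * rho) * D by ring.
  rewrite -/rho rg; apply: lerXn2r.
  - rewrite nnegrE; apply: mulr_ge0 => //; apply: mulr_ge0 => //; lra.
  - rewrite nnegrE -[X in 0 <= X]mulrA; apply: mulr_ge0 => //; lra.
  have q4 : 0 <= (32 * 15) * (s ^+ 2 * rho) by apply: mulr_ge0 => //; lra.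
  apply: le_trans (ler_wpM2l q4 D4) _.
  rewrite le_eqVlt; apply/orP; left; apply/eqP; ring.
have m2le : m2 <= 4 ^+ r * (2^-1 * (\int[tau]_w (W s (z *m U w) - e) ^+ r.*2 + e ^+ r.*2)).
  have bc : bmf (fun w => (W s (z *m U w) - e) ^+ r.*2).
    by apply: bmfX; apply: bmfB => //; exact: bmf_cst.
  have bk : bmf (fun _ : borelType 'M[R]_n => e ^+ r.*2) by exact: bmf_cst.
  have b2 := bmfD bc bk.
  have b3 : bmf (fun w => 2^-1 * ((W s (z *m U w) - e) ^+ r.*2 + e ^+ r.*2)).
    by apply: bmfM => //; exact: bmf_cst.
  have b4 : bmf (fun w => 4 ^+ r * (2^-1 * ((W s (z *m U w) - e) ^+ r.*2 + e ^+ r.*2))).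
    by apply: bmfM => //; exact: bmf_cst.
  apply: le_trans (bint_le tau (bmfX r.*2 bZ) b4 _) _ => [w|].
    by rewrite -[X in X ^+ _ <= _](subrK e); exact: power_mean2.
  by rewrite (bintZ tau _ b3) (bintZ tau _ b2) (bintD tau bc bk) pint_cst.
have ee : e <= moment_cst s * n%:R `^ (1 - s / 2) by exact: powmean_mean.
have key : m2 <= (2 * e) ^+ r.*2 + (A `^ (s / 2)) ^+ r.*2.
  have e20 : 0 <= e ^+ r.*2 by rewrite exprn_ge0.
  have h1 : 4 ^+ r * (2^-1 * ((4 * (32 * 15)) * s ^+ 2 * rho) ^+ r * (4 ^+ r * (2^-1 *
      (eta ^+ r.*2 * m2 + kap ^+ r.*2)))) = 4^-1 * (m2 + (A `^ (s / 2)) ^+ r.*2).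
    have Am : m2 = A ^+ r * (eta ^+ r.*2 * m2) by rewrite mulrA Aeta mul1r.
    rewrite -Akap [X in _ = _ * (X + _)]Am.
    have -> : A ^+ r = 4 ^+ r * ((4 * (32 * 15)) * s ^+ 2 * rho) ^+ r * 4 ^+ r.
      by rewrite -!exprMn /A; congr (_ ^+ r); ring.
    by field.
  have h2 : 4 ^+ r * e ^+ r.*2 = (2 * e) ^+ r.*2.
    have e4 : 4 ^+ r = 2 ^+ r.*2 :> R by rewrite -mul2n exprM; congr (_ ^+ _); ring.
    by rewrite e4 -exprMn.
  have p0 : 0 <= ((4 * (32 * 15)) * s ^+ 2 * rho) ^+ r.
    apply: exprn_ge0; apply: mulr_ge0; last exact: ltW.
    by apply: mulr_ge0; [lra|exact: sqr_ge0].
  have h3 := le_trans cm (ler_wpM2l p0 gm).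
  have q0 : 0 <= 4 ^+ r * 2^-1 :> R by rewrite mulr_ge0// exprn_ge0.
  have h4 : m2 <= 4^-1 * (m2 + (A `^ (s / 2)) ^+ r.*2) + 2^-1 * (2 * e) ^+ r.*2.
    apply: le_trans m2le _; rewrite mulrA mulrDr -h1 -h2; apply: lerD.
      apply: le_trans (ler_wpM2l q0 h3) _.
      rewrite le_eqVlt; apply/orP; left; apply/eqP; ring.
    rewrite le_eqVlt; apply/orP; left; apply/eqP; ring.
  have a0 : 0 <= (A `^ (s / 2)) ^+ r.*2 by rewrite exprn_ge0// powR_ge0.
  have b0 : 0 <= (2 * e) ^+ r.*2 by rewrite exprn_ge0// mulr_ge0.
  have fin (p q t : R) : p <= 4^-1 * (p + t) + 2^-1 * q -> 0 <= t -> 0 <= q -> p <= q + t by lra.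
  exact: fin h4 a0 b0.
apply: le_trans key _; apply: le_trans (exprD_superadd _ _ _) _; rewrite ?double_gt0 ?mulr_ge0 ?powR_ge0//.
apply: lerXn2r.
- by rewrite nnegrE; apply: addr_ge0; [exact: mulr_ge0|exact: powR_ge0].
- rewrite nnegrE; apply: addr_ge0; last exact: powR_ge0.
  by rewrite mulr_ge0 ?powR_ge0// mulr_ge0// moment_cst_ge0.
by rewrite /powmean_bound -/A lerD2r -mulrA; apply: ler_wpM2l.
Qed.

Lemma powmean_bound_ge0 s rho : 0 <= powmean_bound s rho (n%:R : R).
Proof.
apply: addr_ge0; last exact: powR_ge0.
by rewrite mulr_ge0 ?powR_ge0// mulr_ge0// moment_cst_ge0.
Qed.

Lemma powmean_moment1 z s r : 2 <= s -> (0 < r)%N -> dot z z = 1 ->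
  \int[tau]_w W s (z *m U w) ^+ r <= powmean_bound s (r%:R / n%:R) n%:R ^+ r.
Proof.
move=> s2 r0 z1; have bZ : bmf (fun w => W s (z *m U w) ^+ r) by apply: bmfX; apply: bWU; lra.
have B0 := powmean_bound_ge0 s (r%:R / n%:R).
have I0 : 0 <= \int[tau]_w W s (z *m U w) ^+ r.
  by apply: bint_ge0 => w; rewrite exprn_ge0// powmean_ge0.
rewrite -(@ler_pXn2r _ 2)// ?nnegrE ?exprn_ge0//.
have jz : (\int[tau]_w W s (z *m U w) ^+ r) ^+ 2 <= \int[tau]_w (W s (z *m U w) ^+ r) ^+ 2.
  by apply: pint_jensen => // w; rewrite exprn_ge0// powmean_ge0.
apply: le_trans jz _.
under eq_Rintegral do rewrite -exprM muln2.
by rewrite -exprM muln2; exact: powmean_moment.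
Qed.

End IncrementBounds.

Section EuclideanNorm.
Context {R : realType} {n : nat}.
Implicit Types x y a b : 'rV[R]_n.

Lemma enorm_ge0 x : 0 <= enorm x.
Proof. exact: sqrtr_ge0. Qed.

Lemma enorm_sqr x : enorm x ^+ 2 = dot x x.
Proof. by rewrite /enorm sqr_sqrtr ?dot_ge0. Qed.

Lemma enormZ (c : R) x : enorm (c *: x) = `|c| * enorm x.
Proof.
by rewrite /enorm !dotE mulrA -expr2 sqrtrM ?sqr_ge0// sqrtr_sqr.
Qed.

Lemma enorm_eq1 x : (enorm x = 1) <-> (dot x x = 1).
Proof.
split=> [h|h]; first by rewrite -enorm_sqr h expr1n.
by rewrite /enorm h sqrtr1.
Qed.

Lemma enorm0 : enorm (0 : 'rV[R]_n) = 0.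
Proof. by rewrite -(scale0r 0) enormZ normr0 mul0r. Qed.

Lemma enorm_le x (c : R) : 0 <= c -> (enorm x <= c) = (dot x x <= c ^+ 2).
Proof. by move=> c0; rewrite -enorm_sqr ler_pXn2r ?nnegrE ?enorm_ge0. Qed.

Lemma enormD x y : enorm (x + y) <= enorm x + enorm y.
Proof.
rewrite enorm_le ?addr_ge0 ?enorm_ge0// sqrrD !enorm_sqr !dotE (dotC y).
suff : dot x y <= enorm x * enorm y by lra.
apply: le_trans (ler_norm _) _.
rewrite -(@ler_pXn2r _ 2)// ?nnegrE ?mulr_ge0 ?enorm_ge0// exprMn !enorm_sqr.
by rewrite real_normK ?num_real//; exact: dot_CS.
Qed.

Lemma enormN x : enorm (- x) = enorm x.
Proof. by rewrite -scaleN1r enormZ normrN normr1 mul1r. Qed.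

Lemma enorm_sub_le x y : `|enorm x - enorm y| <= enorm (x - y).
Proof.
have h1 := enormD (x - y) y; rewrite subrK in h1.
have h2 := enormD (y - x) x; rewrite subrK -opprB enormN in h2.
rewrite ler_norml; lra.
Qed.

Lemma enorm_normalize x : x != 0 -> exists2 u, dot u u = 1 & x = enorm x *: u.
Proof.
move=> x0; exists ((enorm x)^-1 *: x); first exact: normalize.
rewrite scalerA divff ?scale1r// /enorm gt_eqF// sqrtr_gt0; exact: dot_gt0.
Qed.

(** Homogeneous functions are compared through lengths and directions. A zero vector takes the
    direction of the other, which makes the angular term vanish. *)
Lemma polar_pair a b :
  (exists u0 : 'rV[R]_n, dot u0 u0 = 1) ->
  exists u v, [/\ dot u u = 1, dot v v = 1, a = enorm a *: u, b = enorm b *: v &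
    enorm a * enorm (u - v) <= 2 * enorm (a - b)].
Proof.
move=> [u0 u01].
have [a0|a0] := eqVneq a 0.
  have [b0|b0] := eqVneq b 0.
    by exists u0, u0; split => //; rewrite ?a0 ?b0 ?enorm0 ?scale0r// mul0r mulr_ge0// enorm_ge0.
  have [v v1 bv] := enorm_normalize b0; exists v, v; split => //.
    by rewrite a0 enorm0 scale0r.
  by rewrite a0 enorm0 mul0r mulr_ge0// enorm_ge0.
have [u u1 au] := enorm_normalize a0.
have [b0|b0] := eqVneq b 0.
  exists u, u; split => //; first by rewrite b0 enorm0 scale0r.
  by rewrite subrr enorm0 mulr0 mulr_ge0// enorm_ge0.
have [v v1 bv] := enorm_normalize b0; exists u, v; split => //.
have -> : enorm a * enorm (u - v) = enorm (enorm a *: (u - v)).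
  by rewrite enormZ ger0_norm ?enorm_ge0.
have -> : enorm a *: (u - v) = (a - b) + (enorm b - enorm a) *: v.
  by rewrite scalerBr -au scalerBl -bv addrA subrK.
apply: le_trans (enormD _ _) _.
have -> : enorm ((enorm b - enorm a) *: v) = `|enorm a - enorm b|.
  by rewrite enormZ distrC (proj2 (enorm_eq1 v) v1) mulr1.
have := enorm_sub_le a b; lra.
Qed.

End EuclideanNorm.

(** * The norm as a root of its p-th power mean *)

Section PNorm.
Context {R : realType} {n : nat} {d : measure_display} {T : measurableType d}.
Variables (mu : {finite_measure set T -> \bar R}) (X : T -> 'rV[R]_n).
Hypotheses (hX : bvec X) (X1 : forall t, dot (X t) (X t) = 1).
Hypothesis isoX : forall x, \int[mu]_t (dot x (X t) ^+ 2) = dot x x.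
Variables (p : R) (p2 : 2 < p) (n0 : (0 < n)%N).
Implicit Types (x y z u v a b : 'rV[R]_n).

Local Notation W := (powmean mu X).
Local Notation Q := (powform mu X).

Definition pnorm x : R := W p x `^ p^-1.

Let p0 : 0 < p.
Proof. by apply: lt_trans p2. Qed.
Let nR : (0 : R) < n%:R.
Proof. by rewrite ltr0n. Qed.

Lemma pnorm_ge0 x : 0 <= pnorm x.
Proof. exact: powR_ge0. Qed.

Lemma pnormK x : pnorm x `^ p = W p x.
Proof. by rewrite -powRrM mulVf ?gt_eqF// powRr1// powmean_ge0. Qed.

Lemma pnormZ (c : R) x : pnorm (c *: x) = `|c| * pnorm x.
Proof.
rewrite /pnorm (powmeanZ mu hX)//; last exact: ltW.
by rewrite powRM ?powR_ge0 ?powmean_ge0// -powRrM divff ?gt_eqF// powRr1.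
Qed.

Lemma borel_pnorm : borel_bounded pnorm.
Proof.
move=> d' T' u hu; rewrite /pnorm.
have -> : (fun t => W p (u t) `^ p^-1) = (fun t => `|W p (u t)| `^ p^-1).
  by apply/funext => t; rewrite ger0_norm// powmean_ge0.
by apply: bmf_powR; [rewrite invr_ge0 ltW|apply: (bmf_W mu hX) => //; exact: ltW].
Qed.

(** The norm of a unit x whose squared inner products are all equal to 1/n on a measure of mass n;
    this is the extreme case of Hölder's inequality. *)
Definition lewis_radius : R := n%:R `^ (p^-1 - 2^-1).

Lemma lewis_radius_gt0 : 0 < lewis_radius.
Proof. exact: powR_gt0. Qed.

(* Young's inequality u <= u^q/q + 1 - 1/q, with u = n <x,t>^2 and q = p/2, integrated. *)
Lemma powmean_ge x : dot x x = 1 -> n%:R `^ (1 - p / 2) <= W p x.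
Proof.
have hp := p2; move=> x1; set q := p / 2; have q1 : 1 < q by rewrite /q; lra.
have q0 : 0 < q by lra.
have conj_exp (z : R) : 1 < z -> z^-1 + (z / (z - 1))^-1 = 1.
  by move=> z1; field; apply/andP; split; apply: lt0r_neq0; lra.
have young (t : R) : n%:R * t ^+ 2 <= n%:R `^ q / q * `|t| `^ p + (1 - q^-1).
  have i0 : 0 < q / (q - 1) by rewrite divr_gt0//; lra.
  have ii : q^-1 + (q / (q - 1))^-1 = 1 by exact: conj_exp.
  have a0 : 0 <= n%:R * t ^+ 2 by rewrite mulr_ge0// sqr_ge0.
  have := conjugate_powR a0 ler01 q0 i0 ii.
  rewrite mulr1 powR1 mul1r => h; apply: le_trans h _.
  have -> : (q / (q - 1))^-1 = 1 - q^-1 by lra.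
  rewrite lerD2r powRM ?sqr_ge0// mulrAC.
  rewrite -[t ^+ 2]real_normK ?num_real// -powR_mulrn// -powRrM.
  by have -> : 2%:R * q = p by rewrite /q; field.
have bW := bmf_WX hX x (ltW p0).
have bX : bmf (fun t => dot x (X t) ^+ 2) by apply: bmfX; apply: bmf_dot => //; exact: bvec_cst.
have b1 : bmf (fun t => n%:R * dot x (X t) ^+ 2) by apply: bmfM => //; exact: bmf_cst.
have b2 : bmf (fun t => n%:R `^ q / q * `|dot x (X t)| `^ p) by apply: bmfM => //; exact: bmf_cst.
have bc : bmf (fun _ : T => 1 - q^-1) by exact: bmf_cst.
have := bint_le mu b1 (bmfD b2 bc) (fun t => young (dot x (X t))).
rewrite (bintZ mu _ bX) isoX x1 (bintD mu b2 bc) (bintZ mu _ bW) bint_cst.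
rewrite (isotropic_mass hX X1 isoX) -/(powmean mu X p x) => h.
have h2 : n%:R * q^-1 <= n%:R `^ q / q * W p x by lra.
have h3 : n%:R <= n%:R `^ q * W p x.
  by rewrite mulrAC in h2; rewrite ler_pM2r ?invr_gt0// in h2.
rewrite powRD; last by rewrite (gt_eqF nR) implybT.
rewrite powRr1 ?(ltW nR)// powRN ler_pdivrMr ?powR_gt0//.
by rewrite mulrC.
Qed.

Lemma lewis_radiusX (t : R) : lewis_radius `^ t = n%:R `^ ((p^-1 - 2^-1) * t).
Proof. by rewrite /lewis_radius powRrM. Qed.

Lemma pnorm_ge x : dot x x = 1 -> lewis_radius <= pnorm x.
Proof.
move=> x1; have h := powmean_ge x1.
rewrite /pnorm (_ : lewis_radius = (n%:R `^ (1 - p / 2)) `^ p^-1); last first.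
  rewrite -powRrM /lewis_radius; congr (_ `^ _); field; exact: lt0r_neq0.
by apply: ge0_ler_powR; rewrite ?invr_ge0 ?(ltW p0)// nnegrE ?powR_ge0 ?powmean_ge0.
Qed.

Lemma pnorm_le1 x : dot x x = 1 -> pnorm x <= 1.
Proof.
move=> x1; have h : W p x <= 1.
  by rewrite -x1; apply: (powmean_le1 hX X1 isoX); rewrite ?x1// ltW.
apply: (@le_trans _ _ (1 `^ p^-1)); last by rewrite powR1.
by apply: ge0_ler_powR; rewrite ?invr_ge0 ?(ltW p0)// nnegrE ?powmean_ge0.
Qed.

(** Write y^p = y y^(p-1): for y >= z >= L both y^(p-1) and z^(p-1) may be lowered to z^(p-1), and
    then to L^(p-1). *)
Lemma powR_diff (L u v : R) : 0 < L -> L <= u -> L <= v ->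
  `|u - v| <= L `^ (1 - p) * `|u `^ p - v `^ p|.
Proof.
have hp := p2.
move=> L0.
have main (y z : R) : L <= z -> z <= y -> y - z <= L `^ (1 - p) * (y `^ p - z `^ p).
  move=> Lz zy; have z0 : 0 < z by exact: lt_le_trans Lz.
  have y0 : 0 < y by exact: lt_le_trans zy.
  have split (c : R) : 0 < c -> c `^ p = c * c `^ (p - 1).
    move=> c0; rewrite -{2}(powRr1 (ltW c0)) -powRD; last by rewrite (gt_eqF c0) implybT.
    by congr (_ `^ _); ring.
  have m1 : z `^ (p - 1) <= y `^ (p - 1).
    by apply: ge0_ler_powR; rewrite ?nnegrE ?(ltW z0) ?(ltW y0)//; lra.
  have m2 : L `^ (p - 1) <= z `^ (p - 1).
    by apply: ge0_ler_powR; rewrite ?nnegrE ?(ltW z0) ?(ltW L0)//; lra.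
  have -> : 1 - p = - (p - 1) by ring.
  rewrite powRN ler_pdivlMl ?powR_gt0// mulrC (split y)// (split z)//.
  apply: (@le_trans _ _ ((y - z) * z `^ (p - 1))).
    by apply: ler_wpM2l => //; rewrite subr_ge0.
  rewrite mulrBl lerD2r; apply: ler_wpM2l => //; exact: ltW.
have L1 : 0 <= L `^ (1 - p) by exact: powR_ge0.
move=> Lu Lv; have [uv|uv] := leP u v.
  rewrite distrC (distrC (u `^ p)) !ger0_norm ?subr_ge0//; first exact: main.
  by apply: ge0_ler_powR; rewrite ?nnegrE ?(ltW p0)//; lra.
rewrite !ger0_norm ?subr_ge0 ?(ltW uv)//; first by apply: main => //; exact: ltW.
by apply: ge0_ler_powR; rewrite ?nnegrE ?(ltW p0)//; lra.
Qed.

Lemma pnorm_diff a b : dot a a = 1 -> dot b b = 1 ->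
  `|pnorm a - pnorm b| <= lewis_radius `^ (1 - p) * `|W p a - W p b|.
Proof.
move=> a1 b1; rewrite -(pnormK a) -(pnormK b).
by apply: powR_diff; [exact: lewis_radius_gt0|exact: pnorm_ge|exact: pnorm_ge].
Qed.

Lemma powform_le_enorm s x y : 2 <= s -> dot x x = 1 -> `|Q s x y| <= enorm y.
Proof.
move=> s2 x1.
have main u : dot u u = 1 -> `|Q s x u| <= 1.
  move=> u1; have h z : dot z z = 1 -> Q s x z <= 1.
    move=> z1; have := powform_le_W2 hX isoX x z s2; rewrite z1.
    have s22 : 2 <= 2 * s - 2 by lra.
    have x1' : dot x x <= 1 by rewrite x1.
    have := powmean_le1 hX X1 isoX s22 x1'; rewrite x1; lra.
  have nu1 : dot (- u) (- u) = 1 by rewrite !dotE opprK u1.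
  have h1 := h u u1; have h2 := h (- u) nu1.
  rewrite (powformN mu hX _ _ s2) in h2; rewrite ler_norml; lra.
have [->|y0] := eqVneq y 0.
  by rewrite -(scale0r 0) (powformZ mu hX)// mul0r normr0 enorm_ge0.
have [u u1 yu] := enorm_normalize y0.
rewrite {1}yu (powformZ mu hX)// normrM ger0_norm ?enorm_ge0//.
by rewrite -[leRHS]mulr1; apply: ler_wpM2l; [exact: enorm_ge0|exact: main].
Qed.

Lemma powmean_lipschitz s a b : 2 <= s -> dot a a = 1 -> dot b b = 1 ->
  `|W s a - W s b| <= 2 * s * enorm (a - b).
Proof.
move=> s2 a1 b1; apply: le_trans (powmean_increment mu hX b a s2) _.
have h1 := powform_le_enorm (a - b) s2 b1; have h2 := powform_le_enorm (a - b) s2 a1.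
rewrite (mulrC 2) -mulrA; apply: ler_wpM2l; lra.
Qed.

(** The constant depends on n, which is harmless: it only fixes the depth of chaining, the fineness
    of rotations and the passage to rational points, and enters no final estimate. *)
Lemma pnorm_lipschitz : exists2 C : R, 0 <= C & forall a b, `|pnorm a - pnorm b| <= C * enorm (a - b).
Proof.
have p2' : 2 <= p by exact: ltW.
pose C1 := lewis_radius `^ (1 - p) * (2 * p).
have C10 : 0 <= C1 by apply: mulr_ge0; [exact: powR_ge0|apply: mulr_ge0 => //; exact: ltW].
exists (2 * C1 + 1); first by rewrite addr_ge0// mulr_ge0.
move=> a b.
have u0 : exists u0 : 'rV[R]_n, dot u0 u0 = 1.
  by exists (delta_mx 0 (Ordinal n0)); rewrite dot_delta mxE !eqxx.
have [u [v [u1 v1 au bv huv]]] := polar_pair a b u0.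
have hn (c : R) z : 0 <= c -> pnorm (c *: z) = c * pnorm z.
  by move=> c0; rewrite pnormZ ger0_norm.
have ha : pnorm a = enorm a * pnorm u := etrans (congr1 pnorm au) (hn _ u (enorm_ge0 a)).
have hb : pnorm b = enorm b * pnorm v := etrans (congr1 pnorm bv) (hn _ v (enorm_ge0 b)).
have -> : pnorm a - pnorm b = enorm a * (pnorm u - pnorm v) + (enorm a - enorm b) * pnorm v.
  have alg (A B c z y t : R) : A = c * y -> B = z * t -> A - B = c * (y - t) + (c - z) * t.
    by move=> -> ->; ring.
  exact: alg ha hb.
apply: le_trans (ler_normD _ _) _; rewrite !normrM (ger0_norm (enorm_ge0 a)) (ger0_norm (pnorm_ge0 v)).
have e1 := pnorm_diff u1 v1.
have e2 := powmean_lipschitz p2' u1 v1.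
have e3 := pnorm_le1 v1; have e4 := enorm_sub_le a b.
have e5 : `|pnorm u - pnorm v| <= C1 * enorm (u - v).
  by apply: le_trans e1 _; rewrite /C1 -mulrA; apply: ler_wpM2l => //; exact: powR_ge0.
have e6 : enorm a * `|pnorm u - pnorm v| <= C1 * (2 * enorm (a - b)).
  apply: le_trans (ler_wpM2l (enorm_ge0 a) e5) _; rewrite mulrCA; exact: ler_wpM2l.
have e7 : `|enorm a - enorm b| * pnorm v <= enorm (a - b).
  apply: le_trans e4; rewrite -[leRHS]mulr1; exact: ler_wpM2l.
rewrite mulrDl mul1r; apply: lerD => //; apply: le_trans e6 _.
by rewrite mulrA (mulrC C1).
Qed.

Definition increment_cst : R :=
  (32 * 15) * p ^+ 2 * (2 * moment_cst (2 * p - 2) + ((64 * (32 * 15)) * (2 * p - 2) ^+ 2) `^ (p - 1)).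

Lemma increment_cst_ge0 : 0 <= increment_cst.
Proof.
apply: mulr_ge0; first by apply: mulr_ge0; [lra|exact: sqr_ge0].
by apply: addr_ge0; [apply: mulr_ge0 => //; exact: moment_cst_ge0|exact: powR_ge0].
Qed.

Variables (tau : probability (borelType 'M[R]_n) R) (U : borelType 'M[R]_n -> 'M[R]_n).
Hypotheses (hU : haar_matrix tau U) (n2 : (2 < n)%N).

(** Dividing out L^(p-1) multiplies squares by L^2 n^(p-2). This cancels the size n^(2-p) of the
    mean of W_(2p-2), which gives the term r/n, and turns its fluctuation (r/n)^(p-1), times r/n,
    into r^p/n^2. *)
Lemma pnorm_increment_moment r a b : (0 < r)%N -> dot a a = 1 -> dot b b = 1 ->
  \int[tau]_w (pnorm (a *m U w) - pnorm (b *m U w)) ^+ r.*2 <=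
  (increment_cst * lewis_radius ^+ 2 * (r%:R / n%:R + r%:R `^ p / n%:R ^+ 2) *
    dot (a - b) (a - b)) ^+ r.
Proof.
have hp := p2; move=> r0 a1 b1; have p2' : 2 <= p by exact: ltW.
have s2 : 2 <= 2 * p - 2 by lra.
pose i0 := Ordinal (ltn_trans (ltn_trans (ltn0Sn 0) (ltnSn 1)) n2 : (0 < n)%N).
pose i1 := Ordinal (ltn_trans (ltnSn 1) n2 : (1 < n)%N).
have i01 : i0 != i1 by [].
set L := lewis_radius; have L0 : 0 < L by exact: lewis_radius_gt0.
set rho : R := r%:R / n%:R; have rho0 : 0 < rho by apply: divr_gt0 => //; rewrite ltr0n.
set D := dot (a - b) (a - b); have D0 : 0 <= D by exact: dot_ge0.
have bU x := bvecU hU x.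
have bdW : bmf (fun w => (W p (a *m U w) - W p (b *m U w)) ^+ r.*2).
  by apply: bmfX; apply: bmfB; apply: (bmf_W mu hX) => //; exact: ltW.
have bdf : bmf (fun w => (pnorm (a *m U w) - pnorm (b *m U w)) ^+ r.*2).
  by apply: bmfX; apply: bmfB; apply: borel_pnorm.
have bLd : bmf (fun w => (L `^ (1 - p)) ^+ r.*2 * (W p (a *m U w) - W p (b *m U w)) ^+ r.*2).
  by apply: bmfM => //; exact: bmf_cst.
have h1 : \int[tau]_w (pnorm (a *m U w) - pnorm (b *m U w)) ^+ r.*2 <=
    (L `^ (1 - p)) ^+ r.*2 * \int[tau]_w (W p (a *m U w) - W p (b *m U w)) ^+ r.*2.
  rewrite -(bintZ tau _ bdW); apply: (bint_le tau bdf bLd) => w.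
  have a1w : dot (a *m U w) (a *m U w) = 1 by rewrite (dotU hU).
  have b1w : dot (b *m U w) (b *m U w) = 1 by rewrite (dotU hU).
  have h := pnorm_diff a1w b1w.
  rewrite -exprMn -(exprn_even_norm (pnorm (a *m U w) - pnorm (b *m U w))).
  rewrite -(exprn_even_norm (L `^ (1 - p) * (W p (a *m U w) - W p (b *m U w)))).
  apply: lerXn2r; rewrite ?nnegrE// normrM (ger0_norm (powR_ge0 _ _)); exact: h.
have h2 := powmean_increment_moment hX X1 isoX hU n2 i01 p2' r0 a1 b1.
have h3 := gradmoment_le_W2 hX isoX hU i0 i1 r p2' a1.
have h4 := powmean_moment1 hX X1 isoX hU n2 i01 s2 r0 a1.
rewrite -/rho in h2 h4.
set B := powmean_bound _ _ _ in h4.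
have B0 : 0 <= B by exact: powmean_bound_ge0.
have c0 : 0 <= (32 * 15) * p ^+ 2 * D * rho.
  by apply: mulr_ge0; [apply: mulr_ge0 => //; apply: mulr_ge0; [lra|exact: sqr_ge0]|exact: ltW].
have h5 := le_trans h2 (ler_wpM2l (exprn_ge0 r c0) (le_trans h3 h4)).
have l0 : 0 <= (L `^ (1 - p)) ^+ r.*2 by rewrite exprn_ge0// powR_ge0.
apply: le_trans h1 _; apply: le_trans (ler_wpM2l l0 h5) _.
rewrite -mul2n exprM -!exprMn; apply: lerXn2r; rewrite ?nnegrE.
- by apply: mulr_ge0; [exact: sqr_ge0|exact: mulr_ge0].
- apply: mulr_ge0 => //; apply: mulr_ge0; last first.
    by rewrite addr_ge0// divr_ge0 ?powR_ge0 ?exprn_ge0// ltW.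
  by apply: mulr_ge0; [exact: increment_cst_ge0|exact: sqr_ge0].
have LL : (L `^ (1 - p)) ^+ 2 = L ^+ 2 * n%:R `^ (p - 2).
  rewrite -!powR_mulrn ?powR_ge0 ?(ltW L0)// -powRrM !lewis_radiusX -powRD; last first.
    by rewrite (gt_eqF nR) implybT.
  by congr (_ `^ _); field; exact: lt0r_neq0.
have BE : n%:R `^ (p - 2) * B = 2 * moment_cst (2 * p - 2) +
    ((64 * (32 * 15)) * (2 * p - 2) ^+ 2) `^ (p - 1) * (rho `^ (p - 1) * n%:R `^ (p - 2)).
  rewrite /B /powmean_bound mulrDr; congr (_ + _).
    rewrite mulrCA -powRD; last by rewrite (gt_eqF nR) implybT.
    have -> : p - 2 + (1 - (2 * p - 2) / 2) = 0 by field.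
    by rewrite powRr0 mulr1.
  have -> : (2 * p - 2) / 2 = p - 1 by field.
  rewrite powRM ?(ltW rho0)//; last by apply: mulr_ge0; [lra|exact: sqr_ge0].
  by ring.
have RE : rho * (rho `^ (p - 1) * n%:R `^ (p - 2)) = r%:R `^ p / n%:R ^+ 2.
  have e1 : rho * rho `^ (p - 1) = rho `^ p.
    rewrite -{1}(powRr1 (ltW rho0)) -powRD; last by rewrite (gt_eqF rho0) implybT.
    by congr (_ `^ _); ring.
  have e2 : rho `^ p = r%:R `^ p * n%:R^-1 `^ p by rewrite /rho powRM// invr_ge0 ltW.
  rewrite mulrA e1 e2 -mulrA; congr (_ * _).
  rewrite -powR_inv1 ?(ltW nR)// -powRrM -powRD; last by rewrite (gt_eqF nR) implybT.
  have -> : -1 * p + (p - 2) = - 2%:R by ring.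
  by rewrite powRN powR_mulrn ?ltW.
set K1 := 2 * moment_cst (2 * p - 2) in BE *.
set K2 := _ `^ (p - 1) in BE.
have K10 : 0 <= K1 by apply: mulr_ge0 => //; exact: moment_cst_ge0.
have K20 : 0 <= K2 by exact: powR_ge0.
have -> : (L `^ (1 - p)) ^+ 2 * ((32 * 15) * p ^+ 2 * D * rho * B) =
    (32 * 15) * p ^+ 2 * (L ^+ 2 * D) * (K1 * rho + K2 * (r%:R `^ p / n%:R ^+ 2)).
  transitivity ((32 * 15) * p ^+ 2 * (L ^+ 2 * D) * (rho * (n%:R `^ (p - 2) * B))).
    by rewrite LL; ring.
  by rewrite BE -RE; ring.
rewrite /increment_cst -/K1 -/K2 -/rho.
set q := r%:R `^ p / _; have q0 : 0 <= q by apply: divr_ge0; [exact: powR_ge0|exact: exprn_ge0].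
have -> : (32 * 15) * p ^+ 2 * (K1 + K2) * L ^+ 2 * (rho + q) * D =
  (32 * 15) * p ^+ 2 * (L ^+ 2 * D) * ((K1 + K2) * (rho + q)) by ring.
apply: ler_wpM2l.
  by apply: mulr_ge0; apply: mulr_ge0; rewrite ?sqr_ge0//; lra.
have := mulr_ge0 K10 q0; have := mulr_ge0 K20 (ltW rho0); lra.
Qed.

End PNorm.

(** * Nets and chaining *)

Section Net.
Context {R : realType} (k : nat).
Hypothesis k0 : (0 < k)%N.

Let G := {ffun 'I_k -> 'I_(2 * k).+1 * bool}.
(** The mesh for which rounding every coordinate displaces a point by at most h sqrt k = 1/2.
    Rounding is towards zero, so a point of the unit ball stays in it; there the coordinates are at
    most 2 sqrt k <= 2k steps long. *)
Let h : R := (2 * Num.sqrt k%:R)^-1.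
Let pt (z : G) : 'rV[R]_k := \row_i ((-1) ^+ (z i).2 * ((z i).1)%:R * h).
Let weight (z : G) : nat := \sum_i (z i).1 ^ 2.

Let kR : (0 : R) < k%:R.
Proof. by rewrite ltr0n. Qed.

Let h0 : 0 < h.
Proof. by rewrite invr_gt0 mulr_gt0// sqrtr_gt0. Qed.

Let h2 : h ^+ 2 = (4 * k%:R)^-1.
Proof. by rewrite /h exprVn exprMn sqr_sqrtr ?ltW//; congr (_ * _)^-1; ring. Qed.

Let dot_pt z : dot (pt z) (pt z) = (weight z)%:R * h ^+ 2.
Proof.
rewrite /dot /weight natr_sum mulr_suml; apply: eq_bigr => i _.
by rewrite !mxE -expr2 !exprMn sqrr_sign mul1r natrX.
Qed.

(* Each grid point of weight at most 4k is counted at least once by 16^k 2^-weight, and the sum of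
   2^-weight over all grid points factors over the coordinates. *)
Let net_card : (#|[pred z : G | (weight z <= 4 * k)%N]| <= 64 ^ k)%N.
Proof.
rewrite -(ler_nat R) -sum1_card natr_sum.
pose F (c : 'I_(2 * k).+1 * bool) : R := (2^-1) ^+ (c.1 ^ 2).
have F0 c : 0 <= F c by rewrite exprn_ge0// invr_ge0.
apply: (@le_trans _ _ (\sum_(z : G) 16 ^+ k * \prod_i F (z i))).
  rewrite [leRHS](bigID (fun z : G => (weight z <= 4 * k)%N))/= -[leLHS]addr0; apply: lerD.
    apply: ler_sum => z; rewrite inE => hz.
    have -> : \prod_i F (z i) = (2^-1) ^+ weight z by rewrite /weight -expr_sum.
    have -> : 16 ^+ k = 2 ^+ (4 * k) :> R by rewrite exprM; congr (_ ^+ _); ring.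
    rewrite exprVn ler_pdivlMr ?exprn_gt0// mul1r.
    by apply: ler_weXn2l => //; rewrite ler1n.
  by apply: sumr_ge0 => z _; rewrite mulr_ge0 ?exprn_ge0// prodr_ge0.
rewrite -mulr_sumr -(bigA_distr_bigA (fun _ c => F c)) prodr_const card_ord.
(* Two signs, each contributing the sum of 2^(-t^2), at most the sum of 2^(-t), hence at most 2.
   Together with 16 this gives 64. *)
have S4 : \sum_c F c <= 4.
  rewrite -(pair_bigA _ (fun t b => F (t, b)))/=.
  have geo (m : nat) : \sum_(t < m) (2^-1 : R) ^+ (t ^ 2) <= 2 - 2 * (2^-1) ^+ m.
    elim: m => [|m IH]; first by rewrite big_ord0 expr0; lra.
    rewrite big_ord_recr /= exprS.
    have : (2^-1 : R) ^+ (m ^ 2) <= (2^-1) ^+ m.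
      by apply: ler_wiXn2l; rewrite ?invr_ge0 ?invf_le1 ?ler1n//; case: m {IH} => // m; rewrite -mulnn leq_pmulr.
    lra.
  apply: (@le_trans _ _ (2 * \sum_(t < (2 * k).+1) (2^-1 : R) ^+ (t ^ 2))).
    rewrite mulr_sumr; apply: ler_sum => t _.
    by rewrite big_bool /F/=; lra.
  have := geo (2 * k).+1; have : 0 <= (2^-1 : R) ^+ (2 * k).+1 by rewrite exprn_ge0// invr_ge0.
  lra.
have S0 : 0 <= \sum_c F c by exact: sumr_ge0.
apply: (@le_trans _ _ (16 ^+ k * 4 ^+ k)).
  by apply: ler_wpM2l; [rewrite exprn_ge0|apply: lerXn2r; rewrite ?nnegrE].
by rewrite -exprMn natrX le_eqVlt; apply/orP; left; apply/eqP; congr (_ ^+ _); ring.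
Qed.

Lemma net_exists : exists D : seq 'rV[R]_k, [/\ (size D <= 64 ^ k)%N,
  forall v, v \in D -> dot v v <= 1 &
  forall x, dot x x <= 1 -> exists2 v, v \in D & dot (x - v) (x - v) <= 4^-1].
Proof.
exists [seq pt z | z <- enum [pred z : G | (weight z <= 4 * k)%N]]; split.
- by rewrite size_map -cardE; exact: net_card.
- move=> v /mapP[z]; rewrite mem_enum inE => hz ->; rewrite dot_pt h2.
  by rewrite ler_pdivrMr ?mulr_gt0// mul1r -(natrM _ 4) ler_nat.
move=> x x1.
have xi i : `|x 0 i| <= 1.
  rewrite -(@ler_pXn2r _ 2)// ?nnegrE// expr1n real_normK ?num_real//.
  apply: le_trans x1; rewrite /dot (bigD1 i)//= -expr2 lerDl.
  by apply: sumr_ge0 => j _; rewrite -expr2 sqr_ge0.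
pose m i := Num.truncn (`|x 0 i| / h).
have q0 i : 0 <= `|x 0 i| / h by rewrite divr_ge0// ltW.
have ml i : (m i)%:R <= `|x 0 i| / h by rewrite truncn_le; exact: q0.
have mu i : `|x 0 i| / h < (m i).+1%:R by exact: truncnS_gt.
have mk i : (m i < (2 * k).+1)%N.
  rewrite ltnS -(ler_nat R); apply: le_trans (ml i) _.
  rewrite /h invrK; apply: (@le_trans _ _ (1 * (2 * Num.sqrt k%:R))).
    by apply: ler_wpM2r => //; rewrite mulr_ge0// sqrtr_ge0.
  rewrite mul1r natrM; apply: ler_wpM2l => //.
  rewrite -(@ler_pXn2r _ 2)// ?nnegrE ?sqrtr_ge0// sqr_sqrtr// expr2 ler_peMl//.
  by rewrite ler1n.
pose z : G := [ffun i => (Ordinal (mk i), x 0 i < 0)].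
have wz : (weight z <= 4 * k)%N.
  rewrite -(ler_nat R) /weight natr_sum natrM.
  apply: (@le_trans _ _ (\sum_i x 0 i ^+ 2 / h ^+ 2)).
    apply: ler_sum => i _; rewrite ffunE /= natrX -(real_normK (num_real (x 0 i))) -expr_div_n.
    by apply: lerXn2r; rewrite ?nnegrE.
  rewrite -mulr_suml h2 invrK -[leRHS]mul1r; apply: ler_wpM2r; first by rewrite mulr_ge0.
  by apply: le_trans x1; rewrite /dot; under [leRHS]eq_bigr do rewrite -expr2.
exists (pt z); first by apply: map_f; rewrite mem_enum inE.
have e i : (x - pt z) 0 i * (x - pt z) 0 i <= h ^+ 2.
  rewrite -expr2 !mxE ffunE /=.
  have xs : x 0 i = (-1) ^+ (x 0 i < 0)%R * `|x 0 i|.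
    by case: ltP => hx; rewrite ?expr1 ?expr0 ?mul1r ?mulN1r ?(ltr0_norm hx) ?opprK// ger0_norm.
  rewrite {1}xs -mulrA -mulrBr exprMn sqrr_sign mul1r.
  have l1 : (m i)%:R * h <= `|x 0 i| by rewrite -ler_pdivlMr.
  have l2 : `|x 0 i| < ((m i)%:R + 1) * h by rewrite -ltr_pdivrMr// natr1.
  rewrite ler_pXn2r ?nnegrE ?subr_ge0// ?(ltW h0)//; lra.
apply: (@le_trans _ _ (\sum_(i < k) h ^+ 2)); first exact: ler_sum.
rewrite sumr_const card_ord h2 -mulr_natl le_eqVlt; apply/orP; left; apply/eqP; field.
exact: lt0r_neq0.
Qed.

End Net.

Lemma le_half_mul {R : realType} (a e b c : R) : 2 * a < c * e -> c * e <= b * e -> a <= e / 2 * b.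
Proof. lra. Qed.

Section Chaining.
Context {R : realType} {n : nat}.
Variables (tau : probability (borelType 'M[R]_n) R) (U : borelType 'M[R]_n -> 'M[R]_n).
Hypothesis hU : haar_matrix tau U.
Variables (f : 'rV[R]_n -> R) (C : R) (a0 : 'rV[R]_n) (th : nat -> R).
Hypotheses (bf : borel_bounded f) (fZ : forall (c : R) x, f (c *: x) = `|c| * f x).
Hypotheses (C0 : 0 <= C) (fL : forall a b, `|f a - f b| <= C * enorm (a - b)).
Hypotheses (a01 : dot a0 a0 = 1) (th0 : forall r, 0 <= th r).
Hypothesis f_inc : forall r a b, (0 < r)%N -> dot a a = 1 -> dot b b = 1 ->
  \int[tau]_w (f (a *m U w) - f (b *m U w)) ^+ r.*2 <= (th r * dot (a - b) (a - b)) ^+ r.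
Implicit Types (a b : 'rV[R]_n).

Let M := \int[tau]_w f (a0 *m U w).
Let g w a := f (a *m U w) - M * enorm a.

Let bfU a : bmf (fun w => f (a *m U w)).
Proof. by apply: bf; exact: (bvecU hU). Qed.

Let meanE b : dot b b = 1 -> \int[tau]_w f (b *m U w) = M.
Proof. by move=> b1; apply: (haar_congruence1 hU) => //; rewrite b1. Qed.

Lemma centered_moment r b : (0 < r)%N -> dot b b = 1 ->
  \int[tau]_w (f (b *m U w) - M) ^+ r.*2 <= (4 * th r) ^+ r.
Proof.
move=> r0 b1; rewrite -(meanE b1); apply: (central_moment hU bf b1) => c c1.
apply: le_trans (f_inc r0 b1 c1) _; apply: lerXn2r.
- by rewrite nnegrE mulr_ge0// dot_ge0.
- by rewrite nnegrE mulr_ge0.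
by rewrite mulrC; apply: ler_wpM2r => //; exact: dot_diff_le4.
Qed.

Let bg a : bmf (fun w => g w a).
Proof. by apply: bmfB => //; exact: bmf_cst. Qed.

(** The chain passes through interior points of the ball, so the increments of the homogeneous
    centred function are needed for arbitrary pairs: the angular part comes from [f_inc], the radial
    part from the centred moment. *)
Lemma homogeneous_increment_moment r a b : (0 < r)%N ->
  \int[tau]_w (g w a - g w b) ^+ r.*2 <= (16 * th r * dot (a - b) (a - b)) ^+ r.
Proof.
move=> r0.
have [u [v [u1 v1 au bv huv]]] := polar_pair a b (ex_intro _ a0 a01).
set x := enorm a in au huv *; set y := enorm b in bv *.
have x0 : 0 <= x by exact: enorm_ge0.
have xy : `|x - y| <= enorm (a - b) by exact: enorm_sub_le.
set del := enorm (a - b) in huv xy; have del0 : 0 <= del by exact: enorm_ge0.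
have del2 : del ^+ 2 = dot (a - b) (a - b) by exact: enorm_sqr.
have gE w : g w a - g w b = x * (f (u *m U w) - f (v *m U w)) + (x - y) * (f (v *m U w) - M).
  have e1 : f (a *m U w) = x * f (u *m U w).
    by rewrite [a in LHS]au -scalemxAl fZ ger0_norm.
  have e2 : f (b *m U w) = y * f (v *m U w).
    by rewrite [b in LHS]bv -scalemxAl fZ ger0_norm ?enorm_ge0.
  by rewrite /g e1 e2 -/x -/y; ring.
have b1 : bmf (fun w => (f (u *m U w) - f (v *m U w)) ^+ r.*2) by apply: bmfX; apply: bmfB.
have b2 : bmf (fun w => (f (v *m U w) - M) ^+ r.*2).
  by apply: bmfX; apply: bmfB => //; exact: bmf_cst.
have b3 : bmf (fun w => x ^+ r.*2 * (f (u *m U w) - f (v *m U w)) ^+ r.*2).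
  by apply: bmfM => //; exact: bmf_cst.
have b4 : bmf (fun w => (x - y) ^+ r.*2 * (f (v *m U w) - M) ^+ r.*2).
  by apply: bmfM => //; exact: bmf_cst.
have b5 := bmfD b3 b4.
have b6 : bmf (fun w => 2^-1 * (x ^+ r.*2 * (f (u *m U w) - f (v *m U w)) ^+ r.*2 +
    (x - y) ^+ r.*2 * (f (v *m U w) - M) ^+ r.*2)) by apply: bmfM => //; exact: bmf_cst.
have b7 : bmf (fun w => 4 ^+ r * (2^-1 * (x ^+ r.*2 * (f (u *m U w) - f (v *m U w)) ^+ r.*2 +
    (x - y) ^+ r.*2 * (f (v *m U w) - M) ^+ r.*2))) by apply: bmfM => //; exact: bmf_cst.
have b8 : bmf (fun w => (g w a - g w b) ^+ r.*2) by apply: bmfX; apply: bmfB.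
apply: le_trans (bint_le tau b8 b7 _) _ => [w|].
  by rewrite gE -!exprMn; exact: power_mean2.
rewrite (bintZ tau _ b6) (bintZ tau _ b5) (bintD tau b3 b4) (bintZ tau _ b1) (bintZ tau _ b2).
have B0 : 0 <= 4 * th r * del ^+ 2 by rewrite mulr_ge0 ?sqr_ge0// mulr_ge0.
have h1 : x ^+ r.*2 * \int[tau]_w (f (u *m U w) - f (v *m U w)) ^+ r.*2 <=
    (4 * th r * del ^+ 2) ^+ r.
  have x20 : 0 <= x ^+ r.*2 by rewrite exprn_ge0.
  apply: le_trans (ler_wpM2l x20 (f_inc r0 u1 v1)) _.
  rewrite -mul2n exprM -exprMn; apply: lerXn2r; rewrite ?nnegrE//.
    by rewrite mulr_ge0 ?sqr_ge0// mulr_ge0// dot_ge0.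
  rewrite mulrCA -enorm_sqr -exprMn (mulrC 4) -mulrA; apply: ler_wpM2l => //.
  have -> : 4 * del ^+ 2 = (2 * del) ^+ 2 by ring.
  by apply: lerXn2r; rewrite ?nnegrE ?mulr_ge0 ?enorm_ge0.
have h2 : (x - y) ^+ r.*2 * \int[tau]_w (f (v *m U w) - M) ^+ r.*2 <=
    (4 * th r * del ^+ 2) ^+ r.
  have x20 : 0 <= (x - y) ^+ r.*2 by exact: exprn_even_ge0.
  apply: le_trans (ler_wpM2l x20 (centered_moment r0 v1)) _.
  rewrite -mul2n exprM -exprMn; apply: lerXn2r; rewrite ?nnegrE//.
    by rewrite mulr_ge0 ?sqr_ge0// mulr_ge0.
  rewrite mulrC; apply: ler_wpM2l; first by rewrite mulr_ge0.
  by rewrite -(real_normK (num_real (x - y))); apply: lerXn2r; rewrite ?nnegrE.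
have half (A B D : R) : A <= D -> B <= D -> 2^-1 * (A + B) <= D by lra.
apply: le_trans (ler_wpM2l (exprn_ge0 r _) (half _ _ _ h1 h2)) _ => //.
rewrite -exprMn del2 le_eqVlt; apply/orP; left; apply/eqP; congr (_ ^+ _); ring.
Qed.

Variables (k : nat) (X : 'M[R]_(k, n)) (delta : R).
Hypotheses (k0 : (0 < k)%N) (oX : X *m X^T = 1%:M) (delta0 : 0 < delta).
Hypothesis small : forall j, 2 ^+ 16 * th (j.+1 * k) * (4 / 9) ^+ j <= expR (-1) / 2 * delta ^+ 2.

Let dotX (x y : 'rV[R]_k) : dot (x *m X) (y *m X) = dot x y.
Proof. by rewrite !dot_mulmx trmx_mul mulmxA -(mulmxA x) oX mulmx1. Qed.

Let enormX (x : 'rV[R]_k) : enorm (x *m X) = enorm x.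
Proof. by rewrite /enorm dotX. Qed.

Let gL w a b : `|g w a - g w b| <= (C + `|M|) * enorm (a - b).
Proof.
have e : enorm (a *m U w - b *m U w) = enorm (a - b).
  by rewrite -mulmxBl /enorm (dotU hU).
have h1 := fL (a *m U w) (b *m U w); rewrite e in h1.
have h2 : `|M * (enorm a - enorm b)| <= `|M| * enorm (a - b).
  by rewrite normrM; apply: ler_wpM2l => //; exact: enorm_sub_le.
have -> : g w a - g w b = (f (a *m U w) - f (b *m U w)) - M * (enorm a - enorm b).
  by rewrite /g; ring.
by apply: le_trans (ler_normB _ _) _; rewrite mulrDl; exact: lerD.
Qed.

(** The thresholds add up to at most delta/2. Squared links shrink like 4^(-j), squared thresholds
    like (9/16)^j; the quotient (4/9)^j is left to pay for the growth of [th] along the moment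
    orders (j+1) k. *)
Let thr (j : nat) : R := delta / 8 * (3 / 4) ^+ j.

Let thr0 j : 0 < thr j.
Proof. by rewrite mulr_gt0 ?exprn_gt0// divr_gt0. Qed.

Let sum_thr j : \sum_(i < j) thr i <= delta / 2.
Proof.
suff -> : \sum_(i < j) thr i = delta / 2 * (1 - (3 / 4) ^+ j).
  have : 0 <= (3 / 4 : R) ^+ j by rewrite exprn_ge0// divr_ge0.
  by move: delta0 (_ ^+ j) => dd t; nra.
elim: j => [|j IH]; first by rewrite big_ord0 expr0 subrr mulr0.
by rewrite big_ord_recr /= IH /thr exprS; field.
Qed.

Section Levels.
Variable D : seq 'rV[R]_k.
Hypotheses (sD : (size D <= 64 ^ k)%N) (D1 : forall v, v \in D -> dot v v <= 1).
Hypothesis DN : forall x, dot x x <= 1 -> exists2 v, v \in D & dot (x - v) (x - v) <= 4^-1.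

(** One net of scale 1/2 yields all scales, because the remainder after j steps, magnified by 2^j,
    lies in the unit ball again. *)
Fixpoint chain_points (j : nat) : seq 'rV[R]_k :=
  if j is i.+1 then [seq x + (2^-1) ^+ i *: v | x <- chain_points i, v <- D] else [:: 0].

Let size_points j : size (chain_points j) = (size D ^ j)%N.
Proof. by elim: j => [//|j IH] /=; rewrite size_allpairs IH expnSr. Qed.

Let term j w (x v : 'rV[R]_k) : R :=
  ((g w ((x + (2^-1) ^+ j *: v) *m X) - g w (x *m X)) / thr j) ^+ (j.+1 * k).*2.

(** A sum of nonnegative terms, each at least 1 as soon as its link exceeds the threshold: a sum
    below 1 certifies all links at once, and its integral plays the role of a union bound. *)
Let level j w : R := \sum_(x <- chain_points j) \sum_(v <- D) term j w x v.

Let bterm j x v : bmf (fun w => term j w x v).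
Proof. by apply: bmfX; apply: bmfM; [exact: bmfB|exact: bmf_cst]. Qed.

Let term0 j w x v : 0 <= term j w x v.
Proof. exact: exprn_even_ge0. Qed.

(** The factor e^(-1) gives the final e^(-k); the 1/2 makes the geometric series over levels sum to
    less than that. *)
Let beta : R := expR (-1) / 2.

(** The moment order (j+1) k matches the at most 64^((j+1) k) links of level j, whose number the
    factor 1/64 cancels. *)
Let int_term j x v : v \in D -> \int[tau]_w term j w x v <= (beta / 64) ^+ (j.+1 * k).
Proof.
move=> vD; set r := (j.+1 * k)%N; have r0 : (0 < r)%N by rewrite muln_gt0.
pose c := (thr j)^-1 ^+ r.*2.
have b1 : bmf (fun w => (g w ((x + (2^-1) ^+ j *: v) *m X) - g w (x *m X)) ^+ r.*2).
  by apply: bmfX; exact: bmfB.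
have -> : \int[tau]_w term j w x v =
    c * \int[tau]_w (g w ((x + (2^-1) ^+ j *: v) *m X) - g w (x *m X)) ^+ r.*2.
  by rewrite -(bintZ tau _ b1); apply: eq_Rintegral => w _; rewrite /term -/r exprMn mulrC.
have c0 : 0 <= c by exact: exprn_even_ge0.
apply: le_trans (ler_wpM2l c0 (homogeneous_increment_moment _ _ r0)) _.
rewrite -mulmxBl addrC addKr dotX !dotE /c -mul2n exprM -exprMn; apply: lerXn2r; rewrite ?nnegrE.
- by rewrite mulr_ge0 ?sqr_ge0// mulr_ge0 ?mulr_ge0 ?dot_ge0// exprn_ge0// invr_ge0.
- by rewrite /beta !divr_ge0 ?expR_ge0.
have v1 := D1 vD; have sm := small j; rewrite -/r in sm.
have p4 : 0 < (4^-1 : R) ^+ j by rewrite exprn_gt0// invr_gt0.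
have p9 : 0 < (9 / 16 : R) ^+ j by rewrite exprn_gt0// divr_gt0.
have e4 : (2^-1 : R) ^+ j * (2^-1) ^+ j = (4^-1) ^+ j.
  by rewrite -exprMn; congr (_ ^+ _); field.
have eT : (thr j)^-1 ^+ 2 = 64 / (delta ^+ 2 * (9 / 16) ^+ j).
  have -> : (9 / 16 : R) ^+ j = ((3 / 4) ^+ j) ^+ 2 by rewrite exprAC; congr (_ ^+ _); field.
  rewrite /thr; field; rewrite lt0r_neq0//= ?lt0r_neq0// exprn_gt0// divr_gt0//.
have e9 : (4 / 9 : R) ^+ j * (9 / 16) ^+ j = (4^-1) ^+ j.
  by rewrite -exprMn; congr (_ ^+ _); field.
have d2 : 0 < delta ^+ 2 by rewrite exprn_gt0.
have -> : (thr j)^-1 ^+ 2 * (16 * th r * ((2^-1) ^+ j * ((2^-1) ^+ j * dot v v))) =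
    64 * (16 * th r * ((4^-1) ^+ j * dot v v)) / (delta ^+ 2 * (9 / 16) ^+ j).
  by rewrite eT -e4; ring.
rewrite ler_pdivrMr ?mulr_gt0//.
apply: (@le_trans _ _ (64 * (16 * th r * (4^-1) ^+ j))).
  apply: ler_wpM2l => //; apply: ler_wpM2l; first by rewrite mulr_ge0.
  by rewrite -[leRHS]mulr1; apply: ler_wpM2l; first exact: ltW.
rewrite -e9; set q := (4 / 9) ^+ j in sm *.
have -> : 64 * (16 * th r * (q * (9 / 16) ^+ j)) = (2 ^+ 16 * th r * q) * ((9 / 16) ^+ j / 64) by field.
have -> : beta / 64 * (delta ^+ 2 * (9 / 16) ^+ j) = (beta * delta ^+ 2) * ((9 / 16) ^+ j / 64) by field.
by apply: ler_wpM2r => //; rewrite divr_ge0// ltW.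
Qed.

Let beta0 : 0 < beta.
Proof. by rewrite divr_gt0 ?expR_gt0. Qed.

Let int_level j : \int[tau]_w level j w <= (beta ^+ k) ^+ j.+1.
Proof.
have bs x : bmf (fun w => \sum_(v <- D) term j w x v) by apply: bmf_sum => v; exact: bterm.
rewrite /level (bint_sum tau _ _ bs).
set B := (beta / 64) ^+ (j.+1 * k); have B0 : 0 <= B by rewrite exprn_ge0// divr_ge0// ltW.
have h x : \int[tau]_w (\sum_(v <- D) term j w x v) <= (size D)%:R * B.
  rewrite (bint_sum tau _ _ (bterm j x)) big_seq.
  apply: le_trans (ler_sum _ (fun v vD => int_term j x vD)) _.
  by rewrite -big_seq big_const_seq count_predT iter_addr addr0 mulr_natl.
apply: le_trans (ler_sum _ (fun x _ => h x)) _.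
rewrite big_const_seq count_predT iter_addr addr0 size_points -[X in X <= _]mulr_natl mulrA -natrM -expnSr.
have -> : (beta ^+ k) ^+ j.+1 = ((64 ^ k) ^ j.+1)%:R * B.
  by rewrite /B -!exprM !natrX -exprM (mulnC k) -exprMn; congr (_ ^+ _); field.
by apply: ler_wpM2r => //; rewrite ler_nat leq_exp2r.
Qed.

Let geometric (q : R) J : 0 < q -> q <= 2^-1 -> \sum_(j < J) q ^+ j.+1 < 2 * q.
Proof.
move=> q0 q2; suff h : \sum_(j < J) q ^+ j.+1 <= 2 * q * (1 - (2^-1) ^+ J).
  have : 0 < (2^-1 : R) ^+ J by rewrite exprn_gt0// invr_gt0.
  by move: h; move: (_ ^+ J) => t h t0; have := mulr_gt0 q0 t0; lra.
elim: J => [|J IH]; first by rewrite big_ord0 expr0 subrr mulr0.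
rewrite big_ord_recr /= !exprS.
have : q ^+ J <= (2^-1) ^+ J by apply: lerXn2r; rewrite ?nnegrE ?invr_ge0// ltW.
move: IH; set t := (2^-1) ^+ J; set s := q ^+ J; set S := \sum_(_ < _) _ => IH; nra.
Qed.

Let chain_mass J : \int[tau]_w (\sum_(j < J) level j w) < expR (- k%:R).
Proof.
have bl j : bmf (level j).
  by apply: bmf_sum => x; apply: bmf_sum => v; exact: bterm.
rewrite (bint_sum tau _ _ (fun j : (ordinal J) => bl j)).
apply: le_lt_trans (ler_sum _ (fun j _ => int_level (nat_of_ord j))) _.
have bk : beta ^+ k <= expR (- k%:R) / 2.
  rewrite /beta expr_div_n -expRM_natl mulr_natl mulNrn; apply: ler_wpM2l; first exact: expR_ge0.
  rewrite lef_pV2 ?posrE ?exprn_gt0//.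
  by rewrite -[leLHS]expr1; apply: ler_weXn2l => //; rewrite ler1n.
have e1 : expR (- k%:R) <= 1 :> R by rewrite -expR0 ler_expR oppr_le0.
apply: lt_le_trans (geometric _ _ _) _; [by rewrite exprn_gt0|lra|lra].
Qed.

Let chain_bound J w : \sum_(j < J) level j w < 1 -> (C + `|M|) * (2^-1) ^+ J <= delta / 2 ->
  forall x : 'rV[R]_k, dot x x <= 1 -> `|g w (x *m X)| <= delta.
Proof.
move=> hL hJ x x1.
have step j y v : (j < J)%N -> y \in chain_points j -> v \in D ->
    `|g w ((y + (2^-1) ^+ j *: v) *m X) - g w (y *m X)| <= thr j.
  move=> jJ yj vD.
  have h1 : term j w y v <= \sum_(j < J) level j w.
    rewrite (bigD1 (Ordinal jJ))//= -[leLHS]addr0; apply: lerD; last first.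
      by apply: sumr_ge0 => i _; apply: sumr_ge0 => z _; apply: sumr_ge0.
    rewrite /level (big_rem y)//= -[leLHS]addr0; apply: lerD; last first.
      by apply: sumr_ge0 => z _; apply: sumr_ge0.
    rewrite (big_rem v)//= -[leLHS]addr0; apply: lerD => //.
    exact: sumr_ge0.
  have h2 := le_lt_trans h1 hL; rewrite leNgt; apply/negP => bad.
  move: h2; rewrite ltNge => /negP; apply.
  rewrite /term -exprn_even_norm normrM (gtr0_norm (_ : 0 < (thr j)^-1)) ?invr_gt0//.
  by rewrite exprn_ege1// ler_pdivlMr// mul1r ltW.
have main j : (j <= J)%N -> exists2 y, y \in chain_points j &
    dot (x - y) (x - y) <= (4^-1) ^+ j /\ `|g w (y *m X)| <= \sum_(i < j) thr i.
  elim: j => [_|j IH jJ].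
    exists 0; first by rewrite mem_head.
    split; first by rewrite subr0 expr0.
    have e0 : f 0 = 0 by rewrite -(scale0r 0) fZ normr0 mul0r.
    by rewrite big_ord0 /g !mul0mx e0 enorm0 mulr0 subrr normr0.
  have [y yj [yd yg]] := IH (ltnW jJ).
  (* The magnified remainder, to which the net is applied once more. *)
  pose x' := 2 ^+ j *: (x - y).
  have x'1 : dot x' x' <= 1.
    rewrite /x' dotZl dotZr mulrA -exprMn; apply: (@le_trans _ _ ((2 * 2) ^+ j * (4^-1) ^+ j)).
      by apply: ler_wpM2l => //; rewrite exprn_ge0.
    by rewrite -exprMn (_ : 2 * 2 * 4^-1 = 1 :> R) ?expr1n//; field.
  have [v vD hv] := DN x'1.
  exists (y + (2^-1) ^+ j *: v); first exact: allpairs_f.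
  have ee : (2^-1 : R) ^+ j * 2 ^+ j = 1 by rewrite -exprMn mulVf ?expr1n// pnatr_eq0.
  split.
    have -> : x - (y + (2^-1) ^+ j *: v) = (2^-1) ^+ j *: (x' - v).
      by rewrite scalerBr /x' scalerA ee scale1r opprD addrA.
    rewrite dotZl dotZr mulrA -exprMn exprSr (_ : 2^-1 * 2^-1 = 4^-1 :> R); last by field.
    by apply: ler_wpM2l => //; rewrite exprn_ge0// invr_ge0.
  rewrite big_ord_recr /=; have := step j y v jJ yj vD.
  move: yg; set A := g w _; set B := g w _ => yg hAB.
  have -> : B = A + (B - A) by ring.
  by apply: le_trans (ler_normD _ _) _; apply: lerD.
have [y _ [yd yg]] := main J (leqnn J).
have hxy : enorm (x - y) <= (2^-1) ^+ J.
  rewrite enorm_le ?exprn_ge0 ?invr_ge0//; apply: le_trans yd _.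
  by rewrite -exprM mulnC exprM le_eqVlt; apply/orP; left; apply/eqP; congr (_ ^+ _); field.
have h1 := gL w (x *m X) (y *m X); rewrite -mulmxBl enormX in h1.
have h2 : (C + `|M|) * enorm (x - y) <= delta / 2.
  by apply: le_trans hJ; apply: ler_wpM2l => //; rewrite addr_ge0.
have h3 := le_trans yg (sum_thr J).
have -> : g w (x *m X) = g w (y *m X) + (g w (x *m X) - g w (y *m X)) by ring.
apply: le_trans (ler_normD _ _) _.
move: h1 h2 h3; set A := `|_|; set B := `|_|; lra.
Qed.

Let chain_depth : exists J : nat, (C + `|M|) * (2^-1) ^+ J <= delta / 2.
Proof.
have K0 : 0 <= C + `|M| by rewrite addr_ge0.
pose J := (Num.truncn (2 * (C + `|M|) / delta)).+1; exists J.
have hJ : 2 * (C + `|M|) / delta < J%:R by exact: truncnS_gt.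
have hJ2 : (J%:R : R) <= 2 ^+ J by rewrite -natrX ler_nat ltnW// ltn_expl.
have p2 : (0 : R) < 2 ^+ J by rewrite exprn_gt0.
rewrite exprVn ler_pdivrMr//; rewrite ltr_pdivrMr// in hJ.
exact: le_half_mul hJ (ler_wpM2r (ltW delta0) hJ2).
Qed.

Lemma chaining_levels : exists Phi : borelType 'M[R]_n -> R, [/\ bmf Phi, forall w, 0 <= Phi w,
  \int[tau]_w Phi w < expR (- k%:R) & forall w, Phi w < 1 ->
  forall x : 'rV[R]_k, dot x x = 1 -> `|f (x *m X *m U w) - M| <= delta].
Proof.
have [J hJ] := chain_depth; exists (fun w => \sum_(j < J) level j w); split.
- by apply: bmf_sum => j; apply: bmf_sum => x; apply: bmf_sum => v; exact: bterm.
- by move=> w; apply: sumr_ge0 => j _; apply: sumr_ge0 => x _; apply: sumr_ge0.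
- exact: chain_mass.
move=> w hw x x1; have := chain_bound hw hJ (x := x).
by rewrite x1 => /(_ (lexx 1)); rewrite /g enormX (proj2 (enorm_eq1 x) x1) mulr1.
Qed.

End Levels.

(** The majorant [Phi] of the indicator of failure replaces the event itself, an intersection over
    uncountably many x, whose measurability is thereby avoided. *)
Theorem chaining : exists Phi : borelType 'M[R]_n -> R, [/\ bmf Phi, forall w, 0 <= Phi w,
  \int[tau]_w Phi w < expR (- k%:R) & forall w, Phi w < 1 ->
  forall x : 'rV[R]_k, dot x x = 1 -> `|f (x *m X *m U w) - M| <= delta].
Proof. by have [D [sD D1 DN]] := @net_exists R k k0; exact: (chaining_levels sD D1 DN). Qed.

End Chaining.

(** * Concentration of truncated deviations *)

Lemma sin_le_id {R : realType} (t : R) : 0 <= t -> sin t <= t.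
Proof.
move=> t0.
have cont : {within `[0, t], continuous (@sin R)}.
  by apply: continuous_subspaceT => x; exact: continuous_sin.
have [c _] := MVT_segment t0 (fun x _ => is_derive_sin x) cont.
rewrite sin0 !subr0 => ->.
by rewrite -[leRHS]mul1r; apply: ler_wpM2r => //; exact: cos_le1.
Qed.

Lemma norm_sin_le {R : realType} (t : R) : 0 <= t -> `|sin t| <= t.
Proof.
move=> t0; have [t1|t1] := leP t 1.
  have pi2 := @pi_ge2 R.
  by rewrite ger0_norm ?sin_le_id// sin_ge0_pi// t0; lra.
exact: le_trans (sin_max t) (ltW t1).
Qed.

Lemma one_sub_cos_le {R : realType} (t : R) : 0 <= t <= 1 -> 0 <= 1 - cos t <= t.
Proof.
move=> /andP[t0 t1]; have pi2 := @pi_ge2 R.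
have c0 : 0 <= cos t by apply: cos_ge0_pihalf; lra.
have c1 := cos_le1 t; rewrite subr_ge0 c1/=.
have s0 : 0 <= sin t by apply: sin_ge0_pi; lra.
have s1 := sin_le_id t0; have := cos2Dsin2 t.
move: (cos t) (sin t) c0 c1 s0 s1 => c s; nra.
Qed.

Section TruncatedDeviation.
Context {R : realType} {n : nat}.
Variables (tau : probability (borelType 'M[R]_n) R) (U : borelType 'M[R]_n -> 'M[R]_n).
Hypothesis hU : haar_matrix tau U.
Variables (f W : 'rV[R]_n -> R) (C L M delta Theta : R) (a0 : 'rV[R]_n).
Hypotheses (bf : borel_bounded f) (bW : borel_bounded W).
Hypothesis WN : forall x, W (- x) = W x.
Hypotheses (C0 : 0 <= C) (fL : forall a b, `|f a - f b| <= C * enorm (a - b)).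
Hypotheses (L0 : 0 <= L) (fW : forall a b, dot a a = 1 -> dot b b = 1 ->
  `|f a - f b| <= L * `|W a - W b| /\ 0 <= (f a - f b) * (W a - W b)).
Hypothesis delta0 : 0 < delta.
Implicit Types (x y a b : 'rV[R]_n).

Definition clip (t : R) : R := Num.max (- delta) (Num.min delta t).

Definition near_mean x : R := (`|f x - M| <= 2 * delta)%R%:R.

Let h x := clip (f x - M).

Lemma clipP t : [\/ t <= - delta /\ clip t = - delta,
  (- delta <= t /\ t <= delta) /\ clip t = t | delta <= t /\ clip t = delta].
Proof.
have d := delta0; have [t1|t1] := leP t (- delta).
  apply: Or31; split => //; rewrite /clip (min_idPr _); last lra.
  exact: (max_idPl t1).
have [t2|t2] := leP t delta.
  apply: Or32; split; first by split=> //; exact: ltW.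
  by rewrite /clip (min_idPr t2); exact: (max_idPr (ltW t1)).
apply: Or33; split; first exact: ltW.
rewrite /clip (min_idPl (ltW t2)); apply/max_idPr; lra.
Qed.

Lemma clip_lip s t : `|clip s - clip t| <= `|s - t|.
Proof.
have d := delta0; have h1 := ler_norm (s - t); have h2 : t - s <= `|s - t| by rewrite distrC ler_norm.
move: `|s - t| h1 h2 => N h1 h2; rewrite ler_norml.
by case: (clipP s) => -[? ->]; case: (clipP t) => -[? ->]; apply/andP; split; lra.
Qed.

Lemma clip_mono s t : 0 <= (s - t) * (clip s - clip t).
Proof.
have d := delta0; have main (u v : R) : u <= v -> 0 <= clip v - clip u.
  by move=> uv; case: (clipP u) => -[? ->]; case: (clipP v) => -[? ->]; lra.
have [st|st] := leP s t.
  by rewrite -mulrNN !opprB mulr_ge0 ?subr_ge0// -subr_ge0; exact: main.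
by rewrite mulr_ge0 ?subr_ge0 ?(ltW st)// -subr_ge0; apply: main; exact: ltW.
Qed.

(** The truncation is locally constant away from the mean. Its increments therefore see only points
    where f is within 2 delta of M, which brings [near_mean] into every gradient bound. *)
Lemma clip_far s t u : 2 * delta < `|s| -> `|t - s| <= delta -> `|u - s| <= delta ->
  clip t = clip u.
Proof.
rewrite ltr_normr !ler_norml => /orP s2 /andP[t1 t2] /andP[u1 u2].
rewrite /clip /Num.max /Num.min; have d := delta0.
case: s2 => s2; (do 4 case: ifP) => ? ? ? ?; lra.
Qed.

(** Integrated, the first bound speaks of the probability of being near the mean, the second of the
    mean absolute deviation. *)
Lemma clip_lower s : 2 * delta ^+ 2 * (1 - (`|s| <= 2 * delta)%R%:R) <= s * clip s
  /\ delta * (`|s| - delta) <= s * clip s.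
Proof.
have d := delta0; have dd : 0 < delta * delta by rewrite mulr_gt0.
case: (clipP s) => -[h1 ->].
- have s0 : s <= 0 by lra.
  rewrite ler0_norm//; split; last by nra.
  by case: (leP (- s) (2 * delta)) => hs /=; nra.
- have sn : `|s| <= delta by rewrite ler_norml; lra.
  have -> : `|s| <= 2 * delta by lra.
  by rewrite subrr mulr0 -expr2 sqr_ge0; split => //; have := sqr_ge0 s; nra.
have s0 : 0 <= s by lra.
rewrite ger0_norm//; split; last by nra.
by case: (leP s (2 * delta)) => hs /=; nra.
Qed.

Lemma borel_near_mean : borel_bounded near_mean.
Proof.
move=> d T u hu; have [mf _] : bmf (fun t => `|f (u t) - M|).
  by apply: bmf_norm; apply: bmfB; [exact: bf|exact: bmf_cst].
have mA : measurable [set t | `|f (u t) - M| <= 2 * delta].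
  rewrite [X in measurable X](_ : _ = (fun t => `|f (u t) - M|) @^-1` `]-oo, 2 * delta]).
    by rewrite -[X in measurable X]setTI; exact: mf.
  by apply/seteqP; split => t /=; rewrite in_itv.
have := bmf_indic (R := R) mA; congr bmf; apply/funext => t.
by rewrite indicE /near_mean; congr (_%:R); congr nat_of_bool; apply/idP/idP; rewrite inE.
Qed.

Lemma borel_clip : borel_bounded h.
Proof.
move=> d T u hu; have [mf [K hK]] : bmf (fun t => f (u t) - M).
  by apply: bmfB; [exact: bf|exact: bmf_cst].
split.
  by apply: measurable_maxr => //; exact: measurable_minr.
exists (K + `|clip 0|) => t; have := clip_lip (f (u t) - M) 0.
rewrite subr0 => e; have := hK t; have := ler_normD (h (u t) - clip 0) (clip 0).
rewrite subrK /h; lra.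
Qed.

Hypothesis Theta_bound : forall x y (c e : R), dot x x = 1 -> dot y y = 1 -> dot x y = 0 ->
  c ^+ 2 + e ^+ 2 = 1 ->
  \int[tau]_w (near_mean (x *m U w) *
    (W (c *: (x *m U w) + e *: (y *m U w)) - W (c *: (x *m U w) - e *: (y *m U w))) ^+ 2)
    <= e ^+ 2 * Theta.
Hypothesis Theta0 : 0 <= Theta.

Let bU x : bvec (fun w => x *m U w).
Proof. exact: (bvecU hU). Qed.

(* One step of the rotation: x is the midpoint of the two consecutive points, and the
   reflection y -> -y exchanges them. *)
Let step x y (m t : R) : dot x x = 1 -> dot y y = 1 -> dot x y = 0 -> 0 < t -> t <= 1 ->
  C * (2 * t) <= delta ->
  \int[tau]_w (W (cos m *: (x *m U w) - sin m *: (y *m U w)) *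
    (h (cos t *: (x *m U w) - sin t *: (y *m U w)) - h (cos t *: (x *m U w) + sin t *: (y *m U w))))
  <= L * Theta * t.
Proof.
move=> x1 y1 xy t0 t1 Ct.
pose wp x y := W (cos m *: x + sin m *: y).
pose wm x y := W (cos m *: x - sin m *: y).
pose vp x y := W (cos t *: x + sin t *: y).
pose vm x y := W (cos t *: x - sin t *: y).
pose hp x y := h (cos t *: x + sin t *: y).
pose hm x y := h (cos t *: x - sin t *: y).
have bb (F : 'rV[R]_n -> R) (c e : R) x' y' : borel_bounded F ->
    bmf (fun w => F (c *: (x' *m U w) + e *: (y' *m U w))).
  by move=> bF; apply: bF; apply: bvecD; apply: bvecZ.
have bbm (F : 'rV[R]_n -> R) (c e : R) x' y' : borel_bounded F ->
    bmf (fun w => F (c *: (x' *m U w) - e *: (y' *m U w))).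
  by move=> bF; apply: bF; apply: bvecD; [|apply: bvecN]; apply: bvecZ.
have bwp x' y' : bmf (fun w => wp (x' *m U w) (y' *m U w)) by exact: bb.
have bwm x' y' : bmf (fun w => wm (x' *m U w) (y' *m U w)) by exact: bbm.
have bvp x' y' : bmf (fun w => vp (x' *m U w) (y' *m U w)) by exact: bb.
have bvm x' y' : bmf (fun w => vm (x' *m U w) (y' *m U w)) by exact: bbm.
have bhp x' y' : bmf (fun w => hp (x' *m U w) (y' *m U w)) by apply: bb; exact: borel_clip.
have bhm x' y' : bmf (fun w => hm (x' *m U w) (y' *m U w)) by apply: bbm; exact: borel_clip.
have bg : bmf (fun w => near_mean (x *m U w)) by exact: borel_near_mean.
have Tm := Theta_bound x1 y1 xy (cos2Dsin2 m).
have Tt := Theta_bound x1 y1 xy (cos2Dsin2 t).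
have unit_p w (c e : R) : c ^+ 2 + e ^+ 2 = 1 ->
    dot (c *: (x *m U w) + e *: (y *m U w)) (c *: (x *m U w) + e *: (y *m U w)) = 1.
  by move=> ce; apply: etrans ce; rewrite !dotE !(dotU hU) x1 y1 (dotC y) xy; ring.
have pt w : (wm (x *m U w) (y *m U w) - wp (x *m U w) (y *m U w)) *
    (hm (x *m U w) (y *m U w) - hp (x *m U w) (y *m U w)) <=
    L / 2 * (t * (near_mean (x *m U w) * (wp (x *m U w) (y *m U w) - wm (x *m U w) (y *m U w)) ^+ 2) +
      t^-1 * (near_mean (x *m U w) * (vp (x *m U w) (y *m U w) - vm (x *m U w) (y *m U w)) ^+ 2)).
  set A := wm _ _ - wp _ _; set B := hm _ _ - hp _ _.
  set x' := x *m U w; set y' := y *m U w.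
  have x'1 : dot x' x' = 1 by rewrite (dotU hU).
  have y'1 : dot y' y' = 1 by rewrite (dotU hU).
  have cst : 0 <= t <= 1 by rewrite ltW.
  have /andP[c0 c1] := one_sub_cos_le cst.
  have s1 := norm_sin_le (ltW t0).
  have close (e : R) : `|e| <= t -> `|f (cos t *: x' + e *: y') - f x'| <= delta.
    move=> et; apply: le_trans (fL _ _) (le_trans _ Ct); apply: ler_wpM2l => //.
    have -> : cos t *: x' + e *: y' - x' = - (1 - cos t) *: x' + e *: y'.
      by rewrite opprB scalerBl scale1r addrAC.
    apply: le_trans (enormD _ _) _; rewrite !enormZ normrN (ger0_norm c0).
    by rewrite (proj2 (enorm_eq1 x') x'1) (proj2 (enorm_eq1 y') y'1) !mulr1; lra.
  have hpl := close (sin t) s1.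
  have hml := close (- sin t); rewrite normrN scaleNr in hml; have {hml}hml := hml s1.
  have hB : `|B| <= near_mean x' * (L * `|vp x' y' - vm x' y'|).
    rewrite /near_mean; have [far|far] := leP `|f x' - M| (2 * delta); last first.
      have -> : B = 0.
        apply/eqP; rewrite subr_eq0; apply/eqP; apply: (clip_far far).
          by rewrite (_ : _ - M - (f x' - M) = f (cos t *: x' - sin t *: y') - f x')//; ring.
        by rewrite (_ : _ - M - (f x' - M) = f (cos t *: x' + sin t *: y') - f x')//; ring.
      by rewrite normr0 mul0r.
    rewrite mul1r; apply: le_trans (clip_lip _ _) _.
    rewrite (_ : _ - M - _ = f (cos t *: x' - sin t *: y') - f (cos t *: x' + sin t *: y')); last by ring.
    rewrite distrC; apply: (proj1 (fW _ _)); first exact: unit_p (cos2Dsin2 t).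
    by rewrite -scaleNr; apply: unit_p; rewrite sqrrN cos2Dsin2.
  apply: le_trans (ler_norm _) _; rewrite normrM.
  apply: le_trans (ler_wpM2l (normr_ge0 A) hB) _.
  have nA : `|A| = `|wp x' y' - wm x' y'| by rewrite distrC.
  rewrite nA -(real_normK (num_real (wp x' y' - wm x' y'))).
  rewrite -(real_normK (num_real (vp x' y' - vm x' y'))).
  set P := `|_|; set Q := `|_|; set g := near_mean x'.
  have g0 : 0 <= g by rewrite /g /near_mean ler0n.
  (* Arithmetic-geometric mean with weight t: P spans an angle of order one and Q an angle of order
     t, so both weighted squares contribute order t. *)
  have -> : L / 2 * (t * (g * P ^+ 2) + t^-1 * (g * Q ^+ 2)) =
     P * (g * (L * Q)) + L * g / (2 * t) * (t * P - Q) ^+ 2 by field; exact: lt0r_neq0.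
  by rewrite lerDl mulr_ge0 ?sqr_ge0// divr_ge0 ?mulr_ge0// ltW.
(* Averaging with the image under y -> -y, which reverses the increment of h, replaces the value of
   W by an increment of W across x. *)
have -> : \int[tau]_w (wm (x *m U w) (y *m U w) *
     (hm (x *m U w) (y *m U w) - hp (x *m U w) (y *m U w))) =
   2^-1 * \int[tau]_w ((wm (x *m U w) (y *m U w) - wp (x *m U w) (y *m U w)) *
    (hm (x *m U w) (y *m U w) - hp (x *m U w) (y *m U w))).
  pose H x y := wm x y * (hm x y - hp x y).
  have bH x' y' : bmf (fun w => H (x' *m U w) (y' *m U w)).
    by apply: bmfM => //; exact: bmfB.
  have e : \int[tau]_w H (x *m U w) (- y *m U w) = \int[tau]_w H (x *m U w) (y *m U w).
    by apply: (haar_congruence2 hU (H := H)) => //; rewrite !dotE ?opprK// xy oppr0.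
  have e2 w : (wm (x *m U w) (y *m U w) - wp (x *m U w) (y *m U w)) *
    (hm (x *m U w) (y *m U w) - hp (x *m U w) (y *m U w)) =
    H (x *m U w) (y *m U w) + H (x *m U w) (- y *m U w).
    by rewrite /H /wm /wp /hm /hp mulNmx !scalerN !opprK; ring.
  under [in RHS]eq_Rintegral do rewrite e2.
  rewrite (bintD tau (bH _ _) (bH _ _)) e.
  have hz (z : R) : z = 2^-1 * (z + z) by field.
  exact: hz.
have b1 : bmf (fun w => near_mean (x *m U w) * (wp (x *m U w) (y *m U w) - wm (x *m U w) (y *m U w)) ^+ 2).
  by apply: bmfM => //; apply: bmfX; exact: bmfB.
have b2 : bmf (fun w => near_mean (x *m U w) * (vp (x *m U w) (y *m U w) - vm (x *m U w) (y *m U w)) ^+ 2).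
  by apply: bmfM => //; apply: bmfX; exact: bmfB.
have b3 : bmf (fun w => t * (near_mean (x *m U w) * (wp (x *m U w) (y *m U w) - wm (x *m U w) (y *m U w)) ^+ 2)).
  by apply: bmfM => //; exact: bmf_cst.
have b4 : bmf (fun w => t^-1 * (near_mean (x *m U w) * (vp (x *m U w) (y *m U w) - vm (x *m U w) (y *m U w)) ^+ 2)).
  by apply: bmfM => //; exact: bmf_cst.
have b5 := bmfD b3 b4.
have b6 := bmfM (bmf_cst (L / 2)) b5.
have b0 : bmf (fun w => (wm (x *m U w) (y *m U w) - wp (x *m U w) (y *m U w)) *
    (hm (x *m U w) (y *m U w) - hp (x *m U w) (y *m U w))) by apply: bmfM; exact: bmfB.
have h1 := bint_le tau b0 b6 pt.
rewrite (bintZ tau _ b5) (bintD tau b3 b4) (bintZ tau _ b1) (bintZ tau _ b2) in h1.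
have sm : sin m ^+ 2 * Theta <= Theta.
  have s1 : sin m ^+ 2 <= 1 by rewrite -[leRHS](cos2Dsin2 m) lerDr sqr_ge0.
  by have := ler_wpM2r Theta0 s1; rewrite mul1r.
have st : sin t ^+ 2 * Theta <= t ^+ 2 * Theta.
  apply: ler_wpM2r => //; rewrite -(real_normK (num_real (sin t))).
  by apply: lerXn2r; rewrite ?nnegrE ?(ltW t0)//; exact: norm_sin_le (ltW t0).
have i1 := ler_wpM2l (ltW t0) (le_trans Tm sm).
have ti : 0 <= t^-1 by rewrite invr_ge0 ltW.
have i2 := ler_wpM2l ti (le_trans Tt st).
have i3 : t^-1 * (t ^+ 2 * Theta) = t * Theta by field; exact: lt0r_neq0.
rewrite i3 in i2.
have LL : 0 <= L / 2 by rewrite divr_ge0.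
have i4 := le_trans h1 (ler_wpM2l LL (lerD i1 i2)).
have half0 : 0 <= 2^-1 :> R by rewrite invr_ge0.
apply: le_trans (ler_wpM2l half0 i4) _.
have LTt : 0 <= L * Theta * t by rewrite mulr_ge0 ?mulr_ge0// ltW.
have -> : 2^-1 * (L / 2 * (t * Theta + t * Theta)) = 2^-1 * (L * Theta * t) by field.
by apply: ler_piMl; [exact: LTt|rewrite invf_le1 ?ltr0n// ler1n].
Qed.

(** With W held at a, the increment of h from a to b telescopes along the great circle. Each step
    contributes L Theta t, and N t is half the angle between a and b, so refining the path costs
    nothing. *)
Let covariance_W a b : dot a a = 1 -> dot b b = 1 ->
  \int[tau]_w ((W (a *m U w) - W (b *m U w)) * (h (a *m U w) - h (b *m U w))) <= 2 * pi * L * Theta.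
Proof.
move=> a1 b1; have pi0 := @pi_ge0 R.
have R0 : 0 <= 2 * pi * L * Theta by rewrite !mulr_ge0.
have db := dot_unit_bound a1 b1.
have dI : dot a b \in `[(-1), 1] by rewrite in_itv.
set al := acos (dot a b).
have cal : cos al = dot a b by exact: (acosK dI).
have al0 : 0 <= al by exact: acos_ge0.
have alpi : al <= pi by exact: acos_lepi.
have cs := cos2Dsin2 al.
(* Here b = a or b = -a, and W has no increment because it is even. *)
have [s0|s0] := eqVneq (sin al) 0.
  have : (dot a b - 1) * (dot a b + 1) = 0 by rewrite -cal; rewrite s0 in cs; nra.
  move=> /eqP; rewrite mulf_eq0 => /orP[] /eqP e.
    have ab : a - b = 0 by apply: dot_eq0; rewrite dot_subsq// (dotC b); lra.
    move/subr0_eq: ab => <-; under eq_Rintegral do rewrite !subrr mulr0.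
    by rewrite pint_cst.
  have ab : a + b = 0.
    by apply: dot_eq0; rewrite !dotE a1 b1 (dotC b); lra.
  have -> : b = - a by apply/eqP; rewrite -addr_eq0 addrC ab.
  under eq_Rintegral do rewrite mulNmx WN subrr mul0r.
  by rewrite pint_cst.
have al_gt0 : 0 < al by rewrite lt_neqAle al0 andbT; apply: contra_neq s0 => <-; rewrite sin0.
set e := (sin al)^-1 *: (b - dot a b *: a).
have ae : dot a e = 0 by rewrite /e !dotE a1 mulr1 subrr mulr0.
have e1 : dot e e = 1.
  rewrite /e !dotE a1 b1 (dotC b) -cal; have := cs.
  set c := cos al; set s := sin al in s0 * => cs'.
  have -> : s^-1 * (s^-1 * (1 - c * c) - c * (s^-1 * (c - c * 1))) = (1 - c ^+ 2) / s ^+ 2.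
    by field.
  by rewrite (_ : 1 - c ^+ 2 = s ^+ 2) ?divff ?expf_neq0//; lra.
have bE : b = cos al *: a + sin al *: e.
  by rewrite /e scalerA divff// scale1r cal addrC subrK.
clearbody e.
(* Fine enough that the half step t is at most 1 and f moves by at most delta from the midpoint to
   either end, as [clip_far] demands. *)
pose N := (Num.truncn (al + C * al / delta)).+1.
have NR : al + C * al / delta < N%:R by exact: truncnS_gt.
have N0 : (0 : R) < N%:R by rewrite ltr0n.
have q0 : 0 <= C * al / delta by rewrite divr_ge0 ?mulr_ge0// ltW.
pose t := al / N%:R / 2.
have t0 : 0 < t by rewrite !divr_gt0.
have alN : al / N%:R <= 1 by rewrite ler_pdivrMr// mul1r; lra.
have t1 : t <= 1 by rewrite /t; lra.
have Ct : C * (2 * t) <= delta.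
  have -> : C * (2 * t) = C * al / N%:R by rewrite /t; field; exact: lt0r_neq0.
  have CN : C * al / delta <= N%:R by lra.
  by rewrite ler_pdivrMr// (mulrC delta) -ler_pdivrMr.
pose p (j : nat) := cos (j%:R * (2 * t)) *: a + sin (j%:R * (2 * t)) *: e.
have p1 j : dot (p j) (p j) = 1.
  by rewrite -[RHS](cos2Dsin2 (j%:R * (2 * t))) !dotE a1 e1 (dotC e) ae; ring.
have p0 : p 0%N = a by rewrite /p mul0r cos0 sin0 scale1r scale0r addr0.
have pN : p N = b.
  by rewrite /p (_ : N%:R * (2 * t) = al) ?bE// /t; field; exact: lt0r_neq0.
have bh := borel_clip.
pose D a b := W a * (h a - h b).
have bD x y z : bmf (fun w => W (x *m U w) * (h (y *m U w) - h (z *m U w))).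
  by apply: bmfM; [exact: bW|apply: bmfB; exact: bh].
have st j : \int[tau]_w (W (a *m U w) * (h (p j *m U w) - h (p j.+1 *m U w))) <= L * Theta * t.
  (* The midpoint of the arc from p j to p (j+1), at angle m from a; y is the unit tangent there. *)
  pose m := (j%:R * (2 * t) + t); pose x := cos m *: a + sin m *: e.
  pose y := cos m *: e - sin m *: a.
  have x1 : dot x x = 1 by rewrite -[RHS](cos2Dsin2 m) !dotE a1 e1 (dotC e) ae; ring.
  have y1 : dot y y = 1 by rewrite -[RHS](cos2Dsin2 m) !dotE a1 e1 (dotC e) ae; ring.
  have xy : dot x y = 0 by rewrite !dotE a1 e1 (dotC e) ae; ring.
  have := step m x1 y1 xy t0 t1 Ct; congr (_ <= _); apply: eq_Rintegral => w _.
  have E1 : cos m *: x - sin m *: y = a.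
    apply/rowP => i; rewrite !mxE.
    transitivity ((cos m ^+ 2 + sin m ^+ 2) * a 0 i); first by ring.
    by rewrite cos2Dsin2 mul1r.
  have E2 : cos t *: x - sin t *: y = p j.
    have -> : p j = cos (m - t) *: a + sin (m - t) *: e by rewrite /p /m addrK.
    by rewrite cosB sinB; apply/rowP => i; rewrite !mxE; ring.
  have E3 : cos t *: x + sin t *: y = p j.+1.
    have jm : j.+1%:R * (2 * t) = m + t by rewrite /m -natr1; ring.
    rewrite /p jm (cosD m t) (sinD m t) {jm}; move: (cos m) (sin m) (cos t) (sin t) @x @y {x1 y1 xy E1 E2}.
    by move=> cm sm ct st x y; apply/rowP => i; rewrite !mxE; ring.
  by rewrite !scalemxAl -!mulmxBl -!mulmxDl E1 E2 E3.
have tel : \int[tau]_w (W (a *m U w) * (h (a *m U w) - h (b *m U w))) <= L * Theta * (N%:R * t).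
  have -> : \int[tau]_w (W (a *m U w) * (h (a *m U w) - h (b *m U w))) =
     \sum_(j < N) \int[tau]_w (W (a *m U w) * (h (p j *m U w) - h (p j.+1 *m U w))).
    rewrite -(bint_sum tau _ _ (fun j : (ordinal N) => bD a (p j) (p j.+1))).
    apply: eq_Rintegral => w _; rewrite -mulr_sumr; congr (_ * _).
    have tele (v : nat -> R) : \sum_(j < N) (v j - v j.+1) = v 0%N - v N.
      rewrite -(big_mkord xpredT (fun j => v j - v j.+1)).
      under eq_bigr do rewrite -opprB.
      by rewrite sumrN telescope_sumr// opprB.
    by rewrite (tele (fun j => h (p j *m U w))) p0 pN.
  apply: le_trans (ler_sum _ (fun j _ => st (nat_of_ord j))) _.
  by rewrite sumr_const card_ord -mulr_natl le_eqVlt; apply/orP; left; apply/eqP; ring.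
have sw : \int[tau]_w (W (b *m U w) * (h (b *m U w) - h (a *m U w))) =
    \int[tau]_w (W (a *m U w) * (h (a *m U w) - h (b *m U w))).
  apply: (haar_congruence2 hU (H := D)); rewrite ?a1 ?b1// 1?dotC//.
  exact: bD.
have -> : \int[tau]_w ((W (a *m U w) - W (b *m U w)) * (h (a *m U w) - h (b *m U w))) =
    \int[tau]_w (W (a *m U w) * (h (a *m U w) - h (b *m U w)) +
      W (b *m U w) * (h (b *m U w) - h (a *m U w))).
  by apply: eq_Rintegral => w _; ring.
rewrite (bintD tau (bD a a b) (bD b b a)) sw.
have Nt : N%:R * t = al / 2 by rewrite /t; field; exact: lt0r_neq0.
rewrite Nt in tel.
have LT : 0 <= L * Theta by rewrite mulr_ge0.
have := ler_wpM2l LT alpi; have := mulr_ge0 LT pi0.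
have fin (I A P : R) : I <= L * Theta * (A / 2) -> L * Theta * A <= L * Theta * P ->
  0 <= L * Theta * P -> I + I <= 2 * P * L * Theta by lra.
move=> LTpi LTal; exact: fin tel LTal LTpi.
Qed.

Hypotheses (a01 : dot a0 a0 = 1) (ME : M = \int[tau]_w f (a0 *m U w)).

(** Increments of f, W and the truncation share their sign, so the covariance of f with its
    truncation is at most L times that of W; the latter is bounded along great circles, the former
    from below by [clip_lower]. *)
Theorem truncated_deviation :
  2 * delta ^+ 2 * (1 - \int[tau]_w near_mean (a0 *m U w)) <= pi * L ^+ 2 * Theta /\
  delta * ((\int[tau]_w `|f (a0 *m U w) - M|) - delta) <= pi * L ^+ 2 * Theta.
Proof.
have bh := borel_clip; have b0 := bU a0.
have bfM : bmf (fun w => f (a0 *m U w) - M) by apply: bmfB; [exact: bf|exact: bmf_cst].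
have bcl : bmf (fun w => (f (a0 *m U w) - M) * h (a0 *m U w)) by apply: bmfM => //; exact: bh.
have cov : \int[tau]_w ((f (a0 *m U w) - M) * h (a0 *m U w)) <= pi * L ^+ 2 * Theta.
  rewrite {1}ME; apply: (decoupled_covariance hU bf a01 bh) => b b1.
  have bWh : bmf (fun w => (W (a0 *m U w) - W (b *m U w)) * (h (a0 *m U w) - h (b *m U w))).
    by apply: bmfM; apply: bmfB; [exact: bW|exact: bW|exact: bh|exact: bh].
  have bfh : bmf (fun w => (f (a0 *m U w) - f (b *m U w)) * (h (a0 *m U w) - h (b *m U w))).
    by apply: bmfM; apply: bmfB; [exact: bf|exact: bf|exact: bh|exact: bh].
  have bLW := bmfM (bmf_cst L) bWh.
  apply: le_trans (bint_le tau bfh bLW _) _ => [w|].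
    have u1 : dot (a0 *m U w) (a0 *m U w) = 1 by rewrite (dotU hU).
    have v1 : dot (b *m U w) (b *m U w) = 1 by rewrite (dotU hU).
    have [q1 q2] := fW u1 v1.
    have q3 := clip_mono (f (a0 *m U w) - M) (f (b *m U w) - M).
    rewrite (_ : f (a0 *m U w) - M - (f (b *m U w) - M) = f (a0 *m U w) - f (b *m U w)) in q3; last by ring.
    rewrite -/(h _) -/(h _) in q3; move: q1 q2 q3.
    set A := f _ - f _; set B := W _ - W _; set E := h _ - h _ => q1 q2 q3.
    have q4 : `|E| <= `|A|.
      apply: le_trans (clip_lip _ _) _.
      by rewrite (_ : _ - M - _ = A)// /A; ring.
    have [A0|A0|A0] := ltgtP A 0.
    - have B0 : B <= 0 by rewrite -(nmulr_rge0 _ A0).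
      have E0 : E <= 0 by rewrite -(nmulr_rge0 _ A0).
      rewrite ltr0_norm// ler0_norm// in q1.
      have NE0 : 0 <= - E by rewrite oppr_ge0.
      by have := ler_wpM2r NE0 q1; move: A B E {A0 B0 E0 NE0 q1 q2 q3 q4} => A B E; lra.
    - have B0 : 0 <= B by rewrite -(pmulr_rge0 _ A0).
      have E0 : 0 <= E by rewrite -(pmulr_rge0 _ A0).
      rewrite gtr0_norm// ger0_norm// in q1.
      by rewrite mulrA; exact: ler_wpM2r.
    have -> : E = 0 by apply/eqP; rewrite -normr_le0; apply: le_trans q4 _; rewrite A0 normr0.
    by rewrite !mulr0.
  rewrite (bintZ tau _ bWh).
  apply: le_trans (ler_wpM2l L0 (covariance_W a01 b1)) _.
  by rewrite le_eqVlt; apply/orP; left; apply/eqP; ring.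
have bn : bmf (fun w => near_mean (a0 *m U w)) by exact: borel_near_mean.
have bc1 : bmf (fun _ : borelType 'M[R]_n => (1 : R)) by exact: bmf_cst.
have bn1 := bmfB bc1 bn.
have bn2 := bmfM (bmf_cst (2 * delta ^+ 2)) bn1.
have bnf : bmf (fun w => `|f (a0 *m U w) - M|) by exact: bmf_norm.
have bcd : bmf (fun _ : borelType 'M[R]_n => delta) by exact: bmf_cst.
have bn3 := bmfB bnf bcd.
have bn4 := bmfM (bmf_cst delta) bn3.
split; apply: le_trans cov.
  have := bint_le tau bn2 bcl (fun w => proj1 (clip_lower (f (a0 *m U w) - M))).
  by rewrite (bintZ tau _ bn1) (bintB tau bc1 bn) pint_cst.
have := bint_le tau bn4 bcl (fun w => proj2 (clip_lower (f (a0 *m U w) - M))).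
by rewrite (bintZ tau _ bn3) (bintB tau bnf bcd) pint_cst.
Qed.

End TruncatedDeviation.

(** * Near-constant norms *)

Section EvenPolynomials.
Context {R : realType}.
Implicit Types (x y s q : R).

(* The real and imaginary parts of (x + i y)^k. *)
Fixpoint zpow (k : nat) x y : R * R :=
  if k is k'.+1 then (x * (zpow k' x y).1 - y * (zpow k' x y).2,
                      x * (zpow k' x y).2 + y * (zpow k' x y).1)
  else (1, 0).

Lemma zpow_norm k x y : (zpow k x y).1 ^+ 2 + (zpow k x y).2 ^+ 2 = (x ^+ 2 + y ^+ 2) ^+ k.
Proof.
elim: k => [|k IH] /=; first by rewrite expr0n expr1n addr0 expr0.
by rewrite [RHS]exprS -IH; ring.
Qed.

(** The rotated pair is x + i y multiplied by e^(-it). *)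
Lemma zpow_rotate k x y t :
  zpow k (cos t * x + sin t * y) (cos t * y - sin t * x) =
  (cos (k%:R * t) * (zpow k x y).1 + sin (k%:R * t) * (zpow k x y).2,
   cos (k%:R * t) * (zpow k x y).2 - sin (k%:R * t) * (zpow k x y).1).
Proof.
elim: k => [|k IH] /=.
  by rewrite mul0r cos0 sin0 !mul1r !mul0r addr0 subr0.
have -> : k.+1%:R * t = t + k%:R * t by rewrite -natr1 mulrDl mul1r addrC.
rewrite IH cosD sinD /=; congr (_, _); ring.
Qed.

Lemma zpow_le1 k x y : x ^+ 2 + y ^+ 2 <= 1 -> `|(zpow k x y).1| <= 1 /\ `|(zpow k x y).2| <= 1.
Proof.
move=> xy; have h := zpow_norm k x y.
have h1 : (x ^+ 2 + y ^+ 2) ^+ k <= 1 by apply: exprn_ile1 => //; rewrite addr_ge0 ?sqr_ge0.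
have s1 := sqr_ge0 (zpow k x y).1; have s2 := sqr_ge0 (zpow k x y).2.
by split; rewrite -(@ler_pXn2r _ 2)// ?nnegrE// expr1n real_normK ?num_real//; lra.
Qed.

(* (evenpoly j x y).1 is the polynomial in s^2 equal to the even part in q of (s x + q y)^(2 j) when
   q^2 = 1 - s^2; the pair carries two consecutive terms of its linear recurrence. *)
Fixpoint evenpoly (j : nat) x y : {poly R} * {poly R} :=
  if j is j'.+1 then
    let P := (evenpoly j' x y).1 in let Q := (evenpoly j' x y).2 in
    (Q, (2 * y ^+ 2) *: Q + (2 * (x ^+ 2 - y ^+ 2)) *: ('X * Q) -
      (y ^+ 4 *: P - (2 * y ^+ 2 * (x ^+ 2 + y ^+ 2)) *: ('X * P) +
       (x ^+ 2 + y ^+ 2) ^+ 2 *: ('X * ('X * P))))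
  else (1%:P, (y ^+ 2)%:P + (x ^+ 2 - y ^+ 2) *: 'X).

Lemma evenpoly_horner j x y s q : q ^+ 2 = 1 - s ^+ 2 ->
  2 * (evenpoly j x y).1.[s ^+ 2] = (s * x + q * y) ^+ j.*2 + (s * x - q * y) ^+ j.*2.
Proof.
move=> q2; suff : 2 * (evenpoly j x y).1.[s ^+ 2] =
    ((s * x + q * y) ^+ 2) ^+ j + ((s * x - q * y) ^+ 2) ^+ j /\
  2 * (evenpoly j x y).2.[s ^+ 2] =
    ((s * x + q * y) ^+ 2) ^+ j.+1 + ((s * x - q * y) ^+ 2) ^+ j.+1.
  by case=> -> _; rewrite -!exprM mul2n.
elim: j => [|j [IH1 IH2]] /=.
  rewrite !(hornerD, hornerZ, hornerX, hornerC) !expr0 !expr1; split; first by ring.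
  have -> : (s * x + q * y) ^+ 2 + (s * x - q * y) ^+ 2 = 2 * (s ^+ 2 * x ^+ 2 + q ^+ 2 * y ^+ 2) by ring.
  by rewrite q2; ring.
split=> //; rewrite !(hornerD, hornerN, hornerZ, hornerM, hornerX).
move: IH1 IH2; set P := (evenpoly j x y).1.[_]; set Q := (evenpoly j x y).2.[_] => IH1 IH2.
set A := (s * x + q * y) ^+ 2 in IH1 IH2 *; set B := (s * x - q * y) ^+ 2 in IH1 IH2 *.
have AB : A + B = 2 * (y ^+ 2 + s ^+ 2 * (x ^+ 2 - y ^+ 2)).
  by transitivity (2 * (s ^+ 2 * x ^+ 2 + q ^+ 2 * y ^+ 2)); [rewrite /A /B; ring|rewrite q2; ring].
have PAB : A * B = (y ^+ 2 - s ^+ 2 * (x ^+ 2 + y ^+ 2)) ^+ 2.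
  transitivity ((s ^+ 2 * x ^+ 2 - q ^+ 2 * y ^+ 2) ^+ 2); first by rewrite /A /B; ring.
  by rewrite q2; ring.
(* Newton's recurrence for A^j + B^j; the condition on q makes A + B and A B polynomials in s^2. *)
transitivity ((A + B) * (2 * Q) - A * B * (2 * P)); first by rewrite AB PAB; ring.
by rewrite IH1 IH2 !exprS; ring.
Qed.

Lemma evenpoly_coefS j x y i : (evenpoly j.+1 x y).2`_i =
  2 * y ^+ 2 * (evenpoly j x y).2`_i +
  2 * (x ^+ 2 - y ^+ 2) * (if i == 0%N then 0 else (evenpoly j x y).2`_i.-1) -
  (y ^+ 4 * (evenpoly j x y).1`_i -
   2 * y ^+ 2 * (x ^+ 2 + y ^+ 2) * (if i == 0%N then 0 else (evenpoly j x y).1`_i.-1) +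
   (x ^+ 2 + y ^+ 2) ^+ 2 * (if i == 0%N then 0 else if i.-1 == 0%N then 0
     else (evenpoly j x y).1`_i.-2)).
Proof. by rewrite /= !(coefD, coefB, coefN, coefZ, coefXM). Qed.

Lemma evenpoly_coef0 x y i :
  (evenpoly 0 x y).1`_i = (i == 0%N)%:R /\
  (evenpoly 0 x y).2`_i = (if i == 0%N then y ^+ 2 else 0) + (x ^+ 2 - y ^+ 2) * (i == 1%N)%:R.
Proof. by rewrite /= !(coefD, coefC, coefZ, coefX); split => //; case: (i == 0%N). Qed.

(** To leading order in s the relation q^2 = 1 - s^2 reads q = i s, so the top coefficient is the
    mean of (x + i y)^(2j) and its conjugate. *)
Lemma evenpoly_lead j x y : (evenpoly j x y).1`_j = (zpow j.*2 x y).1 /\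
  forall i, (j < i)%N -> (evenpoly j x y).1`_i = 0.
Proof.
suff : ((evenpoly j x y).1`_j = (zpow j.*2 x y).1 /\
    forall i, (j < i)%N -> (evenpoly j x y).1`_i = 0) /\
  ((evenpoly j x y).2`_j.+1 = (zpow j.+1.*2 x y).1 /\
    forall i, (j.+1 < i)%N -> (evenpoly j x y).2`_i = 0) by case.
elim: j => [|j [[a1 a2] [b1 b2]]].
  have E i := evenpoly_coef0 x y i; split; split.
  - by rewrite (proj1 (E 0%N)).
  - by move=> [|i]// _; rewrite (proj1 (E i.+1)).
  - by rewrite (proj2 (E 1%N)) /= mulr1; ring.
  - by move=> [|[|i]]// _; rewrite (proj2 (E i.+2)) /= mulr0 addr0.
split; first by split; [exact: b1|exact: b2].
split=> [|[|[|i]]// hi]; rewrite evenpoly_coefS /=.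
  rewrite (b2 j.+2)// b1 (a2 j.+2)// (a2 j.+1)// a1 !doubleS /=; ring.
by rewrite (b2 i.+2) ?(b2 i.+1) ?(a2 i.+2) ?(a2 i.+1) ?(a2 i)//; [ring|lia..].
Qed.

(** The recurrence has total weight at most 4 on each of the two preceding terms, and 4 * 8^(j+1) +
    4 * 8^j <= 8^(j+2). *)
Lemma evenpoly_bound j x y i : x ^+ 2 + y ^+ 2 <= 1 -> `|(evenpoly j x y).1`_i| <= 8 ^+ j.
Proof.
move=> xy; have x2 := sqr_ge0 x; have y2 := sqr_ge0 y.
have y4 : `|y ^+ 4| <= 1.
  have -> : y ^+ 4 = (y ^+ 2) ^+ 2 by ring.
  rewrite ger0_norm ?sqr_ge0//; apply: exprn_ile1 => //; lra.
have c1 : `|2 * y ^+ 2| <= 2 by rewrite ger0_norm; lra.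
have c2 : `|2 * (x ^+ 2 - y ^+ 2)| <= 2 by rewrite ler_norml; apply/andP; split; lra.
have c3 : `|2 * y ^+ 2 * (x ^+ 2 + y ^+ 2)| <= 2.
  rewrite ger0_norm; last by rewrite mulr_ge0 ?addr_ge0// mulr_ge0.
  by move: (x ^+ 2) (y ^+ 2) xy x2 y2 => p q *; nra.
have c4 : `|(x ^+ 2 + y ^+ 2) ^+ 2| <= 1.
  by rewrite ger0_norm ?sqr_ge0//; apply: exprn_ile1 => //; rewrite addr_ge0.
have M (b c u v : R) : `|b| <= u -> `|c| <= v -> `|b * c| <= u * v.
  by move=> hb hc; rewrite normrM; apply: ler_pM.
suff : (forall i, `|(evenpoly j x y).1`_i| <= 8 ^+ j) /\
  (forall i, `|(evenpoly j x y).2`_i| <= 8 ^+ j.+1) by case.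
elim: j {i} => [|j [IH1 IH2]]; split=> i.
- rewrite (proj1 (evenpoly_coef0 x y i)) expr0; case: (i == 0%N) => /=; rewrite ?normr1 ?normr0//.
- rewrite (proj2 (evenpoly_coef0 x y i)) expr1.
  case: i => [|[|i]] /=; rewrite ?mulr0 ?mulr1 ?addr0 ?add0r ?normr0//;
  rewrite ler_norml; apply/andP; split; lra.
- exact: IH2.
have Q0 k : `|if k == 0%N then 0 else (evenpoly j x y).2`_i.-1| <= 8 ^+ j.+1.
  by case: ifP => // _; rewrite normr0 exprn_ge0.
have P0 k : `|if k == 0%N then 0 else (evenpoly j x y).1`_i.-1| <= 8 ^+ j.
  by case: ifP => // _; rewrite normr0 exprn_ge0.
have P1 k l : `|if k == 0%N then 0 else if l == 0%N then 0 else (evenpoly j x y).1`_i.-2| <= 8 ^+ j.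
  by case: ifP => _; [rewrite normr0 exprn_ge0|case: ifP => // _; rewrite normr0 exprn_ge0].
rewrite evenpoly_coefS.
have e1 := M _ _ _ _ c1 (IH2 i); have e2 := M _ _ _ _ c2 (Q0 i).
have e3 := M _ _ _ _ y4 (IH1 i); have e4 := M _ _ _ _ c3 (P0 i).
have e5 := M _ _ _ _ c4 (P1 i i.-1).
have tri (a b c e f : R) : `|a + b - (c - e + f)| <= `|a| + `|b| + (`|c| + `|e| + `|f|).
  apply: le_trans (ler_normB _ _) _; apply: lerD; first exact: ler_normD.
  by apply: le_trans (ler_normD _ _) _; rewrite lerD2r; exact: ler_normB.
apply: le_trans (tri _ _ _ _ _) _; have e8 : 0 <= (8 : R) ^+ j by rewrite exprn_ge0.
move: e1 e2 e3 e4 e5; rewrite !(exprS 8); move: (8 ^+ j) e8 => E E0 *; lra.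
Qed.

Lemma bmf_evenpoly {d : measure_display} {T : measurableType d} (X Y : T -> R) j i :
  bmf X -> bmf Y -> bmf (fun w => (evenpoly j (X w) (Y w)).1`_i).
Proof.
move=> bX bY.
suff : (forall i, bmf (fun w => (evenpoly j (X w) (Y w)).1`_i)) /\
  (forall i, bmf (fun w => (evenpoly j (X w) (Y w)).2`_i)) by case.
have bc (c : R) : bmf (fun _ : T => c) by exact: bmf_cst.
elim: j {i} => [|j [IH1 IH2]]; split=> i.
- have -> : (fun w => (evenpoly 0 (X w) (Y w)).1`_i) = (fun=> (i == 0%N)%:R).
    by apply/funext => w; rewrite (proj1 (evenpoly_coef0 _ _ i)).
  exact: bmf_cst.
- have -> : (fun w => (evenpoly 0 (X w) (Y w)).2`_i) =
    (fun w => (if i == 0%N then Y w ^+ 2 else 0) + (X w ^+ 2 - Y w ^+ 2) * (i == 1%N)%:R).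
    by apply/funext => w; rewrite (proj2 (evenpoly_coef0 _ _ i)).
  apply: bmfD; first by case: (i == 0%N) => //; exact: bmfX.
  by apply: bmfM => //; apply: bmfB; exact: bmfX.
- exact: IH2.
under eq_fun do rewrite evenpoly_coefS.
have bX2 := bmfX 2 bX; have bY2 := bmfX 2 bY; have bY4 := bmfX 4 bY.
have bXY := bmfD bX2 bY2; have bXmY := bmfB bX2 bY2.
apply: bmfB.
  by apply: bmfD; apply: bmfM; [exact: bmfM|exact: IH2|exact: bmfM|case: (i == 0%N)].
apply: bmfD; last first.
  by apply: bmfM; [exact: bmfX|case: (i == 0%N) => //; case: (i.-1 == 0%N)].
apply: bmfB; first by apply: bmfM.
apply: bmfM; last by case: (i == 0%N).
by apply: bmfM => //; apply: bmfM.
Qed.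

Lemma powR_tangent_ge0 (s a b : R) : 2 <= s -> 0 <= a -> 0 <= b ->
  s * (a `^ (s - 1) * (b - a)) <= b `^ s - a `^ s.
Proof.
move=> s2 a0 b0; have := powR_tangent a b s2; rewrite (ger0_norm a0) (ger0_norm b0).
have [->|an0] := eqVneq a 0.
  have h : s - 1 != 0 by lra.
  by rewrite mulr0 (powR0 h) !mul0r.
have ap : 0 < a by rewrite lt_neqAle eq_sym an0.
have -> // : a `^ (s - 2) * a = a `^ (s - 1).
rewrite -{2}(powRr1 a0) -powRD; last by rewrite (gt_eqF ap) implybT.
by congr (_ `^ _); ring.
Qed.

Lemma powR_lip1 (s a b : R) : 2 <= s -> 0 <= a <= 1 -> 0 <= b <= 1 ->
  `|a `^ s - b `^ s| <= s * `|a - b|.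
Proof.
move=> s2.
have main (u v : R) : 0 <= v -> v <= u -> u <= 1 -> 0 <= u `^ s - v `^ s <= s * (u - v).
  move=> v0 vu u1; have u0 := le_trans v0 vu.
  have h := powR_tangent_ge0 s2 u0 v0.
  have p1 : u `^ (s - 1) <= 1.
    apply: (@le_trans _ _ (1 `^ (s - 1))); last by rewrite powR1.
    apply: ge0_ler_powR; rewrite ?nnegrE//; lra.
  have p2 : v `^ s <= u `^ s by apply: ge0_ler_powR; rewrite ?nnegrE//; lra.
  have p0 : 0 <= u `^ (s - 1) by exact: powR_ge0.
  apply/andP; split; first lra.
  have : u `^ (s - 1) * (u - v) <= u - v by nra.
  nra.
move=> /andP[a0 a1] /andP[b0 b1]; have [ab|ab] := leP a b.
  have /andP[h1 h2] := main b a a0 ab b1.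
  by rewrite distrC (distrC a) !ger0_norm//; lra.
have /andP[h1 h2] := main a b b0 (ltW ab) a1.
by rewrite !ger0_norm//; lra.
Qed.

(** A first-order Taylor bound for t |t|^p. For equal signs two tangent inequalities enclose the
    remainder; for opposite signs |x| and |y| are at most |y - x|, so that every term is quadratic
    by itself. *)
Lemma odd_power_taylor (p x y : R) : 2 <= p -> `|x| <= 1 -> `|y| <= 1 ->
  `|(`|y| `^ p * y) - (`|x| `^ p * x) - (p + 1) * `|x| `^ p * (y - x)| <=
  (p + 3) ^+ 2 * (y - x) ^+ 2.
Proof.
move=> p2.
have mulE (a : R) : 0 <= a -> a `^ p * a = a `^ (p + 1).
  move=> a0; have [->|an0] := eqVneq a 0.
    by rewrite mulr0 powR0//; lra.
  rewrite -{2}(powRr1 a0) -powRD// (_ : a == 0 = false) ?implybT//; exact/negbTE.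
have pos (a b : R) : 0 <= a <= 1 -> 0 <= b <= 1 ->
    `|b `^ p * b - a `^ p * a - (p + 1) * a `^ p * (b - a)| <= (p + 3) ^+ 2 * (b - a) ^+ 2.
  move=> a01 b01; have /andP[a0 a1] := a01; have /andP[b0 b1] := b01.
  rewrite !mulE//.
  have p3 : 2 <= p + 1 by lra.
  have h1 := powR_tangent_ge0 p3 a0 b0; have h2 := powR_tangent_ge0 p3 b0 a0.
  rewrite addrK in h1 h2.
  have h3 := powR_lip1 p2 b01 a01.
  have h4 : (b `^ p - a `^ p) * (b - a) <= p * (b - a) ^+ 2.
    apply: le_trans (ler_norm _) _; rewrite normrM.
    apply: le_trans (ler_wpM2r (normr_ge0 _) h3) _.
    by rewrite -mulrA -expr2 real_normK ?num_real.
  have h5 := sqr_ge0 (b - a).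
  rewrite ger0_norm; last by lra.
  have : (p + 1) * (p * (b - a) ^+ 2) <= (p + 3) ^+ 2 * (b - a) ^+ 2.
    by rewrite mulrA; apply: ler_wpM2r => //; nra.
  have : (p + 1) * ((b `^ p - a `^ p) * (b - a)) <= (p + 1) * (p * (b - a) ^+ 2).
    by apply: ler_wpM2l => //; lra.
  lra.
have opp (a b : R) : 0 <= a <= 1 -> 0 <= b <= 1 ->
    `|b `^ p * b + a `^ p * a - (p + 1) * a `^ p * (b + a)| <= (p + 3) ^+ 2 * (b + a) ^+ 2.
  move=> /andP[a0 a1] /andP[b0 b1].
  have le_id (c : R) : 0 <= c -> c <= 1 -> 0 <= c `^ p <= c.
    move=> c0 c1; rewrite powR_ge0/=.
    apply: le_trans (powR_le_sqr p2 _) _; first by rewrite c0.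
    by rewrite expr2 ler_piMl.
  have /andP[u0 u1] := le_id a a0 a1; have /andP[v0 v1] := le_id b b0 b1.
  have e1 : 0 <= b `^ p * b <= b * b by rewrite mulr_ge0//=; exact: ler_wpM2r.
  have e2 : 0 <= a `^ p * a <= a * a by rewrite mulr_ge0//=; exact: ler_wpM2r.
  have e3 : 0 <= a `^ p * (b + a) <= a * (b + a).
    by rewrite mulr_ge0 ?addr_ge0//=; apply: ler_wpM2r => //; rewrite addr_ge0.
  have ab0 : 0 <= a * b by rewrite mulr_ge0.
  have p0 : 0 <= p + 1 by lra.
  have /andP[e1a e1b] := e1; have /andP[e2a e2b] := e2; have /andP[e3a e3b] := e3.
  have f1 := ler_wpM2l p0 e3b; have f0 := mulr_ge0 p0 e3a.
  have q2 : p + 3 <= (p + 3) ^+ 2 by nra.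
  have g0 : 0 <= (b + a) ^+ 2 by exact: sqr_ge0.
  have g1 := ler_wpM2r g0 q2.
  have g2 : a * (b + a) <= (b + a) ^+ 2 by nra.
  have g3 := ler_wpM2l p0 g2.
  rewrite ler_norml; apply/andP; split; nra.
move=> x1 y1; have := x1; have := y1; rewrite !(ler_norml _ 1) => /andP[ya yb] /andP[xa xb].
have [x0|x0] := lerP 0 x; have [y0|y0] := lerP 0 y.
- rewrite (ger0_norm x0) (ger0_norm y0); apply: pos; lra.
- rewrite (ger0_norm x0) (ltr0_norm y0).
  have i1 : 0 <= x <= 1 by rewrite x0.
  have i2 : 0 <= - y <= 1 by lra.
  have := opp x (- y) i1 i2; rewrite -normrN.
  by congr (`|_| <= _); ring.
- rewrite (ltr0_norm x0) (ger0_norm y0).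
  have i1 : 0 <= - x <= 1 by lra.
  have i2 : 0 <= y <= 1 by rewrite y0.
  have := opp (- x) y i1 i2.
  by congr (`|_| <= _); ring.
rewrite (ltr0_norm x0) (ltr0_norm y0).
have i1 : 0 <= - x <= 1 by lra.
have i2 : 0 <= - y <= 1 by lra.
have := pos (- x) (- y) i1 i2; rewrite -normrN.
by congr (`|_| <= _); ring.
Qed.

End EvenPolynomials.

(** * Fourier moments of a random vector in a coordinate plane *)

Section PlanarMoments.
Context {R : realType} {n : nat}.
Variables (tau : probability (borelType 'M[R]_n) R) (U : borelType 'M[R]_n -> 'M[R]_n).
Hypothesis hU : haar_matrix tau U.
Variables (p : R) (p2 : 2 < p) (a t v : 'rV[R]_n).
Hypotheses (a1 : dot a a = 1) (t1 : dot t t = 1) (v1 : dot v v = 1) (tv : dot t v = 0).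

Let X w := dot (t *m U w) a.
Let Y w := dot (v *m U w) a.

Let bX : bmf X.
Proof. by apply: bmf_dot; [exact: (bvecU hU)|exact: bvec_cst]. Qed.
Let bY : bmf Y.
Proof. by apply: bmf_dot; [exact: (bvecU hU)|exact: bvec_cst]. Qed.

Let XY1 w : X w ^+ 2 + Y w ^+ 2 <= 1.
Proof.
have h := dot_ge0 (a - X w *: (t *m U w) - Y w *: (v *m U w)).
rewrite !dotE !(dotU hU) t1 v1 tv (dotC v) tv a1 !(dotC a) -/(X w) -/(Y w) in h.
by move: (X w) (Y w) h => x y h; lra.
Qed.

Let X1 w : `|X w| <= 1.
Proof.
rewrite -(@ler_pXn2r _ 2)// ?nnegrE// expr1n real_normK ?num_real//.
by apply: le_trans (XY1 w); rewrite lerDl sqr_ge0.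
Qed.

Let Y1 w : `|Y w| <= 1.
Proof.
rewrite -(@ler_pXn2r _ 2)// ?nnegrE// expr1n real_normK ?num_real//.
by apply: le_trans (XY1 w); rewrite lerDr sqr_ge0.
Qed.

Let p0 : 0 <= p.
Proof. by apply: le_trans (ltW p2). Qed.

Let bP : bmf (fun w => `|X w| `^ p).
Proof. exact: bmf_powR. Qed.

Let bZ k : bmf (fun w => (zpow k (X w) (Y w)).1) /\ bmf (fun w => (zpow k (X w) (Y w)).2).
Proof.
elim: k => [|k [IH1 IH2]] /=; first by split; exact: bmf_cst.
by split; [apply: bmfB|apply: bmfD]; apply: bmfM.
Qed.

Let rho w := X w ^+ 2 + Y w ^+ 2.

Let brho l : bmf (fun w => rho w ^+ l).
Proof. by apply: bmfX; apply: bmfD; exact: bmfX. Qed.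

Let P1 w : 0 <= `|X w| `^ p <= 1.
Proof.
rewrite powR_ge0/=; have p2' : 2 <= p by exact: ltW.
apply: le_trans (powR_le_sqr p2' _) _; first by rewrite normr_ge0 X1.
by apply: exprn_ile1.
Qed.

Let rho1 l w : 0 <= rho w ^+ l <= 1.
Proof.
have r0 : 0 <= rho w by rewrite addr_ge0 ?sqr_ge0.
rewrite exprn_ge0//=; apply: exprn_ile1; [exact: r0|exact: XY1].
Qed.

Let F (x : R) := `|x| `^ p * x.

Let err : R := (4 * (p + 3) ^+ 2 + 2 * (p + 1)).

(* Pointwise expansion, to first order in the angle, of the function F(x) rho^l Im z^k along a
   rotation of the pair (x, y). *)
Let expansion k (x y u r : R) : x ^+ 2 + y ^+ 2 <= 1 -> `|x| <= 1 -> `|y| <= 1 -> 0 <= r <= 1 ->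
  0 < u -> u * k.+1%:R <= 1 ->
  forall C S, C = r * (zpow k x y).1 -> S = r * (zpow k x y).2 ->
  `|F (cos u * x + sin u * y) * (cos (k%:R * u) * S - sin (k%:R * u) * C) - F x * S -
     u * ((p + 1) * (`|x| `^ p * y * S) - k%:R * (F x * C))| <=
  (err + 2 * k%:R * (err + p + 1) + 2 * k%:R ^+ 2) * u ^+ 2.
Proof.
move=> xy1 x1 y1 /andP[r0 r1] u0 uk C S CE SE.
have [z1 z2] := zpow_le1 k xy1.
have hp : 2 <= p by exact: ltW.
have C1 : `|C| <= 1.
  by rewrite CE normrM (ger0_norm r0); apply: mulr_ile1.
have S1 : `|S| <= 1.
  by rewrite SE normrM (ger0_norm r0); apply: mulr_ile1.
have k0 : (0 : R) <= k%:R by exact: ler0n.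
have uk' : u * k%:R + u <= 1 by rewrite -natr1 in uk; lra.
have ku0 : 0 <= k%:R * u by rewrite mulr_ge0// ltW.
have u1 : u <= 1 by lra.
have ku1 : k%:R * u <= 1 by lra.
have small (e : R) : 0 <= e -> e <= 1 -> [/\ `|sin e| <= e, `|cos e - 1| <= e ^+ 2 & `|sin e - e| <= e ^+ 2].
  move=> e0 e1; have pi2 := @pi_ge2 R.
  have s0 : 0 <= sin e by apply: sin_ge0_pi; lra.
  have s1 := sin_le_id e0.
  have c0 : 0 <= cos e by apply: cos_ge0_pihalf; lra.
  have c1 := cos_le1 e; have cs := cos2Dsin2 e.
  have s2 : sin e ^+ 2 <= e ^+ 2 by apply: lerXn2r.
  have c2 : 1 - cos e <= e ^+ 2 by nra.
  split; first by rewrite ger0_norm.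
    by rewrite distrC ger0_norm//; lra.
  have cont : {within `[0, e], continuous (@sin R)}.
    by apply: continuous_subspaceT => z; exact: continuous_sin.
  have [c cI] := MVT_segment e0 (fun z _ => is_derive_sin z) cont.
  rewrite sin0 !subr0 => sE; move: cI; rewrite in_itv/= => /andP[cc0 cc1].
  have /andP[_ h2] : 0 <= 1 - cos c <= c by apply: one_sub_cos_le; rewrite cc0; lra.
  rewrite distrC ger0_norm; last by lra.
  by rewrite sE; nra.
have [su cu su2] := small u (ltW u0) u1.
have [sk ck sk2] := small (k%:R * u) ku0 ku1.
set x' := cos u * x + sin u * y.
have x'1 : `|x'| <= 1.
  rewrite -(@ler_pXn2r _ 2)// ?nnegrE// expr1n real_normK ?num_real//.
  have cs := cos2Dsin2 u.
  have : x' ^+ 2 + (cos u * y - sin u * x) ^+ 2 = (cos u ^+ 2 + sin u ^+ 2) * (x ^+ 2 + y ^+ 2).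
    by rewrite /x'; ring.
  rewrite cs mul1r; have := sqr_ge0 (cos u * y - sin u * x); lra.
have dx : x' - x = (cos u - 1) * x + sin u * y by rewrite /x'; ring.
have M (b c e f : R) : `|b| <= e -> `|c| <= f -> `|b * c| <= e * f.
  by move=> hb hc; rewrite normrM; apply: ler_pM.
have u2u : u ^+ 2 <= u by rewrite expr2 ler_piMl// ltW.
have d1 : `|x' - x| <= 2 * u.
  rewrite dx; apply: le_trans (ler_normD _ _) _.
  have := M _ _ _ _ cu x1; have := M _ _ _ _ su y1; lra.
have d2 : `|x' - x - u * y| <= 2 * u ^+ 2.
  have -> : x' - x - u * y = (cos u - 1) * x + (sin u - u) * y by rewrite dx; ring.
  apply: le_trans (ler_normD _ _) _.
  have := M _ _ _ _ cu x1; have := M _ _ _ _ su2 y1; lra.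
have px : `| `|x| `^ p| <= 1.
  rewrite ger0_norm ?powR_ge0//; apply: le_trans (powR_le_sqr hp _) _.
    by rewrite normr_ge0 x1.
  by apply: exprn_ile1.
have p10 : 0 <= p + 1 by lra.
have dF1 : `|F x' - F x - u * ((p + 1) * (`|x| `^ p * y))| <= err * u ^+ 2.
  have h1 := odd_power_taylor hp x1 x'1; rewrite -/(F x) -/(F x') in h1.
  have h2 : (x' - x) ^+ 2 <= 4 * u ^+ 2.
    rewrite -(real_normK (num_real (x' - x))) (_ : 4 * u ^+ 2 = (2 * u) ^+ 2); last by ring.
    by apply: lerXn2r; rewrite ?nnegrE// mulr_ge0// ltW.
  have h3 : `|(p + 1) * (`|x| `^ p * (x' - x - u * y))| <= (p + 1) * (1 * (2 * u ^+ 2)).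
    by apply: (M); [rewrite ger0_norm|exact: (M)].
  have -> : F x' - F x - u * ((p + 1) * (`|x| `^ p * y)) =
    (F x' - F x - (p + 1) * `|x| `^ p * (x' - x)) + (p + 1) * (`|x| `^ p * (x' - x - u * y)) by ring.
  apply: le_trans (ler_normD _ _) _.
  have h4 : (p + 3) ^+ 2 * (x' - x) ^+ 2 <= (p + 3) ^+ 2 * (4 * u ^+ 2).
    by apply: ler_wpM2l => //; exact: sqr_ge0.
  rewrite /err; lra.
have err0 : 0 <= err by rewrite /err addr_ge0// mulr_ge0 ?sqr_ge0.
have dF2 : `|F x' - F x| <= (err + p + 1) * u.
  have h3 : `|u * ((p + 1) * (`|x| `^ p * y))| <= u * ((p + 1) * (1 * 1)).
    by apply: (M); [rewrite ger0_norm// ltW|apply: (M); [rewrite ger0_norm|exact: (M)]].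
  have -> : F x' - F x = (F x' - F x - u * ((p + 1) * (`|x| `^ p * y))) +
    u * ((p + 1) * (`|x| `^ p * y)) by ring.
  apply: le_trans (ler_normD _ _) _.
  have := ler_wpM2l err0 u2u; lra.
have Fx : `|F x| <= 1 * 1 by apply: M.
set E := F x' - F x in dF1 dF2.
have -> : F x' * (cos (k%:R * u) * S - sin (k%:R * u) * C) - F x * S -
     u * ((p + 1) * (`|x| `^ p * y * S) - k%:R * (F x * C)) =
   (E - u * ((p + 1) * (`|x| `^ p * y))) * S +
   E * ((cos (k%:R * u) - 1) * S - sin (k%:R * u) * C) +
   F x * ((cos (k%:R * u) - 1) * S - (sin (k%:R * u) - k%:R * u) * C) by rewrite /E; ring.
have q1 := M _ _ _ _ dF1 S1.
have ku2 : (k%:R * u) ^+ 2 <= k%:R * u by rewrite expr2 ler_piMl.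
have q2 : `|(cos (k%:R * u) - 1) * S - sin (k%:R * u) * C| <= 2 * (k%:R * u).
  apply: le_trans (ler_normB _ _) _.
  have := M _ _ _ _ ck S1; have := M _ _ _ _ sk C1; lra.
have q3 := M _ _ _ _ dF2 q2.
have q4 : `|(cos (k%:R * u) - 1) * S - (sin (k%:R * u) - k%:R * u) * C| <= 2 * (k%:R * u) ^+ 2.
  apply: le_trans (ler_normB _ _) _.
  have := M _ _ _ _ ck S1; have := M _ _ _ _ sk2 C1; lra.
have q5 := M _ _ _ _ Fx q4.
apply: le_trans (ler_normD _ _) _; apply: le_trans (lerD (ler_normD _ _) (lexx _)) _.
apply: le_trans (lerD (lerD q1 q3) q5) _.
rewrite le_eqVlt; apply/orP; left; apply/eqP; ring.
Qed.

Let Ez l k := \int[tau]_w (`|X w| `^ p * (rho w ^+ l * (zpow k (X w) (Y w)).1)).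

Let bEz l k : bmf (fun w => `|X w| `^ p * (rho w ^+ l * (zpow k (X w) (Y w)).1)).
Proof. by apply: bmfM => //; apply: bmfM => //; exact: (proj1 (bZ k)). Qed.

(* Stationarity under rotations of the (t, v)-plane. *)
Let angular_identity l k :
  \int[tau]_w ((p + 1) * (`|X w| `^ p * Y w * (rho w ^+ l * (zpow k (X w) (Y w)).2)) -
    k%:R * (F (X w) * (rho w ^+ l * (zpow k (X w) (Y w)).1))) = 0.
Proof.
set D := fun w => (p + 1) * (`|X w| `^ p * Y w * (rho w ^+ l * (zpow k (X w) (Y w)).2)) -
    k%:R * (F (X w) * (rho w ^+ l * (zpow k (X w) (Y w)).1)).
have bF : bmf (fun w => F (X w)) by apply: bmfM.
have bS : bmf (fun w => rho w ^+ l * (zpow k (X w) (Y w)).2) by apply: bmfM => //; exact: (proj2 (bZ k)).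
have bC : bmf (fun w => rho w ^+ l * (zpow k (X w) (Y w)).1) by apply: bmfM => //; exact: (proj1 (bZ k)).
have bD : bmf D.
  apply: bmfB; apply: bmfM; [exact: bmf_cst| |exact: bmf_cst|exact: bmfM].
  by apply: bmfM => //; exact: bmfM.
set K := err + 2 * k%:R * (err + p + 1) + 2 * k%:R ^+ 2.
pose G (x y : 'rV[R]_n) := F (dot x a) *
  ((dot x a ^+ 2 + dot y a ^+ 2) ^+ l * (zpow k (dot x a) (dot y a)).2).
(* Rotating the pair (t, v) by the angle u leaves the integral of G unchanged, so the first-order
   term alone must be of second order in u. *)
have main u : 0 < u -> u * k.+1%:R <= 1 -> `|u * \int[tau]_w D w| <= K * u ^+ 2.
  move=> u0 uk; have cs := cos2Dsin2 u.
  pose t' := cos u *: t + sin u *: v; pose v' := cos u *: v - sin u *: t.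
  pose G1 w := F (cos u * X w + sin u * Y w) *
    (cos (k%:R * u) * (rho w ^+ l * (zpow k (X w) (Y w)).2) -
     sin (k%:R * u) * (rho w ^+ l * (zpow k (X w) (Y w)).1)).
  pose G0 w := F (X w) * (rho w ^+ l * (zpow k (X w) (Y w)).2).
  have bG0 : bmf G0 by apply: bmfM.
  have bxu : bmf (fun w => cos u * X w + sin u * Y w).
    by apply: bmfD; apply: bmfM => //; exact: bmf_cst.
  have bG1 : bmf G1.
    apply: bmfM; first by apply: bmfM => //; apply: bmf_powR.
    by apply: bmfB; apply: bmfM => //; exact: bmf_cst.
  have GE w : G (t' *m U w) (v' *m U w) = G1 w.
    have e1 : dot (t' *m U w) a = cos u * X w + sin u * Y w.
      by rewrite /t' mulmxDl -!scalemxAl !dotE.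
    have e2 : dot (v' *m U w) a = cos u * Y w - sin u * X w.
      by rewrite /v' mulmxBl -!scalemxAl !dotE.
    rewrite /G /G1 e1 e2 zpow_rotate /=.
    have -> : (cos u * X w + sin u * Y w) ^+ 2 + (cos u * Y w - sin u * X w) ^+ 2 = rho w.
      by transitivity ((cos u ^+ 2 + sin u ^+ 2) * rho w); [rewrite /rho; ring|rewrite cs mul1r].
    by congr (_ * _); ring.
  have I : \int[tau]_w G1 w = \int[tau]_w G0 w.
    transitivity (\int[tau]_w G (t' *m U w) (v' *m U w)).
      by apply: eq_Rintegral => w _; rewrite GE.
    apply: (haar_congruence2 hU (H := G)).
    - by rewrite t1 -cs !dotE t1 v1 tv (dotC v) tv; ring.
    - by rewrite v1 -cs !dotE t1 v1 tv (dotC v) tv; ring.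
    - by rewrite tv !dotE t1 v1 tv (dotC v) tv; ring.
    by have := bG1; congr bmf; apply/funext => w; rewrite GE.
  have b1 := bmfB bG1 bG0.
  have buD := bmfM (bmf_cst u) bD.
  have b2 := bmfB b1 buD.
  have e : \int[tau]_w (G1 w - G0 w - u * D w) = - (u * \int[tau]_w D w).
    by rewrite (bintB tau b1 buD) (bintB tau bG1 bG0) I subrr sub0r (bintZ tau _ bD).
  rewrite -normrN -e; apply: le_trans (bint_norm tau b2) _.
  rewrite -[leRHS](pint_cst tau); apply: (bint_le tau (bmf_norm b2) (bmf_cst _)) => w.
  exact: (expansion (k := k) (XY1 w) (X1 w) (Y1 w) (rho1 l w) u0 uk erefl erefl).
have K0 : 0 <= K.
  have e0 : 0 <= err.
    by rewrite /err; have hp := p2; apply: addr_ge0; apply: mulr_ge0; rewrite ?sqr_ge0//; lra.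
  have hp := p0.
  have a1' : 0 <= err + p + 1 by lra.
  rewrite /K; apply: addr_ge0; last by apply: mulr_ge0 => //; exact: sqr_ge0.
  by apply: addr_ge0 => //; apply: mulr_ge0 => //; exact: mulr_ge0.
set d := \int[tau]_w D w in main *; apply/eqP; rewrite -normr_eq0; apply/eqP; apply/le_anti.
rewrite normr_ge0 andbT; apply/ler_addgt0Pr => eps eps0; rewrite add0r.
pose u := Num.min (k.+1%:R^-1) (eps / (K + 1)).
have K1 : 0 < K + 1 by lra.
have u0 : 0 < u by rewrite lt_min invr_gt0 ltr0n/= divr_gt0.
have uk : u * k.+1%:R <= 1 by rewrite -ler_pdivlMr// mul1r ge_min lexx.
have := main u u0 uk; rewrite normrM (gtr0_norm u0) (_ : K * u ^+ 2 = u * (K * u)); last by ring.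
rewrite ler_pM2l// => h; apply: le_trans h _.
have ue : u <= eps / (K + 1) by rewrite ge_min lexx orbT.
rewrite ler_pdivlMr// in ue; have uu := ltW u0; lra.
Qed.

(** The angular identity at k = 2j+1, since for z = x + i y both x Re z^k and y Im z^k are half sums
    or differences of Re z^(k+1) and |z|^2 Re z^(k-1). *)
Let recurrence l j : (p + (2 * j + 2)%:R) * Ez l j.+1.*2 = (p - (2 * j)%:R) * Ez l.+1 j.*2.
Proof.
have := angular_identity l j.*2.+1.
pose A w := `|X w| `^ p * (rho w ^+ l * (zpow j.+1.*2 (X w) (Y w)).1).
pose B w := `|X w| `^ p * (rho w ^+ l.+1 * (zpow j.*2 (X w) (Y w)).1).
have bA : bmf A by exact: bEz.
have bB : bmf B by exact: bEz.
have e : \int[tau]_w ((p + 1) * (`|X w| `^ p * Y w * (rho w ^+ l * (zpow j.*2.+1 (X w) (Y w)).2)) -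
    j.*2.+1%:R * (F (X w) * (rho w ^+ l * (zpow j.*2.+1 (X w) (Y w)).1))) =
  \int[tau]_w ((p - (2 * j)%:R) / 2 * B w - (p + (2 * j + 2)%:R) / 2 * A w).
  apply: eq_Rintegral => w _; rewrite /A /B /F doubleS /= exprS /rho.
  have -> : j.*2.+1%:R = 2 * j%:R + 1 :> R by rewrite -natr1 -mul2n natrM.
  rewrite natrD !natrM; set c := (zpow j.*2 (X w) (Y w)).1.
  set s := (zpow j.*2 (X w) (Y w)).2; set q := (X w ^+ 2 + Y w ^+ 2) ^+ l; set P := _ `^ p.
  by field.
have bA' := bmfM (bmf_cst ((p + (2 * j + 2)%:R) / 2)) bA.
have bB' := bmfM (bmf_cst ((p - (2 * j)%:R) / 2)) bB.
rewrite e (bintB tau bB' bA') (bintZ tau _ bA) (bintZ tau _ bB) -/(Ez l j.+1.*2) -/(Ez l.+1 j.*2).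
move: (Ez l j.+1.*2) (Ez l.+1 j.*2) => a' b'; lra.
Qed.

(** The ratio of the mean of |cos|^p cos(2j .) to that of |cos|^p. It is positive while 2i < p for
    all i < j, which governs the degrees that can be tested. *)
Definition planar_cst (j : nat) : R :=
  \prod_(i < j) ((p - (2 * i)%:R) / (p + (2 * i + 2)%:R)).

Let EzE j l : Ez l j.*2 = planar_cst j * \int[tau]_w (`|X w| `^ p * rho w ^+ (l + j)).
Proof.
elim: j l => [|j IH] l.
  rewrite /planar_cst big_ord0 mul1r addn0; apply: eq_Rintegral => w _ /=.
  by rewrite mulr1.
have q0 : 0 < p + (2 * j + 2)%:R by rewrite ltr_pwDl// (lt_trans _ p2).
have lj : (l + j.+1 = l.+1 + j)%N by rewrite addnS.
apply: (mulfI (lt0r_neq0 q0)); rewrite recurrence IH lj /planar_cst big_ord_recr /=.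
by move: (p + (2 * j + 2)%:R) q0 => q q0; field; exact: lt0r_neq0.
Qed.

(** After the recurrence, |X|^p rho^j >= |X|^(p+2j) >= |X|^(2m), because rho >= X^2 and |X| <= 1. *)
Lemma planar_lead j m : (forall i, (i < j)%N -> (2 * i)%:R < p) -> p + (2 * j)%:R <= (2 * m)%:R ->
  planar_cst j * \int[tau]_w (X w ^+ 2) ^+ m <=
  \int[tau]_w (`|X w| `^ p * (zpow j.*2 (X w) (Y w)).1).
Proof.
move=> hj hm; have -> : \int[tau]_w (`|X w| `^ p * (zpow j.*2 (X w) (Y w)).1) = Ez 0 j.*2.
  by apply: eq_Rintegral => w _; rewrite expr0 mul1r.
rewrite EzE; have c0 : 0 <= planar_cst j.
  apply: prodr_ge0 => i _; have hp := p0; apply: divr_ge0; last by rewrite addr_ge0.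
  by rewrite subr_ge0; apply: ltW; apply: hj; exact: ltn_ord.
have hp := p0.
have b1 : bmf (fun w => (X w ^+ 2) ^+ m) by apply: bmfX; exact: bmfX.
have b2 : bmf (fun w => `|X w| `^ p * rho w ^+ (0 + j)) by exact: bmfM.
apply: ler_wpM2l => //; apply: (bint_le tau b1 b2) => w; rewrite add0n.
have x0 := normr_ge0 (X w).
have -> : (X w ^+ 2) ^+ m = `|X w| `^ (2 * m)%:R.
  by rewrite powR_mulrn// -exprM -normrX ger0_norm// exprM exprn_ge0// sqr_ge0.
have [X0|X0] := eqVneq `|X w| 0.
  have pm : (2 * m)%:R != 0 :> R.
    by apply: lt0r_neq0; apply: lt_le_trans hm; rewrite ltr_pwDl// (lt_trans _ p2).
  rewrite X0 powR0// mulr_ge0 ?powR_ge0//; have /andP[] := rho1 j w; by [].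
have Xp : 0 < `|X w| by rewrite lt_neqAle eq_sym X0.
apply: (@le_trans _ _ (`|X w| `^ (p + (2 * j)%:R))).
  have [->|Xn1] := eqVneq `|X w| 1; first by rewrite !powR1.
  have le1 : 0 < `|X w| <= 1 by rewrite Xp X1.
  exact: (ger_powR le1 hm).
rewrite powRD; last by rewrite X0 implybT.
apply: ler_wpM2l; first exact: powR_ge0.
rewrite powR_mulrn// exprM real_normK ?num_real//; apply: lerXn2r; rewrite ?nnegrE ?sqr_ge0//.
  by rewrite addr_ge0 ?sqr_ge0.
by rewrite lerDl sqr_ge0.
Qed.

End PlanarMoments.

(** * From near-constancy in mean to a pointwise bound *)

Section NearConstant.
Context {R : realType} {n : nat} {d : measure_display} {T : measurableType d}.
Variables (mu : {finite_measure set T -> \bar R}) (X : T -> 'rV[R]_n).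
Hypotheses (hX : bvec X) (X1 : forall t, dot (X t) (X t) = 1).
Hypothesis isoX : forall x, \int[mu]_t (dot x (X t) ^+ 2) = dot x x.
Variables (tau : probability (borelType 'M[R]_n) R) (U : borelType 'M[R]_n -> 'M[R]_n).
Hypotheses (hU : haar_matrix tau U) (n2 : (2 < n)%N).
Variables (p : R) (p2 : 2 < p).
Implicit Types (x y z u v a b : 'rV[R]_n).

Local Notation W := (powmean mu X).

Let nR : (0 : R) < n%:R.
Proof. by rewrite ltr0n; apply: leq_trans n2. Qed.
Let p0 : 0 <= p.
Proof. by apply: le_trans (ltW p2). Qed.

Variables (a t0 v0 : 'rV[R]_n).
Hypotheses (a1 : dot a a = 1) (t01 : dot t0 t0 = 1) (v01 : dot v0 v0 = 1) (tv0 : dot t0 v0 = 0).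

Let bU x : bvec (fun w => x *m U w).
Proof. exact: (bvecU hU). Qed.
Let bUa x : bmf (fun w => dot (x *m U w) a).
Proof. by apply: bmf_dot => //; exact: bvec_cst. Qed.

Lemma dot_le1 x y : dot x x = 1 -> dot y y = 1 -> `|dot x y| <= 1.
Proof. by move=> x1 y1; rewrite ler_norml; exact: dot_unit_bound. Qed.

Let aU1 w : dot (a *m U w) (a *m U w) = 1.
Proof. by rewrite (dotU hU). Qed.

(** U and its transpose have the same law, so the rotated vector and the fixed ones may exchange
    roles. *)
Lemma haar_dual (Phi : R -> R -> R) x y :
  bmf (fun w => Phi (dot (x *m U w) a) (dot (y *m U w) a)) ->
  \int[tau]_w Phi (dot (a *m U w) x) (dot (a *m U w) y) =
  \int[tau]_w Phi (dot (x *m U w) a) (dot (y *m U w) a).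
Proof.
move=> hb; rewrite -(haar_transpose hU (H := fun A => Phi (dot (x *m A) a) (dot (y *m A) a)) hb).
have e w z : dot (z *m (U w)^T) a = dot (a *m U w) z.
  by rewrite [RHS]dotC !dot_mulmx trmx_mul mulmxA.
by apply: eq_Rintegral => w _; rewrite !e.
Qed.

(** Coefficients of the zonal kernel, the average of |<aU, t>|^p <aU, x>^(2j), as a polynomial in
    <t, x>^2. They depend only on t0, v0 being orthonormal. *)
Definition kernel_coef (j i : nat) : R := \int[tau]_w (`|dot (t0 *m U w) a| `^ p *
  (evenpoly j (dot (t0 *m U w) a) (dot (v0 *m U w) a)).1`_i).

Let bcoef j i t v : bmf (fun w => `|dot (t *m U w) a| `^ p *
  (evenpoly j (dot (t *m U w) a) (dot (v *m U w) a)).1`_i).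
Proof. by apply: bmfM; [exact: bmf_powR|exact: bmf_evenpoly]. Qed.

(** Decompose x along t and a unit v orthogonal to t. The symmetry v -> -v removes odd powers of q,
    and [evenpoly] is what remains. *)
Lemma kernel_expansion j t x : dot t t = 1 -> dot x x = 1 ->
  \int[tau]_w (`|dot (a *m U w) t| `^ p * dot (a *m U w) x ^+ j.*2) =
  \sum_(i < j.+1) kernel_coef j i * (dot t x ^+ 2) ^+ i.
Proof.
move=> t1 x1; set s := dot t x.
have bP y z : bmf (fun w => `|dot (y *m U w) a| `^ p * dot (z *m U w) a ^+ j.*2).
  by apply: bmfM; [exact: bmf_powR|exact: bmfX].
rewrite (haar_dual (Phi := fun b c : R => `|b| `^ p * c ^+ j.*2) (bP t x)).
have [v [q [v1 tv q2 xE]]] : exists v (q : R), [/\ dot v v = 1, dot t v = 0, q ^+ 2 = 1 - s ^+ 2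
    & x = s *: t + q *: v].
  pose y := x - s *: t.
  have ty : dot t y = 0 by rewrite /y !dotE t1 mulr1 subrr.
  have yy : dot y y = 1 - s ^+ 2 by rewrite /y !dotE x1 t1 (dotC x) -/s; ring.
  have [y0|y0] := eqVneq y 0.
    have [v v1 hv] := @exists_unit_orthogonal _ _ [:: t] (ltnW n2).
    exists v, 0; split=> //; first by rewrite dotC; apply: hv; rewrite mem_head.
      by rewrite -yy y0 dot0r expr0n.
    by rewrite scale0r addr0; apply/eqP; rewrite -subr_eq0 -/y y0.
  have [v v1 yv] := enorm_normalize y0; exists v, (enorm y); split=> //.
  - have e0 : enorm y != 0.
      by apply: contra_neq y0 => e; rewrite yv e scale0r.
    by apply: (mulfI e0); rewrite mulr0 -dotZr -yv.
  - by rewrite enorm_sqr.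
  by rewrite -yv /y addrC subrK.
pose Xw w := dot (t *m U w) a; pose Yw w := dot (v *m U w) a.
have xw w : dot (x *m U w) a = s * Xw w + q * Yw w.
  by rewrite {1}xE mulmxDl -!scalemxAl !dotE.
pose H y z := `|dot y a| `^ p * (s * dot y a + q * dot z a) ^+ j.*2.
have bH y z : bmf (fun w => H (y *m U w) (z *m U w)).
  apply: bmfM; first exact: bmf_powR.
  by apply: bmfX; apply: bmfD; apply: bmfM => //; exact: bmf_cst.
have flip : \int[tau]_w H (t *m U w) (- v *m U w) = \int[tau]_w H (t *m U w) (v *m U w).
  by apply: (haar_congruence2 hU (H := H)) => //; rewrite !dotE ?opprK// tv oppr0.
have E1 : \int[tau]_w (`|dot (t *m U w) a| `^ p * dot (x *m U w) a ^+ j.*2) =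
    \int[tau]_w (`|Xw w| `^ p * (evenpoly j (Xw w) (Yw w)).1.[s ^+ 2]).
  transitivity (\int[tau]_w H (t *m U w) (v *m U w)).
    by apply: eq_Rintegral => w _; rewrite xw.
  have hz (z I : R) : I = z + z -> z = 2^-1 * I by move=> ->; field.
  have bS : bmf (fun w => H (t *m U w) (v *m U w) + H (t *m U w) (- v *m U w)) by exact: bmfD.
  transitivity (2^-1 * \int[tau]_w (H (t *m U w) (v *m U w) + H (t *m U w) (- v *m U w))).
    by apply: hz; rewrite (bintD tau (bH _ _) (bH _ _)) flip.
  rewrite -(bintZ tau _ bS); apply: eq_Rintegral => w _.
  have h := evenpoly_horner j (Xw w) (Yw w) q2.
  have e2 : dot (- v *m U w) a = - Yw w by rewrite mulNmx !dotE.
  rewrite /H e2 -/(Xw w) -/(Yw w) mulrN -mulrDr -h.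
  by field.
rewrite E1.
have sz w : (size (evenpoly j (Xw w) (Yw w)).1 <= j.+1)%N.
  by apply/leq_sizeP => i hi; apply: (proj2 (evenpoly_lead j _ _)).
have bc i : bmf (fun w => `|Xw w| `^ p * (evenpoly j (Xw w) (Yw w)).1`_i) by exact: bcoef.
have bci i : bmf (fun w => (s ^+ 2) ^+ i * (`|Xw w| `^ p * (evenpoly j (Xw w) (Yw w)).1`_i)).
  by apply: bmfM => //; exact: bmf_cst.
transitivity (\int[tau]_w \sum_(i < j.+1)
    ((s ^+ 2) ^+ i * (`|Xw w| `^ p * (evenpoly j (Xw w) (Yw w)).1`_i))).
  apply: eq_Rintegral => w _; rewrite (horner_coef_wide _ (sz w)) mulr_sumr.
  by apply: eq_bigr => i _; ring.
rewrite (bint_sum tau _ _ (fun i : (ordinal j.+1) => bci i)); apply: eq_bigr => i _.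
rewrite (bintZ tau _ (bc i)) mulrC; congr (_ * _); rewrite /kernel_coef.
apply: (haar_congruence2 hU (H := fun y z => `|dot y a| `^ p * (evenpoly j (dot y a) (dot z a)).1`_i)).
- by rewrite t1 t01.
- by rewrite v1 v01.
- by rewrite tv tv0.
exact: bcoef.
Qed.

Lemma kernel_coef_bound j i : `|kernel_coef j i| <= 8 ^+ j.
Proof.
have hp : 2 <= p by exact: ltW.
apply: le_trans (bint_norm tau (bcoef j i t0 v0)) _.
rewrite -[leRHS](pint_cst tau); apply: (bint_le tau (bmf_norm (bcoef j i t0 v0)) (bmf_cst _)) => w.
set x := dot _ a; set y := dot _ a.
have xy : x ^+ 2 + y ^+ 2 <= 1.
  have h := dot_ge0 (a - x *: (t0 *m U w) - y *: (v0 *m U w)).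
  rewrite !dotE !(dotU hU) t01 v01 tv0 (dotC v0) tv0 a1 !(dotC a) -/x -/y in h.
  by move: x y h => x y h; lra.
have x1 : `|x| <= 1.
  rewrite -(@ler_pXn2r _ 2)// ?nnegrE// expr1n real_normK ?num_real//.
  by apply: le_trans xy; rewrite lerDl sqr_ge0.
rewrite normrM -[leRHS]mul1r; apply: ler_pM => //; last exact: evenpoly_bound.
rewrite ger0_norm ?powR_ge0//; apply: le_trans (powR_le_sqr hp _) _.
  by rewrite normr_ge0 x1.
by apply: exprn_ile1.
Qed.

Lemma haar_second_moment x : dot x x = 1 -> \int[tau]_w dot (x *m U w) a ^+ 2 = n%:R^-1.
Proof.
move=> x1.
have b i : bmf (fun w => dot (row i (U w)) a ^+ 2).
  by apply: bmfX; under eq_fun do rewrite rowE; exact: bUa.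
have e i : \int[tau]_w dot (row i (U w)) a ^+ 2 = \int[tau]_w dot (x *m U w) a ^+ 2.
  under eq_Rintegral do rewrite rowE.
  apply: (haar_congruence1 hU (H := fun z => dot z a ^+ 2)); first by rewrite dot_delta mxE !eqxx x1.
  exact: bmfX.
have : \int[tau]_w (\sum_i dot (row i (U w)) a ^+ 2) = 1.
  rewrite -[RHS](pint_cst tau); apply: eq_Rintegral => w _.
  rewrite -a1 -(dot_orthogonal a a (orthogonal_tr (haar_orthogonal hU w))) [RHS]/dot.
  apply: eq_bigr => i _; rewrite -expr2; congr (_ ^+ 2).
  by rewrite !mxE dotC; apply: eq_bigr => j _; rewrite !mxE.
rewrite (bint_sum tau _ _ b) (eq_bigr (fun=> \int[tau]_w dot (x *m U w) a ^+ 2)); last by move=> i _; exact: e.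
rewrite sumr_const card_ord => h.
by apply: (mulfI (lt0r_neq0 nR)); rewrite mulr_natl h divff// lt0r_neq0.
Qed.

(** The leading coefficient is the Fourier moment of [planar_lead], and by Jensen its 2m-th moment
    is at least the m-th power of the second moment 1/n. *)
Lemma kernel_lead j m : (forall i, (i < j)%N -> (2 * i)%:R < p) -> p + (2 * j)%:R <= (2 * m)%:R ->
  planar_cst p j * (n%:R^-1) ^+ m <= kernel_coef j j.
Proof.
move=> hj hm; have hp := p0.
have c0 : 0 <= planar_cst p j.
  apply: prodr_ge0 => i _; apply: divr_ge0; last by rewrite addr_ge0.
  by rewrite subr_ge0; apply: ltW; apply: hj; exact: ltn_ord.
have -> : kernel_coef j j = \int[tau]_w (`|dot (t0 *m U w) a| `^ p *
    (zpow j.*2 (dot (t0 *m U w) a) (dot (v0 *m U w) a)).1).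
  by apply: eq_Rintegral => w _; rewrite (proj1 (evenpoly_lead j _ _)).
apply: le_trans (planar_lead hU p2 a1 t01 v01 tv0 hj hm).
apply: ler_wpM2l => //; rewrite -(haar_second_moment t01).
by apply: pint_jensen => [|w]; [exact: bmfX|exact: sqr_ge0].
Qed.

Variable x : 'rV[R]_n.
Hypothesis x1 : dot x x = 1.

Let S i := \int[mu]_t (dot x (X t) ^+ 2) ^+ i.
Let Nn i := \int[tau]_w (dot (a *m U w) x ^+ 2) ^+ i.
Let w0 := \int[tau]_w W p (a *m U w).

Let bWa : bmf (fun w => W p (a *m U w)).
Proof. by apply: (bmf_W mu hX). Qed.
Let bax i : bmf (fun w => (dot (a *m U w) x ^+ 2) ^+ i).
Proof. by apply: bmfX; apply: bmfX; apply: bmf_dot => //; exact: bvec_cst. Qed.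
Let bXx i : bmf (fun t => (dot x (X t) ^+ 2) ^+ i).
Proof. by apply: bmfX; apply: bmfX; apply: bmf_dot => //; exact: bvec_cst. Qed.

Let mu_side j : \int[tau]_w (W p (a *m U w) * dot (a *m U w) x ^+ j.*2) =
  \sum_(i < j.+1) kernel_coef j i * S i.
Proof.
pose F (z : borelType 'M[R]_n * T) :=
  `|dot (a *m U z.1) (X z.2)| `^ p * dot (a *m U z.1) x ^+ j.*2.
have b1 : bvec (fun z : borelType 'M[R]_n * T => a *m U z.1) by exact: (bvec_comp measurable_fst (bU a)).
have bF : bmf F.
  apply: bmfM.
    by apply: bmf_powR => //; apply: bmf_dot => //; exact: (bvec_comp measurable_snd hX).
  by apply: bmfX; apply: bmf_dot => //; exact: bvec_cst.
transitivity (\int[tau]_w \int[mu]_t F (w, t)).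
  by apply: eq_Rintegral => w _; rewrite /F /= bintZr//; apply: (bmf_WX hX).
rewrite (bint_Fubini tau mu bF).
have bS i : bmf (fun t => kernel_coef j i * (dot x (X t) ^+ 2) ^+ i).
  by apply: bmfM => //; exact: bmf_cst.
transitivity (\int[mu]_t \sum_(i < j.+1) kernel_coef j i * (dot x (X t) ^+ 2) ^+ i).
  by apply: eq_Rintegral => t _; rewrite /F /= (kernel_expansion j (X1 t) x1) (dotC x).
rewrite (bint_sum mu _ _ (fun i : (ordinal j.+1) => bS i)); apply: eq_bigr => i _.
exact: bintZ.
Qed.

Let kernel00 t : dot t t = 1 -> \int[tau]_w `|dot (a *m U w) t| `^ p = kernel_coef 0 0.
Proof.
move=> t1; have := kernel_expansion 0 t1 x1; rewrite big_ord1 !expr0 mulr1 => <-.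
by apply: eq_Rintegral => w _; rewrite expr0 mulr1.
Qed.

(** The counterpart of [mu_side] for a uniformly distributed t, against which the kernel integrates
    to a constant times <., x>^(2j). *)
Let tau_side j : \sum_(i < j.+1) kernel_coef j i * Nn i = kernel_coef 0 0 * Nn j.
Proof.
pose F (z : borelType 'M[R]_n * borelType 'M[R]_n) :=
  `|dot (a *m U z.1) (a *m U z.2)| `^ p * dot (a *m U z.1) x ^+ j.*2.
have b1 : bvec (fun z : borelType 'M[R]_n * borelType 'M[R]_n => a *m U z.1).
  exact: (bvec_comp measurable_fst (bU a)).
have b2 : bvec (fun z : borelType 'M[R]_n * borelType 'M[R]_n => a *m U z.2).
  exact: (bvec_comp measurable_snd (bU a)).
have bF : bmf F.
  apply: bmfM; first by apply: bmf_powR => //; exact: bmf_dot.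
  by apply: bmfX; apply: bmf_dot => //; exact: bvec_cst.
have bS i : bmf (fun w => kernel_coef j i * (dot (a *m U w) x ^+ 2) ^+ i).
  by apply: bmfM => //; exact: bmf_cst.
transitivity (\int[tau]_w \sum_(i < j.+1) kernel_coef j i * (dot (a *m U w) x ^+ 2) ^+ i).
  rewrite (bint_sum tau _ _ (fun i : (ordinal j.+1) => bS i)); apply: eq_bigr => i _.
  by rewrite (bintZ tau _ (bax i)).
transitivity (\int[tau]_v \int[tau]_w F (w, v)).
  by apply: eq_Rintegral => v _; rewrite /F /= (kernel_expansion j (aU1 v) x1).
rewrite -(bint_Fubini tau tau bF) -(bintZ tau _ (bax j)).
apply: eq_Rintegral => w _; rewrite /F /=.
have bd : bmf (fun q : borelType 'M[R]_n => `|dot (a *m U w) (a *m U q)| `^ p).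
  by apply: bmf_powR => //; apply: bmf_dot => //; exact: bvec_cst.
rewrite (bintZr tau _ bd) -exprM mul2n; congr (_ * _).
rewrite -(kernel00 (aU1 w)); apply: eq_Rintegral => v _; by rewrite dotC.
Qed.

Let S0 : S 0%N = n%:R.
Proof.
rewrite /S; under eq_Rintegral do rewrite expr0.
by rewrite bint_cst mul1r; exact: (isotropic_mass hX X1 isoX).
Qed.

Let mean_mass : w0 = kernel_coef 0 0 * n%:R.
Proof.
have := mu_side 0; rewrite big_ord1 S0 => <-.
by apply: eq_Rintegral => w _; rewrite expr0 mulr1.
Qed.

Let tau0 := \int[tau]_w `|W p (a *m U w) - w0|.

Let discrepancy i := S i - n%:R * Nn i.

(** Up to sign the sum is W_p minus its mean, tested against <., x>^(2j), a polynomial bounded by 1.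
    As j varies this is a triangular system for the discrepancies. *)
Let discrepancy_sum j : `|\sum_(i < j.+1) kernel_coef j i * discrepancy i| <= tau0.
Proof.
have bd : bmf (fun w => dot (a *m U w) x ^+ j.*2).
  by apply: bmfX; apply: bmf_dot => //; exact: bvec_cst.
have bc : bmf (fun _ : borelType 'M[R]_n => w0) by exact: bmf_cst.
have bWd := bmfM bWa bd.
have bwd := bmfM bc bd.
have bWw := bmfB bWa bc.
have bf := bmfM bWw bd.
have -> : \sum_(i < j.+1) kernel_coef j i * discrepancy i =
    \int[tau]_w ((W p (a *m U w) - w0) * dot (a *m U w) x ^+ j.*2).
  transitivity (\sum_(i < j.+1) kernel_coef j i * S i - n%:R * \sum_(i < j.+1) kernel_coef j i * Nn i).
    by rewrite mulr_sumr -sumrB; apply: eq_bigr => i _; rewrite /discrepancy; ring.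
  rewrite -mu_side tau_side.
  have -> : \int[tau]_w ((W p (a *m U w) - w0) * dot (a *m U w) x ^+ j.*2) =
    \int[tau]_w (W p (a *m U w) * dot (a *m U w) x ^+ j.*2 - w0 * dot (a *m U w) x ^+ j.*2).
    by apply: eq_Rintegral => w _; ring.
  rewrite (bintB tau bWd bwd) (bintZ tau _ bd); congr (_ - _).
  have -> : \int[tau]_w dot (a *m U w) x ^+ j.*2 = Nn j.
    by apply: eq_Rintegral => w _; rewrite -exprM mul2n.
  by rewrite mean_mass; ring.
apply: le_trans (bint_norm tau bf) _.
apply: (bint_le tau (bmf_norm bf) (bmf_norm bWw)) => w.
rewrite normrM -[leRHS]mulr1; apply: ler_wpM2l => //.
by rewrite normrX; apply: exprn_ile1 => //; exact: dot_le1.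
Qed.

Variables (J m : nat).
Hypotheses (J0 : (0 < J)%N) (hJ : forall i, (i < J)%N -> (2 * i)%:R < p)
  (hm : p + (2 * J)%:R <= (2 * m)%:R) (pJ : p <= (2 * J)%:R).

(** The loss in one substitution: the bound 8^J on coefficients over the lower bound on the
    diagonal, polynomial in n. *)
Definition near_constant_gain (nn : R) : R := 1 + 8 ^+ J / (planar_cst p J * (nn^-1) ^+ m).

Let kap : R := planar_cst p J * (n%:R^-1) ^+ m.

Let planar_mono j : (j <= J)%N -> 0 < planar_cst p J <= planar_cst p j.
Proof.
move=> jJ; have hp := p0.
have f0 i : (i < J)%N -> 0 < (p - (2 * i)%:R) / (p + (2 * i + 2)%:R) <= 1.
  move=> iJ; have h := hJ iJ; have q0 : 0 < p + (2 * i + 2)%:R by rewrite ltr_wpDl// ltr0n addn2.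
  rewrite divr_gt0 ?subr_gt0//= ler_pdivrMr// mul1r lerD2l.
  by apply: le_trans (ler0n R _); rewrite oppr_le0.
have c0 k : (k <= J)%N -> 0 < planar_cst p k.
  by move=> kJ; apply: prodr_gt0 => i _; have /andP[] := f0 i (leq_trans (ltn_ord i) kJ).
rewrite c0//=.
have main k : (j + k <= J)%N -> planar_cst p (j + k) <= planar_cst p j.
  elim: k => [|k IH]; first by rewrite addn0.
  rewrite addnS => kJ; apply: le_trans (IH (ltnW kJ)).
  rewrite {1}/planar_cst big_ord_recr /= -[leRHS]mulr1.
  by apply: ler_wpM2l; [exact: ltW (c0 _ (ltnW kJ))|have /andP[] := f0 _ kJ].
by have := main (J - j)%N; rewrite subnKC//; apply.
Qed.

Let kap0 : 0 < kap.
Proof. by have /andP[c _] := planar_mono (leqnn J); rewrite mulr_gt0// exprn_gt0// invr_gt0. Qed.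

Let coef_lead j : (j <= J)%N -> kap <= kernel_coef j j.
Proof.
move=> jJ; have /andP[_ c] := planar_mono jJ.
have hj i : (i < j)%N -> (2 * i)%:R < p by move=> ij; apply: hJ; exact: leq_trans jJ.
have hm' : p + (2 * j)%:R <= (2 * m)%:R.
  by apply: le_trans hm; rewrite lerD2l ler_nat leq_pmul2l.
by apply: le_trans (kernel_lead hj hm'); apply: ler_wpM2r => //.
Qed.

(** Forward substitution in the triangular system; the accumulated sum grows by the gain at each
    degree. *)
Let discrepancy_bound j : (j <= J)%N ->
  tau0 + \sum_(i < j.+1) `|discrepancy i| <= near_constant_gain n%:R ^+ j.+1 * tau0.
Proof.
have g8 : 0 <= (8 : R) ^+ J / kap by rewrite divr_ge0 ?exprn_ge0// ltW.
have t0' : 0 <= tau0 by exact: bint_ge0.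
have G1 : near_constant_gain n%:R = 1 + 8 ^+ J / kap by [].
pose A j := tau0 + \sum_(i < j) `|discrepancy i|.
have A0 i : 0 <= A i by rewrite addr_ge0// sumr_ge0.
have stp k : (k <= J)%N -> `|discrepancy k| <= 8 ^+ J / kap * A k.
  move=> kJ; have := discrepancy_sum k; rewrite big_ord_recr /= => h.
  have ck := coef_lead kJ; have ck0 : 0 < kernel_coef k k by exact: lt_le_trans ck.
  have e8 : (8 : R) ^+ k <= 8 ^+ J by apply: ler_weXn2l => //; rewrite ler1n.
  have h1 : `|\sum_(i < k) kernel_coef k i * discrepancy i| <= 8 ^+ J * \sum_(i < k) `|discrepancy i|.
    apply: le_trans (ler_norm_sum _ _ _) _; rewrite mulr_sumr; apply: ler_sum => i _.
    by rewrite normrM; apply: ler_wpM2r => //; exact: le_trans (kernel_coef_bound k i) e8.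
  have h2 : kernel_coef k k * `|discrepancy k| <= tau0 + 8 ^+ J * \sum_(i < k) `|discrepancy i|.
    rewrite -(gtr0_norm ck0) -normrM.
    set P := \sum_(i < k) _ in h h1; set Q := _ * _.
    have -> : Q = (P + Q) - P by ring.
    by apply: le_trans (ler_normB _ _) _; exact: lerD.
  have h3 : tau0 <= 8 ^+ J * tau0.
    by rewrite -[leLHS]mul1r; apply: ler_wpM2r => //; apply: exprn_ege1; rewrite ler1n.
  rewrite mulrAC ler_pdivlMr// mulrC.
  apply: le_trans (ler_wpM2r (normr_ge0 _) ck) _; apply: le_trans h2 _.
  by rewrite /A mulrDr lerD2r.
have main k : (k <= J.+1)%N -> A k <= near_constant_gain n%:R ^+ k * tau0.
  elim: k => [_|k IH kJ]; first by rewrite /A big_ord0 addr0 expr0 mul1r.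
  have e : A k.+1 = A k + `|discrepancy k| by rewrite /A big_ord_recr /= addrA.
  rewrite e exprS -mulrA.
  apply: (@le_trans _ _ (near_constant_gain n%:R * A k)).
    by rewrite G1 mulrDl mul1r lerD2l; exact: stp.
  by apply: ler_wpM2l; [rewrite G1 addr_ge0|apply: IH; exact: ltnW].
by move=> jJ; exact: main.
Qed.

(** The 2J-th moment of [mu] in the direction x is then of the order n^(1-J) that n times the
    uniform law would give. Since p <= 2J, interpolation with the second moment, fixed by isotropy,
    bounds W_p. *)
Lemma near_constant_bound : near_constant_gain n%:R ^+ J.+1 * tau0 <= n%:R / n%:R ^+ J ->
  W p x <= (2 + (3 * (4 * J%:R + 1)) ^+ J) * n%:R `^ (1 - p / 2).
Proof.
move=> small; have hp : 2 <= p by exact: ltW.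
have nJ : (0 : R) < n%:R ^+ J by rewrite exprn_gt0.
set c : R := (3 * (4 * J%:R + 1)) ^+ J.
have NJ : Nn J <= c / n%:R ^+ J.
  have [y y1 hy] := @exists_unit_orthogonal _ _ [:: a] (ltnW n2).
  have ya : dot y a = 0 by apply: hy; rewrite mem_head.
  have := dot_moment hU n2 (g := fun=> 1) (fun=> ler01) (fun=> bmf_cst 1) y1 a1 ya J x.
  rewrite pint_cst mulr1 x1 mulr1 expr_div_n -/c.
  congr (_ <= _); apply: eq_Rintegral => w _; by rewrite mul1r -exprM mul2n.
have SJ : S J <= (1 + c) * (n%:R / n%:R ^+ J).
  have h := le_trans (discrepancy_bound (leqnn J)) small.
  have h2 : `|discrepancy J| <= n%:R / n%:R ^+ J.
    apply: le_trans h; rewrite big_ord_recr /= addrA lerDr addr_ge0//; first exact: bint_ge0.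
    exact: sumr_ge0.
  have h3 := le_trans (ler_norm _) h2.
  have h4 := ler_wpM2l (ltW nR) NJ; rewrite /discrepancy in h3.
  have -> : (1 + c) * (n%:R / n%:R ^+ J) = n%:R / n%:R ^+ J + n%:R * (c / n%:R ^+ J) by ring.
  lra.
have b2 : bmf (fun t => dot x (X t) ^+ 2) by apply: bmfX; apply: bmf_dot => //; exact: bvec_cst.
have bJ := bXx J.
have b2n := bmfM (bmf_cst n%:R) b2.
have bJn := bmfM (bmf_cst (n%:R ^+ J)) bJ.
have bs := bmfD b2n bJn.
have bsn := bmfM (bmf_cst (n%:R `^ (- (p / 2)))) bs.
have bW := bmf_WX hX x p0.
have pJ' : p <= J.*2%:R by rewrite -mul2n.
apply: le_trans (bint_le mu bW bsn _) _ => [t|].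
  have := powR_le_even hp pJ' nR (normr_ge0 (dot x (X t))).
  by rewrite real_normK ?num_real// exprn_even_norm -mul2n exprM.
rewrite (bintZ mu _ bs) (bintD mu b2n bJn) (bintZ mu _ b2) (bintZ mu _ bJ) isoX x1 mulr1 -/(S J).
rewrite powRD; last by rewrite (gt_eqF nR) implybT.
rewrite powRr1 ?(ltW nR)// mulrA mulrC; apply: ler_wpM2r; first exact: powR_ge0.
have h := ler_wpM2l (ltW nJ) SJ.
have e : n%:R ^+ J * ((1 + c) * (n%:R / n%:R ^+ J)) = (1 + c) * n%:R :> R by field; exact: lt0r_neq0.
rewrite e in h; lra.
Qed.

End NearConstant.

(** * Spherical sections of a fixed body *)

Lemma weighted_sqr_triangle {R : realType} (g a b c : R) : 0 <= g ->
  g * (a - c) ^+ 2 <= 2 * (g * (a - b) ^+ 2 + g * (b - c) ^+ 2).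
Proof. by move=> g0; have := mulr_ge0 g0 (sqr_ge0 (a - b - (b - c))); lra. Qed.

Lemma double_step {R : realType} (a b k e h : R) : a <= k * e * h -> b <= k * e * h ->
  2 * (a + b) <= e * (4 * k * h).
Proof. lra. Qed.

Section TwoPointGradient.
Context {R : realType} {n : nat} {d : measure_display} {T : measurableType d}.
Variables (mu : {finite_measure set T -> \bar R}) (X : T -> 'rV[R]_n).
Hypotheses (hX : bvec X) (X1 : forall t, dot (X t) (X t) = 1).
Hypothesis isoX : forall x, \int[mu]_t (dot x (X t) ^+ 2) = dot x x.
Variables (tau : probability (borelType 'M[R]_n) R) (U : borelType 'M[R]_n -> 'M[R]_n).
Hypotheses (hU : haar_matrix tau U) (n2 : (2 < n)%N).
Variables (p : R) (p2 : 2 < p) (i0 i1 : 'I_n) (i01 : i0 != i1).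
Variables (g : 'rV[R]_n -> R) (H : R).
Hypotheses (g0 : forall x, 0 <= g x) (bg : borel_bounded g).
Implicit Types (x y z u v a b : 'rV[R]_n).

Local Notation W := (powmean mu X).
Local Notation Q := (powform mu X).

Let nR : (0 : R) < n%:R.
Proof. by rewrite ltr0n; apply: leq_trans n2. Qed.

Let bgU x : bmf (fun w => g (x *m U w)).
Proof. by apply: bg; exact: (bvecU hU). Qed.

Hypothesis gradient_bound : forall c e : R, c ^+ 2 + e ^+ 2 = 1 ->
  \int[tau]_w (g (row i0 (U w)) * gradsq mu X (U w) (fun i => (i != i0) && (i != i1)) p
    (c *: row i0 (U w) + e *: row i1 (U w))) <= H.

(** [increment_moment] excludes obtuse angles, so y and -y are joined through a unit z orthogonal to
    x and y, in two steps of squared length 2. *)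
Lemma antipodal_increment x y (c e : R) : dot x x = 1 -> dot y y = 1 -> dot x y = 0 ->
  c ^+ 2 + e ^+ 2 = 1 ->
  \int[tau]_w (g (x *m U w) *
    (W p (c *: (x *m U w) + e *: (y *m U w)) - W p (c *: (x *m U w) - e *: (y *m U w))) ^+ 2)
    <= e ^+ 2 * (4 * (32 * p ^+ 2 * 2 * (15 / n%:R)) * H).
Proof.
move=> x1 y1 xy ce; have hp : 2 <= p by exact: ltW.
have [z z1 hz] := @exists_unit_orthogonal _ _ [:: x; y] n2.
have xz : dot x z = 0 by rewrite dotC; apply: hz; rewrite !inE eqxx.
have zy : dot z y = 0 by apply: hz; rewrite !inE eqxx orbT.
have ny1 : dot (- y) (- y) = 1 by rewrite !dotE opprK.
have xny : dot x (- y) = 0 by rewrite !dotE xy oppr0.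
have step a b : dot a a = 1 -> dot b b = 1 -> dot x a = 0 -> dot x b = 0 -> dot a b = 0 ->
  \int[tau]_w (g (x *m U w) * (W p (c *: (x *m U w) + e *: (a *m U w)) -
      W p (c *: (x *m U w) + e *: (b *m U w))) ^+ 2) <=
   (32 * p ^+ 2 * 2 * (15 / n%:R)) * e ^+ 2 * H.
  move=> a1 b1 xa xb ab.
  have ab0 : 0 <= dot a b by rewrite ab.
  have := @increment_moment _ _ _ _ mu X hX X1 isoX tau U hU n2 p g c e 1 i0 i1 hp i01
    ce g0 bgU x a b isT x1 a1 b1 xa xb ab0.
  set Gam := \int[tau]_w (g (row i0 (U w)) * _); rewrite expr1.
  have -> : dot (a - b) (a - b) = 2 by rewrite dot_subsq// (dotC b) ab; ring.
  move=> h; apply: le_trans h _.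
  have GH : Gam <= H.
    by apply: le_trans (gradient_bound ce); rewrite /Gam; under eq_Rintegral do rewrite expr1.
  have k1 := ratio_le15 (R := R) n2 (isT : (0 < 1)%N); rewrite mulr1 div1r in k1 *.
  have c0 : 0 <= 32 * p ^+ 2 * e ^+ 2 * 2 by rewrite mulr_ge0// mulr_ge0 ?sqr_ge0// mulr_ge0 ?sqr_ge0.
  have G0 : 0 <= Gam.
    by apply: bint_ge0 => w; rewrite mulr_ge0// expr1 gradsq_ge0.
  have k0 : 0 <= (15 / n%:R : R) by rewrite divr_ge0// ltW.
  apply: le_trans (ler_wpM2r G0 (ler_wpM2l c0 k1)) _.
  apply: le_trans (ler_wpM2l _ GH) _; first by rewrite mulr_ge0.
  by rewrite le_eqVlt; apply/orP; left; apply/eqP; ring.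
have bb a : bmf (fun w => W p (c *: (x *m U w) + e *: (a *m U w))).
  apply: (bmf_W mu hX); first lra.
  by apply: bvecD; apply: bvecZ; exact: (bvecU hU).
have b1 a b : bmf (fun w => g (x *m U w) * (W p (c *: (x *m U w) + e *: (a *m U w)) -
      W p (c *: (x *m U w) + e *: (b *m U w))) ^+ 2).
  by apply: bmfM => //; apply: bmfX; exact: bmfB.
have s1 := step y z y1 z1 xy xz (etrans (dotC _ _) zy).
have zny : dot z (- y) = 0 by rewrite !dotE zy oppr0.
have s2 := step z (- y) z1 ny1 xz xny zny.
have b2 := bmfD (b1 y z) (b1 z (- y)).
have b3 := bmfM (bmf_cst 2) b2.
have e1 : \int[tau]_w (g (x *m U w) *
    (W p (c *: (x *m U w) + e *: (y *m U w)) - W p (c *: (x *m U w) - e *: (y *m U w))) ^+ 2) =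
  \int[tau]_w (g (x *m U w) * (W p (c *: (x *m U w) + e *: (y *m U w)) -
      W p (c *: (x *m U w) + e *: (- y *m U w))) ^+ 2).
  by apply: eq_Rintegral => w _; rewrite mulNmx scalerN.
rewrite e1; apply: le_trans (bint_le tau (b1 y (- y)) b3 _) _ => [w|].
  exact: weighted_sqr_triangle.
rewrite (bintZ tau _ b2) (bintD tau (b1 y z) (b1 z (- y))).
exact: double_step s1 s2.
Qed.

End TwoPointGradient.

Section CrudeGradient.
Context {R : realType} {n : nat} {d : measure_display} {T : measurableType d}.
Variables (mu : {finite_measure set T -> \bar R}) (X : T -> 'rV[R]_n).
Hypotheses (hX : bvec X) (X1 : forall t, dot (X t) (X t) = 1).
Hypothesis isoX : forall x, \int[mu]_t (dot x (X t) ^+ 2) = dot x x.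
Variables (tau : probability (borelType 'M[R]_n) R) (U : borelType 'M[R]_n -> 'M[R]_n).
Hypotheses (hU : haar_matrix tau U).
Variables (p : R) (p2 : 2 < p) (g : 'rV[R]_n -> R).
Hypotheses (g0 : forall x, 0 <= g x) (bg : borel_bounded g).

Local Notation W := (powmean mu X).

Lemma crude_antipodal_increment x y (c e : R) : dot x x = 1 -> dot y y = 1 -> dot x y = 0 ->
  c ^+ 2 + e ^+ 2 = 1 ->
  \int[tau]_w (g (x *m U w) *
    (W p (c *: (x *m U w) + e *: (y *m U w)) - W p (c *: (x *m U w) - e *: (y *m U w))) ^+ 2)
    <= e ^+ 2 * (16 * p ^+ 2 * \int[tau]_w g (x *m U w)).
Proof.
move=> x1 y1 xy ce; have hp : 2 <= p by exact: ltW.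
have bgU : bmf (fun w => g (x *m U w)) by apply: bg; exact: (bvecU hU).
have bW z : bmf (fun w => W p (c *: (x *m U w) + e *: (z *m U w))).
  apply: (bmf_W mu hX); first lra.
  by apply: bvecD; apply: bvecZ; exact: (bvecU hU).
have bWm : bmf (fun w => W p (c *: (x *m U w) - e *: (y *m U w))).
  apply: (bmf_W mu hX); first lra.
  by apply: bvecD; [|apply: bvecN]; apply: bvecZ; exact: (bvecU hU).
have b1 : bmf (fun w => g (x *m U w) *
    (W p (c *: (x *m U w) + e *: (y *m U w)) - W p (c *: (x *m U w) - e *: (y *m U w))) ^+ 2).
  by apply: bmfM => //; apply: bmfX; exact: (bmfB (bW y) bWm).
have b2 := bmfM (bmf_cst (e ^+ 2 * (16 * p ^+ 2))) bgU.
apply: le_trans (bint_le tau b1 b2 _) _ => [w|]; last first.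
  by rewrite (bintZ tau _ bgU) -mulrA.
rewrite mulrC; apply: ler_wpM2r; first exact: g0.
set a := c *: (x *m U w) + e *: (y *m U w); set b := c *: (x *m U w) - e *: (y *m U w).
have xU : dot (x *m U w) (x *m U w) = 1 by rewrite (dotU hU).
have yU : dot (y *m U w) (y *m U w) = 1 by rewrite (dotU hU).
have xyU : dot (x *m U w) (y *m U w) = 0 by rewrite (dotU hU).
have a1 : dot a a = 1 by apply: etrans ce; rewrite !dotE xU yU (dotC (y *m _)) xyU; ring.
have bb1 : dot b b = 1 by apply: etrans ce; rewrite !dotE xU yU (dotC (y *m _)) xyU; ring.
have h := powmean_lipschitz hX X1 isoX hp a1 bb1.
have ab : enorm (a - b) = 2 * `|e|.
  have -> : a - b = (2 * e) *: (y *m U w).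
    by rewrite /a /b opprB addrC addrA subrK -scalerDl; congr (_ *: _); ring.
  by rewrite enormZ (proj2 (enorm_eq1 _) yU) mulr1 normrM ger0_norm.
rewrite ab in h; rewrite -(real_normK (num_real (W p a - W p b))).
have -> : e ^+ 2 * (16 * p ^+ 2) = (2 * p * (2 * `|e|)) ^+ 2.
  by rewrite -[in LHS](real_normK (num_real e)); ring.
by apply: lerXn2r; rewrite ?nnegrE// !mulr_ge0//; lra.
Qed.

End CrudeGradient.

Lemma mul_exprV_ge0 {R : numFieldType} (l : R) (m : nat) : 0 <= l -> 0 <= l * l ^- m.
Proof. by move=> l0; rewrite mulr_ge0// invr_ge0 exprn_ge0. Qed.

Lemma scaled_power {R : numFieldType} (c N : R) (r : nat) (l : R) : 0 < l ->
  l * l ^- r.*2 * (c * (l ^+ 2 / N)) ^+ r = l * (c / N) ^+ r.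
Proof.
move=> l0; rewrite -mul2n exprM -mulrA; congr (l * _).
by rewrite [c * _]mulrCA (exprMn r (l ^+ 2)) mulKf// !expf_neq0// lt0r_neq0.
Qed.

Lemma weighted_le {R : realDomainType} (g a t : R) : g <= 1 -> 0 <= t -> g * (a + t) <= a * g + t.
Proof. by move=> g1 t0; rewrite mulrDr [g * a]mulrC lerD2l ler_piMl. Qed.

Lemma le_add_even_power {R : realDomainType} (q : R) (r : nat) : (0 < r)%N -> q <= 1 + q ^+ r.*2.
Proof.
move=> r0; have q0 : 0 <= q ^+ r.*2 by rewrite -muln2 exprM sqr_ge0.
have [q1|q1] := leP q 1; first by rewrite (le_trans q1)// lerDl.
by rewrite -[leLHS]add0r lerD// -[leLHS]expr1; apply: ler_weXn2l; rewrite ?(ltW q1)// double_gt0.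
Qed.

Lemma near_mean_le1 {R : realType} {n : nat} (f : 'rV[R]_n -> R) (m delta : R) x :
  near_mean f m delta x <= 1.
Proof. by rewrite /near_mean lern1 leq_b1. Qed.

Lemma add_le_double {R : realType} (a b c : R) : a <= c -> b <= c -> a + b <= 2 * c.
Proof. lra. Qed.

Lemma near_mean_ge0 {R : realType} {n : nat} (f : 'rV[R]_n -> R) (m delta : R) x :
  0 <= near_mean f m delta x.
Proof. exact: ler0n. Qed.

Lemma powR_incr_sign {R : realType} (e b c : R) : 0 <= e -> 0 <= b -> 0 <= c ->
  0 <= (b `^ e - c `^ e) * (b - c).
Proof.
move=> e0 b0 c0; have mono (s t : R) : 0 <= s -> s <= t -> 0 <= t `^ e - s `^ e.
  by move=> s0 st; rewrite subr_ge0; apply: ge0_ler_powR; rewrite ?nnegrE//; exact: le_trans st.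
have [st|st] := leP b c.
  by rewrite -mulrNN !opprB mulr_ge0 ?subr_ge0// -subr_ge0; exact: mono.
by rewrite mulr_ge0 ?subr_ge0 ?(ltW st)// -subr_ge0; apply: mono => //; exact: ltW.
Qed.

Definition gradient_cst {R : realType} (p : R) : R := 4 * (32 * p ^+ 2 * 2 * 15).

Lemma gradient_cst_ge0 {R : realType} (p : R) : 0 <= gradient_cst p.
Proof. by rewrite /gradient_cst mulr_ge0// mulr_ge0// mulr_ge0// mulr_ge0 ?sqr_ge0. Qed.

Lemma gradient_cstE {R : realType} (p : R) : gradient_cst p = 4 * (32 * p ^+ 2 * 2 * 15).
Proof. by []. Qed.

Opaque gradient_cst.

Lemma powR_balance {R : realType} (x p : R) : 0 < x ->
  x `^ (p - 2) * (x `^ (1 - p / 2)) ^+ 2 = 1.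
Proof.
move=> x0; rewrite -powR_mulrn ?powR_ge0// -powRrM -powRD; last by rewrite (gt_eqF x0) implybT.
by rewrite (_ : p - 2 + (1 - p / 2) * 2%:R = 0) ?powRr0//; field.
Qed.

Lemma powR_cancel {R : realType} (x p : R) : 0 < x -> x `^ (p - 2) * x `^ (2 - p) = 1.
Proof.
move=> x0; rewrite -powRD; last by rewrite (gt_eqF x0) implybT.
by rewrite (_ : p - 2 + (2 - p) = 0) ?powRr0//; ring.
Qed.

Lemma half_exponent {R : realType} (p : R) : 1 - (2 * p - 2) / 2 = 2 - p.
Proof. by field. Qed.

Lemma c15_ge0 {R : realType} : 0 <= 32 * 15 :> R.
Proof. by rewrite mulr_ge0. Qed.

Lemma c480_ge0 {R : realType} : 0 <= 4 * (32 * 15) :> R.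
Proof. by rewrite mulr_ge0// mulr_ge0. Qed.

Lemma square_scale_le {R : realType} (c t rho D : R) (r : nat) :
  0 <= c * t * rho -> 0 <= D -> D <= 4 ->
  (c * t * D * rho) ^+ r <= (4 * c * t * rho) ^+ r.
Proof.
move=> q0 D0 D4; have -> : c * t * D * rho = c * t * rho * D by ring.
have -> : 4 * c * t * rho = c * t * rho * 4 by ring.
have m0 : 0 <= c * t * rho * 4 by exact: mulr_ge0.
have m1 : 0 <= c * t * rho * D by exact: mulr_ge0.
by apply: lerXn2r; rewrite ?nnegrE//; exact: ler_wpM2l.
Qed.

Lemma powmean_bound_le {R : realType} (p N r : R) : 2 < p -> 1 <= N -> 0 <= r ->
  powmean_bound (2 * (2 * p - 2) - 2) (r / N) N <=
  (2 * moment_cst (2 * (2 * p - 2) - 2) +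
    (64 * (32 * 15) * (2 * (2 * p - 2) - 2) ^+ 2 * r) `^ ((2 * p - 2) - 1)) * (N `^ (2 - p)) ^+ 2.
Proof.
move=> p2 N1 r0; set s := 2 * p - 2; have s2 : 2 <= s by rewrite /s; lra.
have N0 : 0 < N by lra.
set A := 64 * (32 * 15) * (2 * s - 2) ^+ 2.
have A0 : 0 <= A by apply: mulr_ge0; [rewrite mulr_ge0// c15_ge0|exact: sqr_ge0].
have -> : (N `^ (2 - p)) ^+ 2 = N `^ (2 - s).
  by rewrite -powR_mulrn ?powR_ge0// -powRrM /s; congr (_ `^ _); ring.
rewrite /powmean_bound -/A [leRHS]mulrDl.
have -> : 1 - (2 * s - 2) / 2 = 2 - s by field.
have -> : (2 * s - 2) / 2 = s - 1 by field.
rewrite lerD2l mulrA powRM ?invr_ge0 ?(ltW N0)//; last exact: mulr_ge0.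
apply: ler_wpM2l; first exact: powR_ge0.
rewrite -powR_inv1 ?(ltW N0)// -powRrM; apply: ler_powR => //; lra.
Qed.

(** * Lower bounds for the probability of being near the mean *)

Section BoundedRate.
Context {R : realType} {n : nat} {d : measure_display} {T : measurableType d}.
Variables (mu : {finite_measure set T -> \bar R}) (X : T -> 'rV[R]_n).
Hypotheses (hX : bvec X) (X1 : forall t, dot (X t) (X t) = 1).
Hypothesis isoX : forall x, \int[mu]_t (dot x (X t) ^+ 2) = dot x x.
Variables (tau : probability (borelType 'M[R]_n) R) (U : borelType 'M[R]_n -> 'M[R]_n).
Hypotheses (hU : haar_matrix tau U) (n0 : (0 < n)%N).
Variables (p : R) (p2 : 2 < p) (a : 'rV[R]_n) (a1 : dot a a = 1).
Implicit Types (x y z u v b : 'rV[R]_n).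

Local Notation W := (powmean mu X).
Local Notation f := (pnorm mu X p).
Local Notation L := (lewis_radius (n := n) p).

Let nR : (0 : R) < n%:R.
Proof. by rewrite ltr0n. Qed.
Let p0 : 0 < p.
Proof. by apply: lt_trans p2. Qed.

Let M := \int[tau]_w f (a *m U w).

Let bf : borel_bounded f.
Proof. by apply: borel_pnorm. Qed.
Let bW : borel_bounded (W p).
Proof. by apply: borel_powmean => //; exact: ltW. Qed.
Let bfa : bmf (fun w => f (a *m U w)).
Proof. by apply: bf; exact: (bvecU hU). Qed.

Lemma lewis_radius_le_mean : L <= M.
Proof.
rewrite -[leLHS](pint_cst tau); apply: (bint_le tau (bmf_cst L) bfa) => w.
by apply: (pnorm_ge hX X1 isoX p2 n0); rewrite (dotU hU).
Qed.

Lemma mean_le1 : M <= 1.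
Proof.
rewrite -[leRHS](pint_cst tau); apply: (bint_le tau bfa (bmf_cst 1)) => w.
by apply: (pnorm_le1 hX X1 isoX p2); rewrite (dotU hU).
Qed.

Let L0 : 0 < L.
Proof. exact: lewis_radius_gt0. Qed.
Let M0 : 0 < M.
Proof. exact: lt_le_trans L0 lewis_radius_le_mean. Qed.

Variables (eps : R) (eps0 : 0 < eps).

Let delta := eps * M / 4.
Let delta0 : 0 < delta.
Proof. by rewrite divr_gt0// mulr_gt0. Qed.

Let g := near_mean f M delta.

Local Notation g0 := (@near_mean_ge0 R n f M delta).
Let bg : borel_bounded g.
Proof. by apply: borel_near_mean. Qed.
Let gU x : dot x x = 1 -> \int[tau]_w g (x *m U w) = \int[tau]_w g (a *m U w).
Proof.
by move=> x1; apply: (haar_congruence1 hU (H := g)); [rewrite x1 a1|apply: bg; exact: (bvecU hU)].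
Qed.

Let P2 := \int[tau]_w g (a *m U w).
Let dev := \int[tau]_w `|f (a *m U w) - M|.

Lemma deviation_bounds (Theta : R) : 0 <= Theta ->
  (forall x y (c e : R), dot x x = 1 -> dot y y = 1 -> dot x y = 0 -> c ^+ 2 + e ^+ 2 = 1 ->
  \int[tau]_w (g (x *m U w) *
    (W p (c *: (x *m U w) + e *: (y *m U w)) - W p (c *: (x *m U w) - e *: (y *m U w))) ^+ 2)
    <= e ^+ 2 * Theta) ->
  2 * delta ^+ 2 * (1 - P2) <= pi * (L ^+ 2 * n%:R `^ (p - 2)) * Theta /\
  delta * (dev - delta) <= pi * (L ^+ 2 * n%:R `^ (p - 2)) * Theta.
Proof.
move=> T0 HT.
have [C C0 fL] := pnorm_lipschitz hX X1 isoX p2 n0.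
have LL : L ^+ 2 * n%:R `^ (p - 2) = (L `^ (1 - p)) ^+ 2.
  rewrite -!powR_mulrn ?powR_ge0 ?(ltW L0)// -powRrM !lewis_radiusX -powRD; last first.
    by rewrite (gt_eqF nR) implybT.
  by congr (_ `^ _); field; exact: lt0r_neq0.
have WN x : W p (- x) = W p x by exact: powmeanN.
have fW b c : dot b b = 1 -> dot c c = 1 ->
    `|f b - f c| <= L `^ (1 - p) * `|W p b - W p c| /\ 0 <= (f b - f c) * (W p b - W p c).
  move=> b1 c1; split; first exact: (pnorm_diff hX X1 isoX p2 n0).
  by apply: powR_incr_sign; [rewrite invr_ge0 ltW|exact: powmean_ge0|exact: powmean_ge0].
rewrite LL.
have h := (@truncated_deviation R n tau U hU f (W p) C (L `^ (1 - p)) M delta Theta a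
  bf bW WN C0 fL (powR_ge0 _ _) fW delta0 HT T0 a1 erefl).
exact h.
Qed.

Let eL : eps ^+ 2 * L ^+ 2 <= 16 * delta ^+ 2.
Proof.
have -> : 16 * delta ^+ 2 = eps ^+ 2 * M ^+ 2 by rewrite /delta; field.
apply: ler_wpM2l; first exact: sqr_ge0.
by apply: lerXn2r; rewrite ?nnegrE ?(ltW L0) ?(ltW M0)//; exact: lewis_radius_le_mean.
Qed.

Let L2 : 0 < L ^+ 2.
Proof. by rewrite exprn_gt0. Qed.

Lemma probability_lower (Theta : R) : 2 * delta ^+ 2 * (1 - P2) <= pi * (L ^+ 2 * n%:R `^ (p - 2)) * Theta ->
  P2 < 2^-1 -> eps ^+ 2 <= 16 * pi * n%:R `^ (p - 2) * Theta.
Proof.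
move=> h hP; rewrite -(ler_pM2r L2); apply: le_trans eL _.
have d2 : 0 <= delta ^+ 2 by exact: sqr_ge0.
have h2 : delta ^+ 2 <= 2 * delta ^+ 2 * (1 - P2).
  by have := mulr_ge0 d2 (_ : 0 <= 2^-1 - P2); rewrite subr_ge0 ltW// => /(_ isT); lra.
apply: (@le_trans _ _ (16 * (pi * (L ^+ 2 * n%:R `^ (p - 2)) * Theta))).
  by apply: ler_wpM2l => //; exact: le_trans h.
by rewrite le_eqVlt; apply/orP; left; apply/eqP; ring.
Qed.

(** The deterministic Lipschitz bound for W_p. It loses a power of n, acceptable where n is bounded
    in terms of p and C1. *)
Lemma probability_crude : P2 < 2^-1 -> eps ^+ 2 <= 16 * pi * n%:R `^ (p - 2) * (16 * p ^+ 2 * P2).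
Proof.
have T0 : 0 <= 16 * p ^+ 2 * P2 by rewrite mulr_ge0 ?bint_ge0// mulr_ge0 ?sqr_ge0.
have [|h _] := deviation_bounds T0; last exact: probability_lower.
move=> x y c e x1 y1 xy ce; rewrite /P2 -(gU x1).
exact: (crude_antipodal_increment hX X1 isoX hU p2 g0 bg x1 y1 xy ce).
Qed.

Section Large.
Hypothesis n2 : (2 < n)%N.

Let i0 := Ordinal (ltn_trans (ltn_trans (ltn0Sn 0) (ltnSn 1)) n2 : (0 < n)%N).
Let i1 := Ordinal (ltn_trans (ltnSn 1) n2 : (1 < n)%N).
Let i01 : i0 != i1. Proof. by []. Qed.

Let u (c e : R) w := c *: row i0 (U w) + e *: row i1 (U w).

Let u1 c e w : c ^+ 2 + e ^+ 2 = 1 -> dot (u c e w) (u c e w) = 1.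
Proof.
move=> ce; have dr := dot_row (haar_orthogonal hU w).
by apply: etrans ce; rewrite /u !dotE !dr /=; ring.
Qed.

Let G c e w := gradsq mu X (U w) (fun i => (i != i0) && (i != i1)) p (u c e w).

Let bG c e : bmf (G c e).
Proof.
apply: (bmf_gradsq mu hX) => // [|i|]; first exact: ltW.
  by under eq_fun do rewrite rowE; exact: (bvecU hU).
by apply: bvecD; apply: bvecZ; under eq_fun do rewrite rowE; exact: (bvecU hU).
Qed.

Let bg0 : bmf (fun w => g (row i0 (U w))).
Proof. by under eq_fun do rewrite rowE; apply: bg; exact: (bvecU hU). Qed.

Let P2E : \int[tau]_w g (row i0 (U w)) = P2.
Proof. by under eq_Rintegral do rewrite rowE; apply: gU; rewrite dot_delta mxE !eqxx. Qed.

Local Notation K1 := (gradient_cst p).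
Local Notation K10 := (gradient_cst_ge0 p).

Lemma gradient_deviation (H : R) : (forall c e, c ^+ 2 + e ^+ 2 = 1 ->
    \int[tau]_w (g (row i0 (U w)) * G c e w) <= H) ->
  2 * delta ^+ 2 * (1 - P2) <= pi * (L ^+ 2 * n%:R `^ (p - 2)) * (K1 / n%:R * H) /\
  delta * (dev - delta) <= pi * (L ^+ 2 * n%:R `^ (p - 2)) * (K1 / n%:R * H).
Proof.
move=> hH.
have H0 : 0 <= H.
  have ce : (1 : R) ^+ 2 + 0 ^+ 2 = 1 by rewrite expr1n expr0n addr0.
  apply: le_trans (hH _ _ ce); apply: bint_ge0 => w; apply: mulr_ge0; [exact: g0|exact: gradsq_ge0].
apply: deviation_bounds.
  by apply: mulr_ge0; [apply: divr_ge0; [exact: K10|exact: (ltW nR)]|exact: H0].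
move=> x y c e x1 y1 xy ce.
apply: le_trans (antipodal_increment hX X1 isoX hU n2 p2 i01 g0 bg hH x1 y1 xy ce) _.
by rewrite le_eqVlt; apply/orP; left; apply/eqP; rewrite gradient_cstE; ring.
Qed.

Lemma probability_gradient (H : R) : (forall c e, c ^+ 2 + e ^+ 2 = 1 ->
    \int[tau]_w (g (row i0 (U w)) * G c e w) <= H) -> P2 < 2^-1 ->
  eps ^+ 2 * n%:R <= 16 * pi * K1 * (n%:R `^ (p - 2) * H).
Proof.
move=> hH hP; have [h _] := gradient_deviation hH.
have := probability_lower h hP => h2.
apply: le_trans (ler_wpM2r (ltW nR) h2) _.
by rewrite le_eqVlt; apply/orP; left; apply/eqP; field; exact: lt0r_neq0.
Qed.

(** A pointwise bound on W_p bounds its squared gradient by a multiple of n^(2-p), which cancels the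
    factor n^(p-2) exactly. *)
Lemma probability_flat (K : R) : 0 <= K -> (forall x, dot x x = 1 -> W p x <= K * n%:R `^ (1 - p / 2)) ->
  P2 < 2^-1 -> eps ^+ 2 * n%:R <= 16 * pi * K1 * (4 * K ^+ 2) * P2.
Proof.
move=> K0 hK hP; have hp : 2 <= p by exact: ltW.
set k := n%:R `^ (1 - p / 2); have k0 : 0 <= k by exact: powR_ge0.
have kk : n%:R `^ (p - 2) * k ^+ 2 = 1 by exact: powR_balance.
have hG c e w : c ^+ 2 + e ^+ 2 = 1 -> G c e w <= (2 * (K * k)) ^+ 2.
  move=> ce; apply: (gradsq_le hX _ (haar_orthogonal hU w) hp) => y y1.
  apply: le_trans (ler_norm _) _; apply: le_trans (powform_abs_le mu hX _ _ hp) _.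
  exact: add_le_double (hK _ (u1 w ce)) (hK _ y1).
have hH c e : c ^+ 2 + e ^+ 2 = 1 ->
    \int[tau]_w (g (row i0 (U w)) * G c e w) <= (2 * (K * k)) ^+ 2 * P2.
  move=> ce; rewrite -P2E -(bintZ tau _ bg0).
  have b1 := bmfM bg0 (bG c e); have b2 := bmfM (bmf_cst ((2 * (K * k)) ^+ 2)) bg0.
  apply: (bint_le tau b1 b2) => w; rewrite [leRHS]mulrC.
  by apply: ler_wpM2l; [exact: g0|exact: hG].
apply: le_trans (probability_gradient hH hP) _.
have -> : n%:R `^ (p - 2) * ((2 * (K * k)) ^+ 2 * P2) = 4 * K ^+ 2 * P2 * (n%:R `^ (p - 2) * k ^+ 2) by ring.
by rewrite kk le_eqVlt; apply/orP; left; apply/eqP; ring.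
Qed.

Let W2le1 c e w : c ^+ 2 + e ^+ 2 = 1 -> G c e w <= W (2 * p - 2) (u c e w).
Proof. by move=> ce; apply: (gradsq_le_W2 hX isoX); [exact: (haar_orthogonal hU)|exact: ltW]. Qed.

(** The squared gradient is only bounded by 1 here, a loss of n^(p-2), but the second deviation
    bound gains the ratio of the mean deviation to delta, which by hypothesis makes up for it. *)
Lemma probability_spread : 2 * n%:R `^ (p - 2) * delta <= dev ->
  eps ^+ 2 * n%:R <= 16 * pi * K1 * P2.
Proof.
move=> hdev; have hp := p2.
have hH c e : c ^+ 2 + e ^+ 2 = 1 -> \int[tau]_w (g (row i0 (U w)) * G c e w) <= P2.
  move=> ce; rewrite -P2E.
  apply: (bint_le tau (bmfM bg0 (bG c e)) bg0) => w; rewrite -[leRHS]mulr1.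
  apply: ler_wpM2l; first exact: g0.
  have s2 : 2 <= 2 * p - 2 by lra.
  have u1' : dot (u c e w) (u c e w) <= 1 by rewrite u1.
  exact: le_trans (W2le1 w ce) (le_trans (powmean_le1 hX X1 isoX s2 u1') u1').
have [_ h] := gradient_deviation hH.
set N := n%:R `^ (p - 2) in hdev h *; have N1 : 1 <= N.
  rewrite /N -[leLHS](powRr0 n%:R); apply: ler_powR; first by rewrite ler1n.
  lra.
have N0 : 0 < N by lra.
have d0 := delta0.
have h1 : delta ^+ 2 * N <= delta * (dev - delta).
  rewrite expr2 -mulrA; apply: ler_wpM2l; first exact: ltW.
  have : delta <= delta * N by rewrite ler_pMr.
  lra.
have h2 := le_trans h1 h.
have NL : 0 < N * L ^+ 2 by rewrite mulr_gt0.
rewrite -(ler_pM2r NL).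
apply: (@le_trans _ _ (n%:R * N * (16 * delta ^+ 2))).
  have -> : eps ^+ 2 * n%:R * (N * L ^+ 2) = n%:R * N * (eps ^+ 2 * L ^+ 2) by ring.
  by apply: ler_wpM2l; [exact: (mulr_ge0 (ltW nR) (ltW N0))|exact: eL].
have h3 := ler_wpM2l (mulr_ge0 (ler0n R 16) (ltW nR)) h2.
have -> : n%:R * N * (16 * delta ^+ 2) = 16 * n%:R * (delta ^+ 2 * N) by ring.
apply: le_trans h3 _.
by rewrite le_eqVlt; apply/orP; left; apply/eqP; field; exact: lt0r_neq0.
Qed.

Let s := 2 * p - 2.
Let lam := n%:R `^ (2 - p) : R.

Definition typical_cst (r : nat) : R :=
  4 * (32 * 15) * s ^+ 2 * r%:R *
  (2 * moment_cst (2 * s - 2) + ((64 * (32 * 15)) * (2 * s - 2) ^+ 2 * r%:R) `^ (s - 1)).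

Lemma typical_cst_ge0 r : 0 <= typical_cst r.
Proof.
apply: mulr_ge0.
  by apply: mulr_ge0; [apply: mulr_ge0; [exact: c480_ge0|exact: sqr_ge0]|exact: ler0n].
apply: addr_ge0; last exact: powR_ge0.
by apply: mulr_ge0; [exact: ler0n|exact: moment_cst_ge0].
Qed.

Let lam0 : 0 < lam.
Proof. exact: powR_gt0. Qed.

Let typical_moment r z : (0 < r)%N -> dot z z = 1 ->
  \int[tau]_w (W s (z *m U w) - \int[tau]_w W s (z *m U w)) ^+ r.*2 <=
  (typical_cst r * (lam ^+ 2 / n%:R)) ^+ r.
Proof.
move=> r0 z1; have hp := p2; have s2 : 2 <= s by rewrite /s; lra.
have s20 : 0 <= s by lra.
have s22 : 2 <= 2 * s - 2 by lra.
set rho : R := r%:R / n%:R; have rho0 : 0 <= rho by rewrite divr_ge0.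
have gm : gradmoment mu X tau U i0 i1 s r <= powmean_bound (2 * s - 2) rho n%:R ^+ r.
  by apply: le_trans (gradmoment_le_W2 hX isoX hU i0 i1 r s2 z1) _; exact: (powmean_moment1 hX X1 isoX hU n2 i01 s22 r0 z1).
have g0' : 0 <= gradmoment mu X tau U i0 i1 s r.
  by apply: bint_ge0 => w; apply: exprn_ge0; exact: gradsq_ge0.
have c0 : 0 <= 4 * (32 * 15) * s ^+ 2 * rho.
  by apply: mulr_ge0; [apply: mulr_ge0; [exact: c480_ge0|exact: sqr_ge0]|exact: rho0].
have cm : \int[tau]_w (W s (z *m U w) - \int[tau]_w W s (z *m U w)) ^+ r.*2 <=
    (4 * (32 * 15) * s ^+ 2 * rho) ^+ r * powmean_bound (2 * s - 2) rho n%:R ^+ r.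
  apply: (central_moment hU (borel_powmean mu hX s20) z1) => b b1.
  apply: le_trans (powmean_increment_moment hX X1 isoX hU n2 i01 s2 r0 z1 b1) _.
  apply: ler_pM; [|exact: g0'| |exact: gm].
    apply: exprn_ge0; apply: mulr_ge0; last exact: rho0.
    apply: mulr_ge0; last exact: dot_ge0.
    by apply: mulr_ge0; [exact: c15_ge0|exact: sqr_ge0].
  have D4 := dot_diff_le4 z1 b1; have D0 := dot_ge0 (z - b).
  have q0 : 0 <= 32 * 15 * s ^+ 2 * rho.
    by apply: mulr_ge0; [apply: mulr_ge0; [exact: c15_ge0|exact: sqr_ge0]|exact: rho0].
  exact: (@square_scale_le R (32 * 15) (s ^+ 2) rho (dot (z - b) (z - b)) r q0 D0 D4).
apply: le_trans cm _; rewrite -exprMn; apply: lerXn2r; rewrite ?nnegrE.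
- by apply: mulr_ge0; [exact: c0|exact: powmean_bound_ge0].
- apply: mulr_ge0; first exact: typical_cst_ge0.
  by apply: divr_ge0; [exact: sqr_ge0|exact: (ltW nR)].
have pb : powmean_bound (2 * s - 2) rho n%:R <=
    (2 * moment_cst (2 * s - 2) + (64 * (32 * 15) * (2 * s - 2) ^+ 2 * r%:R) `^ (s - 1)) * lam ^+ 2.
  by apply: powmean_bound_le; rewrite ?ler1n.
apply: le_trans (ler_wpM2l c0 pb) _.
rewrite /typical_cst /rho; move: (2 * moment_cst _ + _) => B.
by rewrite le_eqVlt; apply/orP; left; apply/eqP; ring.
Qed.

(** On the event the squared gradient is at most W_(2p-2), of size n^(2-p) up to an excess charged
    to a centred moment. The excess gives (C/n)^r, free of the event, to be absorbed when eps is not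
    too small. *)
Lemma probability_typical r : (0 < r)%N -> P2 < 2^-1 ->
  eps ^+ 2 * n%:R <= 16 * pi * K1 * ((moment_cst s + 1) * P2 + (typical_cst r / n%:R) ^+ r).
Proof.
move=> r0 hP; have hp := p2; have s2 : 2 <= s by rewrite /s; lra.
have s20 : 0 <= s by lra.
have Nl : n%:R `^ (p - 2) * lam = 1.
  exact: powR_cancel.
have hH c e : c ^+ 2 + e ^+ 2 = 1 -> \int[tau]_w (g (row i0 (U w)) * G c e w) <=
    lam * ((moment_cst s + 1) * P2 + (typical_cst r / n%:R) ^+ r).
  move=> ce; pose z : 'rV[R]_n := c *: delta_mx 0 i0 + e *: delta_mx 0 i1.
  have uE w : u c e w = z *m U w by rewrite /u /z mulmxDl -!scalemxAl -!rowE.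
  have z1 : dot z z = 1.
    by have := u1 (0 : borelType 'M[R]_n) ce; rewrite uE (dotU hU).
  set EZ := \int[tau]_w W s (z *m U w).
  have EZle : EZ <= moment_cst s * lam.
    by rewrite /lam -half_exponent; exact: (powmean_mean hX X1 isoX hU n2 s2 z1).
  have bZ : bmf (fun w => W s (z *m U w)) by apply: (bmf_W mu hX); [exact: s20|exact: (bvecU hU)].
  have bc : bmf (fun _ : borelType 'M[R]_n => EZ) by exact: bmf_cst.
  have b1 := bmfX r.*2 (bmfB bZ bc).
  have b2 := bmfM (bmf_cst ((moment_cst s + 1) * lam)) bg0.
  have b3 := bmfM (bmf_cst (lam * (lam ^- r.*2))) b1.
  apply: le_trans (bint_le tau (bmfM bg0 (bG c e)) (bmfD b2 b3) _) _ => [w|].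
    have hG := W2le1 w ce; rewrite uE -/s in hG.
    set Z := W s (z *m U w) in hG *.
    have g1 : g (row i0 (U w)) <= 1 by exact: near_mean_le1.
    have gg : 0 <= g (row i0 (U w)) by exact: g0.
    move: (g _) gg g1 => gv gg g1; apply: le_trans (ler_wpM2l gg hG) _.
    have T0 : 0 <= (Z - EZ) ^+ r.*2 by exact: exprn_even_ge0.
    have TE : lam * (lam ^- r.*2) * (Z - EZ) ^+ r.*2 = lam * ((Z - EZ) / lam) ^+ r.*2.
      by rewrite expr_div_n; ring.
    rewrite TE; set q := (Z - EZ) / lam.
    have q0 : 0 <= q ^+ r.*2 by exact: exprn_even_ge0.
    have ZE : Z = EZ + lam * q by rewrite /q; field; exact: lt0r_neq0.
    (* The normalised excess is split so that its bounded part keeps the weight g while the rest is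
       integrated with g <= 1. *)
    have qq : q <= 1 + q ^+ r.*2.
      exact: le_add_even_power.
    have Zle : Z <= (moment_cst s + 1) * lam + lam * q ^+ r.*2.
      rewrite ZE; have := ler_wpM2l (ltW lam0) qq; lra.
    apply: le_trans (ler_wpM2l gg Zle) _.
    exact: (weighted_le ((moment_cst s + 1) * lam) g1 (mulr_ge0 (ltW lam0) q0)).
  rewrite (bintD tau b2 b3) (bintZ tau _ bg0) (bintZ tau _ (bmfX r.*2 (bmfB bZ bc))) P2E.
  have tm := typical_moment r0 z1; rewrite -/EZ in tm.
  have h := ler_wpM2l (mul_exprV_ge0 r.*2 (ltW lam0)) tm.
  have es := scaled_power (typical_cst r) n%:R r lam0.
  rewrite es in h; rewrite mulrDr; apply: lerD; last exact: h.
  by rewrite le_eqVlt; apply/orP; left; apply/eqP; ring.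
apply: le_trans (probability_gradient hH hP) _.
by rewrite [n%:R `^ _ * (lam * _)]mulrA Nl mul1r.
Qed.

End Large.
End BoundedRate.

Lemma spherical_probability {R : realType} (p : R) : 2 < p -> forall C1 : R, 0 < C1 ->
  exists2 c2 : R, 0 < c2 & forall (n : nat) (d : measure_display) (T : measurableType d)
    (mu : {finite_measure set T -> \bar R}) (X : T -> 'rV[R]_n)
    (tau : probability (borelType 'M[R]_n) R) (U : borelType 'M[R]_n -> 'M[R]_n)
    (a : 'rV[R]_n) (eps : R),
  bvec X -> (forall t, dot (X t) (X t) = 1) ->
  (forall x, \int[mu]_t (dot x (X t) ^+ 2) = dot x x) ->
  haar_matrix tau U -> (0 < n)%N -> dot a a = 1 -> 0 < eps < 1 -> eps ^+ 2 * n%:R <= C1 ->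
  forall M, M = \int[tau]_w pnorm mu X p (a *m U w) ->
  c2 * (eps ^+ 2 * n%:R) <=
    \int[tau]_w near_mean (pnorm mu X p) M (eps * M / 4) (a *m U w).
Proof.
move=> p2 C1 C10; have p0 : 0 < p by exact: lt_trans p2.
(* The least J with p <= 2J: large enough to interpolate up to 2J, and minimal, so that all factors
   of [planar_cst p J] are positive. *)
have exJ : exists j : nat, p <= (2 * j)%:R.
  exists (Num.truncn p).+1; apply: le_trans (ltW (truncnS_gt p)) _.
  by rewrite ler_nat leq_pmull.
pose J := ex_minn exJ.
have [pJ hJ] : p <= (2 * J)%:R /\ forall i, (i < J)%N -> (2 * i)%:R < p.
  rewrite /J; case: ex_minnP => j hj mj; split=> // i ij.
  by rewrite ltNge; apply/negP => /mj; rewrite leqNgt ij.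
have J0 : (0 < J)%N.
  by rewrite lt0n; apply/eqP => J0; move: pJ; rewrite J0 muln0 leNgt p0.
pose m := (Num.truncn (p + (2 * J)%:R)).+1.
have hm : p + (2 * J)%:R <= (2 * m)%:R.
  by apply: le_trans (ltW (truncnS_gt _)) _; rewrite ler_nat leq_pmull.
have plan0 : 0 < planar_cst p J.
  apply: prodr_gt0 => i _; rewrite divr_gt0 ?subr_gt0 ?hJ//.
  by rewrite ltr_pwDl.
pose Gc : R := 1 + 8 ^+ J / planar_cst p J.
have Gc0 : 0 < Gc by rewrite addr_gt0// divr_gt0// exprn_gt0.
(* Since the gain is at most Gc n^m and the deviation of W_p at most 2p that of N, a mean deviation
   of at most c3 n^(-q) makes the left side of [near_constant_bound] at most n^(-J). *)
pose q := (m * J.+1 + J)%N.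
pose c3 : R := (2 * p * Gc ^+ J.+1)^-1.
have c30 : 0 < c3 by rewrite invr_gt0 mulr_gt0 ?exprn_gt0// mulr_gt0.
(* The added exponent exceeds p - 2: for eps <= c4 n^(-Q) a mean deviation above c3 n^(-q) dominates
   2 n^(p-2) delta. *)
pose Q := (q + (Num.truncn (p - 2)).+1)%N.
pose K1 : R := gradient_cst p.
have K10 : 0 <= K1 by exact: gradient_cst_ge0.
have pi0 := @pi_ge0 R.
(* In the remaining case eps^2 n exceeds c4^2 n^(1-2Q), a factor n above the order n^(-r) of the
   error in [probability_typical]. *)
pose r := (2 * Q)%N.
have r0 : (0 < r)%N by rewrite muln_gt0 /Q addnS.
pose A : R := 16 * pi * K1 * typical_cst p r ^+ r.
have pi16 : 0 <= 16 * pi :> R by rewrite mulr_ge0.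
have pK : 0 <= 16 * pi * K1 by exact: mulr_ge0.
have A0 : 0 <= A by apply: mulr_ge0 => //; apply: exprn_ge0; exact: typical_cst_ge0.
pose c4 : R := 2 * c3.
have c40 : 0 < c4 by rewrite mulr_gt0.
(* From here on that factor n makes the error at most half of eps^2 n; the 3 ensures n > 2. *)
pose n0 := (Num.truncn (2 * A / c4 ^+ 2) + 3)%N.
pose Kf : R := 2 + (3 * (4 * J%:R + 1)) ^+ J.
have Kf0 : 0 <= Kf by rewrite addr_ge0// exprn_ge0// mulr_ge0// addr_ge0// mulr_ge0.
pose E1 := 2 * C1.
pose E2 : R := n0%:R * (16 * pi * n0%:R `^ (p - 2) * (16 * p ^+ 2)).
pose E3 := 16 * pi * K1 * (4 * Kf ^+ 2).
pose E4 := 16 * pi * K1.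
pose E5 := 2 * (16 * pi * K1 * (moment_cst (2 * p - 2) + 1)).
have E10 : 0 <= E1 by rewrite mulr_ge0// ltW.
have E20 : 0 <= E2.
  apply: mulr_ge0; first exact: ler0n.
  apply: mulr_ge0; first by apply: mulr_ge0 => //; exact: powR_ge0.
  by apply: mulr_ge0; [exact: ler0n|exact: sqr_ge0].
have E40 : 0 <= E4 by exact: pK.
have E30 : 0 <= E3 by apply: mulr_ge0 => //; rewrite mulr_ge0// sqr_ge0.
have E50 : 0 <= E5.
  by apply: mulr_ge0 => //; apply: mulr_ge0 => //; rewrite addr_ge0// moment_cst_ge0.
pose E := E1 + E2 + E3 + E4 + E5 + 1.
have E0 : 0 < E by rewrite /E; lra.
exists E^-1; first by rewrite invr_gt0.
move=> n d T mu X tau U a eps hX X1 isoX hU nn a1 /andP[eps0 eps1] hC _ ->.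
pose M := \int[tau]_w pnorm mu X p (a *m U w); rewrite -/M.
set P2 := \int[tau]_w _.
have nR : (0 : R) < n%:R by rewrite ltr0n.
have P0 : 0 <= P2 by apply: bint_ge0 => w; exact: ler0n.
have conc (F : R) : F <= E -> eps ^+ 2 * n%:R <= F * P2 -> E^-1 * (eps ^+ 2 * n%:R) <= P2.
  move=> FE h; rewrite ler_pdivrMl//; apply: le_trans h _; exact: ler_wpM2r.
have [P2h|P2h] := leP 2^-1 P2.
  apply: (conc E1); first by rewrite /E; lra.
  apply: le_trans hC _; rewrite /E1.
  have : C1 * 2^-1 <= C1 * P2 by apply: ler_wpM2l => //; exact: ltW.
  lra.
have [nsmall|nlarge] := ltnP n n0.
  apply: (conc E2); first by rewrite /E; lra.
  have := probability_crude hX X1 isoX hU nn p2 a1 eps0 P2h; rewrite -/M -/P2 => h.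
  have nn0 : (n%:R : R) <= n0%:R by rewrite ler_nat ltnW.
  apply: le_trans (ler_wpM2r (ltW nR) h) _.
  have np : n%:R `^ (p - 2) <= n0%:R `^ (p - 2) :> R.
    by apply: ge0_ler_powR; rewrite ?nnegrE//; lra.
  have pp : 0 <= 16 * p ^+ 2 * P2 by rewrite mulr_ge0// mulr_ge0 ?sqr_ge0.
  have y0 : 0 <= n%:R `^ (p - 2) :> R by exact: powR_ge0.
  have le1 : 16 * pi * n%:R `^ (p - 2) * (16 * p ^+ 2 * P2) <=
      16 * pi * n0%:R `^ (p - 2) * (16 * p ^+ 2 * P2).
    by apply: ler_wpM2r => //; apply: ler_wpM2l.
  have ge0 : 0 <= 16 * pi * n%:R `^ (p - 2) * (16 * p ^+ 2 * P2).
    by apply: mulr_ge0 => //; exact: mulr_ge0.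
  rewrite mulrC; apply: le_trans (ler_pM (ler0n R n) ge0 nn0 le1) _.
  by rewrite /E2 !mulrA.
have n2 : (2 < n)%N by apply: leq_trans nlarge; rewrite /n0 addn3.
pose dev := \int[tau]_w `|pnorm mu X p (a *m U w) - M|.
have M1 : M <= 1 by exact: (mean_le1 hX X1 isoX hU p2 a1).
have N1 : (1 : R) <= n%:R by rewrite ler1n.
have Ninv (k : nat) : 0 < (n%:R^-1 : R) ^+ k by rewrite exprn_gt0// invr_gt0.
have [flat|spread] := leP dev (c3 * (n%:R^-1) ^+ q).
  apply: (conc E3); first by rewrite /E; lra.
  apply: (probability_flat hX X1 isoX hU nn p2 a1 eps0 n2 Kf0 _ P2h) => x x1.
  have [v0 v01 hv] := @exists_unit_orthogonal _ _ [:: a] (ltnW n2).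
  have av : dot a v0 = 0 by rewrite dotC; apply: hv; rewrite mem_head.
  apply: (near_constant_bound hX X1 isoX hU n2 p2 a1 a1 v01 av x1 hJ hm pJ).
  have bW : bmf (fun w => powmean mu X p (a *m U w)).
    by apply: (bmf_W mu hX); [exact: ltW|exact: (bvecU hU)].
  have bf : bmf (fun w => pnorm mu X p (a *m U w)).
    by apply: (borel_pnorm mu hX p2); exact: (bvecU hU).
  set w0 := \int[tau]_w powmean mu X p (a *m U w).
  have bdev : bmf (fun w => `|pnorm mu X p (a *m U w) - M|).
    by apply: bmf_norm; apply: bmfB => //; exact: bmf_cst.
  have M0 : 0 <= M by apply: bint_ge0 => w; exact: pnorm_ge0.
  have bMp : bmf (fun _ : borelType 'M[R]_n => M `^ p) by exact: bmf_cst.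
  have bWM := bmfB bW bMp.
  (* The p-th power is p-Lipschitz on [0, 1], which contains N and M. Centring at the mean of W_p
     instead of M^p costs the same amount again. *)
  have ptw w : `|powmean mu X p (a *m U w) - M `^ p| <= p * `|pnorm mu X p (a *m U w) - M|.
    rewrite -(pnormK mu X p2); apply: powR_lip1; first exact: ltW.
      by rewrite pnorm_ge0 (pnorm_le1 hX X1 isoX p2)// (dotU hU).
    by rewrite M0.
  have d1 : \int[tau]_w `|powmean mu X p (a *m U w) - M `^ p| <= p * dev.
    rewrite -(bintZ tau _ bdev).
    exact: (bint_le tau (bmf_norm bWM) (bmfM (bmf_cst p) bdev) ptw).
  have d2 : `|w0 - M `^ p| <= p * dev.
    apply: le_trans d1; apply: le_trans (bint_norm tau bWM).
    by rewrite (bintB tau bW bMp) pint_cst.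
  have bWw : bmf (fun w => `|powmean mu X p (a *m U w) - w0|).
    by apply: bmf_norm; apply: bmfB => //; exact: bmf_cst.
  have d3 : \int[tau]_w `|powmean mu X p (a *m U w) - w0| <= 2 * p * dev.
    have bs := bmfD (bmf_norm bWM) (bmf_cst (`|w0 - M `^ p|)).
    apply: le_trans (bint_le tau bWw bs _) _ => [w|].
      have -> : powmean mu X p (a *m U w) - w0 =
        (powmean mu X p (a *m U w) - M `^ p) - (w0 - M `^ p) by ring.
      exact: ler_normB.
    rewrite (bintD tau (bmf_norm bWM) (bmf_cst _)) pint_cst.
    have := lerD d1 d2; lra.
  have gain : near_constant_gain p J m n%:R <= Gc * n%:R ^+ m.
    have nm : 1 <= (n%:R : R) ^+ m by exact: exprn_ege1.
    rewrite /near_constant_gain /Gc mulrDl mul1r; apply: lerD => //.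
    rewrite invfM exprVn invrK mulrA; exact: lexx.
  have g0 : 0 <= near_constant_gain p J m n%:R.
    rewrite /near_constant_gain addr_ge0// divr_ge0 ?exprn_ge0// mulr_ge0 ?exprn_ge0 ?invr_ge0//.
    exact: ltW.
  have t0 : 0 <= \int[tau]_w `|powmean mu X p (a *m U w) - w0| by exact: bint_ge0.
  have gJ : near_constant_gain p J m n%:R ^+ J.+1 <= (Gc * n%:R ^+ m) ^+ J.+1.
    by apply: lerXn2r; rewrite ?nnegrE// mulr_ge0 ?exprn_ge0// ltW.
  apply: le_trans (ler_pM _ t0 gJ d3) _; first exact: exprn_ge0.
  have dev0 : 0 <= 2 * p by rewrite mulr_ge0// ltW.
  have G0 : 0 <= (Gc * n%:R ^+ m) ^+ J.+1.
    by rewrite exprn_ge0// mulr_ge0 ?exprn_ge0// ltW.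
  apply: le_trans (ler_wpM2l G0 (ler_wpM2l dev0 flat)) _.
  have -> : (Gc * n%:R ^+ m) ^+ J.+1 * (2 * p * (c3 * n%:R^-1 ^+ q)) = n%:R^-1 ^+ J :> R.
    rewrite exprMn -exprM /q exprD /c3 exprVn.
    have z1 : n%:R ^+ (m * J.+1) != 0 :> R by rewrite expf_neq0// lt0r_neq0.
    have z2 : Gc ^+ J.+1 != 0 by rewrite expf_neq0// lt0r_neq0.
    have z3 : p != 0 by rewrite lt0r_neq0.
    have z4 : n%:R ^+ J != 0 :> R by rewrite expf_neq0// lt0r_neq0.
    rewrite !exprVn; move: (n%:R ^+ (m * J.+1)) (Gc ^+ J.+1) (n%:R ^+ J) z1 z2 z4 => u v w z1 z2 z4.
    by field; rewrite z1 z2 z3 z4.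
  by rewrite exprVn -[leLHS]mul1r; apply: ler_wpM2r => //; rewrite invr_ge0 exprn_ge0.
have [tiny|big] := leP eps (c4 * (n%:R^-1) ^+ Q).
  apply: (conc E4); first by rewrite /E; lra.
  apply: (probability_spread hX X1 isoX hU nn p2 a1 eps0 n2).
  rewrite -/M -/dev; apply: ltW; apply: le_lt_trans spread.
  have nP : n%:R `^ (p - 2) <= n%:R ^+ (Num.truncn (p - 2)).+1 :> R.
    by rewrite -powR_mulrn// ler_powR// ltW// truncnS_gt.
  have M0 : 0 <= M by apply: bint_ge0 => w; exact: pnorm_ge0.
  have eM : eps * M / 4 <= c4 * n%:R^-1 ^+ Q / 4.
    apply: ler_wpM2r; first by rewrite invr_ge0.
    apply: le_trans tiny; rewrite -[leRHS]mulr1; apply: ler_wpM2l => //; exact: ltW.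
  have eM0 : 0 <= eps * M / 4 by rewrite divr_ge0// mulr_ge0// ltW.
  have h := ler_pM (_ : 0 <= 2 * n%:R `^ (p - 2)) eM0 (ler_wpM2l (ler0n R 2) nP) eM.
  rewrite mulr_ge0 ?powR_ge0// in h; have {}h := h isT.
  apply: le_trans h _; rewrite /Q exprD /c4.
  have z1 : n%:R ^+ (Num.truncn (p - 2)).+1 != 0 :> R by rewrite expf_neq0// lt0r_neq0.
  have ex : (n%:R^-1 : R) ^+ (Num.truncn (p - 2)).+1 = (n%:R ^+ (Num.truncn (p - 2)).+1)^-1 by rewrite exprVn.
  rewrite ex; move: (n%:R ^+ (Num.truncn (p - 2)).+1) z1 (n%:R^-1 ^+ q) => y z1 t.
  by rewrite le_eqVlt; apply/orP; left; apply/eqP; field.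
apply: (conc E5); first by rewrite /E; lra.
have := probability_typical hX X1 isoX hU nn p2 a1 eps0 n2 r0 P2h; rewrite -/M -/P2 -/K1 => h.
have hA : 16 * pi * K1 * (typical_cst p r / n%:R) ^+ r <= eps ^+ 2 * n%:R / 2.
  have -> : 16 * pi * K1 * (typical_cst p r / n%:R) ^+ r = A * n%:R^-1 ^+ r.
    by rewrite /A exprMn mulrA.
  have e2 : (c4 * n%:R^-1 ^+ Q) ^+ 2 <= eps ^+ 2.
    by apply: lerXn2r; rewrite ?nnegrE ?(ltW eps0) ?(ltW big)// mulr_ge0// ltW.
  rewrite exprMn -exprM mulnC -/r in e2.
  have nA : 2 * A <= c4 ^+ 2 * n%:R.
    rewrite -ler_pdivrMl ?exprn_gt0// mulrC; apply: ltW; apply: lt_le_trans (truncnS_gt _) _.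
    by rewrite ler_nat; apply: leq_trans nlarge; rewrite /n0 addn3 ltnS ltnW.
  have h1 := ler_wpM2r (ltW nR) e2.
  have h2 := ler_wpM2r (ltW (Ninv r)) nA.
  have e3 : c4 ^+ 2 * n%:R^-1 ^+ r * n%:R = c4 ^+ 2 * n%:R * n%:R^-1 ^+ r by ring.
  rewrite e3 in h1; have := le_trans h2 h1; lra.
move: h hA; rewrite /E5 mulrDr; move: (_ ^+ r) => t; lra.
Qed.

Definition section_rate {R : realType} (n : nat) (p eps : R) : R :=
  Num.min (eps ^+ 2 * n%:R) ((eps * n%:R) `^ (2 / p)).

Lemma near_mean_gt0 {R : realType} {n : nat} (f : 'rV[R]_n -> R) (m delta : R) x :
  0 < near_mean f m delta x -> `|f x - m| <= 2 * delta.
Proof. by rewrite /near_mean ltr0n lt0b. Qed.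

Lemma unit_row1 {R : realType} (x : 'rV[R]_1) : dot x x = 1 -> `|x 0 0| = 1.
Proof.
rewrite /dot big_ord1 -expr2 => e; apply/eqP.
by rewrite -(@eqrXn2 _ 2)// expr1n real_normK ?num_real// e.
Qed.

Lemma powR_invl {R : realType} (x a : R) : 0 < x -> x^-1 `^ a = x `^ (- a).
Proof. by move=> x0; rewrite -powR_inv1 ?(ltW x0)// -powRrM mulN1r. Qed.

(** From y <= e^y with y = (j+1) ln 2 / p comes (j+1)^p <= (p / ln 2)^p 2^(j+1), and 2 (8/9)^j <=
    2. *)
Lemma powR_geometric {R : realType} (p : R) (j : nat) : 0 < p ->
  j.+1%:R `^ p * (4 / 9) ^+ j <= 2 * (p / ln 2) `^ p.
Proof.
move=> p0; have l2 : 0 < ln 2 :> R by apply: ln_gt0; rewrite ltr1n.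
pose y : R := ln 2 * j.+1%:R / p.
have y0 : 0 < y by rewrite divr_gt0// mulr_gt0.
have e1 : j.+1%:R = p / ln 2 * y :> R by rewrite /y; field; rewrite !lt0r_neq0.
have pl : 0 <= p / ln 2 by rewrite divr_ge0// ltW.
rewrite e1 powRM ?(ltW y0)//.
have e2 : y `^ p <= 2 ^+ j.+1.
  apply: (@le_trans _ _ (expR y `^ p)).
    apply: ge0_ler_powR; rewrite ?nnegrE ?expR_ge0 ?(ltW p0) ?(ltW y0)//.
    by apply: le_trans (expR_ge1Dx y); rewrite lerDr.
  have -> : expR y `^ p = expR (ln 2 * j.+1%:R).
    by rewrite /powR gt_eqF ?expR_gt0// expRK; congr expR; rewrite /y; field; exact: lt0r_neq0.
  by rewrite mulrC expRM_natl lnK ?posrE.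
rewrite -mulrA [leRHS]mulrC; apply: ler_wpM2l; first exact: powR_ge0.
have e3 : 0 <= (4 / 9 : R) ^+ j by rewrite exprn_ge0// divr_ge0.
rewrite mulrC; apply: le_trans (ler_wpM2l e3 e2) _.
rewrite exprS mulrCA -exprMn -[leRHS]mulr1; apply: ler_wpM2l => //.
by apply: exprn_ile1; [rewrite mulr_ge0// divr_ge0|rewrite mulrAC ler_pdivrMr// mul1r -natrM ler_nat].
Qed.

Lemma chained_sections {R : realType} (p : R) : 2 < p ->
  exists2 c1 : R, 0 < c1 <= 4^-1 & forall (n : nat) (d : measure_display) (T : measurableType d)
    (mu : {finite_measure set T -> \bar R}) (X : T -> 'rV[R]_n)
    (tau : probability (borelType 'M[R]_n) R) (U : borelType 'M[R]_n -> 'M[R]_n)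
    (a : 'rV[R]_n) (eps : R) (k : nat),
  bvec X -> (forall t, dot (X t) (X t) = 1) ->
  (forall x, \int[mu]_t (dot x (X t) ^+ 2) = dot x x) ->
  haar_matrix tau U -> (2 < n)%N -> dot a a = 1 -> 0 < eps < 1 ->
  (0 < k)%N -> k%:R <= c1 * section_rate n p eps ->
  let M := \int[tau]_w pnorm mu X p (a *m U w) in
  forall X0 : 'M[R]_(k, n), X0 *m X0^T = 1%:M ->
  exists Phi : borelType 'M[R]_n -> R, [/\ bmf Phi, forall w, 0 <= Phi w,
    \int[tau]_w Phi w < expR (- k%:R) & forall w, Phi w < 1 ->
    forall x : 'rV[R]_k, dot x x = 1 -> `|pnorm mu X p (x *m X0 *m U w) - M| <= eps * M / 2].
Proof.
move=> p2; have p0 : 0 < p by exact: lt_trans p2.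
pose B : R := 2 * (p / ln 2) `^ p.
have B0 : 0 <= B by rewrite mulr_ge0// powR_ge0.
pose I := increment_cst p; have I0 : 0 <= I by exact: increment_cst_ge0.
(* The product is what the smallness condition of chaining consumes; the 4 makes c1 <= 1/4, from
   which n > 2 is deduced once c1 times the rate is at least 1. *)
pose D : R := 2 ^+ 16 * I * 2 * B * 8 + 4.
have e0 : 0 < expR (-1) :> R by exact: expR_gt0.
have e1 : expR (-1) <= 1 :> R by rewrite -[leRHS]expR0 ler_expR; lra.
have G0 : 0 <= 2 ^+ 16 * I * 2 * B * 8.
  by apply: mulr_ge0 => //; apply: mulr_ge0 => //; apply: mulr_ge0 => //; apply: mulr_ge0 => //; rewrite exprn_ge0.
have D4 : 4 <= D by rewrite /D lerDr.
have D0 : 0 < D by apply: lt_le_trans D4.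
exists (expR (-1) / D).
  rewrite divr_gt0//= ler_pdivrMr//.
  by apply: le_trans e1 _; rewrite -ler_pdivrMl// invrK mulr1.
move=> n d T mu X tau U a eps k hX X1 isoX hU n2 a1 /andP[eps0 eps1] k0 hk M X0 oX.
have nn : (0 < n)%N by apply: leq_trans n2.
have nR : (0 : R) < n%:R by rewrite ltr0n.
have [C C0 fL] := pnorm_lipschitz hX X1 isoX p2 nn.
pose L := lewis_radius (n := n) p : R; have L0 : 0 < L by exact: lewis_radius_gt0.
pose th (r : nat) : R := I * L ^+ 2 * (r%:R / n%:R + r%:R `^ p / n%:R ^+ 2).
have th0 r : 0 <= th r.
  apply: mulr_ge0; first by rewrite mulr_ge0// sqr_ge0.
  by rewrite addr_ge0// divr_ge0 ?powR_ge0 ?exprn_ge0// ltW.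
have LM : L <= M by exact: (lewis_radius_le_mean hX X1 isoX hU nn p2 a1).
pose delta : R := eps * L / 2.
have delta0 : 0 < delta by rewrite divr_gt0// mulr_gt0.
have bf : borel_bounded (pnorm mu X p) by apply: borel_pnorm.
have fZ (c : R) x : pnorm mu X p (c *: x) = `|c| * pnorm mu X p x by apply: pnormZ.
set c1 := expR (-1) / D in hk.
have c10 : 0 < c1 by rewrite divr_gt0.
have c11 : c1 <= 1.
  rewrite /c1 ler_pdivrMr// mul1r; apply: le_trans e1 _; apply: le_trans D4; by rewrite ler1n.
have kR : (0 : R) < k%:R by rewrite ltr0n.
(* The two members of the minimum in the rate are matched to the two terms r/n and r^p/n^2 of the
   increment moments. *)
have k1 : k%:R / n%:R <= c1 * eps ^+ 2.
  rewrite ler_pdivrMr// -mulrA; apply: le_trans hk _; apply: ler_wpM2l; first exact: ltW.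
  by rewrite ge_min lexx.
have k2 : k%:R `^ p / n%:R ^+ 2 <= c1 * eps ^+ 2.
  rewrite ler_pdivrMr ?exprn_gt0//.
  have h : k%:R <= c1 * (eps * n%:R) `^ (2 / p).
    by apply: le_trans hk _; apply: ler_wpM2l; [exact: ltW|rewrite ge_min lexx orbT].
  have en : 0 <= eps * n%:R by rewrite mulr_ge0// ltW.
  apply: (@le_trans _ _ ((c1 * (eps * n%:R) `^ (2 / p)) `^ p)).
    by apply: ge0_ler_powR; rewrite ?nnegrE ?(ltW p0)//; apply: mulr_ge0; rewrite ?powR_ge0// ltW.
  rewrite powRM ?powR_ge0 ?(ltW c10)// -powRrM divfK ?lt0r_neq0// powR_mulrn// exprMn mulrA.
  apply: ler_wpM2r; first by rewrite exprn_ge0.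
  apply: ler_wpM2r; first by rewrite sqr_ge0.
  rewrite -[leRHS](powRr1 (ltW c10)); apply: ger_powR; first by rewrite c10.
  lra.
have small j : 2 ^+ 16 * th (j.+1 * k) * (4 / 9) ^+ j <= expR (-1) / 2 * delta ^+ 2.
  have j1 : (1 : R) <= j.+1%:R by rewrite ler1n.
  have jp : (j.+1%:R : R) <= j.+1%:R `^ p.
    rewrite -[leLHS](powRr1 (ler0n R _)); apply: ler_powR => //; lra.
  have t1 : (j.+1 * k)%:R / n%:R + (j.+1 * k)%:R `^ p / n%:R ^+ 2 <= j.+1%:R `^ p * (2 * (c1 * eps ^+ 2)).
    have ce : 0 <= c1 * eps ^+ 2 by rewrite mulr_ge0 ?sqr_ge0// ltW.
    rewrite natrM powRM// -[j.+1%:R * _ / _]mulrA -[_ `^ p * _ / _]mulrA.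
    have h1 : j.+1%:R * (k%:R / n%:R) <= j.+1%:R `^ p * (c1 * eps ^+ 2).
      by apply: ler_pM => //; rewrite divr_ge0// ltW.
    have h2 : j.+1%:R `^ p * (k%:R `^ p / n%:R ^+ 2) <= j.+1%:R `^ p * (c1 * eps ^+ 2).
      by apply: ler_wpM2l => //; exact: powR_ge0.
    lra.
  have t2 : th (j.+1 * k)%N <= I * L ^+ 2 * (j.+1%:R `^ p * (2 * (c1 * eps ^+ 2))).
    by apply: ler_wpM2l => //; rewrite mulr_ge0// sqr_ge0.
  have q0 : 0 <= (4 / 9 : R) ^+ j by rewrite exprn_ge0// divr_ge0.
  have z0 : 0 <= (2 : R) ^+ 16 by rewrite exprn_ge0.
  apply: le_trans (ler_wpM2r q0 (ler_wpM2l z0 t2)) _.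
  have -> : 2 ^+ 16 * (I * L ^+ 2 * (j.+1%:R `^ p * (2 * (c1 * eps ^+ 2)))) * (4 / 9) ^+ j =
    (2 ^+ 16 * I * 2) * (L ^+ 2 * eps ^+ 2) * c1 * (j.+1%:R `^ p * (4 / 9) ^+ j) by ring.
  have pg : j.+1%:R `^ p * (4 / 9) ^+ j <= B by exact: powR_geometric.
  have w0 : 0 <= 2 ^+ 16 * I * 2 * (L ^+ 2 * eps ^+ 2) * c1.
    apply: mulr_ge0; last exact: ltW.
    by apply: mulr_ge0; [apply: mulr_ge0 => //; exact: mulr_ge0|rewrite mulr_ge0 ?sqr_ge0].
  apply: le_trans (ler_wpM2l w0 pg) _.
  have -> : expR (-1) / 2 * delta ^+ 2 = (L ^+ 2 * eps ^+ 2) * (expR (-1) / 8).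
    by rewrite /delta; field.
  have -> : 2 ^+ 16 * I * 2 * (L ^+ 2 * eps ^+ 2) * c1 * B = (L ^+ 2 * eps ^+ 2) * (2 ^+ 16 * I * 2 * B * c1) by ring.
  apply: ler_wpM2l; first by rewrite mulr_ge0 ?sqr_ge0.
  rewrite ler_pdivlMr//.
  have -> : 2 ^+ 16 * I * 2 * B * c1 * 8 = c1 * (2 ^+ 16 * I * 2 * B * 8) by ring.
  apply: (@le_trans _ _ (c1 * D)); last by rewrite /c1 divfK ?lexx// lt0r_neq0.
  by apply: ler_wpM2l; [exact: ltW|rewrite /D lerDl].
have inc r b c : (0 < r)%N -> dot b b = 1 -> dot c c = 1 ->
  \int[tau]_w (pnorm mu X p (b *m U w) - pnorm mu X p (c *m U w)) ^+ r.*2 <=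
    (th r * dot (b - c) (b - c)) ^+ r.
  by move=> r0 b1 c1'; exact: (pnorm_increment_moment hX X1 isoX p2 nn hU n2 r0 b1 c1').
have [Phi [h1 h2 h3 h4]] := chaining hU bf fZ C0 fL a1 th0 inc k0 oX delta0 small.
exists Phi; split => // w hw x x1; apply: le_trans (h4 w hw x x1) _.
rewrite /delta; apply: ler_wpM2r; first by rewrite invr_ge0.
by apply: ler_wpM2l => //; exact: ltW.
Qed.

Theorem fixed_body_sections {R : realType} (p : R) : 2 < p ->
  exists2 c : R, 0 < c & forall (n : nat) (d : measure_display) (T : measurableType d)
    (mu : {finite_measure set T -> \bar R}) (X : T -> 'rV[R]_n)
    (tau : probability (borelType 'M[R]_n) R) (U : borelType 'M[R]_n -> 'M[R]_n)
    (a : 'rV[R]_n) (eps : R),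
  bvec X -> (forall t, dot (X t) (X t) = 1) ->
  (forall x, \int[mu]_t (dot x (X t) ^+ 2) = dot x x) ->
  haar_matrix tau U -> (0 < n)%N -> dot a a = 1 -> 0 < eps < 1 ->
  let M := \int[tau]_w pnorm mu X p (a *m U w) in
  exists2 k : 'I_n.+1, c * section_rate n p eps <= (k : nat)%:R &
  forall X0 : 'M[R]_(k, n), X0 *m X0^T = 1%:M ->
  exists Phi : borelType 'M[R]_n -> R, [/\ bmf Phi, forall w, 0 <= Phi w,
    \int[tau]_w Phi w <= expR (- (c * section_rate n p eps)) & forall w, Phi w < 1 ->
    forall x : 'rV[R]_k, dot x x = 1 -> `|pnorm mu X p (x *m X0 *m U w) - M| <= eps * M / 2].
Proof.
move=> p2; have p0 : 0 < p by exact: lt_trans p2.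
have [c1 /andP[c10 c14] regA] := chained_sections p2.
(* If c1 times the rate is below 1, then eps^2 n < 1/c1 or eps n < c1^(-p/2), and eps^2 n <= eps
   n. *)
pose C1 : R := c1 `^ (- (p / 2)) + c1^-1.
have C10 : 0 < C1 by rewrite addr_gt0 ?powR_gt0 ?invr_gt0.
have [c2 c20 regB] := spherical_probability p2 C10.
pose c := Num.min (c1 / 2) c2.
have c0 : 0 < c by rewrite lt_min c20 divr_gt0.
exists c => // n d T mu X tau U a eps hX X1 isoX hU nn a1 /andP[eps0 eps1] M.
have e01 : 0 < eps < 1 by rewrite eps0.
have nR : (0 : R) < n%:R by rewrite ltr0n.
set rt := section_rate n p eps.
have en0 : 0 < eps * n%:R by rewrite mulr_gt0.
have rt0 : 0 < rt by rewrite lt_min powR_gt0// mulr_gt0// exprn_gt0.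
have rtn : rt <= eps ^+ 2 * n%:R by rewrite ge_min lexx.
have e21 : eps ^+ 2 <= 1 by apply: exprn_ile1; rewrite ?ltW.
have rtn1 : rt <= n%:R.
  by apply: le_trans rtn _; rewrite -[leRHS]mul1r; apply: ler_wpM2r => //; exact: ltW.
have cc1 : c * rt <= c1 * rt / 2.
  by rewrite mulrAC; apply: ler_wpM2r; [exact: ltW|rewrite ge_min lexx].
have [hA|hB] := leP 1 (c1 * rt).
  pose k := Num.truncn (c1 * rt).
  have cr0 : 0 <= c1 * rt by rewrite mulr_ge0// ltW.
  have kle : k%:R <= c1 * rt by rewrite truncn_le.
  have kgt : c1 * rt < k.+1%:R by exact: truncnS_gt.
  have k0 : (0 < k)%N.
    by rewrite -(ltr_nat R) -(ltrD2r 1) add0r natr1; exact: le_lt_trans hA kgt.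
  have kn : (k < n.+1)%N.
    rewrite ltnS -(ler_nat R); apply: le_trans kle _; apply: le_trans (_ : 1 * rt <= _); last by rewrite mul1r.
    by apply: ler_wpM2r; [exact: ltW|lra].
  have ck : c * rt <= k%:R.
    have k1 : (1 : R) <= k%:R by rewrite ler1n.
    rewrite -natr1 in kgt; lra.
  have n2 : (2 < n)%N.
    rewrite -(ltr_nat R); have := ler_wpM2r (ltW rt0) c14; lra.
  exists (Ordinal kn) => //= X0 oX.
  have [Phi [h1 h2 h3 h4]] := regA n d T mu X tau U a eps k hX X1 isoX hU n2 a1 e01 k0 kle X0 oX.
  exists Phi; split => //; apply: le_trans (ltW h3) _.
  by rewrite ler_expR lerN2.
have hC : eps ^+ 2 * n%:R <= C1.
  have e1 : eps ^+ 2 * n%:R <= eps * n%:R.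
    by apply: ler_wpM2r; [exact: ltW|rewrite expr2 ler_piMl// ltW].
  have [h|h] := leP (eps ^+ 2 * n%:R) ((eps * n%:R) `^ (2 / p)).
    have rE : rt = eps ^+ 2 * n%:R by rewrite /rt /section_rate (min_idPl h).
    rewrite rE in hB; have : eps ^+ 2 * n%:R <= c1^-1 by rewrite -div1r ler_pdivlMr// mulrC ltW.
    by have := powR_gt0 (- (p / 2)) c10; rewrite /C1; lra.
  have rE : rt = (eps * n%:R) `^ (2 / p) by rewrite /rt /section_rate (min_idPr (ltW h)).
  apply: le_trans e1 _.
  have h2 : (eps * n%:R) `^ (2 / p) <= c1^-1 by rewrite -rE -div1r ler_pdivlMr// mulrC ltW.
  have h3 : eps * n%:R = ((eps * n%:R) `^ (2 / p)) `^ (p / 2).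
    rewrite -powRrM (_ : 2 / p * (p / 2) = 1) ?powRr1 ?(ltW en0)//.
    by field; exact: lt0r_neq0.
  have h4 : eps * n%:R <= c1^-1 `^ (p / 2).
    rewrite {1}h3; apply: ge0_ler_powR; rewrite ?nnegrE ?powR_ge0 ?invr_ge0 ?(ltW c10)//.
    by rewrite divr_ge0// ltW.
  have h5 : c1^-1 `^ (p / 2) = c1 `^ (- (p / 2)).
    exact: powR_invl.
  have : 0 < c1^-1 by rewrite invr_gt0.
  by rewrite /C1 -h5; lra.
have n1 : (1 < n.+1)%N by rewrite ltnS.
exists (Ordinal n1) => /=.
  by have := c10; lra.
move=> X0 oX.
have bg : borel_bounded (near_mean (pnorm mu X p) M (eps * M / 4)).
  by apply: borel_near_mean; apply: borel_pnorm.
have u1 : dot (row 0 X0) (row 0 X0) = 1.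
  have := congr1 (fun A : 'M[R]_1 => A 0 0) oX; rewrite !mxE eqxx => e; transitivity (true%:R : R) => //; rewrite -e.
  by rewrite /dot; apply: eq_bigr => i _; rewrite !mxE.
have bgu : bmf (fun w => near_mean (pnorm mu X p) M (eps * M / 4) (row 0 X0 *m U w)).
  by apply: bg; exact: (bvecU hU).
have gE : \int[tau]_w near_mean (pnorm mu X p) M (eps * M / 4) (row 0 X0 *m U w) =
   \int[tau]_w near_mean (pnorm mu X p) M (eps * M / 4) (a *m U w).
  by apply: (haar_congruence1 hU (H := near_mean (pnorm mu X p) M (eps * M / 4))) => //; rewrite u1 a1.
have bc : bmf (fun _ : borelType 'M[R]_n => (1 : R)) by exact: bmf_cst.
(* For k = 1 failure is decided by a single unit vector up to sign; its probability is at most 1 - c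
   rt, hence at most e^(-c rt). *)
exists (fun w => 1 - near_mean (pnorm mu X p) M (eps * M / 4) (row 0 X0 *m U w)); split.
- exact: bmfB.
- by move=> w; rewrite subr_ge0; exact: near_mean_le1.
- rewrite (bintB tau bc bgu) pint_cst gE.
  have hP := regB n d T mu X tau U a eps hX X1 isoX hU nn a1 e01 hC M erefl.
  have h1 : c * rt <= c2 * (eps ^+ 2 * n%:R).
    by apply: ler_pM; [exact: (ltW c0)|exact: (ltW rt0)|rewrite ge_min lexx orbT|exact: rtn].
  apply: le_trans (_ : _ <= 1 - c * rt) _; first by rewrite lerD2l lerN2; exact: le_trans hP.
  by have := expR_ge1Dx (- (c * rt)).
move=> w; rewrite ltrBlDr ltrDl => /near_mean_gt0 h x x1.
have xE : x *m X0 = x 0 0 *: row 0 X0.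
  by apply/rowP => i; rewrite !mxE big_ord1.
have x00 := unit_row1 x1.
rewrite xE -scalemxAl (pnormZ mu hX p2) x00 mul1r; apply: le_trans h _.
by rewrite le_eqVlt; apply/orP; left; apply/eqP; field.
Qed.

(** * Orthonormal bases and nearly round sections *)

Section OrthonormalBases.
Context {R : realType} {n : nat}.
Implicit Types (x y : 'rV[R]_n) (F : {vspace 'rV[R]_n}).

Definition basis_mx F : 'M[R]_(\dim F, n) := \matrix_(i < \dim F) (vbasis F)`_i.

Lemma mem_basis_mx F x : (x \in F) = (x <= basis_mx F)%MS.
Proof.
apply/idP/submxP => [xF|[D ->]].
  exists (\row_i coord (vbasis F) i x).
  rewrite mulmx_sum_row [LHS](coord_vbasis xF); apply: eq_bigr => i _.
  by rewrite rowK mxE.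
rewrite mulmx_sum_row; apply: rpred_sum => i _; rewrite rowK.
by apply: rpredZ; apply: vbasis_mem; apply: mem_nth; rewrite size_tuple.
Qed.

Lemma basis_mx_inj F (u : 'rV[R]_(\dim F)) : u *m basis_mx F = 0 -> u = 0.
Proof.
rewrite mulmx_sum_row => h; apply/rowP => i; rewrite [RHS]mxE.
have /freeP fF := basis_free (vbasisP F).
apply: (fF (u 0) _ i); rewrite -[RHS]h; apply: eq_bigr => j _.
by rewrite rowK.
Qed.

Lemma orthoproj_cap F : (<<basis_mx F>> :&: kermx (basis_mx F)^T = 0)%MS.
Proof.
apply/eqP/rowV0P => v; rewrite sub_capmx genmxE => /andP[/submxP[D vD] /sub_kermxP vB].
apply: dot_eq0; rewrite dot_mulmx {2}vD trmx_mul mulmxA vB mul0mx.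
by rewrite mxE.
Qed.

Lemma orthoproj_mem F x : x *m orthoproj F \in F.
Proof. by rewrite mem_basis_mx -(genmxE (basis_mx F)) proj_mx_sub. Qed.

Lemma orthoproj_id F x : x \in F -> x *m orthoproj F = x.
Proof.
by move=> xF; apply: proj_mx_id; [exact: orthoproj_cap|rewrite genmxE -mem_basis_mx].
Qed.

(** Gram-Schmidt inside F: as long as j < dim F, some nonzero combination of the basis is orthogonal
    to the j vectors found so far. *)
Lemma orthonormal_basis F : exists2 X : 'M[R]_(\dim F, n), X *m X^T = 1%:M &
  forall x : 'rV[R]_n, x \in F -> exists y : 'rV[R]_(\dim F), x = y *m X.
Proof.
suff h (j : nat) : (j <= \dim F)%N ->
    exists2 X : 'M[R]_(j, n), X *m X^T = 1%:M & (X <= basis_mx F)%MS.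
  have [X oX XF] := h _ (leqnn _); exists X => // x; rewrite mem_basis_mx => xF.
  have rX : \rank X = \dim F.
    apply/eqP; rewrite eqn_leq rank_leq_row /=.
    by have := mxrankM_maxl X X^T; rewrite oX mxrank1.
  have := mxrank_leqif_sup XF; rewrite rX => -[le1 e].
  have BX : (basis_mx F <= X)%MS by rewrite -e eqn_leq le1 rank_leq_row.
  by have /submxP[y ->] := submx_trans xF BX; exists y.
elim: j => [_|j IH jF].
  by exists 0; [apply/matrixP => -[]|exact: sub0mx].
have [X oX XF] := IH (ltnW jF).
have : kermx (basis_mx F *m X^T) != 0.
  rewrite -mxrank_eq0 mxrank_ker -lt0n subn_gt0.
  exact: leq_ltn_trans (rank_leq_col _) jF.
move=> /rowV0Pn[u /sub_kermxP uX u0]; pose v := u *m basis_mx F.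
have v0 : v != 0 by apply: contra u0 => /eqP /basis_mx_inj ->.
have [e e1 ve] := enorm_normalize v0.
have ne0 : enorm v != 0 by apply: contraNneq v0 => e0; rewrite ve e0 scale0r.
have eE : e = (enorm v)^-1 *: v by rewrite ve enormZ scalerA; rewrite {2}/enorm e1 sqrtr1 mulr1 ger0_norm ?enorm_ge0// mulVf// scale1r.
have eX : e *m X^T = 0 by rewrite eE -scalemxAl /v -mulmxA uX scaler0.
have oY : col_mx e X *m (col_mx e X)^T = 1%:M.
  rewrite tr_col_mx mul_col_row eX oX.
  have -> : X *m e^T = 0 by rewrite -[LHS]trmxK trmx_mul trmxK eX trmx0.
  have -> : e *m e^T = 1%:M.
    by apply/matrixP => i k; rewrite !ord1 -dot_mulmx e1 mxE.
  by rewrite -scalar_mx_block.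
have YF : (col_mx e X <= basis_mx F)%MS.
  by rewrite col_mx_sub XF andbT eE; apply: scalemx_sub; exact: submxMl.
by exists (col_mx e X : 'M[R]_((1 + j)%N, n)).
Qed.

Lemma unit_direction F x : x \in F -> x != 0 ->
  exists u, [/\ u \in F, dot u u = 1, 0 < enorm x & x = enorm x *: u].
Proof.
move=> xF x0; have [u u1 xu] := enorm_normalize x0; exists u; split=> //.
  have nx0 : enorm x != 0 by apply: contraNneq x0 => e0; rewrite xu e0 scale0r.
  by rewrite -[u]scale1r -(mulVf nx0) -scalerA -xu rpredZ.
by rewrite lt_def enorm_ge0 andbT; apply: contraNneq x0 => e0; rewrite xu e0 scale0r.
Qed.

Lemma mem_mulmx_orthogonal F (O : 'M[R]_n) x : orthogonal O ->
  (x \in (linfun (mulmxr O) @: F)%VS) = (x *m O^T \in F).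
Proof.
move=> hO; apply/memv_imgP/idP => [[y yF ->]|h].
  by rewrite lfunE /= -mulmxA hO mulmx1.
by exists (x *m O^T); rewrite // lfunE /= -mulmxA (orthogonal_trK hO) mulmx1.
Qed.

Lemma dim_mulmx_orthogonal F (O : 'M[R]_n) : orthogonal O ->
  \dim (linfun (mulmxr O) @: F)%VS = \dim F.
Proof.
move=> hO; apply: limg_dim_eq; apply/eqP; rewrite -subv0; apply/subvP => v.
rewrite memv_cap memv_ker lfunE /= => /andP[_ /eqP v0].
by rewrite memv0 -[v]mulmx1 -hO mulmxA v0 mul0mx.
Qed.

End OrthonormalBases.

Lemma enorm_sum {R : realType} {n : nat} (I : Type) (s : seq I) (F : I -> 'rV[R]_n) :
  enorm (\sum_(i <- s) F i) <= \sum_(i <- s) enorm (F i).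
Proof.
elim/big_rec2 : _ => [|i y x _ h]; first by rewrite enorm0.
by apply: le_trans (enormD _ _) _; rewrite lerD2l.
Qed.

Lemma rational_approx {R : realType} {n : nat} (A : 'M[R]_n) (y : 'rV[R]_n) (e : R) : 0 < e ->
  exists q : 'rV[rat]_n, enorm ((y - map_mx ratr q) *m A) <= e.
Proof.
move=> e0; pose K := \sum_i enorm (row i A) + 1.
have K0 : 0 < K by rewrite ltr_wpDl// sumr_ge0// => i _; exact: enorm_ge0.
have ex i : exists q, `|y 0 i - ratr q| <= e / K.
  have : y 0 i < y 0 i + e / K by rewrite ltrDl divr_gt0.
  move=> /rat_in_itvoo[q]; rewrite in_itv /= => /andP[q1 q2]; exists q.
  by rewrite distrC ger0_norm ?subr_ge0 ?(ltW q1)// lerBlDl ltW.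
have [q hq] := boolp.choice ex.
exists (\row_i q i); rewrite mulmx_sum_row.
apply: le_trans (enorm_sum _ _) _.
apply: (@le_trans _ _ (\sum_i e / K * enorm (row i A))).
  apply: ler_sum => i _; rewrite enormZ; apply: ler_wpM2r; first exact: enorm_ge0.
  by rewrite !mxE.
rewrite -mulr_sumr mulrAC ler_pdivrMr//; apply: ler_wpM2l; first exact: ltW.
by rewrite lerDl.
Qed.

Section NearlyRound.
Context {R : realType} {n : nat}.
Variables (N : 'rV[R]_n -> R) (M eps : R).
Hypotheses (M0 : 0 < M) (eps0 : 0 < eps) (eps1 : eps < 1).
Hypothesis N0 : forall x, 0 <= N x.
Hypothesis Npos : forall x, dot x x = 1 -> 0 < N x.
Hypothesis NZ : forall c x, N (c *: x) = `|c| * N x.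
Implicit Types (x y : 'rV[R]_n) (F : {vspace 'rV[R]_n}).

(** The two inclusions of [spherical] as one condition on a vector: invariant under positive scaling
    and closed, so that it can be tested on the sphere or on a dense set. *)
Definition nearly_round x := (1 - eps) * N x <= M * enorm x <= (1 + eps) * N x.

Lemma nearly_roundZ (c : R) x : 0 < c -> nearly_round (c *: x) = nearly_round x.
Proof.
move=> c0; rewrite /nearly_round NZ enormZ (gtr0_norm c0).
by rewrite ![_ * (c * _)]mulrCA !ler_pM2l.
Qed.

Lemma nearly_round0 : nearly_round 0.
Proof. by rewrite /nearly_round -[0](scale0r 0) NZ enormZ normr0 !mul0r !mulr0 lexx. Qed.

Lemma sphericalE (sigma : probability (borelType 'rV[R]_n) R) F : mean_norm sigma N = M ->
  spherical sigma N eps F <-> forall x, x \in F -> nearly_round x.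
Proof.
move=> MN; rewrite /spherical MN.
have e1 : 0 < 1 - eps by rewrite subr_gt0.
have e2 : 0 < 1 + eps by rewrite addr_gt0.
have e3 : 0 < (1 - eps) / M by rewrite divr_gt0.
have e4 : 0 < (1 + eps) / M by rewrite divr_gt0.
split=> [[h1 h2] x xF|h].
  have [->|x0] := eqVneq x 0; first exact: nearly_round0.
  have [u [uF u1 nx xu]] := unit_direction xF x0.
  have eu : enorm u = 1 by apply/enorm_eq1.
  rewrite xu nearly_roundZ// /nearly_round eu mulr1; apply/andP; split.
    have := h1 (((1 - eps) / M) *: u).
    case; first by exists u => //; split => //; rewrite eu.
    move=> /=; rewrite NZ (gtr0_norm e3) => h _.
    by rewrite mulrAC ler_pdivrMr// mul1r in h.
  have Nu := Npos u1.
  have [|z [zF z1] ez] := h2 ((N u)^-1 *: u).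
    by split; [rewrite /= NZ ger0_norm ?invr_ge0// mulVf// lt0r_neq0|exact: rpredZ].
  have := congr1 enorm ez; rewrite !enormZ eu (gtr0_norm e4) mulr1 ger0_norm ?invr_ge0// => e.
  have : (N u)^-1 <= (1 + eps) / M by rewrite -e -[leRHS]mulr1; apply: ler_wpM2l => //; exact: ltW.
  by rewrite ler_pdivlMr// mulrC ler_pdivrMr.
split=> [_ [x [xF x1] <-]|x [x1 xF]]; have /andP[h1 h2] := h x xF.
  split=> /=; last exact: rpredZ.
  rewrite NZ (gtr0_norm e3) mulrAC ler_pdivrMr// mul1r.
  by apply: le_trans h1 _; rewrite -[leRHS]mulr1; apply: ler_wpM2l => //; exact: ltW.
exists ((M / (1 + eps)) *: x).
  split; first exact: rpredZ.
  rewrite enormZ gtr0_norm ?divr_gt0// mulrAC ler_pdivrMr// mul1r.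
  by apply: le_trans h2 _; rewrite -[leRHS]mulr1; apply: ler_wpM2l => //; exact: ltW.
by rewrite scalerA (_ : _ * _ = 1) ?scale1r//; field; rewrite !lt0r_neq0.
Qed.

(** Half the tolerance is reserved for second-order terms: (1 - eps)(1 + eps/2) <= 1 <= (1 + eps)(1
    - eps/2) for eps in (0, 1). *)
Lemma close_nearly_round x : `|N x - M * enorm x| <= eps * (M * enorm x) / 2 -> nearly_round x.
Proof.
have me : 0 <= M * enorm x by rewrite mulr_ge0 ?enorm_ge0// ltW.
have e0 := eps0; have e1 := eps1.
have e2 : eps ^+ 2 <= eps by rewrite expr2 ler_piMl// ltW.
have e3 := ler_wpM2r me e2; have nx := N0 x.
rewrite /nearly_round; move: (M * enorm x) me e3 => m me e3.
rewrite ler_norml => /andP[h1 h2].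
have a1 : (1 - eps) * N x <= (1 - eps) * (m + eps * m / 2) by apply: ler_wpM2l; lra.
have a2 : (1 + eps) * (m - eps * m / 2) <= (1 + eps) * N x by apply: ler_wpM2l; lra.
have b2 : 0 <= eps ^+ 2 * m by rewrite mulr_ge0 ?sqr_ge0.
have eme : 0 <= eps * m by rewrite mulr_ge0// ltW.
have c1 : (1 - eps) * (m + eps * m / 2) = m - eps * m / 2 - eps ^+ 2 * m / 2 by field.
have c2 : (1 + eps) * (m - eps * m / 2) = m + eps * m / 2 - eps ^+ 2 * m / 2 by field.
apply/andP; split; lra.
Qed.

Lemma close_sphere_nearly_round F (A : 'M[R]_n) : orthogonal A ->
  (forall x, x \in F -> dot x x = 1 -> `|N (x *m A) - M| <= eps * M / 2) ->
  forall x, x \in F -> nearly_round (x *m A).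
Proof.
move=> hA h x xF; have [->|x0] := eqVneq x 0; first by rewrite mul0mx; exact: nearly_round0.
have [u [uF u1 nx xu]] := unit_direction xF x0.
rewrite xu -scalemxAl nearly_roundZ//; apply: close_nearly_round.
have -> : enorm (u *m A) = 1 by apply/enorm_eq1; rewrite (dot_orthogonal _ _ hA).
by rewrite mulr1; exact: h.
Qed.

Variable C : R.
Hypotheses (C0 : 0 <= C) (NL : forall x y, `|N x - N y| <= C * enorm (x - y)).

(** A closed condition on a continuous family; it reduces an uncountable intersection to a countable
    one, for measurability. *)
Lemma nearly_round_rational (A : 'M[R]_n) :
  (forall q : 'rV[rat]_n, nearly_round (map_mx ratr q *m A)) -> forall y, nearly_round (y *m A).
Proof.
move=> h y; have e0 := eps0; have e1 := eps1; have K0 : 0 < 2 * C + M by rewrite ltr_wpDl// mulr_ge0.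
have main (s : R) : 0 < s ->
    (1 - eps) * N (y *m A) - M * enorm (y *m A) <= s /\
    M * enorm (y *m A) - (1 + eps) * N (y *m A) <= s.
  move=> s0; have [q hq] := rational_approx A y (divr_gt0 s0 K0).
  have /andP[r1 r2] := h q; move: hq; rewrite mulmxBl.
  set a := y *m A in r1 r2 *; set b := map_mx ratr q *m A in r1 r2 *; set t := enorm (a - b) => hq.
  have n1 := NL a b; have n2 := enorm_sub_le a b.
  have t0 : 0 <= t by exact: enorm_ge0.
  have Ct : 0 <= C * t by exact: mulr_ge0.
  have Mt : M * `|enorm a - enorm b| <= M * t by apply: ler_wpM2l => //; exact: ltW.
  have Mn : `|M * enorm a - M * enorm b| <= M * t by rewrite -mulrBr normrM (gtr0_norm M0).
  have st : (2 * C + M) * t <= s by rewrite mulrC -ler_pdivlMr.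
  have p1 : (1 - eps) * (N a - N b) <= C * t.
    apply: le_trans (ler_norm _) _; rewrite normrM gtr0_norm ?subr_gt0//.
    by apply: le_trans n1; rewrite ler_piMl// lerBlDr lerDl ltW.
  have p2 : (1 + eps) * (N b - N a) <= 2 * (C * t).
    apply: le_trans (ler_norm _) _; rewrite normrM gtr0_norm ?addr_gt0// distrC.
    by apply: ler_pM => //; lra.
  move: Mn; rewrite ler_norml => /andP[m1 m2].

  have st2 : 2 * (C * t) + M * t <= s by rewrite mulrA -mulrDl.

  by split; lra.
by apply/andP; split; rewrite -subr_le0; apply/ler_addgt0Pl => s s0; rewrite addr0; have [] := main s s0.
Qed.

End NearlyRound.

(** * Passage to the Grassmannian *)

Section SphereRetraction.
Context {R : realType} {n : nat}.
Variable n0 : (0 < n)%N.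

(* Retracting onto the sphere makes functions of the point bounded everywhere, not only mu-almost
   everywhere. *)
Definition sphere_retraction (x : 'rV[R]_n) : 'rV[R]_n :=
  if dot x x == 1 then x else delta_mx 0 (Ordinal n0).

Lemma sphere_retraction_unit x : dot (sphere_retraction x) (sphere_retraction x) = 1.
Proof.
rewrite /sphere_retraction; case: (eqVneq (dot x x) 1) => // _.
by rewrite dot_delta mxE !eqxx.
Qed.

Lemma sphere_retraction_id x : dot x x = 1 -> sphere_retraction x = x.
Proof. by move=> x1; rewrite /sphere_retraction x1 eqxx. Qed.

Lemma bvec_sphere_retraction : bvec (fun x : borelType 'rV[R]_n => sphere_retraction x).
Proof.
split; last by exists 1 => x; rewrite sphere_retraction_unit.
rewrite /sphere_retraction; apply: measurable_fun_ifT.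
- apply: (measurable_fun_bool true); rewrite setTI.
  rewrite (_ : _ @^-1` _ = sphere); first exact: measurable_sphere.
  by apply/seteqP; split => x /=; [move=> /eqP/sphereP|move=> /sphereP ->; rewrite eqxx].
- exact: borel_id.
- exact: measurable_cst.
Qed.

(** Integrate N (x U) over x and U together: for fixed U the integral over x is the spherical mean,
    and for fixed unit x the integral over U is independent of x. *)
Lemma mean_norm_haar (sigma : probability (borelType 'rV[R]_n) R) (N : 'rV[R]_n -> R)
    (tau : probability (borelType 'M[R]_n) R) U (a : 'rV[R]_n) :
  uniform_on_sphere sigma -> haar_matrix tau U -> borel_bounded N -> dot a a = 1 ->
  mean_norm sigma N = \int[tau]_w N (a *m U w).
Proof.
move=> hs hU bN a1; set M := RHS.
pose ind (x : borelType 'rV[R]_n) : R := \1_sphere x.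
have bi : bmf ind by apply: bmf_indic; exact: measurable_sphere.
have br := bN _ _ _ bvec_sphere_retraction.
pose g (x : borelType 'rV[R]_n) : R := ind x * N (sphere_retraction x).
have bg : bmf g by exact: bmfM.
have indU (x : 'rV[R]_n) w : ind (x *m U w) = ind x.
  rewrite /ind !indicE; congr (_%:R); congr (nat_of_bool _).
  by apply/idP/idP; rewrite !inE => /sphereP h; apply/sphereP; move: h; rewrite (dotU hU).
have ind1 (x : 'rV[R]_n) : dot x x = 1 -> ind x = 1.
  by move=> /sphereP x1; rewrite /ind indicE mem_set.
have ind0 (x : 'rV[R]_n) : dot x x != 1 -> ind x = 0.
  by move=> x1; rewrite /ind indicE memNset// => /sphereP/eqP; rewrite (negbTE x1).
have eg : mean_norm sigma N = \int[sigma]_x g x.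
  rewrite /mean_norm Rintegral_mkcond; apply: eq_Rintegral => x _.
  rewrite patchE /g /ind indicE; case: ifP => [|_]; last by rewrite mul0r.
  by rewrite inE => /sphereP x1; rewrite mul1r sphere_retraction_id.
have inv w : \int[sigma]_x g (x *m U w) = \int[sigma]_x g x.
  have mg : measurable_fun setT (fun x : borelType 'rV[R]_n => x *m U w : borelType 'rV[R]_n).
    exact: measurable_mulr.
  have pg S : measurable S ->
      sigma ((fun x : borelType 'rV[R]_n => x *m U w : borelType 'rV[R]_n) @^-1` S) = sigma S.
    by move=> mS; apply: sigma_invariant => //; exact: (haar_orthogonal hU).
  exact: (bint_invariant mg pg bg).
rewrite eg.
have mU : measurable_fun setT (U : _ -> borelType 'M[R]_n) by case: hU.
have b2 : bmf (fun z : borelType 'rV[R]_n * borelType 'M[R]_n => g (z.1 *m U z.2)).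
  apply: (bmf_comp (g := fun z : borelType 'rV[R]_n * borelType 'M[R]_n =>
    z.1 *m U z.2 : borelType 'rV[R]_n) _ bg).
  by apply: measurable_mulmx; [exact: measurable_fst|exact: (measurableT_comp mU measurable_snd)].
have := bint_Fubini sigma tau b2 => /= F.
have -> : \int[sigma]_x g x = \int[tau]_w \int[sigma]_x g (x *m U w).
  by under [RHS]eq_Rintegral do rewrite inv; rewrite pint_cst.
rewrite -F (_ : (fun x => \int[tau]_w g (x *m U w)) = (fun x : borelType 'rV[R]_n => ind x * M)).
  rewrite (bintZr sigma _ bi) bint_indic ?sigma_sphere//; last exact: measurable_sphere.
  by rewrite -[RHS]mul1r; congr (_ * _); exact: (congr1 fine (sigma_sphere hs)).
apply/funext => x; have [x1|x1] := eqVneq (dot x x) 1; last first.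
  rewrite ind0// mul0r -[RHS](pint_cst tau); apply: eq_Rintegral => w _.
  by rewrite /g indU ind0// mul0r.
rewrite ind1// mul1r.
have -> : M = \int[tau]_w N (x *m U w).
  by apply: (haar_congruence1 hU (H := N)); [rewrite x1|apply: bN; exact: (bvecU hU)].
apply: eq_Rintegral => w _.
by rewrite /g indU ind1// mul1r sphere_retraction_id// (dotU hU).
Qed.

End SphereRetraction.

(** Taking traces in the isotropy identity gives [mu0] mass n, so it is a finite measure. Inserting
    the retraction changes no integral, because [mu0] vanishes off the sphere. *)
Lemma lewis_representation {R : realType} {n : nat} (p : R) (N : 'rV[R]_n -> R)
    (n0 : (0 < n)%N) : 2 < p -> lewis_position p N ->
  exists mu : {finite_measure set (borelType 'rV[R]_n) -> \bar R},
    (forall x, \int[mu]_t (dot x (sphere_retraction n0 t) ^+ 2) = dot x x) /\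
    N = pnorm mu (sphere_retraction n0 : borelType 'rV[R]_n -> 'rV[R]_n) p.
Proof.
move=> p2 [mu0 [onS _ iso] hN]; have p0 : 0 < p by exact: lt_trans p2.
have mS := @measurable_sphere R n.
pose X (t : borelType 'rV[R]_n) : 'rV[R]_n := sphere_retraction n0 t.
have hX : bvec X := bvec_sphere_retraction n0.
have Xid (t : 'rV[R]_n) : sphere t -> X t = t by move=> /sphereP; exact: sphere_retraction_id.
have mdot (x : 'rV[R]_n) : measurable_fun setT (fun t : borelType 'rV[R]_n => dot x t).
  by apply: measurable_dot; [exact: measurable_cst|exact: borel_id].
have intS (f : borelType 'rV[R]_n -> \bar R) : measurable_fun setT f -> (forall t, 0 <= f t)%E ->
    (\int[mu0]_t f t = \int[mu0]_(t in sphere) f t)%E.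
  move=> mf f0; rewrite (ge0_negligible_integral (measurableC mS) measurableT mf _ onS)//.
  by rewrite setTD setCK.
have sphere_mass : mu0 sphere = n%:R%:E.
  have : (\int[mu0]_(t in sphere) (\sum_(i < n) (`|dot (delta_mx 0 i) t| ^+ 2)%:E) = n%:R%:E)%E.
    rewrite ge0_integral_sum//; last first.
      move=> i; apply/measurable_EFinP; apply: measurable_funTS.
      by apply: measurable_funX; apply: measurableT_comp => //; exact: mdot.
    under eq_bigr do rewrite -iso enorm_sqr dot_delta mxE !eqxx.
    by rewrite sumEFin sumr_const card_ord.
  move=> <-; rewrite (eq_integral (cst 1%E)); first by rewrite integral_cst// mul1e.
  move=> t; rewrite inE => /sphereP t1; rewrite sumEFin; congr EFin.
  rewrite -[RHS]t1 [RHS]/dot; apply: eq_bigr => i _.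
  by rewrite dotC dot_delta real_normK ?num_real// expr2.
have fin : (mu0 setT < +oo)%E.
  rewrite -(setvU sphere) measureU ?setICl//; last exact: measurableC.
  by rewrite [X in (X + _)%E](onS : mu0 (~` sphere) = 0%E) add0e [X in (X < _)%E]sphere_mass ltry.
pose mu : {finite_measure set (borelType 'rV[R]_n) -> \bar R} := mfrestr measurableT fin.
have muE A : mu A = mu0 A by rewrite /mu /= /mfrestr /mrestr setIT.
have intX (h : R -> R) x : measurable_fun setT h -> (forall t, 0 <= h t) ->
    bmf (fun t => h (dot x (X t))) ->
    (\int[mu0]_t (h (dot x t))%:E)%E = (\int[mu]_t h (dot x (X t)))%:E.
  move=> mh h0 bh; rewrite -(bintE mu bh).
  have -> : (\int[mu]_t (h (dot x (X t)))%:E = \int[mu0]_t (h (dot x (X t)))%:E)%E.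
    by apply: eq_measure_integral => A _ _; exact: muE.
  have m1 : measurable_fun setT (fun t : borelType 'rV[R]_n => (h (dot x t))%:E).
    by apply/measurable_EFinP; apply: (measurableT_comp mh); exact: mdot.
  have m2 : measurable_fun setT (fun t : borelType 'rV[R]_n => (h (dot x (X t)))%:E).
    by apply/measurable_EFinP; case: bh.
  rewrite (intS _ m1) ?(intS _ m2).
  - by apply: eq_integral => t; rewrite inE => /Xid ->.
  - by move=> t; rewrite lee_fin.
  - by move=> t; rewrite lee_fin.
have bdot x : bmf (fun t => dot x (X t)) by apply: bmf_dot => //; exact: bvec_cst.
have msq : measurable_fun setT (fun t : R => t ^+ 2) by exact: exprn_measurable.
exists mu; split=> [x|].
  apply: EFin_inj.
  have <- := intX (fun t => t ^+ 2) x msq (fun t => sqr_ge0 t) (bmfX 2 (bdot x)).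
  rewrite -enorm_sqr iso intS.
  - by apply: eq_integral => t _; rewrite real_normK ?num_real.
  - by apply/measurable_EFinP; apply: measurable_funX; exact: mdot.
  - by move=> t; rewrite lee_fin sqr_ge0.
apply/funext => x; apply: EFin_inj; rewrite hN unlock /pnorm.
rewrite (eq_integral (fun t : borelType 'rV[R]_n => (`|dot x t| `^ p)%:E)); last by [].
rewrite (intX (fun t => `|t| `^ p)) ?poweR_EFin//.
- by apply: (measurableT_comp (measurable_powR p)).
- by apply: bmf_powR; [exact: ltW|exact: bdot].
Qed.

Section RandomSections.
Context {R : realType} {n : nat} (k : 'I_n.+1).
Variables (N : 'rV[R]_n -> R) (M eps C : R).
Hypotheses (M0 : 0 < M) (eps0 : 0 < eps) (eps1 : eps < 1).
Hypothesis N0 : forall x, 0 <= N x.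
Hypothesis NZ : forall c x, N (c *: x) = `|c| * N x.
Hypotheses (C0 : 0 <= C) (NL : forall x y, `|N x - N y| <= C * enorm (x - y)).
Hypothesis bN : borel_bounded N.
Variables (tau : probability (borelType 'M[R]_n) R) (U : borelType 'M[R]_n -> 'M[R]_n).
Hypothesis hU : haar_matrix tau U.

Local Notation grass := (borelType (grassmannian R k)).
Local Notation round := (nearly_round N M eps).

(** [bN] covers bounded vectors only; dividing by 1 + |u|^2 gives one, and homogeneity restores the
    factor. *)
Lemma measurable_homogeneous {d : measure_display} {T : measurableType d} (u : T -> 'rV[R]_n) :
  measurable_fun setT (u : T -> borelType 'rV[R]_n) -> measurable_fun setT (fun t => N (u t)).
Proof.
move=> mu; have md : measurable_fun setT (fun t => dot (u t) (u t)) by exact: measurable_dot.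
have c0 t : 0 < 1 + dot (u t) (u t) by rewrite ltr_pwDl// dot_ge0.
pose v t := (1 + dot (u t) (u t))^-1 *: u t.
have mc : measurable_fun setT (fun t => 1 + dot (u t) (u t)).
  by apply: measurable_funD => //; exact: measurable_cst.
have bv : bvec v.
  split.
    apply: measurable_mx_entries => i j.
    under eq_fun do rewrite mxE.
    apply: measurable_funM; last exact: (measurableT_comp (@borel_entry R 1 n i j) mu).
    under eq_fun do rewrite -powR_inv1 ?(ltW (c0 _))//.
    exact: (measurableT_comp (measurable_powR _) mc).
  exists 1 => t; rewrite /v !dotE mulrA -invfM ler_pdivrMl ?mulr_gt0// mulr1.
  have := dot_ge0 (u t); move: (dot _ _) => x x0.
  have -> : (1 + x) * (1 + x) = 1 + 2 * x + x ^+ 2 by ring.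
  have := sqr_ge0 x; lra.
have [mN _] := bN bv.
have -> : (fun t => N (u t)) = (fun t => (1 + dot (u t) (u t)) * N (v t)).
  apply/funext => t; rewrite /v NZ ger0_norm ?invr_ge0 ?(ltW (c0 t))// mulrA divff ?mul1r//.
  exact: lt0r_neq0.
exact: measurable_funM.
Qed.

Lemma measurable_nearly_round {d : measure_display} {T : measurableType d} (u : T -> 'rV[R]_n) :
  measurable_fun setT (u : T -> borelType 'rV[R]_n) -> measurable [set t | round (u t)].
Proof.
move=> mu; have mN := measurable_homogeneous mu.
have me : measurable_fun setT (fun t => enorm (u t)).
  under eq_fun do rewrite /enorm -powR12_sqrt ?dot_ge0//.
  by apply: (measurableT_comp (measurable_powR _)); exact: measurable_dot.
have mcM (c : R) (f : T -> R) : measurable_fun setT f -> measurable_fun setT (fun t => c * f t).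
  by move=> mf; apply: measurable_funM => //; exact: measurable_cst.
have le_set (f g : T -> R) : measurable_fun setT f -> measurable_fun setT g ->
    measurable [set t | f t <= g t].
  move=> mf mg; have := measurable_fun_ler mf mg => /(_ measurableT [set true]).
  by rewrite setTI; apply.
rewrite (_ : [set t | _] = [set t | (1 - eps) * N (u t) <= M * enorm (u t)] `&`
   [set t | M * enorm (u t) <= (1 + eps) * N (u t)]); last first.
  by apply/seteqP; split => t /=; rewrite /nearly_round => /andP.
by apply: measurableI; apply: le_set; exact: mcM.
Qed.

Lemma measurable_orthoproj :
  measurable_fun setT (fun F : grass => orthoproj (val F) : borelType 'M[R]_n).
Proof.
apply: measurable_mx_entries => i j.
apply: (@borel_continuous R (grassmannian R k) (fun F => orthoproj (val F) i j)) => F.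
apply: (@continuous_comp _ _ _ (fun F : grassmannian R k => orthoproj (val F))
  (fun A : 'M[R]_n => A i j)).
  exact: initial_continuous.
exact: coord_continuous.
Qed.

Definition rotated_round (z : grass * borelType 'M[R]_n) :=
  forall x, x \in val z.1 -> round (x *m z.2).

(** Projections of rational vectors are dense in F and depend measurably on F through [orthoproj],
    whereas bases of F need not be chosen measurably. *)
Lemma rotated_roundE (z : grass * borelType 'M[R]_n) :
  rotated_round z <-> forall q : 'rV[rat]_n, round (map_mx ratr q *m orthoproj (val z.1) *m z.2).
Proof.
split=> [h q|h x xF]; first by apply: h; exact: orthoproj_mem.
rewrite -(orthoproj_id xF) -mulmxA.
by apply: (nearly_round_rational M0 eps0 eps1 C0 NL) => q; rewrite mulmxA.
Qed.

Lemma measurable_rotated_round {d : measure_display} {T : measurableType d}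
    (F : T -> grassmannian R k) (A : T -> 'M[R]_n) :
  measurable_fun setT (F : T -> grass) -> measurable_fun setT (A : T -> borelType 'M[R]_n) ->
  measurable [set t | rotated_round (F t, A t)].
Proof.
move=> mF mA.
rewrite (_ : [set t | _] = \bigcap_(q : 'rV[rat]_n)
    [set t | round (map_mx ratr q *m orthoproj (val (F t)) *m A t)]); last first.
  apply/seteqP; split => t /=; first by move=> /rotated_roundE h q _; exact: h.
  by move=> h; apply/rotated_roundE => q; exact: (h q I).
set A' := fun q => _.
rewrite (_ : \bigcap_q A' q = \bigcap_(i : nat) oapp A' setT (unpickle i)); last first.
  apply/seteqP; split => t h i _ /=; last by have := h (pickle i) I; rewrite pickleK.
  by case: (unpickle i) => //= q; exact: h.
apply: bigcapT_measurable => i; case: (unpickle i) => [q|] /=; last exact: measurableT.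
apply: measurable_nearly_round; apply: measurable_mulmx => //.
apply: measurable_mulmx; first exact: measurable_cst.
exact: (measurableT_comp measurable_orthoproj mF).
Qed.

(** The map F -> F O carries the event for O onto the event for the identity. *)
Lemma haar_rotated_round (nu : probability grass R) (O : 'M[R]_n) :
  haar_grassmannian nu -> orthogonal O ->
  nu [set F : grass | rotated_round (F, O)] = nu [set F : grass | rotated_round (F, 1%:M)].
Proof.
move=> hnu hO.
have mA (A : 'M[R]_n) : measurable [set F : grass | rotated_round (F, A)].
  by apply: (measurable_rotated_round (F := fun F : grass => F) (A := fun=> A)); [exact: measurable_id|exact: measurable_cst].
rewrite -(hnu O hO _ (mA O)); congr (nu _); apply/seteqP; split => F /=.
  move=> [E hE FE] x /=; rewrite FE (mem_mulmx_orthogonal _ _ hO) mulmx1 => xE.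
  by have := hE _ xE; rewrite /= -mulmxA (orthogonal_trK hO) mulmx1.
move=> hF; have hT := orthogonal_tr hO.
have dE : \dim (linfun (mulmxr O^T) @: val F)%VS == k.
  by rewrite (dim_mulmx_orthogonal _ hT); exact: (valP F).
exists (exist (fun E : {vspace 'rV[R]_n} => \dim E == k) _ dE : grassmannian R k) => [x|] /=.
  rewrite (mem_mulmx_orthogonal _ _ hT) trmxK => /hF; by rewrite /= mulmx1.
apply/vspaceP => x; rewrite (mem_mulmx_orthogonal _ _ hO) (mem_mulmx_orthogonal _ _ hT).
by rewrite trmxK -mulmxA (orthogonal_trK hO) mulmx1.
Qed.

Lemma random_section (nu : probability grass R) (b : R) : haar_grassmannian nu ->
  (forall X0 : 'M[R]_(k, n), X0 *m X0^T = 1%:M ->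
   exists Phi : borelType 'M[R]_n -> R, [/\ bmf Phi, forall w, 0 <= Phi w,
    \int[tau]_w Phi w <= b & forall w, Phi w < 1 ->
    forall x : 'rV[R]_k, dot x x = 1 -> `|N (x *m X0 *m U w) - M| <= eps * M / 2]) ->
  ((1 - b)%:E <= nu [set F : grassmannian R k | forall x, x \in val F -> round x])%E.
Proof.
move=> hnu hPhi; have mU : measurable_fun setT (U : _ -> borelType 'M[R]_n) by case: hU.
pose S := [set z : grass * borelType 'M[R]_n | rotated_round (z.1, U z.2)].
have mS : measurable S.
  apply: measurable_rotated_round; first exact: measurable_fst.
  exact: (measurableT_comp mU measurable_snd).
have bS : bmf (\1_S : _ -> R) by exact: bmf_indic.
have -> : [set F : grassmannian R k | forall x, x \in val F -> round x] = [set F : grass | rotated_round (F, 1%:M)].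
  by apply/seteqP; split => F h x xF; [rewrite /= mulmx1; exact: h|have := h x xF; rewrite /= mulmx1].
set B := [set F : grass | rotated_round (F, 1%:M)].
have sec w : \int[nu]_F (\1_S (F, w) : R) = fine (nu B).
  rewrite -(haar_rotated_round hnu (haar_orthogonal hU w)).
  rewrite -bint_indic; last first.
    by apply: (measurable_rotated_round (F := fun F : grass => F) (A := fun=> U w)); [exact: measurable_id|exact: measurable_cst].
  by apply: eq_Rintegral => F _; rewrite !indicE; congr (_%:R); congr (nat_of_bool _); apply/idP/idP; rewrite !inE.
have Fub := bint_Fubini nu tau bS.
have R1 : \int[tau]_w \int[nu]_F (\1_S (F, w) : R) = fine (nu B).
  by under eq_Rintegral do rewrite sec; rewrite pint_cst.
rewrite -(fineK (fin_num_measure nu B _)); last first.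
  by apply: (measurable_rotated_round (F := fun F : grass => F) (A := fun=> 1%:M)); [exact: measurable_id|exact: measurable_cst].
rewrite lee_fin -R1 -Fub -[leLHS](pint_cst nu).
apply: (bint_le nu (bmf_cst (1 - b)) (bmf_int2 tau bS)) => F.
have dF : \dim (val F) = k by exact/eqP/(valP F).
have [X oX hX] : exists2 X : 'M[R]_(k, n), X *m X^T = 1%:M &
    forall x : 'rV[R]_n, x \in val F -> exists y : 'rV[R]_k, x = y *m X.
  by have := orthonormal_basis (val F); rewrite dF.
have [Phi [bP P0 Pb hP]] := hPhi X oX.
have bc : bmf (fun _ : borelType 'M[R]_n => 1 : R) by exact: bmf_cst.
apply: (@le_trans _ _ (\int[tau]_w (1 - Phi w))).
  by rewrite (bintB tau bc bP) pint_cst lerD2l lerN2.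
apply: (bint_le tau (bmfB bc bP) (bmf_pair2 F bS)) => w.
rewrite indicE; have [h|h] := ltP (Phi w) 1; last first.
  by apply: (@le_trans _ _ 0); [rewrite subr_le0|exact: ler0n].
rewrite mem_set /=; first by rewrite lerBlDr lerDl.
apply: (close_sphere_nearly_round M0 eps0 eps1 N0 NZ); first exact: (haar_orthogonal hU).
move=> x xF x1; have [y xy] := hX x xF.
have y1 : dot y y = 1.
  by rewrite -x1 xy !dot_mulmx trmx_mul mulmxA -(mulmxA y) oX mulmx1.
by rewrite xy; exact: (hP w h y y1).
Qed.

End RandomSections.

Lemma psi_le_section_rate {R : realType} (n : nat) (p eps : R) : 2 < p ->
  psi n p eps <= section_rate n p eps.
Proof.
move=> p2; have p4 : 1 <= p * 4 `^ p.
  have : 1 <= 4 `^ p :> R by rewrite -[leLHS](powRr0 4); apply: ler_powR; [rewrite ler1n|lra].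
  by move=> h; apply: le_trans h _; rewrite ler_peMl ?powR_ge0//; lra.
rewrite /psi /section_rate le_min !ge_min lexx orbT andbT; apply/orP; left.
rewrite ler_pdivrMr; last by lra.
by rewrite ler_peMr// mulr_ge0 ?sqr_ge0.
Qed.

Lemma psi_gt0 {R : realType} (n : nat) (p eps : R) : 2 < p -> 0 < eps -> (0 < n)%N ->
  0 < psi n p eps.
Proof.
move=> p2 e0 n0; have nR : (0 : R) < n%:R by rewrite ltr0n.
have p0 : 0 < p by exact: lt_trans p2.
rewrite /psi lt_min; apply/andP; split; last by rewrite powR_gt0// mulr_gt0.
by rewrite divr_gt0// mulr_gt0 ?exprn_gt0 ?powR_gt0.
Qed.

Theorem theorem4p2 (R : realType) (p : R) : 2 < p ->
  exists2 c : R, 0 < c &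
  forall (n : nat) (sigma : probability (borelType 'rV[R]_n) R)
         (N : 'rV[R]_n -> R),
    (0 < n)%N -> uniform_on_sphere sigma -> lewis_position p N ->
  forall eps : R, 0 < eps < 1 ->
  exists2 k : 'I_n.+1, c * psi n p eps <= (k : nat)%:R &
  forall nu : probability (borelType (grassmannian R k)) R,
    haar_grassmannian nu ->
    ((1 - expR (- (c * psi n p eps)))%:E <
      nu [set F : grassmannian R k | spherical sigma N eps (val F)])%E.
Proof.
move=> p2; have [c c0 hc] := fixed_body_sections p2.
(* Halving the constant turns the weak inequality into the strict one, since psi is positive. *)
exists (c / 2); first by rewrite divr_gt0.
move=> n sigma N n0 hs hN eps he; have /andP[eps0 eps1] := he.
have [mu [isoX NE]] := lewis_representation n0 p2 hN.
have hX := @bvec_sphere_retraction R n n0.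
have X1 : forall t : borelType 'rV[R]_n, dot (sphere_retraction n0 t) (sphere_retraction n0 t) = 1.
  by move=> t; exact: sphere_retraction_unit.
have [tau [U hU]] := haar_exists n0 hs.
pose a : 'rV[R]_n := delta_mx 0 (Ordinal n0).
have a1 : dot a a = 1 by rewrite dot_delta mxE !eqxx.
have bN : borel_bounded N by rewrite NE; exact: borel_pnorm.
have NZ (t : R) x : N (t *: x) = `|t| * N x by rewrite NE; exact: pnormZ.
have N0 x : 0 <= N x by rewrite NE; exact: pnorm_ge0.
have Lr : 0 < lewis_radius (n := n) p :> R by exact: lewis_radius_gt0.
have Npos x : dot x x = 1 -> 0 < N x.
  by move=> x1; rewrite NE; apply: lt_le_trans Lr _; exact: (pnorm_ge hX X1 isoX p2 n0).
have [C C0 NL] : exists2 C : R, 0 <= C & forall x y, `|N x - N y| <= C * enorm (x - y).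
  by rewrite NE; exact: (pnorm_lipschitz hX X1 isoX p2 n0).
have ps0 := psi_gt0 p2 eps0 n0.
have ps := psi_le_section_rate n eps p2.
have rate : c / 2 * psi n p eps < c * section_rate n p eps.
  have := ler_wpM2l (ltW c0) ps; have := mulr_gt0 c0 ps0; rewrite mulrAC; lra.
have [k kc hk] := hc n _ _ mu _ tau U a eps hX X1 isoX hU n0 a1 he.
have MN := mean_norm_haar n0 hs hU bN a1.
have M0 : 0 < mean_norm sigma N.
  by apply: lt_le_trans Lr _; rewrite MN NE; exact: (lewis_radius_le_mean hX X1 isoX hU n0 p2 a1).
exists k; first by apply: le_trans kc; exact: ltW.
move=> nu hnu; rewrite -NE -MN in hk.
have -> : [set F : grassmannian R k | spherical sigma N eps (val F)] =
    [set F : grassmannian R k | forall x, x \in val F -> nearly_round N (mean_norm sigma N) eps x].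
  by apply/seteqP; split => F /= /(sphericalE M0 eps0 eps1 N0 Npos NZ (val F) (erefl _)).
apply: lt_le_trans (random_section M0 eps0 eps1 N0 NZ C0 NL bN hU hnu hk).
by rewrite lte_fin ltrD2l ltrN2 ltr_expR ltrN2.
Qed.
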